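(* Let $q\in(0,2]$ and let $\beta_c$ be defined by $m\,\psi_q(\beta_c)=1$, with $\psi_q(x)=\frac{e^x-1}{e^x+q-1}$. Let $(\beta_n)_{n\ge0}$ be such that $\lim_{n\to\infty}\beta_n=\beta_c$ and $\lim_{n\to\infty}n(\beta_n-\beta_c)=+\infty$. Let $\pi_n(\beta_n)$ be the connection probability between the root and the leaves of $T_n$ for the random cluster model with parameters $(p_n,q)$, $p_n=1-e^{-\beta_n}$, with wired boundary condition. Let $s=1$ if $q\in(0,2)$ and $s=2$ if $q=2$. (i) If $\mathbf E[Z^{1+s}]<+\infty$, then, almost surely and in $L^{1+s}$, $$\lim_{n\to\infty}\frac{\pi_n(\beta_n)}{(\beta_n-\beta_c)^{1/s}}=\tilde\alpha_q\,W,\qquad\tilde\alpha_q:=\begin{cases}\dfrac{2(m+q-1)}{q(2-q)}\,\mathbf E[W^2]^{-1}&\text{if }q\in(0,2),\\[8pt]\sqrt{\dfrac{3m}{2}}\;\mathbf E[W^3]^{-1/2}&\text{if }q=2.\end{cases}$$ (ii) If $c_1L(x)x^{1+s-\alpha}\le\mathbf E[(Z\wedge x)^{1+s}]\le c_2L(x)x^{1+s-\alpha}$ for all $x\ge1$, for some $\alpha\in(1,1+s]$, some slowly varying function $L(\cdot)$ and constants $c_1,c_2>0$, then $$\Big(\frac{\pi_n(\beta_n)}{h^{-1}(\beta_n-\beta_c)}\Big)_{n}\ \text{ is tight in }(0,+\infty),$$ where $h^{-1}(\cdot)$ is an asymptotic inverse of $x\mapsto L(1/x)x^{\alpha-1}$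 as $x\downarrow0$.
   Context: Tree. $\mu$ is a probability distribution on $\{0,1,2,\dots\}$ with $\mu(0)=0$, $\mu(1)<1$; $Z\sim\mu$ and $m:=\mathbf E[Z]<\infty$ (so $m>1$). $T$ is the Galton--Watson tree with offspring law $\mu$ and root $\rho$; $T_n$ is the subtree of vertices at distance at most $n$ from the root, $\partial T_n$ is the set of vertices at distance exactly $n$, $Z_n=|\partial T_n|$, and $W:=\lim_{n\to\infty}m^{-n}Z_n$ (a.s. limit). $\mathbf P,\mathbf E$ refer to the randomness of the tree. Random cluster model. For a finite (multi)graph $G=(V,E)$, $p\in[0,1]$ and $q>0$, $\mathbb P^G_{p,q}(\omega)=\frac1{Z^G_{p,q}}p^{o(\omega)}(1-p)^{f(\omega)}q^{k(\omega)}$ for $\omega\in\{0,1\}^E$, where $o(\omega)$, $f(\omega)$ are the numbers of open ($\omega_e=1$) and closed ($\omega_e=0$) edges, $k(\omega)$ is the number of connected components (on the vertex set $V$) formed by the open edges, and $Z^G_{p,q}$ is the normalizing constant. Wired boundary condition: $\bar T_n$ is the graph obtained from $T_n$ by identifying all vertices of $\partial T_n$ to a single vertex, and $\pi_n(\beta)=\mathbb P^{\bar T_n}_{p,q}(\rho\leftrightarrow\partial T_n)$ with $p=1-e^{-\beta}$ is the probability that $\rho$ is connected to this vertex by open edges. It is a random variable, function of the tree $T_n$. Asymptotic inverse: a positive function $h^{-1}$ with $h^{-1}(y)\to0$ and $h(h^{-1}(y))\sim y$ as $y\downarrow0$, where $h(x)=L(1/x)x^{\alpha-1}$. Tight in $(0,+\infty)$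 means: for every $\varepsilon>0$ there is a compact interval $I\subset(0,+\infty)$ such that each variable of the sequence belongs to $I$ with probability at least $1-\varepsilon$; here $n$ ranges over all $n$ large enough that $\beta_n-\beta_c>0$ (and $h^{-1}(\beta_n-\beta_c)$ is defined). *)

(* Defs.v *)
From HB Require Import structures.
From mathcomp Require Import all_boot all_order all_algebra.
From mathcomp Require Import all_classical all_reals all_analysis.
Set Implicit Arguments.
Unset Strict Implicit.
Unset Printing Implicit Defensive.
Import Order.TTheory GRing.Theory Num.Theory.
Import numFieldNormedType.Exports.
Local Open Scope classical_set_scope.
Local Open Scope ring_scope.

(* Loops and parallel edges are allowed; the order of the two ends of an edge
   carries no information. *)
Record multigraph := Multigraph {
  vert : finType;
  edge : finType;
  ends : edge -> vert * vert }.

Definition open_adj (G : multigraph) (w : {ffun edge G -> bool}) : rel (vert G) :=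
  fun x y => [exists e : edge G,
    w e && ((ends e == (x, y)) || (ends e == (y, x)))].

Definition open_count (G : multigraph) (w : {ffun edge G -> bool}) : nat :=
  #|[set e | w e]|.
Definition closed_count (G : multigraph) (w : {ffun edge G -> bool}) : nat :=
  #|[set e | ~~ w e]|.
Definition clusters (G : multigraph) (w : {ffun edge G -> bool}) : nat :=
  n_comp (open_adj w) predT.

Section RandomCluster.
Variables (R : realType) (G : multigraph) (p q : R).

Definition rc_weight (w : {ffun edge G -> bool}) : R :=
  p ^+ open_count w * (1 - p) ^+ closed_count w * q ^+ clusters w.

Definition rc_partition : R := \sum_(w : {ffun edge G -> bool}) rc_weight w.

Definition rc_prob (A : pred {ffun edge G -> bool}) : R :=
  (\sum_(w : {ffun edge G -> bool} | A w) rc_weight w) / rc_partition.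

End RandomCluster.

(* All the vertices of B are merged into the single vertex None; the edges are
   kept, so that parallel edges may appear. *)
Definition merge_vertex (G : multigraph) (B : {set vert G}) (x : vert G) :
  option {y : vert G | y \notin B} := insub x.

Definition identify (G : multigraph) (B : {set vert G}) : multigraph :=
  @Multigraph (option {y : vert G | y \notin B}) (edge G)
    (fun e => (merge_vertex B (ends e).1, merge_vertex B (ends e).2)).

(* Ulam-Harris coding of rooted trees, with words written from the tip to the
   root: the root is [::], and the children of u are the words i :: u with
   i < xi u, where xi u is the number of children of u. *)
Fixpoint generation (xi : seq nat -> nat) (n : nat) : seq (seq nat) :=
  if n is k.+1 then [seq i :: u | u <- generation xi k, i <- iota 0 (xi u)]
  else [:: [::]].

Definition tree_words (xi : seq nat -> nat) (n : nat) : seq (seq nat) :=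
  flatten [seq generation xi k | k <- iota 0 n.+1].

Lemma root_tree_words (xi : seq nat -> nat) (n : nat) :
  [::] \in tree_words xi n.
Proof. by rewrite /tree_words /= mem_head. Qed.

Definition is_child (u v : seq nat) : bool := (v != [::]) && (u == behead v).

Section WiredTree.
Variables (xi : seq nat -> nat) (n : nat).

Definition tree_vertex : finType := seq_sub (tree_words xi n).

Definition tree_edge : finType :=
  {uv : tree_vertex * tree_vertex | is_child (val uv.1) (val uv.2)}.

Definition tree_graph : multigraph :=
  @Multigraph tree_vertex tree_edge (fun e => val e).

Definition tree_root : vert tree_graph := SeqSub (root_tree_words xi n).

Definition tree_boundary : {set vert tree_graph} :=
  [set v : tree_vertex | size (val v) == n].

Definition wired_tree : multigraph := identify tree_boundary.

Definition root_to_boundary : pred {ffun edge wired_tree -> bool} :=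
  fun w => connect (@open_adj wired_tree w)
             (merge_vertex tree_boundary tree_root) None.

End WiredTree.

Definition conn_prob (R : realType) (q : R) (xi : seq nat -> nat) (n : nat)
  (beta : R) : R :=
  rc_prob (1 - expR (- beta)) q (@root_to_boundary xi n).

Definition mutually_independent d d' (Omega : measurableType d)
  (T : measurableType d') (R : realType) (P : probability Omega R)
  (I : eqType) (X : I -> {RV P >-> T}) : Prop :=
  forall (s : seq I) (A : I -> set T), uniq s ->
    (forall i, measurable (A i)) ->
    P (\bigcap_(i in [set i | i \in s]) (X i @^-1` A i)) =
    (\prod_(i <- s) P (X i @^-1` A i))%E.

(* xi u is the number of children that the word u has if it belongs to the
   tree. *)
Definition galton_watson d (Omega : measurableType d) (R : realType)
  (P : probability Omega R) (mu : probability nat R)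
  (xi : seq nat -> {RV P >-> nat}) : Prop :=
  (forall (u : seq nat) (A : set nat), distribution P (xi u) A = mu A) /\
  mutually_independent xi.

Section Offspring.
Variables (R : realType) (mu : probability nat R).

Definition offspring_moment (k : nat) : \bar R :=
  (\int[mu]_z (z%:R ^+ k)%:E)%E.

Definition truncated_moment (k : nat) (x : R) : \bar R :=
  (\int[mu]_z (Num.min z%:R x ^+ k)%:E)%E.

Definition offspring_mean : R := fine (offspring_moment 1).

End Offspring.

Section Martingale.
Variables (d : measure_display) (Omega : measurableType d) (R : realType).
Variables (P : probability Omega R) (m : R) (xi : seq nat -> {RV P >-> nat}).

Definition gen_size (n : nat) (w : Omega) : nat :=
  size (generation (fun u => xi u w) n).

(* The limit exists almost surely; on the exceptional null set, limn returns
   an arbitrary value. *)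
Definition gw_limit (w : Omega) : R :=
  limn (fun n => (gen_size n w)%:R / m ^+ n : R).

Definition gw_conn_prob (q : R) (n : nat) (beta : R) (w : Omega) : R :=
  conn_prob q (fun u => xi u w) n beta.

Definition gw_limit_moment (k : nat) : R :=
  fine ('E_P[(fun w => (gw_limit w ^+ k)%R)])%E.

End Martingale.

Definition psi (R : realType) (q x : R) : R :=
  (expR x - 1) / (expR x + q - 1).

(* Only used for 0 < q <= 2. *)
Definition crit_exp (R : realType) (q : R) : nat := if q < 2 then 1%N else 2%N.

Definition crit_const (R : realType) (q m EW2 EW3 : R) : R :=
  if q < 2 then 2 * (m + q - 1) / (q * (2 - q)) * EW2^-1
  else Num.sqrt (3 * m / 2) * EW3 `^ (- 2^-1).

(* Positivity and measurability are required on some half-line only. *)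
Definition slowly_varying (R : realType) (L : R -> R) : Prop :=
  (exists X : R, measurable_fun `[X, +oo[ L /\ forall x, X <= x -> 0 < L x) /\
  forall lambda : R, 0 < lambda -> L (lambda * x) / L x @[x --> +oo] --> (1 : R).

(* An asymptotic inverse at 0+ is only defined on a neighbourhood of 0+: a total
   function g stands for its restriction to the set where it is positive. *)
Definition asymptotic_inverse (R : realType) (h g : R -> R) : Prop :=
  [/\ \forall y \near 0^'+, 0 < g y,
      g y @[y --> 0^'+] --> (0 : R)
    & h (g y) / y @[y --> 0^'+] --> (1 : R)].

Definition tight_pos d (Omega : measurableType d) (R : realType)
  (P : probability Omega R) (N : set nat) (X : nat -> Omega -> R) : Prop :=
  forall eps : R, 0 < eps -> exists a b : R, [/\ 0 < a, a <= b
    & forall n, N n -> ((1 - eps)%:E <= P [set w | (a <= X n w <= b)%R])%E].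

(* Main.v *)
Require Import Defs.
From HB Require Import structures.
From mathcomp Require Import all_boot all_order all_algebra.
From mathcomp Require Import all_classical all_reals all_analysis.
From mathcomp Require Import measurable_realfun ring lra.
Import Order.TTheory GRing.Theory Num.Theory.
Import numFieldNormedType.Exports.
Local Open Scope classical_set_scope.
Local Open Scope ring_scope.
Set Implicit Arguments.
Unset Strict Implicit.
Unset Printing Implicit Defensive.

(** The connection probability of the tree of height [n.+1] is [psi q x], where
    the log odds [x] at the root are the sum over its children of messages
    obtained from the log odds of the subtrees by a deterministic increasing
    concave function [transfer], of slope [psi q beta] at the origin
    ([conn_prob_log_odds]). Indeed the wired tree is a product of its branches,
    and the number of clusters can be read on its closed edges ([clustersE]).
    Hence the mean message [f] satisfies
        [f n.+1 = m * psi q beta * f n - (mean defect)]   ([msg_meanS])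
    where the defect is the distance between the transfer function and its
    tangent, of order [x ^ (s + 1)] at the origin. Near criticality,
    [m * psi q beta - 1] is linear in [beta - betac].

    The mean defect is governed by the truncated moment [Phi] of the offspring
    law. The difficulty is that it depends on the whole law of the messages. Two
    comparisons control it uniformly in the height and in the parameter. The
    transfer function is star-shaped, so that it decreases normalized moments of
    the messages of order [p > 1] ([star_order], [message_powR_bound]); the
    messages are therefore spread over the scale of their mean, which bounds the
    mean defect from below ([defect_mean_lower]). The recursion for the moment of
    order [s + 1] contracts, which bounds the mean defect from above
    ([defect_mean_upper]). The resulting inequalities ([drift]) force the mean
    message to the level where the pull of the defect balances the growth: it
    cannot cross this level downwards by much, and if the tails of the offspring
    law are regular, it reaches it from above in a time of order
    [1 / (beta - betac)] ([msg_mean_scale]). The hypothesis that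
    [n * (beta n - betac)] diverges gives it this time.

    For regularly varying offspring this level is of the order of the asymptotic
    inverse ([msg_mean_inverse]); tightness in [(0, +oo)] follows from Markov's
    inequality and, near zero, from the fact that small log odds at the root
    require small log odds at all the children ([psi_tight]).

    With a finite moment of order [s + 1], the last [k] generations are nearly
    linear, and the log odds divided by their mean are close to a sum of
    independent variables over generation [k], hence to the normalized size of
    this generation ([tot_dist]). They converge to [W] in mean of order [s + 1]
    ([dist_X_cvg]), so that the mean defect is asymptotic to an explicit multiple
    of [f ^ (s + 1)], which identifies the level ([msg_mean_level]) and the
    constant ([limit_const]). All these limits are taken along a filter on pairs
    of a parameter and a height ([scaling]). For almost sure convergence, the
    errors are summable along parameters that converge geometrically
    ([ae_cvg_along]); the log odds increase with the parameter and decrease with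
    the height, so that any sequence is caught between two such sequences
    ([ae_sandwich]).

    All of this takes place on the space of offspring functions with the
    sigma-algebra of the coordinates, where subtrees are shifts; the law of the
    random tree is transported there at the end. *)


(** * Words and subtrees *)

Definition shift (T : Type) (i : nat) (x : seq nat -> T) : seq nat -> T :=
  fun v => x (rcons v i).

Definition subtree (T : Type) (v : seq nat) (x : seq nat -> T) : seq nat -> T :=
  fun u => x (u ++ v).

Lemma shift_subtree (T : Type) i v (x : seq nat -> T) :
  shift i (subtree v x) = subtree (i :: v) x.
Proof. by apply/funext => u; rewrite /shift /subtree cat_rcons. Qed.

Lemma subtree_nil (T : Type) (x : seq nat -> T) : subtree [::] x = x.
Proof. by apply/funext => u; rewrite /subtree cats0. Qed.

Lemma subtree_rcons (T : Type) u i (x : seq nat -> T) :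
  subtree (rcons u i) x = subtree u (shift i x).
Proof. by apply/funext => w; rewrite /shift /subtree rcons_cat. Qed.

Lemma generation_shift (xi : seq nat -> nat) k :
  generation xi k.+1 =
  flatten [seq [seq rcons v i | v <- generation (shift i xi) k]
          | i <- iota 0 (xi [::])].
Proof.
elim: k => [|k IHk].
  by rewrite /= cats0; elim: (iota _ _) => //= i s ->.
rewrite -[LHS]/(flatten [seq [seq i :: u | i <- iota 0 (xi u)]
  | u <- generation xi k.+1]).
rewrite {}IHk; elim: (iota 0 (xi [::])) => //= i s IHs.
rewrite map_cat flatten_cat {}IHs; congr (_ ++ _).
elim: (generation _ k) => //= v t IHt.
rewrite {}IHt map_cat; congr (_ ++ _).
by rewrite -map_comp /shift.
Qed.

Lemma size_generationS (xi : seq nat -> nat) k :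
  size (generation xi k.+1) =
  (\sum_(i < xi [::]) size (generation (shift i xi) k))%N.
Proof.
rewrite generation_shift size_flatten /shape -map_comp sumnE big_map.
rewrite -(big_mkord xpredT (fun i => size (generation (shift i xi) k))).
rewrite /index_iota subn0.
by apply: eq_bigr => i _; rewrite /= size_map.
Qed.

Lemma size_in_generation xi k v : v \in generation xi k -> size v = k.
Proof.
elim: k v => [|k IHk] v; first by rewrite inE => /eqP ->.
by case/allpairsPdep => u [i [/IHk <- _ ->]].
Qed.

Definition in_tree (xi : seq nat -> nat) (v : seq nat) : bool :=
  v \in generation xi (size v).

Lemma in_tree_cons xi i u :
  in_tree xi (i :: u) = in_tree xi u && (i < xi u)%N.
Proof.
apply/idP/idP => [|/andP[uT ui]].
  rewrite {1}/in_tree [size _]/= => /allpairsPdep[u' [i' [u'T]]].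
  rewrite mem_iota /= add0n => iu' [-> ->].
  by rewrite iu' andbT /in_tree (size_in_generation u'T).
rewrite /in_tree [size _]/=; apply/allpairsPdep; exists u, i.
by rewrite mem_iota /= add0n; split.
Qed.

Lemma in_tree_rcons xi u i :
  in_tree xi (rcons u i) = (i < xi [::])%N && in_tree (shift i xi) u.
Proof.
elim: u => [|j u IHu]; first by rewrite /= in_tree_cons andbC.
by rewrite /= !in_tree_cons IHu -andbA.
Qed.

Lemma mem_tree_words xi n v :
  (v \in tree_words xi n) = (size v <= n)%N && in_tree xi v.
Proof.
apply/flattenP/andP => [[s /mapP[k]]|[vn vT]].
  rewrite mem_iota /= add0n ltnS => kn -> vT.
  by rewrite /in_tree (size_in_generation vT).
by exists (generation xi (size v)) => //; apply: map_f; rewrite mem_iota ltnS.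
Qed.

(** The edge above a word is labelled by that word, so the edges of the tree of
    height [n] are its nonempty words. *)
Fixpoint edge_words (n : nat) (xi : seq nat -> nat) : seq (seq nat) :=
  if n is k.+1 then
    flatten [seq [:: i] :: [seq rcons v i | v <- edge_words k (shift i xi)]
            | i <- iota 0 (xi [::])]
  else [::].

Lemma mem_edge_words n xi v :
  (v \in edge_words n xi) = [&& v != [::], (size v <= n)%N & in_tree xi v].
Proof.
elim: n xi v => [|n IHn] xi v; first by case: v.
apply/flattenP/and3P => [[s /mapP[i]]|[]].
  rewrite mem_iota /= add0n => ixi -> {s}.
  rewrite inE => /orP[/eqP -> |/mapP[u]].
    by split => //; rewrite in_tree_cons.
  rewrite IHn => /and3P[u0 un uT] ->.
  by rewrite size_rcons in_tree_rcons ixi; case: (u) un uT.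
case/lastP: v => // u i _; rewrite size_rcons in_tree_rcons => un /andP[ixi uT].
exists ([:: i] :: [seq rcons v i | v <- edge_words n (shift i xi)]).
  by apply/mapP; exists i => //; rewrite mem_iota.
rewrite inE; case: (eqVneq u [::]) => [->|u0]; first by rewrite /= eqxx.
by apply/orP; right; apply/mapP; exists u; rewrite // IHn u0 uT -ltnS un.
Qed.

Lemma uniq_edge_words n xi : uniq (edge_words n xi).
Proof.
elim: n xi => [|n IHn] xi //=.
have : uniq (iota 0 (xi [::])) by exact: iota_uniq.
elim: (iota _ _) => // i s IHs; rewrite [uniq (_ :: _)]/= => /andP[iNs us].
rewrite [flatten _]/= -cat_cons cat_uniq IHs // andbT; apply/andP; split.
  rewrite cons_uniq; apply/andP; split.
    by apply/mapP => -[[|j [|k u]]]//; rewrite mem_edge_words.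
  by rewrite map_inj_uniq //; exact: rcons_injl.
have lastE j v : v \in [:: j] :: [seq rcons v j | v <- edge_words n (shift j xi)]
    -> last 0%N v = j.
  by rewrite inE => /orP[/eqP -> //|/mapP[u _ ->]]; rewrite last_rcons.
apply/negP; case/hasP => v /flattenP[t /mapP[j js ->] /lastE vj] /lastE vi.
by rewrite -vi vj js in iNs.
Qed.

(** * Sums over the configurations of finitely many edges *)

Section ConfigurationSums.
Variables (R : comRingType) (W : eqType).
Implicit Types (c : W -> bool) (s : seq W) (f g : (W -> bool) -> R).

Definition update c v b : W -> bool := fun u => if u == v then b else c u.

Fixpoint config_sum s c f : R :=
  if s is v :: s' then
    config_sum s' (update c v true) f + config_sum s' (update c v false) f
  else f c.

Definition insensitive s f := forall c v b, v \in s -> f (update c v b) = f c.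

Lemma config_sum_eq s c f g :
  (forall c', (forall v, v \notin s -> c' v = c v) -> f c' = g c') ->
  config_sum s c f = config_sum s c g.
Proof.
elim: s c => [|v s IHs] c fg /=; first exact: fg.
congr (_ + _); apply: IHs => c' c'E; apply: fg => u; rewrite inE negb_or;
  by case/andP => uv us; rewrite c'E // /update (negPf uv).
Qed.

Lemma config_sum_cat s1 s2 c f :
  config_sum (s1 ++ s2) c f = config_sum s1 c (fun c' => config_sum s2 c' f).
Proof. by elim: s1 c => [|v s1 IH] c //=; rewrite !IH. Qed.

Lemma insensitiveS s v f : insensitive (v :: s) f -> insensitive s f.
Proof. by move=> fs c u b us; apply: fs; rewrite inE us orbT. Qed.

Lemma config_sumM s c f g : insensitive s f ->
  config_sum s c (fun c' => f c' * g c') = f c * config_sum s c g.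
Proof.
elim: s c => [|v s IHs] c fs //=.
rewrite !IHs ?mulrDr; try exact: insensitiveS fs.
by rewrite !fs ?mem_head.
Qed.

Lemma config_sum_update s c v b f : v \notin s -> insensitive [:: v] f ->
  config_sum s (update c v b) f = config_sum s c f.
Proof.
move=> + fv; elim: s c => [|u s IHs] c /=; first by rewrite fv ?mem_head.
rewrite inE negb_or => /andP[vu vs].
have updC b' : update (update c v b) u b' = update (update c u b') v b.
  apply/funext => w; rewrite /update; case: (eqVneq w u) => // ->.
  by rewrite eq_sym (negPf vu).
by rewrite !updC !IHs.
Qed.

Lemma config_sum_catM s1 s2 c f g : ~~ has (mem s1) s2 ->
  insensitive s2 f -> insensitive s1 g ->
  config_sum (s1 ++ s2) c (fun c' => f c' * g c') =
  config_sum s1 c f * config_sum s2 c g.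
Proof.
move=> s12 fs2 gs1; rewrite config_sum_cat.
under config_sum_eq => c' _ do rewrite config_sumM // mulrC.
rewrite (@config_sumM s1 c (fun c' => config_sum s2 c' g)) 1?[RHS]mulrC //.
move=> c' v b vs; rewrite config_sum_update //.
  by apply/negP => vs2; move/hasPn: s12 => /(_ _ vs2) /=; rewrite vs.
by move=> c'' u b'; rewrite inE => /eqP ->; exact: gs1.
Qed.

Lemma config_sum_sum (I : finType) s c (F : I -> (W -> bool) -> R) :
  config_sum s c (fun c' => \sum_i F i c') = \sum_i config_sum s c (F i).
Proof. by elim: s c => [|v s IHs] c //=; rewrite !IHs -big_split. Qed.

Lemma config_sumMr s c f (k : R) :
  config_sum s c (fun c' => f c' * k) = config_sum s c f * k.
Proof. by elim: s c => [|v s IHs] c //=; rewrite !IHs mulrDl. Qed.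

Lemma config_sumD s c f g :
  config_sum s c (fun c' => f c' + g c') = config_sum s c f + config_sum s c g.
Proof. by elim: s c => [|v s IHs] c //=; rewrite !IHs addrACA. Qed.

Lemma config_sum_delta s c (d : W -> bool) : uniq s ->
  config_sum s c (fun c' => (all (fun v => c' v == d v) s)%:R) = 1.
Proof.
elim: s c => [|v s IHs] c //= /andP[vs us].
have E b : config_sum s (update c v b)
    (fun c' => ((c' v == d v) && all (fun u => c' u == d u) s)%:R) =
    (b == d v)%:R.
  under config_sum_eq => c' c'E do
    rewrite c'E // /update eqxx -mulnb natrM mulrC.
  by rewrite config_sumMr IHs // mul1r.
by rewrite !E; case: (d v); rewrite ?addr0 ?add0r.
Qed.

(** A sum over maps from a finite type [E] of edges becomes an iterated sum over
    the labels of these edges. *)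
Lemma sum_ffun_config (E : finType) (word : E -> W) s f : injective word ->
  uniq s -> (forall v, (v \in s) = (v \in codom word)) ->
  \sum_(w : {ffun E -> bool}) f (fun v => [exists e, (word e == v) && w e]) =
  config_sum s (fun _ => false) f.
Proof.
move=> wI us sE.
pose cw (w : {ffun E -> bool}) v := [exists e, (word e == v) && w e].
have cwE w e : cw w (word e) = w e.
  apply/existsP/idP => [[e' /andP[/eqP/wI -> //]]|we].
  by exists e; rewrite eqxx.
rewrite [RHS](@config_sum_eq _ _ _ (fun c' =>
  \sum_w (all (fun v => c' v == cw w v) s)%:R * f (cw w))); last first.
  move=> c' c'0; pose w0 := [ffun e => c' (word e)].
  have cw0 : cw w0 = c'.
    apply/funext => v; have [vs|vs] := boolP (v \in s).
      by move: (vs); rewrite sE => /codomP[e ->]; rewrite cwE ffunE.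
    rewrite c'0 //; apply/negbTE/existsP => -[e /andP[/eqP ev _]].
    by move: vs; rewrite sE -ev codom_f.
  rewrite (bigD1 w0) //= cw0 (_ : all _ s) ?mul1r; last by apply/allP => v _ /=.
  rewrite big1 ?addr0 // => w ww0; case: allP; last by rewrite mul0r.
  move=> H; case/negP: ww0; apply/eqP/ffunP => e; rewrite ffunE -cwE.
  by apply/esym/eqP; apply: H; rewrite sE codom_f.
rewrite config_sum_sum; apply: eq_bigr => w _.
by rewrite config_sumMr config_sum_delta // mul1r.
Qed.

End ConfigurationSums.

Lemma config_sum_map (R : comRingType) (W W' : eqType) (h : W -> W')
    (s : seq W) (c : W' -> bool) (g : (W -> bool) -> R) : injective h ->
  config_sum (map h s) c (fun c' => g (c' \o h)) = config_sum s (c \o h) g.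
Proof.
move=> hI; elim: s c => [|v s IHs] c //=; rewrite !IHs.
have E b : update c (h v) b \o h = update (c \o h) v b.
  by apply/funext => u /=; rewrite /update inj_eq.
by rewrite !E.
Qed.

(** * Clusters of a configuration on the wired tree *)

(** For a configuration [c] of the edges of the tree of height [n]: is some word
    of length [n] joined to the root by open edges? *)
Fixpoint reaches (n : nat) (xi : seq nat -> nat) (c : seq nat -> bool) : bool :=
  if n is k.+1 then
    has (fun i => c [:: i] && reaches k (shift i xi) (shift i c))
        (iota 0 (xi [::]))
  else true.

Definition reaches_from n xi c v : bool :=
  reaches (n - size v) (subtree v xi) (subtree v c).

Lemma reaches_fromE n xi c v : (size v < n)%N ->
  reaches_from n xi c v =
  has (fun i => c (i :: v) && reaches_from n xi c (i :: v)) (iota 0 (xi v)).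
Proof.
move=> vn; rewrite {1}/reaches_from -(prednK (n := n - size v)) ?subn_gt0 //=.
by apply: eq_has => i; rewrite !shift_subtree /reaches_from -subnS.
Qed.

Lemma reaches_from_leaf n xi c v : size v = n -> reaches_from n xi c v.
Proof. by move=> vn; rewrite /reaches_from vn subnn. Qed.

(** An invariant that singles out one vertex of each cluster counts them. *)
Lemma n_comp_representatives (T : finType) (e : rel T) (rep : T -> T) :
  connect_sym e -> (forall x, connect e x (rep x)) ->
  (forall x y, e x y -> rep x = rep y) ->
  (forall x y, connect e x y = (rep x == rep y)) /\
  n_comp e predT = #|[set x | rep x == x]%SET|.
Proof.
move=> symE conn inv.
have eqrep x y : connect e x y = (rep x == rep y).
  apply/idP/eqP => [/connectP[s]|xy].
    elim: s x => [|z s IHs] x /= => [_ -> //|/andP[/inv -> /IHs]]; exact.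
  by rewrite (connect_trans (conn x)) // xy symE.
have repK x : rep (rep x) = rep x by apply/eqP; rewrite -eqrep symE.
split => //; rewrite /n_comp_mem.
have repI : {in roots e &, injective rep}.
  move=> x y /eqP xr /eqP yr xy.
  by rewrite -xr -yr; apply/eqP; rewrite root_connect // eqrep xy.
rewrite -(card_in_image (f := rep) (A := [predI roots e & predT])); last first.
  by move=> x y /andP[xr _] /andP[yr _]; exact: repI.
apply: eq_card => y; rewrite inE; apply/fintype.imageP/eqP => [[x _ ->] //|yE].
exists (fingraph.root e y); first by rewrite !inE /= roots_root.
by rewrite -yE; apply/eqP; rewrite -eqrep yE connect_root.
Qed.

Section WiredTreeClusters.
Variables (xi : seq nat -> nat) (n : nat).
Hypothesis n_gt0 : (0 < n)%N.
Let G := wired_tree xi n.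
Let B := tree_boundary xi n.

Definition vertex_of (v : seq nat) : vert G :=
  if insub v is Some y then merge_vertex B y else None.

Lemma vertex_of_val (y : tree_vertex xi n) : vertex_of (val y) = merge_vertex B y.
Proof. by rewrite /vertex_of valK. Qed.

Lemma vertex_ofE v (vT : v \in tree_words xi n) :
  vertex_of v = merge_vertex B (SeqSub vT).
Proof. by rewrite -vertex_of_val. Qed.

Lemma vertex_of_leaf v : (n <= size v)%N -> vertex_of v = None.
Proof.
move=> vn; rewrite /vertex_of; case: insubP => //= y yT yv.
rewrite /merge_vertex insubF //; apply/negbTE; rewrite negbK inE.
by rewrite eqn_leq /= yv vn andbT; move: yT; rewrite mem_tree_words => /andP[].
Qed.

Lemma vertex_of_inner v : v \in tree_words xi n -> (size v < n)%N ->
  exists2 y, vertex_of v = Some y & val (val y) = v.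
Proof.
move=> vT vn; rewrite (vertex_ofE vT) /merge_vertex.
case: insubP => [y _ yv|]; first by exists y; rewrite // yv.
by rewrite negbK inE /= (ltn_eqF vn).
Qed.

Lemma vertex_of_some (y : {y : tree_vertex xi n | y \notin B}) :
  vertex_of (val (val y)) = Some y.
Proof. by rewrite vertex_of_val /merge_vertex valK. Qed.

Definition edge_word (e : edge G) : seq nat := val (val e).2.

Lemma edge_wordP (e : edge G) :
  exists i u, [/\ edge_word e = i :: u, u = val (val e).1 &
               ends e = (vertex_of u, vertex_of (i :: u))].
Proof.
have : is_child (val (val e).1) (val (val e).2) := valP e.
rewrite /edge_word /is_child; case bE: (val (val e).2) => [|i u] //= /eqP ua.
exists i, u; split=> //.
by rewrite -bE -[in vertex_of u]ua !vertex_of_val.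
Qed.

Lemma edge_word_inj : injective edge_word.
Proof.
move=> e e'; case: (edge_wordP e) (edge_wordP e') => i [u [eE uE _]].
case=> i' [u' [eE' uE' _]] ee'; apply/val_inj.
have [ii' uu'] : i = i' /\ u = u' by move: ee'; rewrite eE eE' => -[].
rewrite (surjective_pairing (val e)) (surjective_pairing (val e')).
by congr pair; apply: val_inj; rewrite -?uE -?uE'.
Qed.

Lemma codom_edge_word v : (v \in edge_words n xi) = (v \in codom edge_word).
Proof.
rewrite mem_edge_words; apply/and3P/codomP => [[v0 vn vT]|[e ->]].
  case: v v0 vn vT => // i u _ un uT.
  have vT : i :: u \in tree_words xi n by rewrite mem_tree_words un uT.
  have pT : u \in tree_words xi n.
    rewrite mem_tree_words ltnW //=.
    by move: uT; rewrite in_tree_cons => /andP[].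
  have ch : is_child (val (SeqSub pT)) (val (SeqSub vT)).
    by rewrite /is_child /= eqxx.
  by exists (exist _ (SeqSub pT, SeqSub vT) ch).
have [i [u [eE _ _]]] := edge_wordP e.
have : edge_word e \in tree_words xi n := ssvalP (val e).2.
by rewrite mem_tree_words => /andP[-> ->]; rewrite eE.
Qed.

Variable w : {ffun edge G -> bool}.
Definition edge_config (v : seq nat) : bool :=
  [exists e, (edge_word e == v) && w e].
Let c := edge_config.
Let D := reaches_from n xi c.

(** The last word reached from [v] by following open edges towards the root. *)
Fixpoint summit (v : seq nat) : seq nat :=
  if v is i :: u then if c v then summit u else v else [::].

Lemma edge_configP v : reflect (exists2 e, edge_word e = v & w e) (c v).
Proof.
apply: (iffP existsP) => [[e /andP[/eqP <- we]]|[e <- we]]; exists e => //.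
by rewrite eqxx.
Qed.

Lemma edge_config_adj i u : c (i :: u) ->
  open_adj w (vertex_of u) (vertex_of (i :: u)).
Proof.
case/edge_configP => e eE we; apply/existsP; exists e; rewrite we andTb.
have [j [u' [eE' _ enE]]] := edge_wordP e.
by move: eE; rewrite eE' => -[<- <-]; rewrite enE eqxx.
Qed.

Lemma open_adj_sym : symmetric (open_adj w).
Proof. by move=> x y; apply: eq_existsb => e; rewrite orbC. Qed.

Lemma edge_config_tree v : c v -> v \in tree_words xi n.
Proof. by case/edge_configP => e <- _; exact: ssvalP. Qed.

Lemma connect_summit v : connect (open_adj w) (vertex_of v) (vertex_of (summit v)).
Proof.
elim: v => [|i u IHu] //; rewrite [summit _]/=; case: ifP => // cv.
apply: connect_trans IHu; apply: connect1.
by rewrite open_adj_sym; exact: edge_config_adj.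
Qed.

Lemma connect_boundary v : v \in tree_words xi n -> D v ->
  connect (open_adj w) (vertex_of v) None.
Proof.
move: {2}(n - size v)%N (erefl (n - size v)%N) => k.
elim: k v => [|k IHk] v nv vT Dv.
  by rewrite vertex_of_leaf // -subn_eq0 nv.
have vn : (size v < n)%N by rewrite -subn_gt0 nv.
move: Dv; rewrite /D reaches_fromE // => /hasP[i iv /andP[cv Dv]].
apply: connect_trans (connect1 (edge_config_adj cv)) _.
apply: IHk => //; first by rewrite /= subnS nv.
exact: edge_config_tree.
Qed.

Lemma summit_tree v : v \in tree_words xi n -> summit v \in tree_words xi n.
Proof.
elim: v => [|i u IHu] // vT; rewrite [summit _]/=; case: ifP => // _; apply: IHu.
move: vT; rewrite !mem_tree_words in_tree_cons => /andP[/ltnW -> /andP[-> _]].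
by [].
Qed.

Lemma reaches_summit v : v \in tree_words xi n -> D v -> D (summit v).
Proof.
elim: v => [|i u IHu] // vT Dv; rewrite [summit _]/=; case: ifP => // cv.
move: vT; rewrite mem_tree_words in_tree_cons => /andP[un /andP[uT iu]].
apply: IHu; first by rewrite mem_tree_words ltnW.
by rewrite /D reaches_fromE //; apply/hasP; exists i; rewrite ?mem_iota ?cv.
Qed.

(** Clusters meeting the boundary are represented by the merged vertex, the
    others by their highest vertex. *)
Let word_rep v : vert G := if D (summit v) then None else vertex_of (summit v).
Let rep (x : vert G) : vert G :=
  if x is Some y then word_rep (val (val y)) else None.

Lemma rep_vertex_of v : v \in tree_words xi n -> rep (vertex_of v) = word_rep v.
Proof.
move=> vT; have [vn|vn] := leqP n (size v).
  rewrite vertex_of_leaf //= /word_rep (_ : D (summit v) = true) //.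
  apply: reaches_summit => //; apply: reaches_from_leaf.
  by apply/eqP; rewrite eqn_leq vn andbT; move: vT; rewrite mem_tree_words => /andP[].
by have [y -> /= ->] := vertex_of_inner vT vn.
Qed.

Lemma rep_spec :
  (forall x y, connect (open_adj w) x y = (rep x == rep y)) /\
  clusters w = #|[set x | rep x == x]%SET|.
Proof.
apply: n_comp_representatives.
- exact/sym_connect_sym/open_adj_sym.
- case=> [y|] //=; rewrite -{1}(vertex_of_some y) /word_rep.
  apply: connect_trans (connect_summit _) _; case: ifP => // Dt.
  by apply: connect_boundary => //; apply: summit_tree; exact: ssvalP.
- move=> x y /existsP[e /andP[we]].
  have [i [u [eE uE ->]]] := edge_wordP e.
  have vT : i :: u \in tree_words xi n by rewrite -eE; exact: ssvalP.
  have uT : u \in tree_words xi n by rewrite uE; exact: ssvalP.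
  have cv : c (i :: u) by apply/edge_configP; exists e.
  have E : rep (vertex_of u) = rep (vertex_of (i :: u)).
    by rewrite !rep_vertex_of // /word_rep [summit (i :: u)]/= cv.
  by case/orP => /eqP[<- <-].
Qed.

Lemma root_to_boundaryE : root_to_boundary w = reaches n xi c.
Proof.
have [connE _] := rep_spec.
have rT := root_tree_words xi n.
rewrite -[LHS]/(connect (open_adj w) (merge_vertex B (tree_root xi n)) None).
rewrite -(vertex_of_val (tree_root xi n)) connE rep_vertex_of // /word_rep /=.
rewrite /D /reaches_from /= subn0 !subtree_nil; case: (reaches _ _ _); rewrite ?eqxx //.
by have [y ->] := vertex_of_inner rT n_gt0.
Qed.

(** The clusters are the one of the boundary, that of the root if it is
    another one, and one for each closed edge whose end farther from the root
    is not joined to the boundary through its own subtree: this end is the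
    summit of its cluster. The factor [q ^ clusters] is thus a product over
    the edges, which makes the partition function recursive. *)
Lemma clustersE : clusters w =
  (1 + ~~ reaches n xi c + #|[set e | ~~ w e & ~~ D (edge_word e)]%SET|)%N.
Proof.
have [_ ->] := rep_spec.
set S := [set e | _ & _]%SET.
have rT := root_tree_words xi n.
have Dn v : v \in tree_words xi n -> ~~ D v -> (size v < n)%N.
  rewrite mem_tree_words => /andP[vn _] Dv; rewrite ltn_neqAle vn andbT.
  by apply: contra Dv => /eqP vE; exact: reaches_from_leaf.
have DE : reaches n xi c = D [::] by rewrite /D /reaches_from !subtree_nil subn0.
have cE e : c (edge_word e) = w e.
  apply/edge_configP/idP => [[e' /edge_word_inj -> //]|we]; by exists e.
have SE e : e \in S -> summit (edge_word e) = edge_word e /\ ~~ D (edge_word e).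
  rewrite inE => /andP[we De]; split=> //.
  by have [i [u [eE _ _]]] := edge_wordP e; rewrite eE /= -eE cE (negPf we).
pose R0 := if D [::] then finset.set0 else [set vertex_of [::]]%SET.
have eT e : edge_word e \in tree_words xi n := ssvalP (val e).2.
have vI e v : e \in S -> v \in tree_words xi n -> (size v < n)%N ->
    vertex_of (edge_word e) = vertex_of v -> edge_word e = v.
  move=> /SE[_ /(Dn _ (eT e)) en] vT vn.
  have [y -> yE] := vertex_of_inner (eT e) en.
  by have [y' -> y'E] := vertex_of_inner vT vn => -[yy]; rewrite -yE -y'E yy.
have -> : [set x | rep x == x]%SET =
    (None |: (R0 :|: [set vertex_of (edge_word e) | e in S]))%SET.
  apply/setP => x; rewrite !inE; case: x => [y|] //=.
  rewrite -(vertex_of_some y); set v := val (val y).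
  have vT : v \in tree_words xi n := ssvalP (val y).
  have vn : (size v < n)%N.
    have := valP y; rewrite inE /= => yn; rewrite ltn_neqAle yn /=.
    by move: vT; rewrite mem_tree_words => /andP[].
  apply/eqP/idP => [|/orP[|/imsetP[e eS ve]]].
  - rewrite /word_rep; case: ifP => [_|/negbT Dt]; first by rewrite vertex_of_some.
    move=> tv; have tE : summit v = v.
      have := vertex_of_inner (summit_tree vT) (Dn _ (summit_tree vT) Dt).
      by case=> z; rewrite tv vertex_of_some => -[<-].
    rewrite tE in Dt; move: tE Dt; rewrite vertex_of_some; case vE: v => [|i u] /=.
      by rewrite /R0 => _ /negPf ->; rewrite inE -vE vertex_of_some eqxx.
    case: ifP => [cv tu|/negbT cv _ Dv].
      have : (size (summit u) <= size u)%N.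
        by elim: (u) => //= j t IH; case: ifP => // _; exact: leqW.
      by rewrite tu /= ltnn.
    have : v \in edge_words n xi.
      by rewrite mem_edge_words vE; move: vT; rewrite mem_tree_words vE.
    rewrite codom_edge_word => /codomP[e ve].
    apply/orP; right; apply/imsetP; exists e; last by rewrite -ve vertex_of_some.
    by rewrite inE -ve vE Dv -cE -ve vE cv.
  - rewrite /R0; case: ifP => [_|/negbT D0]; rewrite !inE // => /eqP vE.
    have -> : v = [::].
      have [z] := vertex_of_inner rT n_gt0.
      by rewrite -vE vertex_of_some => -[<-].
    by rewrite /word_rep /= (negPf D0).
  - rewrite -(vI e v eS vT vn (esym ve)) /word_rep.
    by have [-> /negPf ->] := SE _ eS.
rewrite cardsU1 cardsU card_in_imset; last first.
  move=> e e' eS e'S ee'; apply: edge_word_inj; apply: vI => //.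
  by apply: Dn => //; have [] := SE _ e'S.
rewrite (_ : R0 :&: _ = finset.set0)%SET; last first.
  apply/setP => x; rewrite !inE; apply/negP => /andP[].
  rewrite /R0; case: ifP; rewrite !inE // => _ /eqP -> /imsetP[e eS eE].
  have := vI e [::] eS rT n_gt0 (esym eE).
  by have [i [u [-> _ _]]] := edge_wordP e.
rewrite cards0 subn0 addnA; congr (_ + _)%N; congr (_ + _)%N; last first.
  by rewrite /R0 DE; case: (D _); rewrite ?cards0 ?cards1.
rewrite !inE negb_or; apply/eqP; rewrite eqb1; apply/andP; split.
  rewrite /R0; case: ifP; rewrite ?inE // => _.
  by have [y ->] := vertex_of_inner rT n_gt0.
apply/imsetP => -[e eS].
have [_ /(Dn _ (eT e)) en] := SE _ eS.
by have [y ->] := vertex_of_inner (eT e) en.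
Qed.

End WiredTreeClusters.

(** * The recursion for the connection probability *)

Section TreeWeights.
Variables (R : comRingType) (p q : R).

(** The weight of a configuration, without the factors [q] of the clusters of
    the root and of the boundary. *)
Fixpoint tree_weight (n : nat) (xi : seq nat -> nat) (c : seq nat -> bool) : R :=
  if n is k.+1 then
    \prod_(i <- iota 0 (xi [::]))
      ((if c [:: i] then p
        else (1 - p) * q ^+ (~~ reaches k (shift i xi) (shift i c)))
       * tree_weight k (shift i xi) (shift i c))
  else 1.

Lemma tree_weightE n xi c :
  tree_weight n xi c =
  \prod_(v <- edge_words n xi)
     (if c v then p else (1 - p) * q ^+ (~~ reaches_from n xi c v)).
Proof.
elim: n xi c => [|n IHn] xi c /=; first by rewrite big_nil.
rewrite big_flatten big_map; apply: eq_bigr => i _.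
rewrite big_cons big_map IHn; congr (_ * _).
  by rewrite /reaches_from /= subSS subn0 -!shift_subtree !subtree_nil.
apply: eq_bigr => v _; congr (if _ then _ else _ * _ ^+ ~~ _).
by rewrite /reaches_from size_rcons subSS !subtree_rcons.
Qed.

(** Splitting the partition function according to the event of interest yields
    a closed recursion for the pair. *)
Definition joined_sum n xi : R :=
  config_sum (edge_words n xi) (fun _ => false)
    (fun c => (reaches n xi c)%:R * tree_weight n xi c).
Definition unjoined_sum n xi : R :=
  config_sum (edge_words n xi) (fun _ => false)
    (fun c => (~~ reaches n xi c)%:R * tree_weight n xi c).

(** Weights that a subtree and the edge above it contribute to the sum over all
    configurations, and to the sum over those in which this edge does not join
    the parent to the boundary. *)
Definition branch_all n xi : R :=
  p * (joined_sum n xi + unjoined_sum n xi)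
  + (1 - p) * (joined_sum n xi + q * unjoined_sum n xi).
Definition branch_unjoined n xi : R :=
  p * unjoined_sum n xi
  + (1 - p) * (joined_sum n xi + q * unjoined_sum n xi).

Lemma config_sum_branches n (s : seq nat) (xi : seq nat -> nat)
    (g : nat -> bool -> (seq nat -> bool) -> R) : uniq s ->
  (forall i b, insensitive [:: [::]] (g i b)) ->
  config_sum
    (flatten [seq [:: i] :: [seq rcons v i | v <- edge_words n (shift i xi)]
             | i <- s])
    (fun _ => false)
    (fun c => \prod_(i <- s) g i (c [:: i]) (shift i c)) =
  \prod_(i <- s)
    (config_sum (edge_words n (shift i xi)) (fun _ => false) (g i true) +
     config_sum (edge_words n (shift i xi)) (fun _ => false) (g i false)).
Proof.
pose ws i := [:: i] :: [seq rcons v i | v <- edge_words n (shift i xi)].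
have lastE j v : v \in ws j -> last 0%N v = j /\ v != [::].
  rewrite inE => /orP[/eqP -> //|/mapP[u _ ->]].
  by rewrite last_rcons; split=> //; case: u.
have sens i v b (c : seq nat -> bool) : v != [::] -> last 0%N v != i ->
    update c v b [:: i] = c [:: i] /\ shift i (update c v b) = shift i c.
  move=> v0 vi; split.
    by rewrite /update; case: eqP => // vE; rewrite -vE eqxx in vi.
  apply/funext => u; rewrite /shift /update; case: eqP => // vE.
  by rewrite -vE last_rcons eqxx in vi.
move=> us gs; elim: s us => [|i s IHs]; first by rewrite /= !big_nil.
rewrite cons_uniq => /andP[iNs us]; rewrite [flatten _]/= -cat_cons -/(ws i).
under config_sum_eq => c _ do rewrite big_cons.
rewrite big_cons (@config_sum_catM _ _ _ _ _
  (fun c => g i (c [:: i]) (shift i c))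
  (fun c => \prod_(j <- s) g j (c [:: j]) (shift j c))).
- rewrite IHs //; congr (_ * _); rewrite /ws /=.
  have E b : config_sum [seq rcons v i | v <- edge_words n (shift i xi)]
      (update (fun=> false) [:: i] b) (fun c => g i (c [:: i]) (shift i c)) =
      config_sum (edge_words n (shift i xi)) (fun=> false) (g i b).
    transitivity (config_sum [seq rcons v i | v <- edge_words n (shift i xi)]
      (update (fun=> false) [:: i] b) (fun c => g i b (c \o rcons^~ i))).
      apply: config_sum_eq => c' c'E; rewrite c'E; first by rewrite /update eqxx.
      by apply/mapP => -[[|j [|k u]]]//; rewrite mem_edge_words.
    have ir : injective (rcons^~ i : seq nat -> seq nat) by exact: rcons_injl.
    rewrite (config_sum_map _ _ _ ir).
    have -> : update (fun=> false) [:: i] b \o rcons^~ i =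
        update (fun=> false) [::] b.
      by apply/funext => u; rewrite /update /= -{1}[[:: i]]/(rcons [::] i) (inj_eq ir).
    by rewrite config_sum_update // mem_edge_words.
  by rewrite !E.
- apply/hasPn => v /flattenP[t /mapP[j js ->] /lastE[vj _]] /=.
  by apply/negP => /lastE[vi _]; rewrite -vi vj js in iNs.
- move=> c v b /flattenP[t /mapP[j js ->] /lastE[vj v0]].
  have vi : last 0%N v != i by rewrite vj; apply: contraNneq iNs => <-.
  by have [-> ->] := sens i v b c v0 vi.
- move=> c v b /lastE[vi v0]; apply: eq_big_seq => j js.
  have vj : last 0%N v != j by rewrite vi; apply: contraNneq iNs => ->.
  by have [-> ->] := sens j v b c v0 vj.
Qed.

Lemma root_insensitive n xi (F : bool -> R) :
  insensitive [:: [::]] (fun c => F (reaches n xi c) * tree_weight n xi c).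
Proof.
move=> c v b; rewrite inE => /eqP ->.
have E i : shift i (update c [::] b) = shift i c.
  by apply/funext => -[|j u].
case: n => [|n] //=; congr (F _ * _); first by apply: eq_has => i; rewrite E.
by apply: eq_bigr => i _; rewrite E.
Qed.

Lemma has_prod (s : seq nat) (P : pred nat) :
  (~~ has P s)%:R = \prod_(i <- s) (~~ P i)%:R :> R.
Proof.
elim: s => [|i s IHs]; first by rewrite big_nil.
by rewrite big_cons -IHs /= negb_or -mulnb natrM.
Qed.

Lemma unjoined_sumS n xi :
  unjoined_sum n.+1 xi = \prod_(i < xi [::]) branch_unjoined n (shift i xi).
Proof.
pose g i (b : bool) (c : seq nat -> bool) : R :=
  (~~ (b && reaches n (shift i xi) c))%:R *
  ((if b then p else (1 - p) * q ^+ (~~ reaches n (shift i xi) c)) *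
   tree_weight n (shift i xi) c).
rewrite /unjoined_sum.
under config_sum_eq => c _ do rewrite /= has_prod -big_split /=.
rewrite (@config_sum_branches n _ xi g) ?iota_uniq //; last first.
  have H i b := @root_insensitive n (shift i xi) (fun r =>
    (~~ (b && r))%:R * (if b then p else (1 - p) * q ^+ (~~ r))).
  by move=> i b c v b' vs; rewrite /g !mulrA; exact: H.
rewrite -(big_mkord xpredT (fun i => branch_unjoined n (shift i xi))).
rewrite /index_iota subn0; apply: eq_bigr => i _; rewrite /branch_unjoined.
rewrite /unjoined_sum /joined_sum mulrDr !(mulrA (1 - p)).
rewrite ![_ * config_sum _ _ _]mulrC -!config_sumMr -!config_sumD.
apply: config_sum_eq => c _; rewrite /g /=.
by case: (reaches _ _ _); rewrite /= ?expr0 ?expr1; ring.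
Qed.

Lemma all_sumS n xi :
  joined_sum n.+1 xi + unjoined_sum n.+1 xi =
  \prod_(i < xi [::]) branch_all n (shift i xi).
Proof.
pose g i (b : bool) (c : seq nat -> bool) : R :=
  ((if b then p else (1 - p) * q ^+ (~~ reaches n (shift i xi) c)) *
   tree_weight n (shift i xi) c).
rewrite /unjoined_sum /joined_sum -config_sumD.
under config_sum_eq => c _ do
  rewrite -mulrDl -natrD addnC addn_negb mul1r /=.
rewrite (@config_sum_branches n _ xi g) ?iota_uniq //; last first.
  move=> i b; exact: (@root_insensitive n (shift i xi)
    (fun r => (if b then p else (1 - p) * q ^+ (~~ r)))).
rewrite -(big_mkord xpredT (fun i => branch_all n (shift i xi))).
rewrite /index_iota subn0; apply: eq_bigr => i _; rewrite /branch_all.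
rewrite /unjoined_sum /joined_sum !mulrDr !(mulrA (1 - p)).
rewrite ![_ * config_sum _ _ _]mulrC -!config_sumMr -!config_sumD.
apply: config_sum_eq => c _; rewrite /g /=.
by case: (reaches _ _ _); rewrite /= ?expr0 ?expr1; ring.
Qed.

End TreeWeights.


Section ConnectionProbability.
Variables (R : realType) (q : R).

Lemma rc_weight_tree (p : R) xi n (w : {ffun edge (wired_tree xi n) -> bool}) :
  (0 < n)%N ->
  rc_weight p q w =
  q * q ^+ (~~ reaches n xi (edge_config w)) *
  tree_weight p q n xi (edge_config w).
Proof.
move=> n0; rewrite /rc_weight clustersE // tree_weightE.
set c := edge_config w; set D := reaches_from n xi c.
have -> : \prod_(v <- edge_words n xi)
    (if c v then p else (1 - p) * q ^+ (~~ D v)) =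
    \prod_(e : edge (wired_tree xi n))
    (if w e then p else (1 - p) * q ^+ (~~ D (edge_word e))).
  rewrite (perm_big (codom (@edge_word xi n))); last first.
    apply: uniq_perm; first exact: uniq_edge_words.
      by rewrite map_inj_uniq ?enum_uniq //; exact: edge_word_inj.
    exact: codom_edge_word.
  rewrite big_map big_enum /=; apply: eq_bigr => e _.
  congr (if _ then _ else _); apply/edge_configP/idP => [|we]; last by exists e.
  by case=> e' /edge_word_inj ->.
rewrite (bigID w) /= (eq_bigr (fun=> p)); last by move=> e ->.
rewrite prodr_const.
rewrite (eq_bigr (fun e => (1 - p) * q ^+ (~~ D (edge_word e)))); last first.
  by move=> e /negPf ->.
rewrite big_split /= prodr_const prodrXr.
have -> : open_count w = #|w : pred _|.
  by apply: eq_card => e; apply/idP/idP => [/set_mem //|we]; exact/mem_set.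
have -> : closed_count w = #|[pred e | ~~ w e]|.
  by apply: eq_card => e; apply/idP/idP => [/set_mem //|we]; exact/mem_set.
have -> : #|[set e | ~~ w e & ~~ D (edge_word e)]%SET| =
    (\sum_(e | ~~ w e) ~~ D (edge_word e))%N.
  rewrite -sum1_card big_mkcond [RHS]big_mkcond; apply: eq_bigr => e _.
  by rewrite inE; case: (w e) => //; case: (D _).
have qE a b : q ^+ (1 + a + b) = q * q ^+ a * q ^+ b by rewrite !exprD expr1.
rewrite qE; move: (q ^+ (\sum_(e | _) _)) (p ^+ _) ((1 - p) ^+ _) => Q P C.
by move: (q ^+ _) => Q'; ring.
Qed.

Lemma conn_probE (beta : R) xi n : (0 < n)%N -> let p := 1 - expR (- beta) in
  conn_prob q xi n beta =
  q * joined_sum p q n xi /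
  (q * (joined_sum p q n xi + q * unjoined_sum p q n xi)).
Proof.
move=> n0 p; rewrite /conn_prob /rc_prob /rc_partition -/p.
have sumE F : \sum_(w : {ffun edge (wired_tree xi n) -> bool}) F (edge_config w) =
    config_sum (edge_words n xi) (fun=> false) F :> R.
  apply: sum_ffun_config; first exact: edge_word_inj.
    exact: uniq_edge_words.
  exact: codom_edge_word.
have cE (k : R) F : k * config_sum (edge_words n xi) (fun=> false) F =
    config_sum (edge_words n xi) (fun=> false) (fun c => F c * k).
  by rewrite config_sumMr mulrC.
congr (_ / _).
  rewrite big_mkcond /joined_sum cE -sumE; apply: eq_bigr => w _.
  rewrite root_to_boundaryE // rc_weight_tree //.
  by case: (reaches _ _ _); rewrite /= ?expr0 ?mul0r ?mul1r ?mulr1 // mulrC.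
rewrite (cE q (fun c => (~~ reaches n xi c)%:R * tree_weight p q n xi c)).
rewrite -config_sumD cE -sumE; apply: eq_bigr => w _.
rewrite rc_weight_tree //.
by case: (reaches _ _ _); rewrite /= ?expr0 ?expr1; ring.
Qed.

(** The contribution of a subtree to the log odds of its parent, as a function
    of the log odds of its own root. *)
Definition transfer (beta x : R) : R :=
  ln ((expR beta * expR x + q - 1) / (expR x + expR beta + q - 2)).

Lemma transfer_gt0 (e t : R) : 0 < q -> 1 < e -> 1 <= t ->
  0 < e * t + q - 1 /\ 0 < t + e + q - 2.
Proof. by move=> q0 e1 t1; split; nra. Qed.

(** Additive form of the recursion: the contribution of a child whose subtree
    has height [n]. A leaf is certainly joined to the boundary, so that only
    the edge above it contributes. *)
Fixpoint message (beta : R) (n : nat) (xi : seq nat -> nat) : R :=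
  if n is k.+1 then
    transfer beta (\sum_(i < xi [::]) message beta k (shift i xi))
  else beta.

Definition log_odds (beta : R) (n : nat) (xi : seq nat -> nat) : R :=
  \sum_(i < xi [::]) message beta n (shift i xi).

Hypothesis q_gt0 : 0 < q.

(** The quotient of the two weights of a subtree is the exponential of its
    message: this turns the products of the recursion into sums. *)
Lemma branch_message (beta : R) n xi : 0 < beta -> let p := 1 - expR (- beta) in
  [/\ 0 < branch_unjoined p q n xi,
      branch_unjoined p q n xi <= branch_all p q n xi &
      branch_all p q n xi = branch_unjoined p q n xi * expR (message beta n xi)].
Proof.
move=> beta0 p; have e0 : 0 < expR beta := expR_gt0 _.
have pE : p = 1 - (expR beta)^-1 by rewrite /p expRN.
have e1 : 1 < expR beta by rewrite expR_gt1.
have p0 : 0 < p by rewrite pE subr_gt0 invf_lt1.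
have p1 : 0 < 1 - p by rewrite pE opprB addrCA subrr addr0 invr_gt0.
elim: n xi => [|n IHn] xi.
  rewrite /branch_all /branch_unjoined /joined_sum /unjoined_sum /=.
  rewrite !mul1r !mul0r !mulr0 !addr0 !mulr1 add0r; split => //; first lra.
  by rewrite pE; field; rewrite gt_eqF.
set b := unjoined_sum p q n.+1 xi; set a := joined_sum p q n.+1 xi.
pose x := \sum_(i < xi [::]) message beta n (shift i xi).
have b0 : 0 < b.
  by rewrite /b unjoined_sumS; apply: prodr_gt0 => i _; have [] := IHn (shift i xi).
have abE : a + b = b * expR x.
  rewrite all_sumS /b unjoined_sumS /x expR_sum -big_split /=.
  by apply: eq_bigr => i _; have [_ _ ->] := IHn (shift i xi).
have a0 : 0 <= a.
  rewrite -(lerD2r b) add0r all_sumS /b unjoined_sumS; apply: ler_prod => i _.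
  by have [/ltW -> -> _] := IHn (shift i xi).
have aE : a = b * expR x - b by rewrite -abE addrK.
have x1 : 1 <= expR x by rewrite -(ler_pM2l b0) mulr1 -abE lerDr.
have M0 : 0 < branch_unjoined p q n.+1 xi.
  rewrite /branch_unjoined -/a -/b addr_gt0 ?mulr_gt0 //.
  by rewrite ltr_wpDl // mulr_gt0.
split => //.
  by rewrite /branch_unjoined /branch_all lerD2r ler_pM2l // lerDr.
rewrite /= /transfer -/x lnK; last first.
  by have [N0 D0] := transfer_gt0 q_gt0 e1 x1; rewrite posrE divr_gt0.
rewrite /branch_unjoined /branch_all -/a -/b aE pE.
have [_ D0] := transfer_gt0 q_gt0 e1 x1.
move: (expR beta) (expR x) e0 D0 => e t e0 D0; field.
by rewrite !gt_eqF.
Qed.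

(** Only the quotient of the two partition functions enters the connection
    probability, and its logarithm is the sum of the messages of the children
    of the root. *)
Theorem conn_prob_log_odds (beta : R) n xi : 0 < beta ->
  conn_prob q xi n.+1 beta = psi q (log_odds beta n xi).
Proof.
move=> beta0; rewrite conn_probE //= /psi.
set p := 1 - _; set a := joined_sum p q n.+1 xi.
set b := unjoined_sum p q n.+1 xi; set t := expR _.
have b0 : 0 < b.
  rewrite /b unjoined_sumS; apply: prodr_gt0 => i _.
  by have [] := branch_message n (shift i xi) beta0.
have abE : a + b = b * t.
  rewrite all_sumS /b unjoined_sumS /t /log_odds expR_sum -big_split /=.
  by apply: eq_bigr => i _; have [_ _ ->] := branch_message n (shift i xi) beta0.
have a0 : 0 <= a.
  rewrite -(lerD2r b) add0r all_sumS /b unjoined_sumS; apply: ler_prod => i _.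
  by have [/ltW -> -> _] := branch_message n (shift i xi) beta0.
have aE : a = b * t - b by rewrite -abE addrK.
have t1 : 1 <= t by rewrite -(ler_pM2l b0) mulr1 -abE lerDr.
have -> : q * (a + q * b) = (q * b) * (t + q - 1) by rewrite aE; ring.
have -> : q * a = (q * b) * (t - 1) by rewrite aE; ring.
by rewrite -mulf_div divff ?mul1r // mulf_neq0 ?gt_eqF.
Qed.

End ConnectionProbability.

(** * The space of offspring functions *)

Definition coordinate_events (U : set (seq nat)) : set (set (seq nat -> nat)) :=
  [set C | exists u (A : set nat), U u /\ C = [set x | A (x u)]].

(** Offspring functions, with the sigma-algebra of the coordinates in [U]. *)
Notation tree_space U := (g_sigma_algebraType (coordinate_events U)).

Definition cylinders (U : set (seq nat)) : set (set (seq nat -> nat)) :=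
  [set C | exists (s : seq (seq nat)) (A : seq nat -> set nat),
     [/\ uniq s, forall u, u \in s -> U u &
         C = [set x | forall u, u \in s -> A u (x u)]]].

Lemma measurable_coordinate U u : U u ->
  measurable_fun [set: tree_space U] (fun x : tree_space U => x u).
Proof.
move=> Uu _ A _; rewrite setTI; apply: sub_sigma_algebra.
by exists u, A.
Qed.

Lemma cylindersE U : @measurable _ (tree_space U) = <<s cylinders U >>.
Proof.
apply/seteqP; split; apply: smallest_sub; try exact: smallest_sigma_algebra.
  move=> _ [u [A [Uu ->]]]; apply: sub_sigma_algebra.
  exists [:: u], (fun=> A); split=> //; first by move=> v; rewrite inE => /eqP ->.
  by apply/seteqP; split=> x /= Ax => [v|]; [rewrite inE => /eqP -> | apply: Ax; rewrite inE].
move=> _ [s [A [_ sU ->]]].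
have -> : [set x | forall u, u \in s -> A u (x u)] =
    \bigcap_(u in [set` s]) [set x | A u (x u)] by [].
rewrite -[X in X _]/(@measurable _ (tree_space U)).
apply: fin_bigcap_measurable; first exact: finite_seq.
by move=> u us; apply: sub_sigma_algebra; exists u, (A u); split=> //; exact: sU.
Qed.

Lemma cylinders_setI U : setI_closed (cylinders U).
Proof.
move=> _ _ [s1 [A1 [u1 U1 ->]]] [s2 [A2 [u2 U2 ->]]].
exists (undup (s1 ++ s2)),
  (fun u => [set k | (u \in s1 -> A1 u k) /\ (u \in s2 -> A2 u k)]).
split; first exact: undup_uniq.
  by move=> u; rewrite mem_undup mem_cat => /orP[/U1|/U2].
apply/seteqP; split=> x /=.
  by move=> [h1 h2] u _; split; [exact: h1 | exact: h2].
by move=> h; split=> u us; have := h u; rewrite mem_undup mem_cat us ?orbT =>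
  /(_ isT)[h1 h2]; [exact: h1|exact: h2].
Qed.

Lemma measurable_sub_space U V : U `<=` V -> forall B : set (seq nat -> nat),
  @measurable _ (tree_space U) B -> @measurable _ (tree_space V) B.
Proof.
move=> UV; apply: smallest_sub; first exact: smallest_sigma_algebra.
by move=> _ [u [A [/UV Vu ->]]]; apply: sub_sigma_algebra; exists u, A.
Qed.

Lemma measurable_fun_sub_space U V d (T : measurableType d)
    (f : (seq nat -> nat) -> T) : U `<=` V ->
  measurable_fun [set: tree_space U] (f : tree_space U -> T) ->
  measurable_fun [set: tree_space V] (f : tree_space V -> T).
Proof.
move=> UV mf _ A mA; rewrite setTI; apply: (measurable_sub_space UV).
by rewrite -[X in _ X]setTI; exact: mf.
Qed.

Definition below (i : nat) : set (seq nat) := [set v | exists u, v = rcons u i].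

Lemma measurable_shift i :
  measurable_fun [set: tree_space (below i)]
    (shift i : tree_space (below i) -> tree_space setT).
Proof.
apply: (@measurability _ _ (tree_space (below i)) (tree_space setT) setT (shift i)
  (coordinate_events setT)) => //.
move=> _ [_ [u [A [_ ->]]] <-]; rewrite setTI; apply: sub_sigma_algebra.
by exists (rcons u i), A; split=> //; exists u.
Qed.

Lemma measurable_fun_shift i d (T : measurableType d) (f : (seq nat -> nat) -> T) :
  measurable_fun [set: tree_space setT] (f : tree_space setT -> T) ->
  measurable_fun [set: tree_space (below i)]
    (f \o shift i : tree_space (below i) -> T).
Proof. by move=> mf; apply: measurableT_comp mf _; exact: measurable_shift. Qed.

Section TreeLaw.
Variables (R : realType) (mu : probability nat R).
Variable Q : probability (tree_space setT) R.

Definition tree_law := forall (s : seq (seq nat)) (A : seq nat -> set nat),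
  uniq s -> Q [set x | forall u, u \in s -> A u (x u)] = (\prod_(u <- s) mu (A u))%E.

Hypothesis QE : tree_law.

Let full_measurable U (B : set (seq nat -> nat)) :
  @measurable _ (tree_space U) B -> @measurable _ (tree_space setT) B.
Proof. exact: measurable_sub_space. Qed.

(** Cylinders are mapped to cylinders of the same probability, because all the
    coordinates have the same law. *)
Lemma shift_law i (B : set (seq nat -> nat)) :
  @measurable _ (tree_space setT) B -> Q (shift i @^-1` B) = Q B.
Proof.
have mS (F : set (seq nat -> nat)) : @measurable _ (tree_space setT) F ->
    @measurable _ (tree_space setT) (shift i @^-1` F).
  by move=> mF; apply: (@full_measurable (below i));
    rewrite -[X in _ X]setTI; exact: measurable_shift.
rewrite cylindersE.
apply: (@dynkin_induction _ (tree_space setT) (cylinders setT)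
  (fun B => Q (shift i @^-1` B) = Q B)).
- exact: cylindersE.
- exact: cylinders_setI.
- by rewrite preimage_setT.
- move=> _ [s [A [us _ ->]]] /=; rewrite QE //.
  pose A' v := A (take (size v).-1 v).
  have AE u : A' (rcons u i) = A u.
    by rewrite /A' size_rcons -cats1 take_size_cat.
  have -> : shift i @^-1` [set x | forall u, u \in s -> A u (x u)] =
      [set x | forall v, v \in [seq rcons u i | u <- s] -> A' v (x v)].
    apply/seteqP; split=> x /= Hx.
      by move=> _ /mapP[u us' ->]; rewrite AE; exact: Hx.
    by move=> u us'; have := Hx (rcons u i); rewrite AE; apply; exact: map_f.
  rewrite QE ?map_inj_uniq //; last exact: rcons_injl.
  by rewrite big_map; under eq_bigr do rewrite AE.
- move=> S mS' SE; rewrite preimage_setC !probability_setC ?SE //; exact: mS.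
- move=> F mF tF FE; rewrite preimage_bigcup !measure_bigcup //.
  + by apply: eq_eseriesr => k _; exact: FE.
  + by move=> k _; apply: mS; exact: mF.
  + apply/trivIsetP => j k _ _ jk; rewrite -preimage_setI.
    by move/trivIsetP : tF => ->; rewrite ?preimage_set0.
Qed.

Let indep_class (U : set (seq nat)) (B : set (seq nat -> nat)) :
  @measurable _ (tree_space setT) B ->
  (forall C, cylinders U C -> Q (C `&` B) = (Q C * Q B)%E) ->
  forall A, @measurable _ (tree_space U) A -> Q (A `&` B) = (Q A * Q B)%E.
Proof.
move=> mB cylB A; rewrite cylindersE.
apply: (@dynkin_induction _ (tree_space U) (cylinders U)
  (fun A => Q (A `&` B) = (Q A * Q B)%E)).
- exact: cylindersE.
- exact: cylinders_setI.
- by rewrite setTI probability_setT mul1e.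
- exact: cylB.
- move=> S /full_measurable mS SE; rewrite probability_setC //.
  have -> : ~` S `&` B = B `\` (B `&` S) by rewrite setDIr setDv set0U setIC.
  have mBS : @measurable _ (tree_space setT) (B `&` S) by exact: measurableI.
  rewrite measureD //; last by rewrite (le_lt_trans (probability_le1 _ _)) ?ltry.
  rewrite setIA setIid setIC; transitivity (Q B - Q S * Q B)%E.
    by congr (_ - _)%E; exact: SE.
  by rewrite muleBl ?mul1e ?fin_num_adde_defr //; exact: fin_num_measure.
- move=> F mF tF FE; rewrite setI_bigcupl !measure_bigcup //.
  + have QBE : Q B = (fine (Q B))%:E by rewrite fineK // fin_num_measure.
    rewrite [RHS]muleC QBE -nneseriesZl //.
    by apply: eq_eseriesr => k _; rewrite -QBE muleC; exact: FE.
  + by move=> k _; apply: (@full_measurable U); exact: mF.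
  + move=> k _; apply: measurableI => //; apply: (@full_measurable U); exact: mF.
  + apply/trivIsetP => j k _ _ jk; rewrite setIACA.
    by move/trivIsetP : tF => ->; rewrite ?set0I.
Qed.

Lemma tree_law_indep U V (A B : set (seq nat -> nat)) : U `&` V = set0 ->
  @measurable _ (tree_space U) A -> @measurable _ (tree_space V) B ->
  Q (A `&` B) = (Q A * Q B)%E.
Proof.
move=> UV0 mA mB.
apply: (@indep_class U) (mA); first exact: full_measurable mB.
move=> C CU; rewrite setIC muleC.
apply: (@indep_class V) (mB).
  apply: (@full_measurable U); rewrite cylindersE; exact: sub_sigma_algebra.
case: CU => s1 [A1 [u1 sU1 ->]] _ [s2 [A2 [u2 sU2 ->]]].
have s12 u : u \in s1 -> u \in s2 -> False.
  by move=> /sU1 Uu /sU2 Vu; suff: (U `&` V) u by rewrite UV0.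
have -> : [set x | forall u, u \in s2 -> A2 u (x u)] `&`
    [set x | forall u, u \in s1 -> A1 u (x u)] =
    [set x | forall u, u \in s2 ++ s1 -> (if u \in s2 then A2 u else A1 u) (x u)].
  apply/seteqP; split=> x /=.
    move=> [h2 h1] u; rewrite mem_cat; case: ifP => [us2 _|_ /= us1]; first exact: h2.
    exact: h1.
  move=> h; split=> u us; have := h u; rewrite mem_cat us ?orbT => /(_ isT).
    by [].
  by case: ifP => // us2; case: (s12 u).
rewrite (@QE (s2 ++ s1) (fun u => if u \in s2 then A2 u else A1 u)); last first.
  rewrite cat_uniq u2 u1 andbT /=; apply/hasPn => u us1 /=.
  by apply/negP => us2; exact: (s12 u).
rewrite big_cat /= !QE //; congr (_ * _)%E.
  by apply: eq_big_seq => u ->.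
apply: eq_big_seq => u us1; case: ifP => // us2; by case: (s12 u).
Qed.

End TreeLaw.

(** * Expectations on the space of trees *)

Definition restrict_to (U : set (seq nat)) : tree_space setT -> tree_space U := id.

Lemma measurable_restrict_to U : measurable_fun setT (restrict_to U).
Proof.
move=> _ B mB; rewrite setTI; exact: (@measurable_sub_space U setT).
Qed.

HB.instance Definition _ U := isMeasurableFun.Build _ _ _ _ (restrict_to U)
  (@measurable_restrict_to U).

Definition restrict_pair (U V : set (seq nat)) (x : tree_space setT) :
  tree_space U * tree_space V := (restrict_to U x, restrict_to V x).

Lemma measurable_restrict_pair U V : measurable_fun setT (restrict_pair U V).
Proof. by apply: measurable_fun_pair; exact: measurable_restrict_to. Qed.

HB.instance Definition _ U V := isMeasurableFun.Build _ _ _ _ (restrict_pair U V)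
  (@measurable_restrict_pair U V).

Section Expectation.
Variables (R : realType) (mu : probability nat R).
Variable Q : probability (tree_space setT) R.
Hypothesis QE : tree_law mu Q.

(** Independence makes the joint law of the restrictions to disjoint sets of
    words a product measure. *)
Lemma tree_law_fubini U V (h : tree_space U * tree_space V -> R) :
  U `&` V = set0 ->
  measurable_fun [set: (tree_space U * tree_space V)%type] h ->
  (forall z, 0 <= h z) ->
  (\int[Q]_x (h (restrict_pair U V x))%:E =
   \int[Q]_x \int[Q]_y (h (restrict_to U x, restrict_to V y))%:E)%E.
Proof.
move=> UV0 mh h0.
pose m1 := distribution Q (restrict_to U).
pose m2 := distribution Q (restrict_to V).
pose m' := distribution Q (restrict_pair U V).
have E X : measurable X -> (m1 \x m2)%E X = m' X.
  apply: product_measure_unique => A B mA mB.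
  exact: (tree_law_indep QE UV0).
have mh' := iffRL (measurable_EFinP _ _) mh.
transitivity (\int[m']_z (h z)%:E)%E.
  by rewrite ge0_integral_pushforward // => z _; rewrite lee_fin.
transitivity (\int[(m1 \x m2)%E]_z (h z)%:E)%E.
  by apply: eq_measure_integral => X mX _; apply/esym/E.
rewrite fubini_tonelli1 //.
rewrite ge0_integral_pushforward //; last 2 first.
- exact: measurable_fun_fubini_tonelli_F.
- by move=> x _; apply: integral_ge0 => y _; rewrite lee_fin.
apply: eq_integral => x _; rewrite /fubini_F /=.
rewrite ge0_integral_pushforward //; last by move=> y _; rewrite lee_fin.
apply: (measurableT_comp mh'); exact: pair1_measurable.
Qed.

Implicit Types f g : (seq nat -> nat) -> R.

Definition meas (U : set (seq nat)) f :=
  measurable_fun [set: tree_space U] (f : tree_space U -> R).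

Definition Itg f := Q.-integrable setT (EFin \o (f : tree_space setT -> R)).
Definition Ex f : R := fine (\int[Q]_x (f x)%:E)%E.

Lemma meas_sub U V f : U `<=` V -> meas U f -> meas V f.
Proof. exact: measurable_fun_sub_space. Qed.

Lemma Itg_meas f : Itg f -> meas setT f.
Proof. by move/measurable_int/measurable_EFinP. Qed.

Lemma ItgP f : meas setT f -> (\int[Q]_x `|f x|%:E < +oo)%E -> Itg f.
Proof. by move=> mf fi; apply/integrableP; split=> //; exact/measurable_EFinP. Qed.

Lemma ExE f : Itg f -> (Ex f)%:E = (\int[Q]_x (f x)%:E)%E.
Proof. by move=> fi; rewrite /Ex fineK // integrable_fin_num. Qed.

Lemma Itg_le f g : meas setT f -> (forall x, `|f x| <= g x) -> Itg g -> Itg f.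
Proof.
move=> mf fg gi; apply: (le_integrable measurableT _ _ gi).
  exact/measurable_EFinP.
by move=> x _ /=; rewrite lee_fin (le_trans (fg x)) // ler_norm.
Qed.

Lemma Itg_cst c : Itg (fun=> c).
Proof. exact: finite_measure_integrable_cst. Qed.

Lemma Itg_bounded f c : meas setT f -> (forall x, `|f x| <= c) -> Itg f.
Proof. by move=> mf fc; apply: (Itg_le mf fc); exact: Itg_cst. Qed.

Lemma ItgD f g : Itg f -> Itg g -> Itg (fun x => f x + g x).
Proof. by move=> fi gi; exact: (integrableD measurableT fi gi). Qed.

Lemma ItgZ c f : Itg f -> Itg (fun x => c * f x).
Proof. by move=> fi; exact: (integrableZl measurableT c fi). Qed.

Lemma ItgB f g : Itg f -> Itg g -> Itg (fun x => f x - g x).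
Proof. by move=> fi gi; exact: (integrableB measurableT fi gi). Qed.

Lemma Itg_norm f : Itg f -> Itg (fun x => `|f x|).
Proof. by move=> fi; exact: (integrable_norm fi). Qed.

Lemma Ex_cst c : Ex (fun=> c) = c.
Proof. by rewrite /Ex integral_cst //= probability_setT mule1. Qed.

Lemma ExD f g : Itg f -> Itg g -> Ex (fun x => f x + g x) = Ex f + Ex g.
Proof. by move=> fi gi; exact: (RintegralD measurableT fi gi). Qed.

Lemma ExB f g : Itg f -> Itg g -> Ex (fun x => f x - g x) = Ex f - Ex g.
Proof. by move=> fi gi; exact: (RintegralB measurableT fi gi). Qed.

Lemma ExZ c f : Itg f -> Ex (fun x => c * f x) = c * Ex f.
Proof. by move=> fi; exact: (RintegralZl c measurableT fi). Qed.

Lemma eq_Ex f g : f =1 g -> Ex f = Ex g.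
Proof. by move=> fg; rewrite /Ex; congr fine; apply: eq_integral => x _; rewrite fg. Qed.

Lemma eq_Itg f g : f =1 g -> Itg f -> Itg g.
Proof. by move=> /funext ->. Qed.

Lemma Itg_sum n (F : 'I_n -> (seq nat -> nat) -> R) :
  (forall i, Itg (F i)) -> Itg (fun x => \sum_(i < n) F i x).
Proof.
elim: n F => [|n IHn] F Fi.
  by apply: (eq_Itg _ (Itg_cst 0)) => x; rewrite big_ord0.
apply: (@eq_Itg (fun x => \sum_(i < n) F (widen_ord (leqnSn n) i) x + F ord_max x)).
  by move=> x; rewrite big_ord_recr.
by apply: ItgD => //; apply: IHn.
Qed.

Lemma Ex_sum n (F : 'I_n -> (seq nat -> nat) -> R) : (forall i, Itg (F i)) ->
  Ex (fun x => \sum_(i < n) F i x) = \sum_(i < n) Ex (F i).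
Proof.
elim: n F => [|n IHn] F Fi.
  by rewrite big_ord0 -[RHS](Ex_cst 0); apply: eq_Ex => x; rewrite big_ord0.
rewrite big_ord_recr /= -IHn // -ExD //; last by apply: Itg_sum.
by apply: eq_Ex => x; rewrite big_ord_recr.
Qed.

Lemma le_Ex f g : Itg f -> Itg g -> (forall x, f x <= g x) -> Ex f <= Ex g.
Proof. by move=> fi gi fg; apply: le_Rintegral. Qed.

Lemma Ex_ge0 f : (forall x, 0 <= f x) -> 0 <= Ex f.
Proof. by move=> f0; exact: Rintegral_ge0. Qed.

Lemma le_norm_Ex f : Itg f -> `|Ex f| <= Ex (fun x => `|f x|).
Proof. by move=> fi; exact: (le_normr_Rintegral measurableT fi). Qed.

Lemma aeS (A B : (seq nat -> nat) -> Prop) : (forall x, A x -> B x) ->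
  {ae Q, forall x, A x} -> {ae Q, forall x, B x}.
Proof. exact: (@filterS _ (almost_everywhere Q) (ae_filter_ringOfSetsType Q)). Qed.

Lemma aeI (A B : (seq nat -> nat) -> Prop) :
  {ae Q, forall x, A x} -> {ae Q, forall x, B x} -> {ae Q, forall x, A x /\ B x}.
Proof. exact: (@filterI _ (almost_everywhere Q) (ae_filter_ringOfSetsType Q)). Qed.

Lemma le_Ex_ae f g : Itg f -> Itg g -> {ae Q, forall x, f x <= g x} -> Ex f <= Ex g.
Proof.
move=> fi gi fg; rewrite -subr_ge0 -ExB //.
have di : Itg (fun x => g x - f x) by exact: ItgB.
have -> : Ex (fun x => g x - f x) = Ex (fun x => `|g x - f x|).
  rewrite /Ex; congr fine; apply: ae_eq_integral => //.
  - exact: (measurable_int Q di).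
  - exact: (measurable_int Q (Itg_norm di)).
  - by apply: aeS fg => x fg _ /=; rewrite ger0_norm // subr_ge0.
by apply: Ex_ge0.
Qed.

Lemma meas_shift i f : meas setT f -> meas (below i) (f \o shift i).
Proof. exact: measurable_fun_shift. Qed.

Lemma meas_shiftT i f : meas setT f -> meas setT (f \o shift i).
Proof. by move=> mf; apply: (@meas_sub (below i)) => //; exact: meas_shift. Qed.

Lemma measurable_shiftT i :
  measurable_fun setT (shift i : tree_space setT -> tree_space setT).
Proof.
move=> _ B mB; rewrite setTI; apply: (@measurable_sub_space (below i) setT) => //.
by rewrite -[X in _ X]setTI; exact: measurable_shift.
Qed.

Lemma integral_shift i f : meas setT f -> (forall x, 0 <= f x) ->
  (\int[Q]_x (f (shift i x))%:E = \int[Q]_x (f x)%:E)%E.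
Proof.
move=> mf f0.
pose m' := pushforward Q (shift i : tree_space setT -> tree_space setT).
transitivity (\int[m']_x (f x)%:E)%E.
  rewrite (ge0_integral_pushforward (measurable_shiftT i)) //.
  - exact/measurable_EFinP.
  - by move=> x _; rewrite lee_fin.
apply: eq_measure_integral => [|mS B mB _]; first exact: measurable_shiftT.
exact: (shift_law QE i mB).
Qed.

Lemma Itg_shift i f : Itg f -> Itg (f \o shift i).
Proof.
move=> /[dup] /Itg_meas mf /integrableP[_ fi]; apply: ItgP; first exact: meas_shiftT.
rewrite (@integral_shift i (fun x => `|f x|)) //; exact: measurableT_comp.
Qed.

Lemma Ex_shift_ge0 i f : meas setT f -> (forall x, 0 <= f x) ->
  Ex (f \o shift i) = Ex f.
Proof. by move=> mf f0; rewrite /Ex (@integral_shift i f). Qed.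

Lemma pos_neg_parts f : Itg f ->
  [/\ Itg (fun x => Num.max (f x) 0), Itg (fun x => Num.max (- f x) 0) &
      f =1 fun x => Num.max (f x) 0 - Num.max (- f x) 0].
Proof.
move=> fi; have mf := Itg_meas fi.
have mN : meas setT (fun x => - f x) by exact: measurableT_comp.
split.
- apply: (Itg_le _ _ (Itg_norm fi)); first exact: measurable_maxr.
  by move=> x; rewrite ger0_norm ?le_max ?lexx ?orbT // ge_max ler_norm normr_ge0.
- apply: (Itg_le _ _ (Itg_norm fi)); first exact: measurable_maxr.
  move=> x; rewrite ger0_norm ?le_max ?lexx ?orbT // ge_max normr_ge0 andbT.
  by rewrite -normrN ler_norm.
- move=> x; have [fx|fx] := orP (le_total 0 (f x)).
    have -> : Num.max (f x) 0 = f x by apply/max_idPl.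
    by have -> : Num.max (- f x) 0 = 0; [apply/max_idPr; rewrite oppr_le0 | rewrite subr0].
  have -> : Num.max (f x) 0 = 0 by apply/max_idPr.
  have -> : Num.max (- f x) 0 = - f x by apply/max_idPl; rewrite oppr_ge0.
  by rewrite sub0r opprK.
Qed.

Lemma Ex_shift i f : Itg f -> Ex (f \o shift i) = Ex f.
Proof.
move=> fi; have [pi ni fE] := pos_neg_parts fi.
rewrite (eq_Ex fE) ExB // -(@Ex_shift_ge0 i _ (Itg_meas pi)); last first.
  by move=> x; rewrite le_max lexx orbT.
rewrite -(@Ex_shift_ge0 i _ (Itg_meas ni)); last by move=> x; rewrite le_max lexx orbT.
by rewrite -ExB; [apply: eq_Ex => x /=; rewrite -fE | exact: Itg_shift..].
Qed.

Let indep_ge0 U V f g : U `&` V = set0 -> meas U f -> meas V g ->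
  (forall x, 0 <= f x) -> (forall x, 0 <= g x) -> Itg f -> Itg g ->
  Itg (fun x => f x * g x) /\ Ex (fun x => f x * g x) = Ex f * Ex g.
Proof.
move=> UV0 mf mg f0 g0 fi gi.
have E : (\int[Q]_x (f x * g x)%:E = (Ex f * Ex g)%:E)%E.
  pose h (z : tree_space U * tree_space V) : R := `|f z.1| * `|g z.2|.
  transitivity (\int[Q]_x (h (restrict_pair U V x))%:E)%E.
    by apply: eq_integral => x _; rewrite /h /= !ger0_norm.
  rewrite tree_law_fubini //; last 2 first.
  - apply: measurable_funM.
      have := measurableT_comp mf (measurable_fst : measurable_fun
        [set: (tree_space U * tree_space V)%type] fst).
      exact: (measurableT_comp (@normr_measurable R setT)).
    have := measurableT_comp mg (measurable_snd : measurable_fun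
      [set: (tree_space U * tree_space V)%type] snd).
    exact: (measurableT_comp (@normr_measurable R setT)).
  - by move=> z; rewrite /h mulr_ge0.
  rewrite EFinM (ExE fi) -ge0_integralZr //; last 3 first.
  - by apply/measurable_EFinP; exact: (Itg_meas fi).
  - by move=> x _; rewrite lee_fin.
  - by rewrite lee_fin Ex_ge0.
  apply: eq_integral => x _; rewrite /h /= !ger0_norm //.
  rewrite (ExE gi) -ge0_integralZl //.
  - by apply: eq_integral => y _; rewrite !ger0_norm // EFinM.
  - by apply/measurable_EFinP; exact: (Itg_meas gi).
  - by move=> y _; rewrite lee_fin.
  - by rewrite lee_fin.
split; last by rewrite /Ex E.
apply: ItgP.
  by apply: measurable_funM; [exact: (Itg_meas fi) | exact: (Itg_meas gi)].
under eq_integral => x _ do rewrite ger0_norm ?mulr_ge0 //.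
by rewrite E ltry.
Qed.

Lemma Ex_indep U V f g : U `&` V = set0 -> meas U f -> meas V g -> Itg f -> Itg g ->
  Itg (fun x => f x * g x) /\ Ex (fun x => f x * g x) = Ex f * Ex g.
Proof.
move=> UV0 mf mg fi gi.
have [fp fn fE] := pos_neg_parts fi; have [gp gn gE] := pos_neg_parts gi.
have pos (h : (seq nat -> nat) -> R) x : 0 <= Num.max (h x) 0.
  by rewrite le_max lexx orbT.
have mp W h : meas W h -> meas W (fun x => Num.max (h x) 0).
  by move=> mh; exact: measurable_maxr.
have mn W h : meas W h -> meas W (fun x => Num.max (- h x) 0).
  by move=> mh; apply: measurable_maxr => //; exact: measurableT_comp.
have I := @indep_ge0 U V _ _ UV0.
have [i1 e1] := I _ _ (mp _ _ mf) (mp _ _ mg) (pos f) (pos g) fp gp.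
have [i2 e2] := I _ _ (mp _ _ mf) (mn _ _ mg) (pos f) (pos (fun x => - g x)) fp gn.
have [i3 e3] := I _ _ (mn _ _ mf) (mp _ _ mg) (pos (fun x => - f x)) (pos g) fn gp.
have [i4 e4] := I _ _ (mn _ _ mf) (mn _ _ mg) (pos (fun x => - f x))
  (pos (fun x => - g x)) fn gn.
pose f1 x := Num.max (f x) 0; pose f2 x := Num.max (- f x) 0.
pose g1 x := Num.max (g x) 0; pose g2 x := Num.max (- g x) 0.
have E : (fun x => f x * g x) =1
    fun x => (f1 x * g1 x - f1 x * g2 x) - (f2 x * g1 x - f2 x * g2 x).
  by move=> x; rewrite fE gE /f1 /f2 /g1 /g2; ring.
have J1 := ItgB i1 i2; have J2 := ItgB i3 i4.
split; first by apply: (@eq_Itg _ _ _ (ItgB J1 J2)) => x; rewrite E.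
rewrite (eq_Ex E) (ExB J1 J2) (ExB i1 i2) (ExB i3 i4) e1 e2 e3 e4.
rewrite (eq_Ex fE) (eq_Ex gE) (ExB fp fn) (ExB gp gn); ring.
Qed.

Definition nonroot : set (seq nat) := [set v | v != [::]].

(** The root and the other words are independent: conditioning on the number
    of children of the root always goes through this identity. *)
Lemma integral_root (g : nat -> (seq nat -> nat) -> R) :
  (forall N, meas nonroot (g N)) -> (forall N x, 0 <= g N x) ->
  (\int[Q]_x (g (x [::]) x)%:E = \int[Q]_x \int[Q]_y (g (x [::]) y)%:E)%E.
Proof.
move=> mg g0.
pose h (z : tree_space [set [::]] * tree_space nonroot) : R := g (z.1 [::]) z.2.
apply: (@tree_law_fubini [set [::]] nonroot h).
- by rewrite -subset0 => v [/= ->].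
- move=> _ B mB; rewrite setTI.
  have -> : (fun z : tree_space [set [::]] * tree_space nonroot => g (z.1 [::]) z.2)
      @^-1` B = \bigcup_N ([set x : tree_space [set [::]] | x [::] = N] `*`
                           [set y : tree_space nonroot | B (g N y)]).
    apply/seteqP; split=> -[x y] /=; first by exists (x [::]).
    by case=> N _ /= [<-].
  apply: bigcupT_measurable => N; apply: measurableX.
    have := @measurable_coordinate [set [::]] [::] erefl measurableT [set N].
    by rewrite setTI; apply.
  by rewrite -[X in _ X]setTI; exact: mg.
- by move=> z; exact: g0.
Qed.

Lemma Ex_root_le (g : nat -> (seq nat -> nat) -> R) (c : nat -> R) :
  (forall N, meas nonroot (g N)) -> (forall N x, 0 <= g N x) ->
  (forall N, Itg (g N)) -> (forall N, Ex (g N) <= c N) ->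
  Itg (fun x => c (x [::])) ->
  Itg (fun x => g (x [::]) x) /\ Ex (fun x => g (x [::]) x) <= Ex (fun x => c (x [::])).
Proof.
move=> mg g0 gi gc ci.
have c0 N : 0 <= c N by apply: le_trans (gc N); exact: Ex_ge0.
have mG : meas setT (fun x => g (x [::]) x).
  move=> _ B mB; rewrite setTI.
  have -> : (fun x : tree_space setT => g (x [::]) x) @^-1` B =
      \bigcup_N ([set x : tree_space setT | x [::] = N] `&`
                 [set x : tree_space setT | B (g N x)]).
    apply/seteqP; split=> x /=; first by exists (x [::]).
    by case=> N _ /= [<-].
  apply: bigcupT_measurable => N; apply: measurableI.
    have := @measurable_coordinate setT [::] I measurableT [set N].
    by rewrite setTI; apply.
  by rewrite -[X in _ X]setTI; apply: (meas_sub _ (mg N)).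
have le1 : (\int[Q]_x (g (x [::]) x)%:E <= \int[Q]_x (c (x [::]))%:E)%E.
  rewrite integral_root //; apply: ge0_le_integral => //.
  - by move=> x _; apply: integral_ge0 => y _; rewrite lee_fin.
  - have -> : (fun x : tree_space setT => \int[Q]_y (g (x [::]) y)%:E)%E =
      (fun x => (Ex (g (x [::])))%:E) by apply/funext => x; rewrite ExE.
    apply/measurable_EFinP.
    apply: (@measurableT_comp _ _ _ _ _ _ (fun N => Ex (g N))) => //.
    exact: measurable_coordinate.
  - exact: (measurable_int Q ci).
  - by move=> x _; rewrite -ExE // lee_fin.
have Gi : Itg (fun x => g (x [::]) x).
  apply: ItgP => //.
  have -> : (fun x : tree_space setT => `|g (x [::]) x|%:E) = fun x => (g (x [::]) x)%:E.
    by apply/funext => x; rewrite ger0_norm.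
  by rewrite (le_lt_trans le1) // -ExE // ltry.
by split => //; rewrite -lee_fin !ExE.
Qed.

Lemma Ex_root_ge (g : nat -> (seq nat -> nat) -> R) (c : nat -> R) :
  (forall N, meas nonroot (g N)) -> (forall N x, 0 <= g N x) ->
  (forall N, Itg (g N)) -> (forall N, c N <= Ex (g N)) -> (forall N, 0 <= c N) ->
  Itg (fun x => g (x [::]) x) ->
  Itg (fun x => c (x [::])) /\ Ex (fun x => c (x [::])) <= Ex (fun x => g (x [::]) x).
Proof.
move=> mg g0 gi gc c0 Gi.
have mc : meas setT (fun x => c (x [::])).
  by apply: (@measurableT_comp _ _ _ _ _ _ c) => //; exact: measurable_coordinate.
have le1 : (\int[Q]_x (c (x [::]))%:E <= \int[Q]_x (g (x [::]) x)%:E)%E.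
  rewrite integral_root //; apply: ge0_le_integral => //.
  - by move=> x _; rewrite lee_fin.
  - exact/measurable_EFinP.
  - have -> : (fun x : tree_space setT => \int[Q]_y (g (x [::]) y)%:E)%E =
      (fun x => (Ex (g (x [::])))%:E) by apply/funext => x; rewrite ExE.
    apply/measurable_EFinP.
    apply: (@measurableT_comp _ _ _ _ _ _ (fun N => Ex (g N))) => //.
    exact: measurable_coordinate.
  - by move=> x _; rewrite -ExE // lee_fin.
have ci : Itg (fun x => c (x [::])).
  apply: ItgP => //.
  have -> : (fun x : tree_space setT => `|c (x [::])|%:E) = fun x => (c (x [::]))%:E.
    by apply/funext => x; rewrite ger0_norm.
  by rewrite (le_lt_trans le1) // -ExE // ltry.
by split => //; rewrite -lee_fin !ExE.
Qed.

End Expectation.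

(** * Analysis of the transfer function *)

Section NondecreasingDerivative.
Variable R : realType.

Lemma le_of_derive (f df : R -> R) :
  (forall x : R, 0 <= x -> is_derive x 1 f (df x)) ->
  (forall x : R, 0 <= x -> 0 <= df x) ->
  forall x y : R, 0 <= x -> x <= y -> f x <= f y.
Proof.
move=> fd d0 x y x0 xy.
have [||z] := @MVT_segment R f df x y xy.
- by move=> z zxy; apply: fd; apply: le_trans x0 _; move: zxy; rewrite in_itv /= => /andP[/ltW].
- apply: derivable_within_continuous => z; rewrite in_itv /= => /andP[xz _].
  by have [] := fd z (le_trans x0 xz).
rewrite in_itv /= => /andP[xz _] E.
by rewrite -subr_ge0 E mulr_ge0 ?subr_ge0 // d0 // (le_trans x0).
Qed.

(** Two functions that agree at the origin are compared through their
    derivatives, which reduces the estimates of the transfer function to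
    algebra. *)
Lemma le_of_derive0 (f g df dg : R -> R) :
  (forall x : R, 0 <= x -> is_derive x 1 f (df x)) ->
  (forall x : R, 0 <= x -> is_derive x 1 g (dg x)) ->
  f 0 = g 0 ->
  forall b : R, (forall x : R, 0 <= x -> x <= b -> df x <= dg x) ->
  forall x : R, 0 <= x -> x <= b -> f x <= g x.
Proof.
move=> fd gd fg0 b dfg x x0 xb.
have [||z] := @MVT_segment R (g - f) (fun z => dg z - df z) 0 x x0.
- move=> z; rewrite in_itv /= => /andP[/ltW z0 _].
  by apply: is_deriveB; [exact: gd | exact: fd].
- apply: derivable_within_continuous => z; rewrite in_itv /= => /andP[z0 _].
  by apply: derivableB; [have [] := gd z z0 | have [] := fd z z0].
rewrite in_itv /= => /andP[z0 zx].
rewrite -[(g - f) x]/(g x - f x) -[(g - f) 0]/(g 0 - f 0) fg0 subrr !subr0 => E.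
by rewrite -subr_ge0 E mulr_ge0 // subr_ge0 dfg // (le_trans zx).
Qed.

End NondecreasingDerivative.

Section Transfer.
Variables (R : realType) (q : R).
Hypothesis q_range : 0 < q <= 2.
Let q_gt0 : 0 < q. Proof. by have /andP[] := q_range. Qed.
Let q_le2 : q <= 2. Proof. by have /andP[] := q_range. Qed.
Let s := crit_exp q.

Notation tr := (transfer q).

Lemma expR_ge1' (x : R) : 0 <= x -> 1 <= expR x.
Proof. by move=> x0; rewrite -expR0 ler_expR. Qed.

Let num (e t : R) := e * t + q - 1.
Let den (e t : R) := t + e + q - 2.

Let num_gt0 (e t : R) : 1 < e -> 1 <= t -> 0 < num e t.
Proof. by move=> e1 t1; have [] := transfer_gt0 q_gt0 e1 t1. Qed.

Let den_gt0 (e t : R) : 1 < e -> 1 <= t -> 0 < den e t.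
Proof. by move=> e1 t1; have [] := transfer_gt0 q_gt0 e1 t1. Qed.

Let algebra_le1 (e t : R) : 1 < e -> 1 <= t -> den e t <= num e t.
Proof. by move=> e1 t1; rewrite /num /den; nra. Qed.

Let algebra_lee (e t : R) : 1 < e -> 1 <= t -> num e t <= e * den e t.
Proof.
move=> e1 t1; have h1 : 0 <= e - 1 by lra.
have h2 : 0 <= e - 1 + q by have := q_gt0; lra.
rewrite -subr_ge0 /num /den (_ : _ - _ = (e - 1) * (e - 1 + q)); last by ring.
exact: mulr_ge0.
Qed.

Let algebra_mono (e t u : R) : 1 < e -> 1 <= t -> t <= u ->
  num e t * den e u <= num e u * den e t.
Proof.
move=> e1 t1 tu; rewrite -subr_ge0 /num /den.
have -> : (e * u + q - 1) * (t + e + q - 2) - (e * t + q - 1) * (u + e + q - 2) =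
  (u - t) * ((e - 1) * (e + q - 1)) by ring.
have h1 : 0 <= e - 1 by lra.
have h2 : 0 <= e + q - 1 by have := q_gt0; lra.
by rewrite mulr_ge0 ?subr_ge0 // mulr_ge0.
Qed.

Lemma transfer0 (beta : R) : 0 < beta -> tr beta 0 = 0.
Proof.
move=> b0; rewrite /transfer expR0 mulr1.
have e1 : 1 < expR beta by rewrite expR_gt1.
have -> : 1 + expR beta + q - 2 = expR beta + q - 1 by ring.
have D0 : 0 < expR beta + q - 1 by have := q_gt0; lra.
by rewrite divff ?ln1 // gt_eqF.
Qed.

Lemma transfer_ge0 (beta x : R) : 0 < beta -> 0 <= x -> 0 <= tr beta x.
Proof.
move=> b0 x0; have e1 : 1 < expR beta by rewrite expR_gt1.
have t1 := expR_ge1' x0.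
apply: ln_ge0; rewrite ler_pdivlMr ?mul1r; last exact: den_gt0.
exact: algebra_le1.
Qed.

Lemma transfer_le (beta x : R) : 0 < beta -> 0 <= x -> tr beta x <= beta.
Proof.
move=> b0 x0; have e1 : 1 < expR beta by rewrite expR_gt1.
have t1 := expR_ge1' x0.
rewrite -ler_expR /transfer lnK; last by rewrite posrE divr_gt0 ?num_gt0 ?den_gt0.
by rewrite ler_pdivrMr; [exact: algebra_lee | exact: den_gt0].
Qed.

Lemma transfer_mono (beta x y : R) : 0 < beta -> 0 <= x -> x <= y ->
  tr beta x <= tr beta y.
Proof.
move=> b0 x0 xy; have e1 : 1 < expR beta by rewrite expR_gt1.
have t1 := expR_ge1' x0; have u1 := expR_ge1' (le_trans x0 xy).
rewrite ler_ln ?posrE ?divr_gt0 ?num_gt0 ?den_gt0 //.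
rewrite ler_pdivrMr ?den_gt0 // mulrAC ler_pdivlMr ?den_gt0 //.
by apply: algebra_mono => //; rewrite ler_expR.
Qed.

(** The formula is symmetric in the weight of the edge and that of the
    subtree, so that monotonicity in [beta] follows from monotonicity in [x]. *)
Lemma transfer_sym (beta x : R) : tr beta x = tr x beta.
Proof.
rewrite /transfer (mulrC (expR beta)); congr (ln (_ / _)); ring.
Qed.

Lemma transfer_mono_beta (beta beta' x : R) : 0 < beta -> beta <= beta' -> 0 <= x ->
  tr beta x <= tr beta' x.
Proof.
move=> b0 bb; rewrite le_eqVlt => /predU1P[<-|x0].
  by rewrite !transfer0 // (lt_le_trans b0).
by rewrite !(transfer_sym _ x) transfer_mono // ltW.
Qed.

Definition transfer_slope (beta x : R) : R :=
  expR x * ((expR beta - 1) * (expR beta + q - 1)) /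
  ((expR beta * expR x + q - 1) * (expR x + expR beta + q - 2)).

Lemma is_derive_transfer (beta x : R) : 0 < beta -> 0 <= x ->
  is_derive x 1 (tr beta) (transfer_slope beta x).
Proof.
move=> b0 x0; have e1 : 1 < expR beta by rewrite expR_gt1.
have t1 := expR_ge1' x0.
pose e := expR beta.
have N0 := num_gt0 e1 t1; have D0 := den_gt0 e1 t1.
pose r (y : R) := (e * expR y + q - 1) / (expR y + e + q - 2).
have dN : is_derive x 1 (fun y => e * expR y + q - 1) (e * expR x).
  have d := is_deriveB (is_deriveD (is_deriveZ e (is_derive_expR x))
    (is_derive_cst q x 1)) (is_derive_cst (1 : R) x 1).
  by apply: (is_derive_eq d); rewrite addr0 subr0.
have dD : is_derive x 1 (fun y => expR y + e + q - 2) (expR x).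
  have d := is_deriveB (is_deriveD (is_deriveD (is_derive_expR x)
    (is_derive_cst e x 1)) (is_derive_cst q x 1)) (is_derive_cst (2 : R) x 1).
  by apply: (is_derive_eq d); rewrite !addr0 subr0.
have DN0 : expR x + e + q - 2 != 0 by rewrite gt_eqF.
have dr : is_derive x 1 r
    (expR x * ((e - 1) * (e + q - 1)) / (expR x + e + q - 2) ^+ 2).
  have [dx vx] := dD.
  have dI : derivable (fun y : R => (expR y + e + q - 2)^-1) x 1.
    exact: (@derivableV _ _ (fun y : R => expR y + e + q - 2)).
  have vI : 'D_1 (fun y : R => (expR y + e + q - 2)^-1) x =
      - (expR x + e + q - 2) ^- 2 * expR x.
    by rewrite (@deriveV _ _ (fun y : R => expR y + e + q - 2)) // vx.
  have dV := DeriveDef dI vI.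
  have dM := is_deriveM dN dV.
  apply: (is_derive_eq dM); rewrite /GRing.scale /=.
  by move: DN0; move: (expR x) => t tN0; field.
have rx0 : 0 < r x by rewrite divr_gt0.
have dl := is_derive1_ln rx0.
have dc := is_derive1_comp dl dr.
apply: (is_derive_eq dc); rewrite /transfer_slope /r -/e.
move: N0 DN0; rewrite /num -/e; move: (expR x) => t /lt0r_neq0 N0 D0'.
by field; rewrite N0 D0'.
Qed.

Let slope_mono (e t u : R) : 1 < e -> 1 <= t -> t <= u ->
  u * (num e t * den e t) <= t * (num e u * den e u).
Proof.
move=> e1 t1 tu; rewrite -subr_ge0 /num /den.
have -> : t * ((e * u + q - 1) * (u + e + q - 2)) -
  u * ((e * t + q - 1) * (t + e + q - 2)) =
  (u - t) * (e * t * u - (q - 1) * (e + q - 2)) by ring.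
rewrite mulr_ge0 ?subr_ge0 //.
have tu1 : 1 <= t * u by nra.
have c0 : (q - 1) * (e + q - 2) <= e.
  by have := q_gt0; have := q_le2 => q2 q0; have [q1|q1] := leP 1 q; nra.
have e0 : 0 <= e by lra.
by rewrite (le_trans c0) // -mulrA ler_peMr.
Qed.

Lemma transfer_slope_mono (beta x y : R) : 0 < beta -> 0 <= x -> x <= y ->
  transfer_slope beta y <= transfer_slope beta x.
Proof.
move=> b0 x0 xy; have e1 : 1 < expR beta by rewrite expR_gt1.
have t1 := expR_ge1' x0; have u1 := expR_ge1' (le_trans x0 xy).
have tu : expR x <= expR y by rewrite ler_expR.
have := slope_mono e1 t1 tu.
have := mulr_gt0 (num_gt0 e1 t1) (den_gt0 e1 t1).
have := mulr_gt0 (num_gt0 e1 u1) (den_gt0 e1 u1).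
rewrite /transfer_slope -/(num (expR beta) (expR x)) -/(den (expR beta) (expR x)).
rewrite -/(num (expR beta) (expR y)) -/(den (expR beta) (expR y)).
have K0 : 0 <= (expR beta - 1) * (expR beta + q - 1).
  by have := q_gt0; move: e1; move: (expR beta) => e e1 q0; rewrite mulr_ge0 //; lra.
move: (_ * den _ _) (num _ _ * den _ _) => Y X Y0 X0 le1.
rewrite ler_pdivrMr // mulrAC ler_pdivlMr // !(mulrAC _ _ Y) !(mulrAC _ _ X).
by rewrite ler_wpM2r.
Qed.

(** Concavity and the value zero at the origin, in the only form in which the
    concavity of the transfer function matters: this is the hypothesis of the
    comparison in the star order. *)
Lemma transfer_star (beta r x : R) : 0 < beta -> 0 <= r <= 1 -> 0 <= x ->
  r * tr beta x <= tr beta (r * x).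
Proof.
move=> b0 /andP[r0 r1] x0.
apply: (@le_of_derive0 R (fun y => r * tr beta y) (fun y => tr beta (r * y))
  (fun y => r * transfer_slope beta y) (fun y => r * transfer_slope beta (r * y))
  _ _ _ x) => //.
- by move=> y y0; have := is_deriveZ r (is_derive_transfer b0 y0).
- move=> y y0; have ry0 : 0 <= r * y by exact: mulr_ge0.
  have d1 : is_derive y 1 (fun z : R => r * z) r.
    by apply: is_derive_eq; rewrite /GRing.scale /= mulr1.
  have := is_derive1_comp (is_derive_transfer b0 ry0) d1.
  by rewrite mulrC.
- by rewrite mulr0 transfer0 // mulr0.
- move=> y y0 _; rewrite ler_wpM2l // transfer_slope_mono ?mulr_ge0 //.
  by rewrite ler_piMl.
Qed.

(** ** The defect of linearity at the origin *)

(** What a generation of the recursion loses with respect to its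
    linearization. *)
Definition defect (beta x : R) : R := psi q beta * x - tr beta x.

(** The derivative of the defect is this factor times the power [s] of [expR x
    - 1]. For [q = 2] the term of order two of the transfer function at the
    origin vanishes, which is why [s] jumps to two. *)
Definition defect_factor (beta x : R) : R :=
  psi q beta *
  (if q < 2 then expR beta * expR x - (q - 1) * (expR beta + q - 2)
   else expR beta) /
  ((expR beta * expR x + q - 1) * (expR x + expR beta + q - 2)).

Lemma psi_gt0 (beta : R) : 0 < beta -> 0 < psi q beta.
Proof.
move=> b0; have e1 : 1 < expR beta by rewrite expR_gt1.
have n0 : 0 < expR beta - 1 by rewrite subr_gt0.
have d0 : 0 < expR beta + q - 1 by have := q_gt0; lra.
by rewrite /psi divr_gt0.
Qed.

Lemma psi_lt1 (beta : R) : 0 < beta -> psi q beta < 1.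
Proof.
move=> b0; have e1 : 1 < expR beta by rewrite expR_gt1.
have d0 : 0 < expR beta + q - 1 by have := q_gt0; lra.
by rewrite /psi ltr_pdivrMr // mul1r; have := q_gt0; lra.
Qed.

Lemma is_derive_defect (beta x : R) : 0 < beta -> 0 <= x ->
  is_derive x 1 (defect beta) (defect_factor beta x * (expR x - 1) ^+ s).
Proof.
move=> b0 x0; have dt := is_derive_transfer b0 x0.
have d1 : is_derive x 1 (fun z : R => psi q beta * z) (psi q beta).
  by apply: is_derive_eq; rewrite /GRing.scale /= mulr1.
apply: (is_derive_eq (is_deriveB d1 dt)).
have e1 : 1 < expR beta by rewrite expR_gt1.
have t1 := expR_ge1' x0.
have := num_gt0 e1 t1; have := den_gt0 e1 t1.
have d0 : 0 < expR beta + q - 1 by have := q_gt0; lra.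
rewrite /transfer_slope /defect_factor /psi /num /den /s /crit_exp.
move: (expR beta) (expR x) d0 => e t /lt0r_neq0 d0 /lt0r_neq0 D0 /lt0r_neq0 N0.
case: ifPn => [_|q2]; first by rewrite expr1; field; rewrite d0 D0 N0.
have qE : q = 2 by apply/eqP; rewrite eq_le q_le2 leNgt.
by move: d0 D0 N0; rewrite qE => d0 D0 N0; field; rewrite d0 D0 N0.
Qed.

Lemma defect0 (beta : R) : 0 < beta -> defect beta 0 = 0.
Proof. by move=> b0; rewrite /defect mulr0 transfer0 // subrr. Qed.

Lemma defect_factor_gt0 (beta x : R) : 0 < beta -> 0 <= x -> 0 < defect_factor beta x.
Proof.
move=> b0 x0; have e1 : 1 < expR beta by rewrite expR_gt1.
have t1 := expR_ge1' x0.
rewrite /defect_factor divr_gt0 //; last by rewrite mulr_gt0 ?num_gt0 ?den_gt0.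
rewrite mulr_gt0 ?psi_gt0 //; case: ifP => [q2|_]; last exact: expR_gt0.
rewrite subr_gt0; move: e1 t1; move: (expR beta) (expR x) => e t e1 t1.
have q0 := q_gt0.
have et : e <= e * t by nra.
apply: lt_le_trans et; rewrite -subr_gt0.
have -> : e - (q - 1) * (e + q - 2) = (2 - q) * (e + q - 1) by ring.
by rewrite mulr_gt0 //; lra.
Qed.

Lemma defect_mono (beta x y : R) : 0 < beta -> 0 <= x -> x <= y ->
  defect beta x <= defect beta y.
Proof.
move=> b0; apply: (@le_of_derive R (defect beta)
  (fun z => defect_factor beta z * (expR z - 1) ^+ s)).
  by move=> z z0; exact: is_derive_defect.
move=> z z0; rewrite mulr_ge0 ?(ltW (defect_factor_gt0 _ _)) //.
by rewrite exprn_ge0 // subr_ge0 expR_ge1'.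
Qed.

Lemma defect_ge0 (beta x : R) : 0 < beta -> 0 <= x -> 0 <= defect beta x.
Proof. by move=> b0 x0; rewrite -(defect0 b0) defect_mono. Qed.

Lemma defect_le_id (beta x : R) : 0 < beta -> 0 <= x -> defect beta x <= x.
Proof.
move=> b0 x0; rewrite /defect lerBlDr (@le_trans _ _ x) //; last first.
  by rewrite lerDl transfer_ge0.
by rewrite ler_piMl // ltW // psi_lt1.
Qed.

Lemma is_deriveXn (c x : R) n :
  is_derive x 1 (fun y : R => c * y ^+ n.+1) (n.+1%:R * c * x ^+ n).
Proof.
have d1 := is_deriveX n.+1 (is_derive_id x (1 : R)).
have d2 := is_deriveZ c d1.
have -> : (fun y : R => c * y ^+ n.+1) = c \*: id ^+ n.+1.
  by apply/funext => y; rewrite /= exprfctE.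
by apply: (is_derive_eq d2); rewrite /GRing.scale /=; ring.
Qed.

Let expR_sub1_bounds (x : R) : 0 <= x -> x <= expR x - 1 /\ expR x - 1 <= x * expR x.
Proof.
move=> x0; split; first by have := expR_ge1Dx x; lra.
have := expR_ge1Dx (- x); rewrite expRN => h.
have t0 := expR_gt0 x.
rewrite -subr_ge0 (_ : _ - _ = expR x * ((expR x)^-1 - (1 - x))).
  have h' : 0 <= (expR x)^-1 - (1 - x) by lra.
  by rewrite mulr_ge0 // ltW.
by field; rewrite gt_eqF.
Qed.

(** Bounds on the derivative give bounds on the defect by integration, since
    [expR x - 1] lies between [x] and [x * expR x]. *)
Lemma defect_le_of_factor (beta K b : R) : 0 < beta ->
  (forall x : R, 0 <= x -> x <= b -> defect_factor beta x * expR x ^+ s <= s.+1%:R * K) ->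
  forall x : R, 0 <= x -> x <= b -> defect beta x <= K * x ^+ s.+1.
Proof.
move=> b0 hK.
apply: (@le_of_derive0 R (defect beta) (fun x => K * x ^+ s.+1)
  (fun x => defect_factor beta x * (expR x - 1) ^+ s)
  (fun x => s.+1%:R * K * x ^+ s)).
- by move=> x x0; exact: is_derive_defect.
- by move=> x _; exact: is_deriveXn.
- by rewrite defect0 // exprS mul0r mulr0.
- move=> x x0 xb; have [h1 h2] := expR_sub1_bounds x0.
  apply: (@le_trans _ _ (defect_factor beta x * (x * expR x) ^+ s)).
    rewrite ler_wpM2l ?(ltW (defect_factor_gt0 _ _)) // lerXn2r ?nnegrE //.
      by rewrite (le_trans x0).
    by rewrite mulr_ge0 ?expR_ge0.
  by rewrite exprMn mulrCA mulrC ler_wpM2r ?exprn_ge0 // hK.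
Qed.

Lemma defect_ge_of_factor (beta k b : R) : 0 < beta ->
  (forall x : R, 0 <= x -> x <= b -> s.+1%:R * k <= defect_factor beta x) ->
  forall x : R, 0 <= x -> x <= b -> k * x ^+ s.+1 <= defect beta x.
Proof.
move=> b0 hk.
apply: (@le_of_derive0 R (fun x => k * x ^+ s.+1) (defect beta)
  (fun x => s.+1%:R * k * x ^+ s)
  (fun x => defect_factor beta x * (expR x - 1) ^+ s)).
- by move=> x _; exact: is_deriveXn.
- by move=> x x0; exact: is_derive_defect.
- by rewrite defect0 // exprS mul0r mulr0.
- move=> x x0 xb; have [h1 h2] := expR_sub1_bounds x0.
  apply: (@le_trans _ _ (defect_factor beta x * x ^+ s)).
    by rewrite ler_wpM2r ?exprn_ge0 // hk.
  rewrite ler_wpM2l ?(ltW (defect_factor_gt0 _ _)) // lerXn2r ?nnegrE //.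
  by rewrite (le_trans x0).
Qed.

(** ** Estimates near the critical point *)

Lemma psi_quad (x : R) : 0 <= x ->
  [/\ 0 <= psi q x, psi q x <= x / q & x / q - psi q x <= x ^+ 2 / q ^+ 2].
Proof.
move=> x0; have q0 := q_gt0; have t1 := expR_ge1' x0.
have [h1 h2] := expR_sub1_bounds x0.
have d0 : 0 < expR x + q - 1 by lra.
have qn : q != 0 by rewrite gt_eqF.
split.
- have h0 : 0 <= expR x - 1 by lra.
  by rewrite /psi divr_ge0 // ltW.
- rewrite /psi ler_pdivrMr // mulrAC ler_pdivlMr //.
  have H := @le_of_derive0 R (fun y => (expR y - 1) * q)
    (fun y => y * (expR y + q - 1)) (fun y => expR y * q)
    (fun y => (expR y + q - 1) + y * expR y) _ _ _ x _ x x0 (lexx x).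
  apply: H.
  + move=> y _; have d1 : is_derive y 1 (fun y : R => expR y - 1) (expR y).
      have d := is_deriveB (is_derive_expR y) (is_derive_cst (1 : R) y 1).
      by apply: (is_derive_eq d); rewrite subr0.
    have := is_deriveZ q d1; rewrite /GRing.scale /= mulrC.
    by congr is_derive; apply/funext => z /=; rewrite mulrC.
  + move=> y _; have d1 : is_derive y 1 (fun y : R => expR y + q - 1) (expR y).
      have d := is_deriveB (is_deriveD (is_derive_expR y) (is_derive_cst q y 1))
        (is_derive_cst (1 : R) y 1).
      by apply: (is_derive_eq d); rewrite addr0 subr0.
    apply: (is_derive_eq (is_deriveM (is_derive_id y (1 : R)) d1)).
    by rewrite /GRing.scale /= mulr1 addrC.
  + by rewrite expR0 subrr !mul0r.
  + move=> y y0 _; have [k1 k2] := expR_sub1_bounds y0.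
    have := q_le2; have := expR_ge1' y0.
    by move: k2 k1; move: (expR y) => t k2 k1 tt q2; nra.
- have -> : x ^+ 2 / q ^+ 2 = x / q - (x / q - x ^+ 2 / q ^+ 2) by ring.
  rewrite lerD2l lerN2 /psi.
  have xq : 0 < x + q by lra.
  apply: (@le_trans _ _ (x / (x + q))).
    rewrite -subr_ge0 (_ : _ - _ = x ^+ 3 / (q ^+ 2 * (x + q))).
      by rewrite divr_ge0 ?exprn_ge0 // mulr_ge0 ?exprn_ge0 ?ltW.
    by field; rewrite qn gt_eqF.
  rewrite ler_pdivrMr // mulrAC ler_pdivlMr //.
  by move: h1; move: (expR x) => t h1; nra.
Qed.

End Transfer.

(** * Estimates that are uniform near the critical point *)

Section Critical.
Variables (R : realType) (q m betac : R).
Hypothesis q_range : 0 < q <= 2.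
Hypothesis m_gt1 : 1 < m.
Hypothesis critical : m * psi q betac = 1.
Let q_gt0 : 0 < q. Proof. by have /andP[] := q_range. Qed.
Let q_le2 : q <= 2. Proof. by have /andP[] := q_range. Qed.
Let s := crit_exp q.
Let bmax := betac + 1.

Lemma critical_expR : (m - 1) * expR betac = m - 1 + q.
Proof.
move: critical; rewrite /psi; have [d0|d0] := eqVneq (expR betac + q - 1) 0.
  by rewrite d0 invr0 !mulr0 => /esym/eqP; rewrite oner_eq0.
move=> h; have : m * (expR betac - 1) = expR betac + q - 1.
  by have := congr1 (fun z => z * (expR betac + q - 1)) h;
    rewrite mul1r -mulrA divfK.
by move: (expR betac) => e he; lra.
Qed.

Lemma betac_gt0 : 0 < betac.
Proof.
rewrite -expR_gt1; have := critical_expR; have := m_gt1; have := q_gt0.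
by move: (expR betac) => e; nra.
Qed.

Let pos_of_range (beta : R) : betac <= beta -> 0 < beta.
Proof. exact: lt_le_trans betac_gt0. Qed.

Lemma psi_mono (x y : R) : 0 < x -> x <= y -> psi q x <= psi q y.
Proof.
move=> x0 xy; have e1 : 1 < expR x by rewrite expR_gt1.
have ef : expR x <= expR y by rewrite ler_expR.
have q0 := q_gt0; have d1 : 0 < expR x + q - 1 by lra.
have d2 : 0 < expR y + q - 1 by lra.
rewrite /psi ler_pdivrMr // mulrAC ler_pdivlMr //.
by move: e1 ef; move: (expR x) (expR y) => e f e1 ef; nra.
Qed.

(** The exact expression shows that the growth rate per generation exceeds one
    by an amount of the order of the distance to criticality. *)
Lemma growth_minus1 (beta : R) : betac <= beta ->
  m * psi q beta - 1 =
  (m - 1 + q) * (expR (beta - betac) - 1) / (expR beta + q - 1).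
Proof.
move=> bb; have b0 := pos_of_range bb.
have e1 : 1 < expR beta by rewrite expR_gt1.
have q0 := q_gt0; have d0 : expR beta + q - 1 != 0 by rewrite gt_eqF //; lra.
have ec := critical_expR; have ec0 : expR betac != 0 by rewrite gt_eqF ?expR_gt0.
have E : (m - 1 + q) * (expR (beta - betac) - 1) =
    m * (expR beta - 1) - (expR beta + q - 1).
  rewrite expRD expRN -ec; move: (expR betac) (expR beta) ec ec0 => c b ec c0.
  have -> : (m - 1) * c * (b / c - 1) = (m - 1) * b - (m - 1) * c by field.
  by rewrite ec; ring.
rewrite E /psi; move: (expR beta) d0 => e d0; field; exact: d0.
Qed.

Let expR_sub1_bounds (x : R) : 0 <= x -> x <= expR x - 1 /\ expR x - 1 <= x * expR x.
Proof.
move=> x0; split; first by have := expR_ge1Dx x; lra.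
have := expR_ge1Dx (- x); rewrite expRN => h.
have t0 := expR_gt0 x.
rewrite -subr_ge0 (_ : _ - _ = expR x * ((expR x)^-1 - (1 - x))).
  have h' : 0 <= (expR x)^-1 - (1 - x) by lra.
  by rewrite mulr_ge0 // ltW.
by field; rewrite gt_eqF.
Qed.

Definition growth_rate : R := (m - 1 + q) / (expR betac + q - 1).

Lemma growth_bounds (beta : R) : betac <= beta ->
  (m - 1 + q) / (expR beta + q - 1) * (beta - betac) <= m * psi q beta - 1 /\
  m * psi q beta - 1 <=
    (m - 1 + q) * expR (beta - betac) / (expR beta + q - 1) * (beta - betac).
Proof.
move=> bb; have e0 : 0 <= beta - betac by rewrite subr_ge0.
have [h1 h2] := expR_sub1_bounds e0.
have e1 : 1 < expR beta by rewrite expR_gt1 pos_of_range.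
have q0 := q_gt0; have d0 : 0 < expR beta + q - 1 by lra.
have n0 : 0 <= m - 1 + q by have := m_gt1; lra.
rewrite growth_minus1 //; split.
  by rewrite mulrAC ler_wpM2r ?invr_ge0 ?(ltW d0) // ler_wpM2l.
rewrite [leRHS]mulrAC ler_wpM2r ?invr_ge0 ?(ltW d0) //.
by rewrite -mulrA ler_wpM2l // mulrC.
Qed.

Lemma growth_linear : exists b1 b2 : R, [/\ 0 < b1, 0 < b2 &
  forall beta : R, betac <= beta -> beta <= bmax ->
    b1 * (beta - betac) <= m * psi q beta - 1 /\
    m * psi q beta - 1 <= b2 * (beta - betac)].
Proof.
have q0 := q_gt0; have m1 := m_gt1; have n0 : 0 < m - 1 + q by lra.
have ec : 1 < expR betac by rewrite expR_gt1 betac_gt0.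
have em : expR betac <= expR bmax by rewrite ler_expR /bmax lerDl ler01.
have dc : 0 < expR betac + q - 1 by lra.
have dm : 0 < expR bmax + q - 1 by lra.
exists ((m - 1 + q) / (expR bmax + q - 1)),
  ((m - 1 + q) * expR 1 / (expR betac + q - 1)).
split; rewrite ?divr_gt0 ?mulr_gt0 ?expR_gt0 // => beta b1 b2.
have [h1 h2] := growth_bounds b1.
have e0 : 0 <= beta - betac by rewrite subr_ge0.
have e1 : expR betac <= expR beta by rewrite ler_expR.
have e2 : expR beta <= expR bmax by rewrite ler_expR.
have d0 : 0 < expR beta + q - 1 by lra.
split.
  apply: le_trans h1; rewrite ler_wpM2r // ler_wpM2l ?(ltW n0) //.
  by rewrite lef_pV2 ?posrE //; lra.
apply: (le_trans h2); rewrite ler_wpM2r // -!mulrA ler_wpM2l ?(ltW n0) //.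
apply: ler_pM; rewrite ?expR_ge0 ?invr_ge0 ?(ltW d0) //.
  by rewrite ler_expR lerBlDl.
by rewrite lef_pV2 ?posrE //; lra.
Qed.

Lemma growth_sharp (eta : R) : 0 < eta -> exists2 delta : R, 0 < delta &
  forall beta : R, betac <= beta -> beta <= betac + delta ->
    (growth_rate - eta) * (beta - betac) <= m * psi q beta - 1 /\
    m * psi q beta - 1 <= (growth_rate + eta) * (beta - betac).
Proof.
move=> eta0.
have q0 := q_gt0.
have ec : 1 < expR betac by rewrite expR_gt1 betac_gt0.
have dc : 0 < expR betac + q - 1 by lra.
have cV : (fun b : R => (expR b + q - 1)^-1) b @[b --> betac] -->
    (expR betac + q - 1)^-1.
  apply: cvgV; first by rewrite gt_eqF.
  by apply: cvgB; [apply: cvgD; [exact: continuous_expR | exact: cvg_cst] | exact: cvg_cst].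
have c1 : (fun b : R => (m - 1 + q) / (expR b + q - 1)) b @[b --> betac] -->
    growth_rate by apply: cvgM => //; exact: cvg_cst.
have c2 : (fun b : R => (m - 1 + q) * expR (b - betac) / (expR b + q - 1)) b
    @[b --> betac] --> growth_rate.
  rewrite (_ : growth_rate = (m - 1 + q) * expR (betac - betac) / (expR betac + q - 1)).
    apply: cvgM => //; apply: cvgM; first exact: cvg_cst.
    apply: (@cvg_comp _ _ _ (fun b : R => b - betac) expR _ (nbhs (betac - betac))).
      by apply: cvgB; [exact: cvg_id | exact: cvg_cst].
    exact: continuous_expR.
  by rewrite subrr expR0 mulr1.
have /cvgrPdist_le /(_ _ eta0) /nbhs_ballP[d1 /= d10 h1] := c1.
have /cvgrPdist_le /(_ _ eta0) /nbhs_ballP[d2 /= d20 h2] := c2.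
exists (Num.min d1 d2 / 2); first by rewrite divr_gt0 // lt_min d10 d20.
move=> beta b1 b2; have [k1 k2] := growth_bounds b1.
have e0 : 0 <= beta - betac by rewrite subr_ge0.
have near : beta - betac < Num.min d1 d2.
  have : 0 < Num.min d1 d2 by rewrite lt_min d10 d20.
  by move: b2; move: (Num.min d1 d2) => d; lra.
move: near; rewrite lt_min => /andP[n1 n2].
have a1 : ball betac d1 beta by rewrite /ball /= distrC ger0_norm.
have a2 : ball betac d2 beta by rewrite /ball /= distrC ger0_norm.
have := h1 _ a1; have := h2 _ a2; rewrite /= !ler_distl => /andP[g1 g2] /andP[g3 g4].
split.
  by apply: le_trans k1; rewrite ler_wpM2r //; lra.
by apply: (le_trans k2); rewrite ler_wpM2r //; lra.
Qed.

Lemma defect_upper : exists2 K : R, 0 < K &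
  forall beta x : R, betac <= beta -> beta <= bmax -> 0 <= x ->
    defect q beta x <= K * x ^+ s.+1.
Proof.
have q0 := q_gt0; have q2 := q_le2.
pose K := 2 * (expR bmax + 1) / q ^+ 2.
have E0 := expR_gt0 bmax.
have K0 : 0 < K by rewrite /K divr_gt0 ?exprn_gt0 // mulr_gt0 // addr_gt0.
exists (Num.max K 1); first by rewrite lt_max K0.
move=> beta x b1 b2 x0; have b0 := pos_of_range b1.
apply: (@defect_le_of_factor R q q_range beta (Num.max K 1) x b0) => // y y0 _.
have e1 : 1 < expR beta by rewrite expR_gt1.
have t1 : 1 <= expR y by rewrite -expR0 ler_expR.
have [N0 D0] := transfer_gt0 q_gt0 e1 t1.
have p1 := ltW (psi_lt1 q_range b0); have p0 := ltW (psi_gt0 q_range b0).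
have eE : expR beta <= expR bmax by rewrite ler_expR.
apply: (@le_trans _ _ (Num.max K 1)); last first.
  by rewrite ler_peMl ?ler1n // le_max ler01 orbT.
rewrite /defect_factor; move: (psi q beta) p1 p0 => p p1 p0.
rewrite /s /crit_exp; case: ifPn => [ql2|qge2].
  rewrite le_max; apply/orP; left; rewrite expr1 -!mulrA.
  set A := (X in _ * X <= _).
  apply: (@le_trans _ _ A); last first.
    rewrite /A mulrCA mulrC ler_pdivrMr ?mulr_gt0 //.
    rewrite /K mulrAC ler_pdivlMr ?exprn_gt0 //.
    move: (expR beta) (expR y) (expR bmax) e1 t1 N0 D0 eE E0 => e t E.
    move=> e1 t1 N0 D0 eE E0.
    apply: (@le_trans _ _ (2 * (e + 1) * ((e * t + q - 1) * (t + e + q - 2)))).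
      have [q1|q1] := leP 1 q.
        have n1 : e * t <= e * t + q - 1 by lra.
        have n2 : t <= t + e + q - 2 by lra.
        have n3 : e * t * t <= (e * t + q - 1) * (t + e + q - 2).
          by apply: ler_pM => //; nra.
        have n4 : 0 <= (q - 1) * (e + q - 2) by rewrite mulr_ge0 //; lra.
        have n5 : (e * t - (q - 1) * (e + q - 2)) * t <= e * t * t by nra.
        have n6 : q ^+ 2 <= 2 * (e + 1) by nra.
        have n7 : 0 <= e * t * t by nra.
        have n8 : 0 <= q ^+ 2 by rewrite sqr_ge0.
        apply: (@le_trans _ _ (e * t * t * q ^+ 2)); first by nra.
        by rewrite [leRHS]mulrC; apply: ler_pM => //; nra.
      have n1 : q * t <= e * t + q - 1 by nra.
      have n2 : q * t <= t + e + q - 2 by nra.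
      have qt : 0 <= q * t by nra.
      have n3 : (q * t) * (q * t) <= (e * t + q - 1) * (t + e + q - 2).
        by apply: ler_pM.
      have n5 : 0 <= e * q by nra.
      have n6 : 0 <= (1 - q) * (2 - q) by rewrite mulr_ge0 //; lra.
      have n7 : e <= e * t by nra.
      have n4 : e * t - (q - 1) * (e + q - 2) <= 2 * (e + 1) * t by nra.
      apply: (@le_trans _ _ (2 * (e + 1) * ((q * t) * (q * t)))).
        have -> : 2 * (e + 1) * ((q * t) * (q * t)) =
          (2 * (e + 1) * t) * (t * q ^+ 2) by ring.
        have n8 : 0 <= t * q ^+ 2 by rewrite mulr_ge0 ?sqr_ge0 //; lra.
        by rewrite -[leLHS]mulrA ler_wpM2r.
      by rewrite ler_wpM2l //; lra.
    rewrite ler_wpM2r ?mulr_ge0 ?(ltW N0) ?(ltW D0) //; lra.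
  rewrite ler_piMl // /A mulr_ge0 // ?mulr_ge0 ?expR_ge0 //.
    have h1 : (expR beta - (q - 1) * (expR beta + q - 2)) = (2 - q) * (expR beta + q - 1).
      by ring.
    have h2 : 0 <= (2 - q) * (expR beta + q - 1) by rewrite mulr_ge0 //; lra.
    have h3 : expR beta <= expR beta * expR y by rewrite ler_peMr // expR_ge0.
    by rewrite subr_ge0; lra.
  by rewrite invr_ge0 mulr_ge0 ?ltW.
rewrite le_max; apply/orP; right.
have qE : q = 2 by apply/eqP; rewrite eq_le q2 leNgt.
move: N0 D0; rewrite qE mulrAC => N0 D0; rewrite ler_pdivrMr ?mulr_gt0 // mul1r.
move: (expR beta) (expR y) e1 t1 N0 D0 => e t e1 t1 N0 D0.
have h1 : e * t <= e * t + 2 - 1 by lra.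
have h2 : t <= t + e + 2 - 2 by lra.
have h3 : (e * t) * t <= (e * t + 2 - 1) * (t + e + 2 - 2) by apply: ler_pM => //; nra.
apply: le_trans h3; have -> : p * e * t ^+ 2 = p * (e * t * t) by ring.
by rewrite ler_piMl //; nra.
Qed.

Lemma defect_lower : exists2 k : R, 0 < k &
  forall beta x : R, betac <= beta -> beta <= bmax -> 0 <= x ->
    k * Num.min x 1 ^+ s.+1 <= defect q beta x.
Proof.
have q0 := q_gt0; have q2 := q_le2.
pose M := (expR bmax * expR 1 + 1) * (expR 1 + expR bmax).
have M0 : 0 < M by rewrite /M mulr_gt0 // addr_gt0 ?mulr_gt0 ?expR_gt0.
pose v := if q < 2 then (2 - q) * q else 1.
have v0 : 0 < v.
  by rewrite /v; case: ifP => // ql2; rewrite mulr_gt0 // subr_gt0.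
have m0 : 0 < m by rewrite (lt_trans ltr01).
pose k := v / (m * M * s.+1%:R).
have k0 : 0 < k by rewrite /k divr_gt0 // !mulr_gt0.
exists k => // beta x b1 b2 x0; have b0 := pos_of_range b1.
have mx0 : 0 <= Num.min x 1 by rewrite le_min x0 ler01.
have mx1 : Num.min x 1 <= 1 by rewrite ge_min lexx orbT.
apply: (@le_trans _ _ (defect q beta (Num.min x 1))); last first.
  by apply: defect_mono => //; rewrite ge_min lexx.
apply: (@defect_ge_of_factor R q q_range beta k 1 b0) => // y y0 y1.
have e1 : 1 < expR beta by rewrite expR_gt1.
have t1 : 1 <= expR y by rewrite -expR0 ler_expR.
have [N0 D0] := transfer_gt0 q_gt0 e1 t1.
have tT : expR y <= expR 1 by rewrite ler_expR.
have eE : expR beta <= expR bmax by rewrite ler_expR.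
have pm : m^-1 <= psi q beta.
  rewrite -[m^-1]mulr1 -critical mulKf ?gt_eqF //.
  by apply: psi_mono => //; exact: betac_gt0.
have -> : s.+1%:R * k = m^-1 * v / M.
  by rewrite /k; field; rewrite !gt_eqF // ltr0n.
rewrite /defect_factor; apply: ler_pM.
- by rewrite mulr_ge0 ?invr_ge0 ?(ltW m0) ?(ltW v0).
- by rewrite invr_ge0 ltW.
- apply: ler_pM => //; rewrite ?invr_ge0 ?(ltW m0) ?(ltW v0) // /v.
  move: (expR beta) (expR y) e1 t1 => e t e1 t1.
  case: ifP => ql2; last exact: ltW.
  have et : e <= e * t by nra.
  have h : e - (q - 1) * (e + q - 2) = (2 - q) * (e + q - 1) by ring.
  by nra.
- rewrite lef_pV2 ?posrE ?mulr_gt0 // /M.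
  move: (expR beta) (expR y) (expR bmax) (expR 1) e1 t1 N0 D0 tT eE => e t E T.
  move=> e1 t1 N0 D0 tT eE.
  have et : e * t <= E * T by apply: ler_pM => //; lra.
  by apply: ler_pM; rewrite ?(ltW N0) ?(ltW D0) //; lra.
Qed.

Definition defect_coef : R := defect_factor q betac 0 / s.+1%:R.

Lemma defect_coef_gt0 : 0 < defect_coef.
Proof. by rewrite divr_gt0 // defect_factor_gt0 // betac_gt0. Qed.

Lemma defect_sharp (eta : R) : 0 < eta -> exists2 delta : R, 0 < delta &
  forall beta x : R, betac <= beta -> beta <= betac + delta -> 0 <= x -> x <= delta ->
    (defect_coef - eta) * x ^+ s.+1 <= defect q beta x /\
    defect q beta x <= (defect_coef + eta) * x ^+ s.+1.
Proof.
move=> eta0; have q0 := q_gt0.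
have bc0 := betac_gt0.
have ec : 1 < expR betac by rewrite expR_gt1.
have [N0 D0] := @transfer_gt0 R q (expR betac) 1 q_gt0 ec (lexx 1).
pose F := filter_prod (nbhs betac) (nbhs (0 : R)).
have ce : expR z.1 @[z --> F] --> expR betac.
  by apply: (@cvg_comp _ _ _ (fun z : R * R => z.1) expR F (nbhs betac));
    [exact: cvg_fst | exact: continuous_expR].
have ct : expR z.2 @[z --> F] --> (1 : R).
  by rewrite -[X in _ --> X]expR0;
    apply: (@cvg_comp _ _ _ (fun z : R * R => z.2) expR F (nbhs (0 : R)));
    [exact: cvg_snd | exact: continuous_expR].
have cc (k : R) : (fun=> k) z @[z --> F] --> k by exact: cvg_cst.
have cfac : defect_factor q z.1 z.2 @[z --> F] --> defect_factor q betac 0.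
  rewrite /defect_factor expR0; apply: cvgM.
    apply: cvgM.
      rewrite /psi; apply: cvgM; first exact: (cvgB ce (cc 1)).
      apply: cvgV; last exact: (cvgB (cvgD ce (cc q)) (cc 1)).
      by rewrite gt_eqF //; lra.
    case: ifP => _ //.
    by apply: cvgB; [exact: cvgM | apply: cvgM => //; exact: (cvgB (cvgD ce (cc q)) (cc 2))].
  apply: cvgV; first by rewrite gt_eqF // mulr_gt0.
  apply: cvgM; first exact: (cvgB (cvgD (cvgM ce ct) (cc q)) (cc 1)).
  exact: (cvgB (cvgD (cvgD ct ce) (cc q)) (cc 2)).
have cfac2 : defect_factor q z.1 z.2 * expR z.2 ^+ s @[z --> F] -->
    defect_factor q betac 0.
  rewrite -[X in _ --> X]mulr1; apply: cvgM => //.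
  have -> : (1 : R) = 1 ^+ s by rewrite expr1n.
  elim: (s) => [|k IHk].
    by rewrite expr0; under eq_fun do rewrite expr0; exact: cvg_cst.
  by rewrite exprS; under eq_fun do rewrite exprS; exact: cvgM.
have s0 : 0 < s.+1%:R :> R by rewrite ltr0n.
have seta : 0 < s.+1%:R * eta by rewrite mulr_gt0.
have /cvgrPdist_le /(_ _ seta) H1 := cfac.
have /cvgrPdist_le /(_ _ seta) H2 := cfac2.
have [[A B] /= [/nbhs_ballP[d1 /= d10 hA] /nbhs_ballP[d2 /= d20 hB]] hAB] := filterI H1 H2.
pose d := Num.min d1 d2 / 2.
have m0 : 0 < Num.min d1 d2 by rewrite lt_min d10 d20.
have dd : d < Num.min d1 d2 by rewrite /d; move: (Num.min d1 d2) m0 => u; lra.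
exists d; first by rewrite divr_gt0.
move: dd; rewrite lt_min => /andP[dd1 dd2].
move=> beta x b1 b2 x0 xd; have b0 := pos_of_range b1.
have bound y : 0 <= y -> y <= d ->
   s.+1%:R * (defect_coef - eta) <= defect_factor q beta y /\
   defect_factor q beta y * expR y ^+ s <= s.+1%:R * (defect_coef + eta).
  move=> y0 yd.
  have Ab : A beta.
    apply: hA; rewrite /ball /= distrC ger0_norm ?subr_ge0 //.
    by rewrite (le_lt_trans _ dd1) // lerBlDl.
  have By : B y.
    by apply: hB; rewrite /ball /= sub0r normrN ger0_norm // (le_lt_trans yd).
  have [/= h1 h2] := hAB (beta, y) (conj Ab By).
  have cE : s.+1%:R * defect_coef = defect_factor q betac 0.
    by rewrite /defect_coef mulrC mulfVK // gt_eqF.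
  move: h1 h2; rewrite !ler_distl mulrBr mulrDr cE => /andP[h1 h2] /andP[h3 h4].
  by split; lra.
split.
  by apply: (@defect_ge_of_factor R q q_range beta _ d b0) => // y y0 yd;
    have [] := bound y y0 yd.
by apply: (@defect_le_of_factor R q q_range beta _ d b0) => // y y0 yd;
  have [] := bound y y0 yd.
Qed.

(** A single slope for the whole range of messages and parameters; it bounds
    how fast the messages may decay. *)
Lemma transfer_lower : exists r : R, [/\ 0 < r, r <= 1 &
  forall beta x : R, betac <= beta -> beta <= bmax -> 0 <= x -> x <= bmax ->
    r * x <= transfer q beta x].
Proof.
have bc0 := betac_gt0; have B0 : 0 < bmax by rewrite /bmax addr_gt0.
have q0 := q_gt0.
pose v := transfer q betac bmax.
have v0 : 0 < v.
  have e1 : 1 < expR betac by rewrite expR_gt1.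
  have t1 : 1 < expR bmax by rewrite expR_gt1.
  have [N0 D0] := transfer_gt0 q_gt0 e1 (ltW t1).
  apply: ln_gt0; rewrite ltr_pdivlMr // mul1r.
  by move: (expR betac) (expR bmax) e1 t1 => e t e1 t1; nra.
exists (v / bmax); split; first exact: divr_gt0.
  rewrite ler_pdivrMr // mul1r (le_trans (transfer_le _ _ _)) ?(ltW B0) //.
  by rewrite /bmax lerDl.
move=> beta x b1 b2 x0 xB.
have r01 : 0 <= x / bmax <= 1.
  by rewrite divr_ge0 ?(ltW B0) //= ler_pdivrMr // mul1r.
have -> : v / bmax * x = x / bmax * v by ring.
apply: (@le_trans _ _ (x / bmax * transfer q beta bmax)).
  rewrite ler_wpM2l //; first by case/andP: r01.
  by apply: transfer_mono_beta => //; exact: ltW.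
apply: (le_trans (transfer_star q_range (pos_of_range b1) r01 (ltW B0))).
by rewrite mulfVK // gt_eqF.
Qed.

End Critical.

(** * Moments of sums over the children *)

Section PowerInequalities.
Variable R : realType.
Implicit Types u v x y p r : R.

Lemma powR_tangent p u v : 1 < p -> 0 <= u -> 0 <= v ->
  u `^ p - v `^ p <= p * u `^ (p - 1) * (u - v).
Proof.
move=> p1 u0 v0; have p0 : 0 < p by rewrite (lt_trans ltr01).
have p10 : 0 < p - 1 by rewrite subr_gt0.
have q0 : 0 < p / (p - 1) by rewrite divr_gt0.
have pq : p^-1 + (p / (p - 1))^-1 = 1 by field; rewrite !gt_eqF.
have := conjugate_powR v0 (powR_ge0 u (p - 1)) p0 q0 pq.
rewrite -powRrM mulrCA mulfV ?gt_eqF // mulr1 => h.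
have uE : u * u `^ (p - 1) = u `^ p by rewrite mulr_powRB1.
move: h; move: (u `^ (p - 1)) (u `^ p) (v `^ p) uE => a b c uE h.
have h2 : p * (v * a) <= p * (c / p + b / (p / (p - 1))) by rewrite ler_pM2l.
have E : p * (c / p + b / (p / (p - 1))) = c + (p - 1) * b by field; rewrite !gt_eqF.
rewrite E in h2; have -> : p * a * (u - v) = p * (u * a) - p * (v * a) by ring.
by rewrite uE; lra.
Qed.

Lemma powR_young r u v : 0 < r < 1 -> 0 <= u -> 0 <= v ->
  v `^ r * u `^ (1 - r) <= r * v + (1 - r) * u.
Proof.
move=> /andP[r0 r1] u0 v0.
have r1' : 0 < 1 - r by rewrite subr_gt0.
have pq : (r^-1)^-1 + ((1 - r)^-1)^-1 = 1 by rewrite !invrK addrC subrK.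
have ri : 0 < r^-1 by rewrite invr_gt0.
have ri' : 0 < (1 - r)^-1 by rewrite invr_gt0.
have := conjugate_powR (powR_ge0 v r) (powR_ge0 u (1 - r)) ri ri' pq.
rewrite -!powRrM !mulfV ?gt_eqF // !powRr1 // !invrK => h.
by rewrite (le_trans h) // mulrC (mulrC u).
Qed.

Lemma powR_split r u : 0 < r < 1 -> 0 <= u -> u `^ r * u `^ (1 - r) = u.
Proof.
move=> /andP[r0 r1]; rewrite le_eqVlt => /predU1P[<-|u0].
  by rewrite powR0 ?gt_eqF // mul0r.
by rewrite -powRD ?gt_eqF ?implybT // (_ : r + (1 - r) = 1) ?powRr1 ?ltW //; ring.
Qed.

Lemma powR_subadd r x y : 0 < r < 1 -> 0 <= x -> 0 <= y ->
  (x + y) `^ r <= x `^ r + y `^ r.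
Proof.
move=> rr x0 y0; have /andP[r0 r1] := rr.
have z0 : 0 <= x + y by exact: addr_ge0.
have [->|zn] := eqVneq (x + y) 0; first by rewrite powR0 ?gt_eqF // addr_ge0 ?powR_ge0.
have zp : 0 < x + y by rewrite lt_neqAle eq_sym zn.
have w0 : 0 < (x + y) `^ (1 - r) by rewrite powR_gt0.
rewrite -(ler_pM2r w0) powR_split // mulrDl; apply: lerD.
  rewrite -{1}(powR_split rr x0) ler_wpM2l ?powR_ge0 // ge0_ler_powR ?nnegrE //.
    by rewrite subr_ge0 ltW.
  by rewrite lerDl.
rewrite -{1}(powR_split rr y0) ler_wpM2l ?powR_ge0 // ge0_ler_powR ?nnegrE //.
  by rewrite subr_ge0 ltW.
by rewrite lerDr.
Qed.

(** The derivative of the power [p] is concave for [p] between 1 and 2, so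
    that only the linear term is charged to the first variable. This gives
    moments of order [p] of sums of independent variables from the first
    moment of the other terms. *)
Lemma powR_add_le p x y : 1 < p < 2 -> 0 <= x -> 0 <= y ->
  (x + y) `^ p <= x `^ p + p * x `^ (p - 1) * y + y `^ p.
Proof.
move=> /andP[p1 p2] x0 y0; pose r := p - 1.
have rr : 0 < r < 1 by rewrite /r subr_gt0 p1 ltrBlDr.
have p0 : 0 < p by rewrite (lt_trans ltr01).
have z0 : 0 <= x + y by exact: addr_ge0.
rewrite -(mulr_powRB1 z0 p0) -(mulr_powRB1 x0 p0) -(mulr_powRB1 y0 p0) -/r mulrDl.
have h1 : x * (x + y) `^ r <= x `^ r * (x + r * y).
  rewrite -{1}(powR_split rr x0) -mulrA ler_wpM2l ?powR_ge0 //.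
  rewrite mulrC (le_trans (powR_young rr x0 z0)) //.
  by rewrite -subr_ge0 (_ : _ - _ = 0) //; ring.
have h2 := ler_wpM2l y0 (powR_subadd rr x0 y0).
apply: (le_trans (lerD h1 h2)); rewrite -subr_ge0 (_ : _ - _ = 0) // /r; ring.
Qed.

End PowerInequalities.

Section ChildSums.
Variables (R : realType) (mu : probability nat R).
Variable Q : probability (tree_space setT) R.
Hypothesis QE : tree_law mu Q.
Implicit Types Y : (seq nat -> nat) -> R.

Notation E := (Ex Q).
Notation Itg := (Itg Q).

Definition child_sum Y N (x : seq nat -> nat) : R := \sum_(i < N) Y (shift i x).

Lemma child_sum0 Y x : child_sum Y 0 x = 0.
Proof. by rewrite /child_sum big_ord0. Qed.

Lemma child_sumS Y N x : child_sum Y N.+1 x = child_sum Y N x + Y (shift N x).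
Proof. by rewrite /child_sum big_ord_recr. Qed.

Lemma child_sum_ge0 Y N x : (forall x, 0 <= Y x) -> 0 <= child_sum Y N x.
Proof. by move=> Y0; apply: sumr_ge0. Qed.

(** The words below the first [N] children, on which the sum over these
    children depends. *)
Definition below_lt (N : nat) : set (seq nat) :=
  [set v | exists i u, (i < N)%N /\ v = rcons u i].

Lemma below_lt_disj N : below_lt N `&` below N = set0.
Proof.
rewrite -subset0 => v [[i [u [iN ->]]] [w] /eqP].
by rewrite eqseq_rcons => /andP[_ /eqP iE]; rewrite iE ltnn in iN.
Qed.

Lemma below_lt_nonroot N : below_lt N `<=` nonroot.
Proof. by move=> v [i [u [_ ->]]]; rewrite /nonroot /=; case: u. Qed.

Lemma meas_cst U c : meas U (fun=> c : R).
Proof. exact: measurable_cst. Qed.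

Lemma meas_comp U (g : R -> R) Y :
  measurable_fun setT g -> meas U Y -> meas U (fun x => g (Y x)).
Proof. by move=> mg mY; rewrite /meas; exact: (measurableT_comp mg mY). Qed.

Lemma meas_child_sum Y N : meas setT Y -> meas (below_lt N) (child_sum Y N).
Proof.
move=> mY; elim: N => [|N IHN].
  have -> : child_sum Y 0 = fun=> 0 by apply/funext => x; exact: child_sum0.
  exact: measurable_cst.
rewrite (_ : child_sum Y N.+1 = fun x => child_sum Y N x + Y (shift N x)); last first.
  by apply/funext => x; rewrite child_sumS.
apply: measurable_funD.
  apply: (meas_sub _ IHN) => v [i [u [iN ->]]]; exists i, u; split => //.
  exact: ltnW.
apply: (@meas_sub _ (below N)); last exact: meas_shift.
by move=> v [u ->]; exists N, u.
Qed.

Lemma meas_child_sum_nonroot Y N : meas setT Y -> meas nonroot (child_sum Y N).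
Proof. by move=> mY; apply: (meas_sub (@below_lt_nonroot N)); exact: meas_child_sum. Qed.

Lemma meas_child_sumT Y N : meas setT Y -> meas setT (child_sum Y N).
Proof. by move=> mY; apply: (@meas_sub _ nonroot) => //; exact: meas_child_sum_nonroot. Qed.

Lemma Itg_child_sum Y N : Itg Y -> Itg (child_sum Y N).
Proof. by move=> Yi; apply: Itg_sum => i; exact: (Itg_shift QE i Yi). Qed.

Lemma Ex_child_sum Y N : Itg Y -> E (child_sum Y N) = N%:R * E Y.
Proof.
move=> Yi; rewrite Ex_sum; last by move=> i; exact: (Itg_shift QE i Yi).
rewrite (eq_bigr (fun=> E Y)); last by move=> i _; exact: (Ex_shift QE i Yi).
by rewrite sumr_const card_ord mulr_natl.
Qed.

(** The two factors depend on disjoint sets of words; this is the step of the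
    inductions on the number of children. *)
Lemma Ex_child_sum_next (g h : R -> R) Y N :
  measurable_fun setT g -> measurable_fun setT h -> meas setT Y ->
  Itg (fun x => g (child_sum Y N x)) -> Itg (fun x => h (Y x)) ->
  Itg (fun x => g (child_sum Y N x) * h (Y (shift N x))) /\
  E (fun x => g (child_sum Y N x) * h (Y (shift N x))) =
    E (fun x => g (child_sum Y N x)) * E (fun x => h (Y x)).
Proof.
move=> mg mh mY gi hi.
have m1 : meas (below_lt N) (fun x => g (child_sum Y N x)).
  by apply: (meas_comp mg); exact: meas_child_sum.
have mhY : meas setT (fun x => h (Y x)) by exact: meas_comp.
have m2 : meas (below N) (fun x => h (Y (shift N x))) by exact: (meas_shift mhY).
have [i1 e1] := Ex_indep QE (below_lt_disj N) m1 m2 gi (Itg_shift QE N hi).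
by split => //; rewrite e1 (Ex_shift QE N hi).
Qed.

Let measX n : measurable_fun setT (fun x : R => x ^+ n).
Proof. exact: exprn_measurable. Qed.

Lemma Ex_child_sum2 Y N : Itg Y -> Itg (fun x => Y x ^+ 2) ->
  Itg (fun x => child_sum Y N x ^+ 2) /\
  E (fun x => child_sum Y N x ^+ 2) =
    N%:R * E (fun x => Y x ^+ 2) + (N%:R ^+ 2 - N%:R) * E Y ^+ 2.
Proof.
move=> Yi Y2; have mY := Itg_meas Yi.
elim: N => [|N [IHi IHe]].
  have -> : (fun x => child_sum Y 0 x ^+ 2) = fun=> 0.
    by apply/funext => x; rewrite child_sum0 expr2 mul0r.
  by split; [exact: Itg_cst | rewrite Ex_cst; ring].
have Si := Itg_child_sum N Yi.
have [ci ce] := @Ex_child_sum_next id id Y N (@measurable_id _ _ _)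
  (@measurable_id _ _ _) mY Si Yi.
have Y2s := Itg_shift QE N Y2.
have -> : (fun x => child_sum Y N.+1 x ^+ 2) = fun x =>
    (child_sum Y N x ^+ 2 + 2 * (child_sum Y N x * Y (shift N x))) +
    Y (shift N x) ^+ 2.
  by apply/funext => x; rewrite child_sumS; ring.
have c2 := ItgZ 2 ci; have i1 := ItgD IHi c2.
split; first exact: (ItgD i1 Y2s).
rewrite (ExD i1 Y2s) (ExD IHi c2) (ExZ _ ci) ce IHe (Ex_child_sum N Yi).
rewrite (Ex_shift QE N Y2) -(natr1 N); ring.
Qed.

Lemma Ex_child_sum3 Y N : (forall x, 0 <= Y x) ->
  Itg Y -> Itg (fun x => Y x ^+ 2) -> Itg (fun x => Y x ^+ 3) ->
  Itg (fun x => child_sum Y N x ^+ 3) /\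
  E (fun x => child_sum Y N x ^+ 3) <=
    N%:R * E (fun x => Y x ^+ 3) + 3 * N%:R ^+ 2 * E Y * E (fun x => Y x ^+ 2)
    + N%:R ^+ 3 * E Y ^+ 3.
Proof.
move=> Y0 Yi Y2 Y3; have mY := Itg_meas Yi.
have f0 := Ex_ge0 Q Y0.
have v0 : 0 <= E (fun x => Y x ^+ 2) by apply: Ex_ge0 => x; exact: sqr_ge0.
elim: N => [|N [IHi IHe]].
  have -> : (fun x => child_sum Y 0 x ^+ 3) = fun=> 0.
    by apply/funext => x; rewrite child_sum0 exprS mul0r.
  by split; [exact: Itg_cst | rewrite Ex_cst -subr_ge0 (_ : _ - _ = 0) //; ring].
have Si := Itg_child_sum N Yi.
have [S2i S2e] := Ex_child_sum2 N Yi Y2.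
have [ci ce] := @Ex_child_sum_next (fun x => x ^+ 2) id Y N (@measX 2)
  (@measurable_id _ _ _) mY S2i Yi.
have [di de] := @Ex_child_sum_next id (fun x => x ^+ 2) Y N (@measurable_id _ _ _)
  (@measX 2) mY Si Y2.
have Y3s := Itg_shift QE N Y3.
have -> : (fun x => child_sum Y N.+1 x ^+ 3) = fun x =>
    ((child_sum Y N x ^+ 3 + 3 * (child_sum Y N x ^+ 2 * Y (shift N x))) +
     3 * (child_sum Y N x * Y (shift N x) ^+ 2)) + Y (shift N x) ^+ 3.
  by apply/funext => x; rewrite child_sumS; ring.
have c3 := ItgZ 3 ci; have d3 := ItgZ 3 di.
have i1 := ItgD IHi c3; have i2 := ItgD i1 d3.
split; first exact: (ItgD i2 Y3s).
rewrite (ExD i2 Y3s) (ExD i1 d3) (ExD IHi c3) (ExZ _ ci) (ExZ _ di) ce de S2e.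
rewrite (Ex_child_sum N Yi) (Ex_shift QE N Y3) -(natr1 N).
move: (E Y) (E (fun x => Y x ^+ 2)) (E (fun x => Y x ^+ 3)) f0 v0 IHe => f v t.
have n0 : 0 <= N%:R :> R by rewrite ler0n.
move: N%:R n0 (E _) => n n0 w f0 v0 IHe.
have h1 : 0 <= n * f ^+ 3 by rewrite mulr_ge0 ?exprn_ge0.
have h2 : 0 <= f * v by rewrite mulr_ge0.
have h3 : 0 <= f ^+ 3 by rewrite exprn_ge0.
rewrite -subr_ge0; rewrite -subr_ge0 in IHe.
have -> : (n + 1) * t + 3 * (n + 1) ^+ 2 * f * v + (n + 1) ^+ 3 * f ^+ 3 -
  (w + 3 * ((n * v + (n ^+ 2 - n) * f ^+ 2) * f) + 3 * (n * f * v) + t) =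
  (n * t + 3 * n ^+ 2 * f * v + n ^+ 3 * f ^+ 3 - w) +
  (3 * (f * v) + 6 * (n * f ^+ 3) + f ^+ 3) by ring.
have k1 : 0 <= 3 * (f * v) by exact: mulr_ge0.
have k2 : 0 <= 6 * (n * f ^+ 3) by exact: mulr_ge0.
exact: (addr_ge0 IHe (addr_ge0 (addr_ge0 k1 k2) h3)).
Qed.

(** A Taylor expansion of [`|x| ^+ 3] to order two, whose linear term vanishes
    in mean for centered variables. *)
Lemma abs3_add (x y : R) :
  `|x + y| ^+ 3 <= `|x| ^+ 3 + 3 * (x * `|x|) * y + 3 * `|x| * y ^+ 2 + `|y| ^+ 3.
Proof.
wlog x0 : x y / 0 <= x.
  move=> H; have [x0|/ltW x0] := leP 0 x; first exact: H.
  have := H (- x) (- y); rewrite oppr_ge0 -opprD !normrN sqrrN => /(_ x0).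
  by move/le_trans; apply; rewrite -subr_ge0 (_ : _ - _ = 0) //; ring.
rewrite (ger0_norm x0); have [y0|/ltW y0] := leP 0 y.
  by rewrite (ger0_norm y0) ger0_norm ?addr_ge0 // -subr_ge0 (_ : _ - _ = 0) //; ring.
rewrite (ler0_norm y0); have [z0|/ltW z0] := leP 0 (x + y).
  rewrite (ger0_norm z0) -subr_ge0 (_ : _ - _ = 2 * (- y) ^+ 3); last by ring.
  by rewrite mulr_ge0 // exprn_ge0 // oppr_ge0.
rewrite (ler0_norm z0) -subr_ge0 (_ : _ - _ = 2 * x ^+ 3 + 6 * (x ^+ 2 * y) +
  6 * (x * y ^+ 2)); last by ring.
have -> : 2 * x ^+ 3 + 6 * (x ^+ 2 * y) + 6 * (x * y ^+ 2) =
  2 * (x * ((x + 3 / 2 * y) ^+ 2 + 3 / 4 * y ^+ 2)) by field.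
by rewrite mulr_ge0 // mulr_ge0 // addr_ge0 ?sqr_ge0 // mulr_ge0 ?sqr_ge0.
Qed.

(** A Rosenthal inequality for sums of centered variables, by induction on the
    number of terms. *)
Lemma Ex_child_sum_abs3 Y N : E Y = 0 ->
  Itg Y -> Itg (fun x => Y x ^+ 2) -> Itg (fun x => `|Y x| ^+ 3) ->
  Itg (fun x => `|child_sum Y N x| ^+ 3) /\
  E (fun x => `|child_sum Y N x| ^+ 3) <=
    N%:R * E (fun x => `|Y x| ^+ 3) +
    3 * N%:R ^+ 2 * E (fun x => `|Y x|) * E (fun x => Y x ^+ 2).
Proof.
move=> EY Yi Y2 Y3; have mY := Itg_meas Yi.
pose a := E (fun x => `|Y x|); pose v := E (fun x => Y x ^+ 2).
have a0 : 0 <= a by apply: Ex_ge0.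
have v0 : 0 <= v by apply: Ex_ge0 => x; exact: sqr_ge0.
elim: N => [|N [IHi IHe]].
  have -> : (fun x => `|child_sum Y 0 x| ^+ 3) = fun=> 0.
    by apply/funext => x; rewrite child_sum0 normr0 exprS mul0r.
  by split; [exact: Itg_cst | rewrite Ex_cst -subr_ge0 (_ : _ - _ = 0) //; ring].
have Si := Itg_child_sum N Yi.
have [S2i S2e] := Ex_child_sum2 N Yi Y2.
have mS := meas_child_sumT N mY.
have mn : measurable_fun [set: R] (fun x : R => `|x|) by exact: normr_measurable.
have mq : measurable_fun [set: R] (fun x : R => x * `|x|).
  by apply: measurable_funM => //; exact: normr_measurable.
have qi : Itg (fun x => child_sum Y N x * `|child_sum Y N x|).
  apply: (Itg_le _ _ S2i); first exact: (meas_comp mq mS).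
  by move=> x; rewrite normrM normr_id -normrM -expr2 ger0_norm ?sqr_ge0.
have [ci ce] := @Ex_child_sum_next (fun x => x * `|x|) id Y N mq
  (@measurable_id _ _ _) mY qi Yi.
have [di de] := @Ex_child_sum_next (fun x => `|x|) (fun x => x ^+ 2) Y N mn
  (@measX 2) mY (Itg_norm Si) Y2.
have Y3s := Itg_shift QE N Y3.
pose G x := ((`|child_sum Y N x| ^+ 3 +
   3 * (child_sum Y N x * `|child_sum Y N x| * Y (shift N x))) +
   3 * (`|child_sum Y N x| * Y (shift N x) ^+ 2)) + `|Y (shift N x)| ^+ 3.
have GE x : `|child_sum Y N.+1 x| ^+ 3 <= G x.
  by rewrite child_sumS (le_trans (abs3_add _ _)) // -subr_ge0 /G (_ : _ - _ = 0) //; ring.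
have c3 := ItgZ 3 ci; have d3 := ItgZ 3 di.
have i1 := ItgD IHi c3; have i2 := ItgD i1 d3.
have Gi : Itg G := ItgD i2 Y3s.
have mS1 : meas setT (fun x => `|child_sum Y N.+1 x| ^+ 3).
  apply: (meas_comp (@measX 3)); apply: (meas_comp mn).
  exact: meas_child_sumT.
have Li : Itg (fun x => `|child_sum Y N.+1 x| ^+ 3).
  by apply: (Itg_le mS1 _ Gi) => x; rewrite ger0_norm ?exprn_ge0.
split => //; apply: (le_trans (le_Ex Li Gi GE)).
have aN : E (fun x => `|child_sum Y N x|) <= N%:R * a.
  rewrite -(Ex_child_sum N (Itg_norm Yi)); apply: le_Ex.
  - exact: Itg_norm.
  - exact: (Itg_child_sum N (Itg_norm Yi)).
  - by move=> x; exact: ler_norm_sum.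
rewrite /G (ExD i2 Y3s) (ExD i1 d3) (ExD IHi c3) (ExZ _ ci) (ExZ _ di) ce de EY.
rewrite (Ex_shift QE N Y3) -/v -/a mulr0 mulr0 addr0 -(natr1 N).
move: IHe aN; rewrite -/a -/v; move: (E _) (E _) (E (fun x => `|Y x| ^+ 3)) => u w t.
have n0 : 0 <= N%:R :> R by rewrite ler0n.
move: N%:R n0 => n n0 IHe aN.
have h1 : u * v <= n * a * v by rewrite ler_wpM2r.
have h2 : 0 <= n * (a * v) by rewrite !mulr_ge0.
have h3 : 0 <= a * v by rewrite mulr_ge0.
rewrite -subr_ge0; rewrite -subr_ge0 in IHe; rewrite -subr_ge0 in h1.
have -> : (n + 1) * t + 3 * (n + 1) ^+ 2 * a * v - (w + 3 * (u * v) + t) =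
  (n * t + 3 * n ^+ 2 * a * v - w) + 3 * (n * a * v - u * v) +
  (3 * (n * (a * v)) + 3 * (a * v)) by ring.
have k1 : 0 <= 3 * (n * a * v - u * v) by exact: mulr_ge0.
have k2 : 0 <= 3 * (n * (a * v)) by exact: mulr_ge0.
have k3 : 0 <= 3 * (a * v) by exact: mulr_ge0.
exact: (addr_ge0 (addr_ge0 IHe k1) (addr_ge0 k2 k3)).
Qed.

Lemma Ex_powR_le (r : R) Y : 0 < r < 1 -> (forall x, 0 <= Y x) -> Itg Y -> 0 < E Y ->
  Itg (fun x => Y x `^ r) /\ E (fun x => Y x `^ r) <= E Y `^ r.
Proof.
move=> rr Y0 Yi f0; have /andP[r0 r1] := rr.
have w0 : 0 < E Y `^ (1 - r) by rewrite powR_gt0.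
pose G x := (E Y `^ (1 - r))^-1 * (r * Y x + (1 - r) * E Y).
have i1 := ItgD (ItgZ r Yi) (Itg_cst Q ((1 - r) * E Y)).
have Gi : Itg G := ItgZ _ i1.
have GE x : Y x `^ r <= G x.
  by rewrite /G mulrC ler_pdivlMr // powR_young // ltW.
have mYr : meas setT (fun x => Y x `^ r).
  by apply: (meas_comp (@measurable_powR R r)); exact: (Itg_meas Yi).
have Yr : Itg (fun x => Y x `^ r).
  by apply: (Itg_le mYr _ Gi) => x; rewrite ger0_norm ?powR_ge0.
split => //; apply: (le_trans (le_Ex Yr Gi GE)).
rewrite /G (ExZ _ i1) (ExD (ItgZ r Yi) (Itg_cst Q _)) (ExZ _ Yi) Ex_cst.
rewrite mulrC ler_pdivrMr // powR_split ?(ltW f0) //.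
by rewrite -subr_ge0 (_ : _ - _ = 0) //; ring.
Qed.

Lemma Ex_child_sum_powR (p : R) Y N : 1 < p < 2 -> (forall x, 0 <= Y x) -> 0 < E Y ->
  Itg Y -> Itg (fun x => Y x `^ p) ->
  Itg (fun x => child_sum Y N x `^ p) /\
  E (fun x => child_sum Y N x `^ p) <=
    N%:R * E (fun x => Y x `^ p) + N%:R `^ p * E Y `^ p.
Proof.
move=> pp Y0 f0 Yi Yp; have /andP[p1 p2] := pp; have mY := Itg_meas Yi.
have rr : 0 < p - 1 < 1 by rewrite subr_gt0 p1 ltrBlDr.
have p0 : 0 < p by rewrite (lt_trans ltr01).
elim: N => [|N [IHi IHe]].
  have -> : (fun x => child_sum Y 0 x `^ p) = fun=> 0.
    by apply/funext => x; rewrite child_sum0 powR0 ?gt_eqF.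
  split; first exact: Itg_cst.
  by rewrite Ex_cst mul0r powR0 ?gt_eqF // mul0r addr0.
have Si := Itg_child_sum N Yi.
have S0 x : 0 <= child_sum Y N x by exact: child_sum_ge0.
have mr : measurable_fun setT (fun x : R => x `^ (p - 1)) by exact: measurable_powR.
have [Sr Sre] : Itg (fun x => child_sum Y N x `^ (p - 1)) /\
    E (fun x => child_sum Y N x `^ (p - 1)) <= (N%:R * E Y) `^ (p - 1).
  case: N S0 Si {IHi IHe} => [|N] S0 Si.
    have -> : (fun x => child_sum Y 0 x `^ (p - 1)) = fun=> 0.
      by apply/funext => x; rewrite child_sum0 powR0 // gt_eqF // subr_gt0.
    by split; [exact: Itg_cst | rewrite Ex_cst powR_ge0].
  rewrite -(Ex_child_sum N.+1 Yi); apply: Ex_powR_le => //.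
  by rewrite Ex_child_sum // mulr_gt0 // ltr0n.
have [ci ce] := @Ex_child_sum_next (fun x => x `^ (p - 1)) id Y N mr
  (@measurable_id _ _ _) mY Sr Yi.
have Yps := Itg_shift QE N Yp.
pose G x := (child_sum Y N x `^ p + p * (child_sum Y N x `^ (p - 1) * Y (shift N x)))
  + Y (shift N x) `^ p.
have GE x : child_sum Y N.+1 x `^ p <= G x.
  by rewrite child_sumS /G mulrA; exact: powR_add_le.
have c1 := ItgZ p ci; have i1 := ItgD IHi c1.
have Gi : Itg G := ItgD i1 Yps.
have mS1 : meas setT (fun x => child_sum Y N.+1 x `^ p).
  by apply: (meas_comp (@measurable_powR R p)); exact: meas_child_sumT.
have Li : Itg (fun x => child_sum Y N.+1 x `^ p).
  by apply: (Itg_le mS1 _ Gi) => x; rewrite ger0_norm ?powR_ge0.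
split => //; apply: (le_trans (le_Ex Li Gi GE)).
rewrite /G (ExD i1 Yps) (ExD IHi c1) (ExZ _ ci) ce (Ex_shift QE N Yp).
have n0 : 0 <= N%:R :> R by rewrite ler0n.
have n1 : 0 <= N.+1%:R :> R by rewrite ler0n.
have h1 := ler_wpM2r (ltW f0) Sre.
rewrite powRM ?(ltW f0) // in h1.
rewrite -mulrA (mulrC (E Y `^ _)) (mulr_powRB1 (ltW f0) p0) in h1.
have := powR_tangent p1 n0 n1; rewrite -(natr1 N).
have -> : (N%:R : R) - (N%:R + 1) = -1 by ring.
rewrite mulrN1 => h2.
have fp0 : 0 <= E Y `^ p by exact: powR_ge0.
move: IHe h1 h2 fp0.
move: (E _) (E _ * E Y) (E (fun x => Y x `^ p)) (E Y `^ p) => w u t fp.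
move: (N%:R `^ p) ((N%:R + 1) `^ p) (N%:R `^ (p - 1)) => a b c IHe h1 h2 fp0.
have h3 : p * u <= p * (c * fp) by rewrite ler_pM2l.
have h4 : p * c * fp <= (b - a) * fp by rewrite ler_wpM2r //; lra.
by move: h3 h4; rewrite mulrA mulrBl mulrDl mul1r; lra.
Qed.

(** ** Sums over all the children of the root *)

Definition tot Y (x : seq nat -> nat) : R := child_sum Y (x [::]) x.

Notation "'E_Z' c" := (E (fun x => c (x [::]))) (at level 10).

Hypothesis Zi : Itg (fun x => (x [::])%:R).

Lemma meas_root (c : nat -> R) : meas setT (fun x => c (x [::])).
Proof.
by apply: (@measurableT_comp _ _ _ _ _ _ c) => //; exact: measurable_coordinate.
Qed.

(** The number of children takes countably many values. *)
Lemma meas_root_choice (g : nat -> (seq nat -> nat) -> R) :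
  (forall N, meas setT (g N)) -> meas setT (fun x => g (x [::]) x).
Proof.
move=> mg _ B mB; rewrite setTI.
have -> : (fun x : tree_space setT => g (x [::]) x) @^-1` B =
    \bigcup_N ([set x : tree_space setT | x [::] = N] `&`
               [set x : tree_space setT | B (g N x)]).
  apply/seteqP; split=> x /=; first by exists (x [::]).
  by case=> N _ /= [<-].
apply: bigcupT_measurable => N; apply: measurableI.
  have := @measurable_coordinate setT [::] I measurableT [set N].
  by rewrite setTI; apply.
by rewrite -[X in _ X]setTI; exact: mg.
Qed.

Lemma meas_tot Y : meas setT Y -> meas setT (tot Y).
Proof. by move=> mY; apply: meas_root_choice => N; exact: meas_child_sumT. Qed.

Let tot_ge0 Y : (forall x, 0 <= Y x) -> Itg Y ->
  Itg (tot Y) /\ E (tot Y) = E_Z (fun N => N%:R) * E Y.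
Proof.
move=> Y0 Yi; have mY := Itg_meas Yi; have f0 := Ex_ge0 Q Y0.
have ci : Itg (fun x => (x [::])%:R * E Y).
  by apply: (eq_Itg _ (ItgZ (E Y) Zi)) => x; rewrite mulrC.
have mg N := meas_child_sum_nonroot N mY.
have g0 N x : 0 <= child_sum Y N x by exact: child_sum_ge0.
have gi N := Itg_child_sum N Yi.
have cle N : E (child_sum Y N) <= N%:R * E Y by rewrite Ex_child_sum.
have cge N : N%:R * E Y <= E (child_sum Y N) by rewrite Ex_child_sum.
have [ti le1] := Ex_root_le QE (c := fun N => N%:R * E Y) mg g0 gi
  cle ci.
have [_ le2] := Ex_root_ge QE (c := fun N => N%:R * E Y) mg g0 gi
  cge (fun N => mulr_ge0 (ler0n _ N) f0) ti.
split => //; apply/eqP; rewrite eq_le mulrC -(ExZ _ Zi).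
have -> : E (fun x => E Y * (x [::])%:R) = E (fun x => (x [::])%:R * E Y).
  by apply: eq_Ex => x; rewrite mulrC.
by rewrite le1 le2.
Qed.

Lemma Ex_tot Y : Itg Y -> Itg (tot Y) /\ E (tot Y) = E_Z (fun N => N%:R) * E Y.
Proof.
move=> Yi; have [pi ni YE] := pos_neg_parts Yi.
have pos (h : (seq nat -> nat) -> R) x : 0 <= Num.max (h x) 0.
  by rewrite le_max lexx orbT.
have [i1 e1] := tot_ge0 (pos Y) pi.
have [i2 e2] := tot_ge0 (pos (fun x => - Y x)) ni.
have TE : tot Y =1 fun x => tot (fun x => Num.max (Y x) 0) x -
    tot (fun x => Num.max (- Y x) 0) x.
  by move=> x; rewrite /tot /child_sum -sumrB; apply: eq_bigr => i _; exact: YE.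
split; first by apply: (@eq_Itg _ _ _ _ _ (ItgB i1 i2)) => x; rewrite TE.
by rewrite (eq_Ex Q TE) (ExB i1 i2) e1 e2 (eq_Ex Q YE) (ExB pi ni) mulrBr.
Qed.

End ChildSums.

(** * Means and moments of the messages *)

Definition mean_children (R : realType) (Q : probability (tree_space setT) R) : R :=
  Ex Q (fun x => (x [::])%:R).

(** Galton--Watson trees without leaves, with finite mean offspring, and the
    critical parameter of the random cluster model on them. *)
Record critical_tree (R : realType) (mu : probability nat R)
    (Q : probability (tree_space setT) R) (q betac : R) : Prop := CriticalTree {
  ct_law : tree_law mu Q;
  ct_q : 0 < q <= 2;
  ct_Itg : Itg Q (fun x => (x [::])%:R);
  ct_pos : {ae Q, forall x : seq nat -> nat, (0 < x [::])%N};
  ct_mean : 1 < mean_children Q;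
  ct_crit : mean_children Q * psi q betac = 1 }.

Section Messages.
Variables (R : realType) (mu : probability nat R).
Variable Q : probability (tree_space setT) R.
Variables (q betac : R).
Hypothesis H : critical_tree mu Q q betac.
Let m := mean_children Q.
Let QE : tree_law mu Q := ct_law H.
Let q_range : 0 < q <= 2 := ct_q H.
Let Zi := ct_Itg H.
Let Zpos := ct_pos H.
Let m_gt1 : 1 < m := ct_mean H.
Let critical : m * psi q betac = 1 := ct_crit H.

Notation E := (Ex Q).
Notation Itg := (Itg Q).
Notation msg := (message q).

Let bmax := betac + 1.
Let bc0 : 0 < betac. Proof. exact: (@betac_gt0 R q m). Qed.

Lemma meas_mono U (g : R -> R) (Y : (seq nat -> nat) -> R) :
  (forall x y, 0 <= x -> x <= y -> g x <= g y) ->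
  (forall x, 0 <= Y x) -> meas U Y -> meas U (fun x => g (Y x)).
Proof.
move=> gm Y0 mY.
have -> : (fun x => g (Y x)) = fun x => g (Num.max (Y x) 0).
  by apply/funext => x; congr g; apply/esym/max_idPl.
apply: (meas_comp (g := fun z => g (Num.max z 0))) => //.
apply: nondecreasing_measurable => // x y xy; apply: gm.
  by rewrite le_max lexx orbT.
by rewrite ge_max !le_max xy lexx orbT.
Qed.

Section FixedBeta.
Variable beta : R.
Hypothesis beta_range : betac <= beta <= bmax.
Let b1 : betac <= beta. Proof. by have /andP[] := beta_range. Qed.
Let b2 : beta <= bmax. Proof. by have /andP[] := beta_range. Qed.
Let b0 : 0 < beta. Proof. exact: lt_le_trans bc0 b1. Qed.
Let Y := msg beta.
Let X n := tot (Y n).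

Lemma message_bounds n x : 0 <= Y n x /\ Y n x <= beta.
Proof.
elim: n x => [|n IHn] x; first by rewrite /Y /= lexx ltW.
have X0 : 0 <= X n x by apply: sumr_ge0 => i _; have [] := IHn (shift i x).
by split; [exact: transfer_ge0 | exact: transfer_le].
Qed.

Lemma message_ge0 n x : 0 <= Y n x. Proof. by have [] := message_bounds n x. Qed.

Lemma tot_ge0 n x : 0 <= X n x.
Proof. by apply: sumr_ge0 => i _; exact: message_ge0. Qed.

Lemma meas_message n : meas setT (Y n).
Proof.
elim: n => [|n IHn]; first exact: measurable_cst.
apply: (@meas_mono setT (transfer q beta) (X n)).
- by move=> x y x0 xy; exact: transfer_mono.
- exact: tot_ge0.
- exact: meas_tot.
Qed.

Lemma Itg_message n : Itg (Y n).
Proof.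
apply: (Itg_bounded Q (meas_message n) (c := beta)) => x.
by rewrite ger0_norm; [have [] := message_bounds n x | exact: message_ge0].
Qed.

Lemma Itg_message_exp n k : Itg (fun x => Y n x ^+ k).
Proof.
apply: (@Itg_bounded _ Q _ (beta ^+ k)).
  by apply: (meas_comp (g := fun z => z ^+ k)); [exact: exprn_measurable | exact: meas_message].
move=> x; have [y0 y1] := message_bounds n x.
by rewrite ger0_norm ?exprn_ge0 // lerXn2r ?nnegrE // ltW.
Qed.

Lemma Itg_message_powR n (p : R) : 0 < p -> Itg (fun x => Y n x `^ p).
Proof.
move=> p0; apply: (@Itg_bounded _ Q _ (beta `^ p)).
  by apply: (meas_comp (@measurable_powR R p)); exact: meas_message.
move=> x; have [y0 y1] := message_bounds n x.
by rewrite ger0_norm ?powR_ge0 // ge0_ler_powR ?nnegrE // ltW.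
Qed.

Lemma message_anti n x : Y n.+1 x <= Y n x.
Proof.
elim: n x => [|n IHn] x.
  by apply: transfer_le => //; exact: (tot_ge0 0).
apply: transfer_mono => //; first exact: (tot_ge0 n.+1).
by apply: ler_sum => i _; exact: IHn.
Qed.

Definition msg_mean n : R := E (Y n).

Lemma Itg_tot n : Itg (X n).
Proof. by have [] := Ex_tot QE Zi (Itg_message n). Qed.

Lemma Ex_tot_message n : E (X n) = m * msg_mean n.
Proof. by have [] := Ex_tot QE Zi (Itg_message n). Qed.

Lemma meas_defect n : meas setT (fun x => defect q beta (X n x)).
Proof.
apply: (@meas_mono setT (defect q beta) (X n)).
- by move=> x y x0 xy; exact: defect_mono.
- exact: tot_ge0.
- by apply: meas_tot; exact: meas_message.
Qed.

Lemma Itg_defect n : Itg (fun x => defect q beta (X n x)).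
Proof.
apply: (Itg_le (meas_defect n) _ (Itg_tot n)) => x.
have X0 := tot_ge0 n x.
by rewrite ger0_norm ?defect_ge0 // defect_le_id.
Qed.

(** The mean of a message loses only the mean defect with respect to its
    linear growth, whatever the distribution of the messages: it is this
    equation that determines the critical asymptotics. *)
Lemma msg_meanS n :
  msg_mean n.+1 = m * psi q beta * msg_mean n - E (fun x => defect q beta (X n x)).
Proof.
have i1 := ItgZ (psi q beta) (Itg_tot n).
rewrite mulrAC -Ex_tot_message mulrC -(ExZ _ (Itg_tot n)) -(ExB i1 (Itg_defect n)).
by apply: eq_Ex => x; rewrite /defect opprB addrCA subrr addr0.
Qed.

Lemma msg_mean_anti n : msg_mean n.+1 <= msg_mean n.
Proof. by apply: le_Ex; [exact: Itg_message | exact: Itg_message | exact: message_anti]. Qed.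

Lemma ae_shift (A : (seq nat -> nat) -> Prop) i :
  {ae Q, forall x, A x} -> {ae Q, forall x, A (shift i x)}.
Proof.
case=> B [mB QB AB]; exists (shift i @^-1` B); split.
- by rewrite -[X in measurable X]setTI; exact: measurable_shiftT.
- by rewrite (shift_law QE i mB).
- by move=> x /= nA; apply: AB.
Qed.

(** One child is enough to bound a message from below. *)
Lemma message_child : {ae Q, forall x : seq nat -> nat, forall n,
  transfer q beta (Y n (shift 0 x)) <= Y n.+1 x}.
Proof.
apply: aeS Zpos => x x0 n; apply: transfer_mono => //; first exact: message_ge0.
rewrite /tot /child_sum; case: (x [::]) x0 => // N _.
rewrite big_ord_recl lerDl; apply: sumr_ge0 => i _; exact: message_ge0.
Qed.

Lemma msg_mean_lower (r : R) : (forall x, 0 <= x -> x <= bmax -> r * x <= transfer q beta x) ->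
  forall n, r * msg_mean n <= msg_mean n.+1.
Proof.
move=> hr n; rewrite /msg_mean -(Ex_shift QE 0 (Itg_message n)).
have is0 := Itg_shift QE 0 (Itg_message n).
rewrite -(ExZ _ is0); apply: le_Ex_ae; [exact: ItgZ | exact: Itg_message |].
apply: aeS message_child => x /(_ n); apply: le_trans; apply: hr.
  exact: message_ge0.
by have [_ h] := message_bounds n (shift 0 x); apply: le_trans h b2.
Qed.

Lemma msg_mean_gt0 n : 0 < msg_mean n.
Proof.
have [r [r0 r1 hr]] := @transfer_lower R q m betac q_range m_gt1 critical.
elim: n => [|n IHn]; first by rewrite /msg_mean /Y /= Ex_cst.
apply: lt_le_trans (msg_mean_lower (fun x x0 xb => hr beta x b1 b2 x0 xb) n).
exact: mulr_gt0.
Qed.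

(** A function that is star-shaped with respect to the origin contracts a
    positive random variable in the convex order, after normalization of the
    means; the graphs of the two normalized variables cross only once. *)
Lemma star_order (p : R) n : 1 < p -> Itg (fun x => X n x `^ p) ->
  E (fun x => Y n.+1 x `^ p) * (m * msg_mean n) `^ p <=
  E (fun x => X n x `^ p) * msg_mean n.+1 `^ p.
Proof.
move=> p1 Xp; pose F := transfer q beta.
pose a := m * msg_mean n; pose f := msg_mean n.+1.
have p0 : 0 < p by rewrite (lt_trans ltr01).
have a0 : 0 < a by rewrite mulr_gt0 ?msg_mean_gt0 // (lt_trans ltr01).
have f0 : 0 < f by exact: msg_mean_gt0.
pose rho := f / a; have rho0 : 0 < rho by exact: divr_gt0.
pose S := [set x : R | 0 <= x /\ rho * x <= F x].
have S0 : S 0 by split => //; rewrite mulr0 transfer_ge0.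
have Sub : has_ubound S.
  exists (beta / rho) => x [x0 xF]; rewrite ler_pdivlMr // mulrC.
  by rewrite (le_trans xF) // transfer_le.
pose c := sup S.
have c0 : 0 <= c by exact: ub_le_sup.
have key x : 0 <= x -> (F x / f) `^ p - (x / a) `^ p <=
    p * (c / a) `^ (p - 1) * (F x / f - x / a).
  move=> x0.
  have u0 : 0 <= F x / f by rewrite divr_ge0 ?(ltW f0) // transfer_ge0.
  have v0 : 0 <= x / a by rewrite divr_ge0 ?(ltW a0).
  have k0 : 0 <= c / a by rewrite divr_ge0 ?(ltW a0).
  apply: (le_trans (powR_tangent p1 u0 v0)).
  have eqf y : (rho * y) / f = y / a.
    by rewrite /rho; field; rewrite !gt_eqF.
  have [xS|xS] := leP (rho * x) (F x).
    have xc : x <= c by exact: ub_le_sup.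
    have Fc : F x <= rho * c.
      have hF y : c < y -> F x <= rho * y.
        move=> cy; have y0 : 0 <= y by rewrite (le_trans c0) // ltW.
        apply: (@le_trans _ _ (F y)).
          by apply: transfer_mono => //; rewrite (le_trans xc) // ltW.
        rewrite leNgt; apply/negP => /ltW yF.
        by have := ub_le_sup Sub (conj y0 yF : S y); rewrite leNgt cy.
      apply/ler_addgt0Pr => e e0; have := hF (c + e / rho).
      rewrite ltrDl divr_gt0 // => /(_ isT); rewrite mulrDr (mulrC rho (e / _)).
      by rewrite divfK ?gt_eqF.
    rewrite ler_wpM2r //.
      by rewrite subr_ge0 -(eqf x) ler_wpM2r // invr_ge0 ltW.
    rewrite ler_wpM2l ?(ltW p0) // ge0_ler_powR ?nnegrE ?subr_ge0 ?(ltW p1) //.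
    by rewrite -(eqf c) ler_wpM2r // invr_ge0 ltW.
  have cx : rho * c <= F x.
    rewrite mulrC -ler_pdivlMr //; apply: ge_sup; first by exists 0.
    move=> y [y0 yF]; rewrite ler_pdivlMr // mulrC (le_trans yF) //.
    apply: transfer_mono => //; rewrite leNgt; apply/negP => xy.
    have y1 : 0 < y by exact: le_lt_trans x0 xy.
    have r01 : 0 <= x / y <= 1.
      by rewrite divr_ge0 //= ler_pdivrMr // mul1r ltW.
    have := transfer_star q_range b0 r01 y0; rewrite divfK ?gt_eqF // => h.
    have : rho * x <= F x.
      apply: le_trans h; rewrite [leLHS](_ : _ = x / y * (rho * y)); last first.
        by field; rewrite gt_eqF.
      by rewrite ler_wpM2l // divr_ge0.
    by rewrite leNgt xS.
  rewrite -subr_ge0 -mulrBl mulr_le0 //; last first.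
    by rewrite subr_le0 -(eqf x) ler_wpM2r ?invr_ge0 // ltW.
  rewrite -mulrBr mulr_ge0_le0 ?(ltW p0) // subr_le0.
  rewrite ge0_ler_powR ?nnegrE ?subr_ge0 ?(ltW p1) //.
  by rewrite -(eqf c) ler_wpM2r // invr_ge0 ltW.
have X0 x : 0 <= X n x by exact: tot_ge0.
have Yp := Itg_message_powR n.+1 p0.
have fp0 : 0 < f `^ p by rewrite powR_gt0.
have ap0 : 0 < a `^ p by rewrite powR_gt0.
pose K := p * (c / a) `^ (p - 1).
pose L x := (f `^ p)^-1 * Y n.+1 x `^ p - (a `^ p)^-1 * X n x `^ p.
pose G x := K * (f^-1 * Y n.+1 x - a^-1 * X n x).
have j1 := ItgZ (f `^ p)^-1 Yp; have j2 := ItgZ (a `^ p)^-1 Xp.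
have j3 := ItgZ f^-1 (Itg_message n.+1); have j4 := ItgZ a^-1 (Itg_tot n).
have LG x : L x <= G x.
  have := key _ (X0 x); rewrite -/K !powRM ?invr_ge0 ?(ltW f0) ?(ltW a0) ?X0 //; last first.
    by rewrite transfer_ge0.
  rewrite -!powR_inv1 ?(ltW f0) ?(ltW a0) // -!powRrM !(mulrC (-1)) !powRrM.
  rewrite !powR_inv1 ?powR_ge0 ?(ltW f0) ?(ltW a0) //.
  by rewrite /L /G -[Y n.+1 x]/(F (X n x)) !(mulrC _^-1).
have := le_Ex (ItgB j1 j2) (ItgZ K (ItgB j3 j4)) LG.
rewrite (ExZ K (ItgB j3 j4)) (ExB j3 j4) (ExZ _ (Itg_message n.+1)) (ExZ _ (Itg_tot n)).
rewrite (ExB j1 j2) (ExZ _ Yp) (ExZ _ Xp) Ex_tot_message -/a.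
rewrite -[E (Y n.+1)]/f !mulVf ?gt_eqF // subrr mulr0 subr_le0.
rewrite -[msg_mean n.+1]/f; move: (E (fun x => Y n.+1 x `^ p)) (E (fun x => X n x `^ p)) => u v h.
have := ler_wpM2l (mulr_ge0 (ltW fp0) (ltW ap0)) h.
have -> : f `^ p * a `^ p * ((f `^ p)^-1 * u) = u * a `^ p.
  by rewrite mulrAC mulrA mulfV ?gt_eqF // mul1r.
have -> : f `^ p * a `^ p * ((a `^ p)^-1 * v) = v * f `^ p.
  by rewrite -mulrA mulVKf ?gt_eqF // mulrC.
by [].
Qed.

End FixedBeta.
End Messages.

(** * Bounds that are uniform in the height and near the critical point *)

Section UniformBounds.
Variables (R : realType) (mu : probability nat R).
Variable Q : probability (tree_space setT) R.
Variables (q betac : R).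
Hypothesis H : critical_tree mu Q q betac.
Let m := mean_children Q.
Let QE : tree_law mu Q := ct_law H.
Let Zi := ct_Itg H.
Let m_gt1 : 1 < m := ct_mean H.
Let m_gt0 : 0 < m. Proof. exact: lt_trans ltr01 m_gt1. Qed.
Let s := crit_exp q.
Let bmax := betac + 1.
Let bc0 : 0 < betac. Proof. exact: (betac_gt0 (ct_q H) (ct_mean H) (ct_crit H)). Qed.
Let bmax0 : 0 < bmax. Proof. by rewrite /bmax addr_gt0. Qed.

Notation E := (Ex Q).
Notation Itg := (Itg Q).
Notation msg := (message q).
Notation "'E_Z' c" := (E (fun x => c (x [::]))) (at level 10).
Notation inrange beta := (betac <= beta <= betac + 1).
Notation f := (msg_mean Q q).

Lemma crit_expP : s = 1%N \/ s = 2%N.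
Proof. by rewrite /s /crit_exp; case: ifP; [left | right]. Qed.

Let pos_beta (beta : R) : inrange beta -> 0 < beta.
Proof. by move=> /andP[b _]; exact: lt_le_trans bc0 b. Qed.

Definition trunc_root (c : R) N : R := Num.min (N%:R * c) 1.

Lemma trunc_root_ge0 (c : R) N : 0 <= c -> 0 <= trunc_root c N.
Proof. by move=> c0; rewrite /trunc_root le_min ler01 mulr_ge0. Qed.

Lemma trunc_root_le1 (c : R) N : trunc_root c N <= 1.
Proof. by rewrite /trunc_root ge_min lexx orbT. Qed.

Lemma trunc_root_le (c : R) N : trunc_root c N <= N%:R * c.
Proof. by rewrite /trunc_root ge_min lexx. Qed.

(** The truncated moment of the offspring law at the scale [1 / c]: the order
    of the mean defect when the messages have mean [c]. *)
Definition Phi (c : R) : R := E_Z (fun N => trunc_root c N ^+ s.+1).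

(** The rate at which the defect pulls the mean message [c] down; [c * pull c]
    bounds the mean defect from above as [Phi c] bounds it from below, and the
    two are comparable when the tails of the offspring law are regular. *)
Definition pull (c : R) : R := E_Z (fun N => N%:R * trunc_root c N ^+ s).

Let trunc_exp (c : R) N k : 0 <= c -> 0 <= trunc_root c N ^+ k <= 1.
Proof.
move=> c0; rewrite exprn_ge0 ?trunc_root_ge0 //=.
by rewrite exprn_ile1 ?trunc_root_ge0 ?trunc_root_le1.
Qed.

Lemma Itg_Phi (c : R) : 0 <= c -> Itg (fun x => trunc_root c (x [::]) ^+ s.+1).
Proof.
move=> c0; apply: (@Itg_bounded _ Q _ 1).
  exact: (meas_root (fun N => trunc_root c N ^+ s.+1)).
by move=> x; have /andP[h0 h1] := trunc_exp (x [::]) s.+1 c0; rewrite ger0_norm.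
Qed.

Lemma Itg_pull (c : R) : 0 <= c -> Itg (fun x => (x [::])%:R * trunc_root c (x [::]) ^+ s).
Proof.
move=> c0; apply: (Itg_le _ _ Zi).
  exact: (meas_root (fun N => N%:R * trunc_root c N ^+ s)).
move=> x; have /andP[h0 h1] := trunc_exp (x [::]) s c0.
by rewrite ger0_norm ?mulr_ge0 // ler_piMr.
Qed.

Lemma Phi_ge (c : R) : 0 <= c -> Num.min c 1 ^+ s.+1 <= Phi c.
Proof.
move=> c0; rewrite -[leLHS](Ex_cst Q); apply: le_Ex_ae.
- exact: Itg_cst.
- exact: Itg_Phi.
- apply: aeS (ct_pos H) => x x0; rewrite lerXn2r ?nnegrE ?trunc_root_ge0 //.
    by rewrite le_min c0 ler01.
  rewrite /trunc_root le_min !ge_min lexx !orbT andbT; apply/orP; left.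
  by rewrite ler_peMl // ler1n.
Qed.

Lemma Phi_gt0 (c : R) : 0 < c -> 0 < Phi c.
Proof.
move=> c0; apply: lt_le_trans (Phi_ge (ltW c0)).
by rewrite exprn_gt0 // lt_min c0 ltr01.
Qed.

Lemma Phi_le_pull (c : R) : 0 <= c -> Phi c <= c * pull c.
Proof.
move=> c0; rewrite -(ExZ c (Itg_pull c0)); apply: le_Ex.
- exact: Itg_Phi.
- exact: (ItgZ c (Itg_pull c0)).
- move=> x; rewrite exprS mulrA (mulrC c); apply: ler_wpM2r.
    by have /andP[] := trunc_exp (x [::]) s c0.
  exact: trunc_root_le.
Qed.

Let trunc_scale (a c : R) N : 1 <= a -> 0 <= c -> trunc_root (a * c) N <= a * trunc_root c N.
Proof.
move=> a1 c0; have a0 : 0 <= a by rewrite (le_trans ler01).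
rewrite /trunc_root; have [h|h] := leP (N%:R * c) 1.
  by rewrite ge_min mulrCA lexx.
by rewrite mulr1 ge_min a1 orbT.
Qed.

Lemma Phi_scale (a c : R) : 1 <= a -> 0 <= c -> Phi (a * c) <= a ^+ s.+1 * Phi c.
Proof.
move=> a1 c0; have a0 : 0 <= a by rewrite (le_trans ler01).
have ac0 : 0 <= a * c by exact: mulr_ge0.
rewrite -(ExZ _ (Itg_Phi c0)); apply: le_Ex; [exact: Itg_Phi | exact: (ItgZ _ (Itg_Phi c0)) |].
move=> x; rewrite -exprMn lerXn2r ?nnegrE ?trunc_root_ge0 ?mulr_ge0 ?trunc_root_ge0 //.
exact: trunc_scale.
Qed.

Let trunc_mono (c d : R) N : c <= d -> trunc_root c N <= trunc_root d N.
Proof.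
move=> cd; rewrite /trunc_root le_min !ge_min lexx orbT andbT; apply/orP; left.
exact: ler_wpM2l.
Qed.

Lemma Phi_mono (c d : R) : 0 <= c -> c <= d -> Phi c <= Phi d.
Proof.
move=> c0 cd; have d0 := le_trans c0 cd.
apply: le_Ex; [exact: Itg_Phi | exact: Itg_Phi |].
by move=> x; rewrite lerXn2r ?nnegrE ?trunc_root_ge0 // trunc_mono.
Qed.

Lemma pull_mono (c d : R) : 0 <= c -> c <= d -> pull c <= pull d.
Proof.
move=> c0 cd; have d0 := le_trans c0 cd.
apply: le_Ex; [exact: Itg_pull | exact: Itg_pull |].
by move=> x; rewrite ler_wpM2l // lerXn2r ?nnegrE ?trunc_root_ge0 // trunc_mono.
Qed.

(** ** Moments of the messages *)

(** Only the term of the sum of highest exponent needs a constant close to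
    one: this is what makes the recursion for the moments contracting. *)
Lemma child_sum_exp (theta : R) : 0 < theta -> exists2 C : R, 0 < C &
  forall (Y : (seq nat -> nat) -> R) N, (forall x, 0 <= Y x) -> 0 < E Y ->
    (forall k, (k <= s.+1)%N -> Itg (fun x => Y x ^+ k)) ->
    Itg (fun x => child_sum Y N x ^+ s.+1) /\
    E (fun x => child_sum Y N x ^+ s.+1) <=
      (1 + theta) * N%:R * E (fun x => Y x ^+ s.+1) + C * (N%:R * E Y) ^+ s.+1.
Proof.
move=> th0; exists (1 + 9 / (4 * theta)).
  by rewrite addr_gt0 // divr_gt0 // mulr_gt0.
move=> Y N Y0 f0 Yk; have Yi : Itg Y by apply: (eq_Itg _ (Yk 1%N _)) => [x|]; rewrite ?expr1.
have Y2 : Itg (fun x => Y x ^+ 2) by apply: Yk; case: crit_expP => ->.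
have Y3 : s = 2%N -> Itg (fun x => Y x ^+ 3) by move=> es; apply: Yk; rewrite es.
have n0 : 0 <= N%:R :> R by exact: ler0n.
have C0 : 0 <= 9 / (4 * theta) by rewrite divr_ge0 // mulr_ge0 // ltW.
case: crit_expP => es; rewrite es.
  have [i e] := Ex_child_sum2 QE N Yi Y2; split => //; rewrite e.
  have v0 : 0 <= E (fun x => Y x ^+ 2) by apply: Ex_ge0 => x; exact: sqr_ge0.
  move: (E (fun x => Y x ^+ 2)) v0 => v v0; move: (E Y) f0 => f f0.
  move: N%:R n0 (9 / (4 * theta)) C0 => n n0 c c0.
  have h1 : 0 <= theta * (n * v) by rewrite !mulr_ge0 // ltW.
  have h2 : 0 <= c * (n * f) ^+ 2 by rewrite mulr_ge0 ?sqr_ge0.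
  have h3 : 0 <= n * f ^+ 2 by rewrite mulr_ge0 ?sqr_ge0.
  rewrite -subr_ge0 (_ : _ - _ = theta * (n * v) + c * (n * f) ^+ 2 + n * f ^+ 2).
    by rewrite !addr_ge0.
  by ring.
have [i e] := Ex_child_sum3 QE N Y0 Yi Y2 (Y3 es); split => //.
apply: (le_trans e); case: N n0 {i e} => [|N] n0.
  by rewrite !(mulr0n, expr0n, mul0r, mulr0, addr0, add0r) /= ?(mulr0n, mul0r, mulr0, addr0, add0r) //=.
have n1 : 0 < N.+1%:R :> R by rewrite ltr0n.
move: N.+1%:R n0 n1 => n n0 n1; set v2 := E (fun x => Y x ^+ 2).
set v3 := E (fun x => Y x ^+ 3); pose tau := 3 * n * E Y / (2 * theta).
have tau0 : 0 < tau by rewrite divr_gt0 ?mulr_gt0.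
have h : v2 <= 2^-1 * (tau * E Y + tau^-1 * v3).
  have i1 := ItgZ tau Yi; have i2 := ItgZ tau^-1 (Y3 es); have i3 := ItgD i1 i2.
  rewrite -(ExZ _ Yi) -(ExZ _ (Y3 es)) -(ExD i1 i2) -(ExZ _ i3).
  apply: le_Ex; [exact: Y2 | exact: (ItgZ _ i3) |] => x.
  rewrite -subr_ge0 (_ : _ - _ = (2 * tau)^-1 * (Y x * (Y x - tau) ^+ 2)).
    have t2 : 0 <= (2 * tau)^-1 by rewrite invr_ge0 mulr_ge0 // ltW.
    exact: mulr_ge0 t2 (mulr_ge0 (Y0 x) (sqr_ge0 _)).
  by field; rewrite gt_eqF.
have k0 : 0 <= 3 * n ^+ 2 * E Y by rewrite !mulr_ge0 ?sqr_ge0 // ltW.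
have h2 := ler_wpM2l k0 h.
have E1 : 3 * n ^+ 2 * E Y * (2^-1 * (tau * E Y + tau^-1 * v3)) =
    theta * n * v3 + 9 / (4 * theta) * (n * E Y) ^+ 3.
  by rewrite /tau; field; rewrite !gt_eqF.
rewrite E1 in h2; apply: (@le_trans _ _ (n * v3 + (theta * n * v3 +
  9 / (4 * theta) * (n * E Y) ^+ 3) + n ^+ 3 * E Y ^+ 3)).
  by rewrite lerD2r lerD2l.
by rewrite -subr_ge0 (_ : _ - _ = 0) //; ring.
Qed.

Definition msg_moment (beta : R) n : R := E (fun x => msg beta n x ^+ s.+1).

Lemma transfer_le_psi (beta x : R) : inrange beta -> 0 <= x ->
  transfer q beta x <= psi q beta * x.
Proof.
by move=> hb x0; rewrite -subr_ge0; exact: (defect_ge0 (ct_q H) (pos_beta hb) x0).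
Qed.

Let Itg_transfer_sum (beta : R) n N k : inrange beta ->
  meas nonroot (fun x => transfer q beta (child_sum (msg beta n) N x) ^+ k) /\
  Itg (fun x => transfer q beta (child_sum (msg beta n) N x) ^+ k).
Proof.
move=> hb; have b0 := pos_beta hb.
have S0 x : 0 <= child_sum (msg beta n) N x.
  by apply: child_sum_ge0 => y; exact: (message_ge0 H hb).
have M : meas nonroot (fun x => transfer q beta (child_sum (msg beta n) N x) ^+ k).
  apply: (meas_comp (g := fun z => z ^+ k)); first exact: exprn_measurable.
  apply: (@meas_mono _ _ (transfer q beta)) => //.
    by move=> x y x0 xy; apply: transfer_mono => //; exact: (ct_q H).
  by apply: meas_child_sum_nonroot; exact: (meas_message H hb n).
split => //; apply: (@Itg_bounded _ Q _ (beta ^+ k)).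
  by apply: (@meas_sub _ nonroot).
move=> x; have q1 := ct_q H.
rewrite ger0_norm ?exprn_ge0 ?transfer_ge0 // lerXn2r ?nnegrE ?transfer_ge0 //.
  exact: ltW.
exact: transfer_le.
Qed.

(** If the root has fewer than [1 / c] children, where [c] is the mean
    message, the linear bound on the transfer function applies to the moments
    of the sum; otherwise the message is bounded, and [Phi c] accounts for the
    event. *)
Lemma msg_moment_step (theta : R) : 0 < theta -> exists2 C : R, 0 < C &
  forall (beta : R) n, inrange beta ->
    msg_moment beta n.+1 <=
      (1 + theta) * (m * psi q beta ^+ s.+1) * msg_moment beta n + C * Phi (f beta n).
Proof.
move=> th0; have [C0 C00 hC] := child_sum_exp th0.
exists (C0 + bmax ^+ s.+1); first by rewrite addr_gt0 // exprn_gt0.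
move=> beta n hb; have b0 := pos_beta hb.
have /andP[b1 b2] := hb; have q1 := ct_q H.
have c0 : 0 < f beta n := msg_mean_gt0 H hb n.
pose c N := (1 + theta) * psi q beta ^+ s.+1 * msg_moment beta n * N%:R +
  (C0 + bmax ^+ s.+1) * trunc_root (f beta n) N ^+ s.+1.
have V0 : 0 <= msg_moment beta n.
  by apply: Ex_ge0 => x; rewrite exprn_ge0 // (message_ge0 H hb).
have p0 := psi_gt0 q1 b0; have p1 := psi_lt1 q1 b0.
have i1 := ItgZ ((1 + theta) * psi q beta ^+ s.+1 * msg_moment beta n) Zi.
have i2 := ItgZ (C0 + bmax ^+ s.+1) (Itg_Phi (ltW c0)).
have ci : Itg (fun x => c (x [::])) by exact: (ItgD i1 i2).
have gc N : E (fun x => transfer q beta (child_sum (msg beta n) N x) ^+ s.+1) <= c N.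
  have [mT iT] := Itg_transfer_sum n N s.+1 hb.
  have [iS eS] := hC (msg beta n) N (message_ge0 H hb n) c0
    (fun k _ => Itg_message_exp H hb n k).
  have S0 x : 0 <= child_sum (msg beta n) N x.
    by apply: child_sum_ge0 => y; exact: (message_ge0 H hb).
  have A0 : 0 <= (1 + theta) * psi q beta ^+ s.+1 * msg_moment beta n * N%:R.
    by rewrite !mulr_ge0 ?exprn_ge0 ?addr_ge0 // ltW.
  have [Nc|Nc] := leP (N%:R * f beta n) 1.
    have tE : trunc_root (f beta n) N = N%:R * f beta n by apply/min_idPl.
    rewrite /c tE.
    apply: (@le_trans _ _ (psi q beta ^+ s.+1 *
      E (fun x => child_sum (msg beta n) N x ^+ s.+1))).
      rewrite -(ExZ _ iS); apply: le_Ex => //; first exact: ItgZ.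
      move=> x; rewrite -exprMn lerXn2r ?nnegrE ?transfer_ge0 //.
        exact: mulr_ge0 (ltW p0) (S0 x).
      exact: transfer_le_psi.
    have pk0 : 0 <= psi q beta ^+ s.+1 by rewrite exprn_ge0 // ltW.
    have pk1 : psi q beta ^+ s.+1 <= 1 by rewrite exprn_ile1 // ltW.
    apply: (le_trans (ler_wpM2l pk0 eS)); rewrite mulrDr; apply: lerD.
      by rewrite -subr_ge0 /msg_moment (_ : _ - _ = 0) //; ring.
    have N0 : 0 <= (N%:R * f beta n) ^+ s.+1 by rewrite exprn_ge0 // mulr_ge0 // ltW.
    rewrite mulrA ler_wpM2r // (@le_trans _ _ C0) //.
      by rewrite ler_piMl // ltW.
    by rewrite lerDl exprn_ge0 // ltW.
  have tE : trunc_root (f beta n) N = 1 by apply/min_idPr; exact: ltW.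
  rewrite /c tE expr1n mulr1; apply: (@le_trans _ _ (bmax ^+ s.+1)).
    rewrite -[leRHS](Ex_cst Q); apply: le_Ex => //; first exact: Itg_cst.
    move=> x; rewrite lerXn2r ?nnegrE ?transfer_ge0 ?(ltW bmax0) //.
    by rewrite (le_trans (transfer_le q1 b0 (S0 x))).
  by rewrite addrA lerDr addr_ge0 // ltW.
have := @Ex_root_le _ _ _ QE
  (fun N x => transfer q beta (child_sum (msg beta n) N x) ^+ s.+1) c.
case.
- by move=> N; have [] := Itg_transfer_sum n N s.+1 hb.
- move=> N x; rewrite exprn_ge0 // transfer_ge0 //.
  by apply: child_sum_ge0 => y; exact: (message_ge0 H hb).
- by move=> N; have [] := Itg_transfer_sum n N s.+1 hb.
- exact: gc.
- exact: ci.
move=> _ le1; apply: (le_trans le1).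
rewrite /c (ExD i1 i2) (ExZ _ Zi) (ExZ _ (Itg_Phi (ltW c0))) -/(Phi _).
by rewrite -[E _]/m lerD2r -subr_ge0 (_ : _ - _ = 0) //; ring.
Qed.

Section PowerMoment.
Variable p : R.
Hypothesis p_range : 1 < p < 2.
Hypothesis Zp : Itg (fun x => (x [::])%:R `^ p).
Let p_gt1 : 1 < p. Proof. by have /andP[] := p_range. Qed.
Let p_gt0 : 0 < p. Proof. exact: lt_trans ltr01 p_gt1. Qed.
Let EZp := E_Z (fun N => N%:R `^ p).

Let EZp0 : 0 <= EZp. Proof. by apply: Ex_ge0 => x; exact: powR_ge0. Qed.

Let tot_powR (beta : R) n : inrange beta ->
  Itg (fun x => tot (msg beta n) x `^ p) /\
  E (fun x => tot (msg beta n) x `^ p) <=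
    m * E (fun x => msg beta n x `^ p) + EZp * f beta n `^ p.
Proof.
move=> hb; have c0 : 0 < f beta n := msg_mean_gt0 H hb n.
have Yi := Itg_message H hb n; have Yp := Itg_message_powR H hb n p_gt0.
have Y0 := message_ge0 H hb n.
pose v := E (fun x => msg beta n x `^ p).
have i1 := ItgZ v Zi; have i2 := ItgZ (f beta n `^ p) Zp.
have ci : Itg (fun x => v * (x [::])%:R + f beta n `^ p * (x [::])%:R `^ p).
  exact: (ItgD i1 i2).
have S N := Ex_child_sum_powR QE N p_range Y0 c0 Yi Yp.
have [||||] := @Ex_root_le _ _ _ QE (fun N x => child_sum (msg beta n) N x `^ p)
  (fun N => v * N%:R + f beta n `^ p * N%:R `^ p) _ _ _ _ ci.
- move=> N; apply: (meas_comp (@measurable_powR R p)).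
  by apply: meas_child_sum_nonroot; exact: (meas_message H hb n).
- by move=> N x; exact: powR_ge0.
- by move=> N; have [] := S N.
- by move=> N; have [_] := S N; rewrite mulrC (mulrC (N%:R `^ p)).
move=> iT eT; split => //; apply: (le_trans eT).
rewrite (ExD i1 i2) (ExZ _ Zi) (ExZ _ Zp) mulrC (mulrC (f _ _ `^ _)); exact: lexx.
Qed.

Let powR_bound_step (a b u v x y t C e : R) : 0 < a -> 0 < b -> 0 < u -> 0 <= v ->
  e <= C * (b - a) -> x <= C * u -> t <= a * x + e * u -> y * (b * u) <= t * v ->
  y <= C * v.
Proof.
move=> a0 b0 u0 v0 h1 h2 h3 h4; have bu : 0 < b * u by exact: mulr_gt0.
have h5 := ler_wpM2l (ltW a0) h2; have h6 := ler_wpM2r (ltW u0) h1.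
have h7 : t <= C * b * u.
  have -> : C * b * u = a * (C * u) + C * (b - a) * u by ring.
  by apply: (le_trans h3); exact: lerD.
rewrite -(ler_pM2r bu); apply: (le_trans h4); have h8 := ler_wpM2r v0 h7.
have -> : C * v * (b * u) = C * b * u * v by ring.
exact: h8.
Qed.

(** After normalization by the mean, the messages are bounded in a space of
    exponent larger than one, uniformly in the height and in the parameter:
    the star order makes the transfer function harmless for normalized
    moments, and those of the linear recursion are bounded because [m ^ p >
    m]. *)
Lemma message_powR_bound : exists2 C : R, 0 < C & forall (beta : R) n, inrange beta ->
  E (fun x => msg beta n x `^ p) <= C * f beta n `^ p.
Proof.
have mp : m < m `^ p.
  rewrite -{1}(powRr1 (ltW m_gt0)).
  rewrite -subr_gt0 -(mulr_powRB1 (ltW m_gt0) p_gt0) powRr1 ?(ltW m_gt0) //.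
  have -> : m * m `^ (p - 1) - m = m * (m `^ (p - 1) - 1) by ring.
  rewrite mulr_gt0 // subr_gt0 -[X in X < _](powRr0 m).
  by rewrite /powR gt_eqF // ltr_expR ltr_pM2r ?subr_gt0 // ln_gt0.
have d0 : 0 < m `^ p - m by rewrite subr_gt0.
pose C := 1 + EZp / (m `^ p - m).
have C1 : 1 <= C by rewrite lerDl divr_ge0 // ltW.
exists C; first by rewrite (lt_le_trans ltr01).
move=> beta n hb; elim: n => [|n IHn].
  rewrite /msg_mean /= !Ex_cst ler_peMl ?powR_ge0 //.
have [iT eT] := tot_powR n hb.
have c0 : 0 < f beta n `^ p by apply: powR_gt0; exact: (msg_mean_gt0 H hb n).
have c1 : 0 <= f beta n.+1 `^ p by exact: powR_ge0.
have h := star_order H hb p_gt1 iT.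
rewrite (powRM p (ltW m_gt0) (ltW (msg_mean_gt0 H hb n))) in h.
have EC : EZp <= C * (m `^ p - m).
  rewrite /C mulrDl mul1r divfK ?gt_eqF // lerDr ltW //.
exact: (powR_bound_step m_gt0 (lt_trans m_gt0 mp) c0 c1 EC IHn eT h).
Qed.

Lemma defect_powR : exists2 K : R, 0 < K & forall (beta : R) n, inrange beta ->
  E (fun x => defect q beta (tot (msg beta n) x)) <= K * f beta n `^ p.
Proof.
have [K K0 hK] := defect_upper (ct_q H) (ct_mean H) (ct_crit H).
have [C C0 hC] := message_powR_bound.
pose K' := Num.max K 1.
have K'0 : 0 < K' by rewrite lt_max ltr01 orbT.
have A0 : 0 < m * C + EZp by rewrite ltr_wpDr // mulr_gt0.
exists (K' * (m * C + EZp)); first exact: mulr_gt0.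
move=> beta n hb; have /andP[b1 b2] := hb; have b0 := pos_beta hb.
have [iT eT] := tot_powR n hb.
apply: (@le_trans _ _ (K' * E (fun x => tot (msg beta n) x `^ p))).
  rewrite -(ExZ _ iT); apply: le_Ex; [exact: (Itg_defect H hb) | exact: ItgZ |].
  move=> x; have X0 := tot_ge0 H hb n x; move: (tot _ x) X0 => y y0.
  have [y1|y1] := leP y 1.
    apply: (@le_trans _ _ (K * y ^+ s.+1)); first exact: hK.
    apply: ler_pM; rewrite ?exprn_ge0 ?(ltW K0) //.
      by rewrite /K' le_max lexx.
    have [->|yn] := eqVneq y 0; first by rewrite exprS mul0r powR_ge0.
    have yp : 0 < y by rewrite lt_neqAle eq_sym yn.
    rewrite -powR_mulrn // ger_powR ?yp //.
    have /andP[_ p2] := p_range; rewrite (le_trans (ltW p2)) //.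
    by rewrite ler_nat; case: crit_expP => ->.
  apply: (@le_trans _ _ y); first by apply: defect_le_id => //; exact: (ct_q H).
  apply: (@le_trans _ _ (y `^ p)); first by rewrite le1r_powR ?ltW.
  by rewrite ler_peMl ?powR_ge0 // /K' le_max lexx orbT.
rewrite -mulrA; apply: (ler_wpM2l (ltW K'0)); apply: (le_trans eT); rewrite mulrDl.
apply: lerD (lexx _); rewrite -mulrA; exact: (ler_wpM2l (ltW m_gt0) (hC beta n hb)).
Qed.

(** Small mean messages change little in a generation, so that the level of
    [Phi] may be followed along the recursion. *)
Lemma msg_mean_slow (eta : R) : 0 < eta -> exists2 delta : R, 0 < delta &
  forall (beta : R) n, inrange beta -> f beta n <= delta ->
    E (fun x => defect q beta (tot (msg beta n) x)) <= eta * f beta n.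
Proof.
move=> eta0; have [K K0 hK] := defect_powR.
have p10 : 0 < p - 1 by rewrite subr_gt0.
exists ((eta / K) `^ (p - 1)^-1); first by rewrite powR_gt0 // divr_gt0.
move=> beta n hb fd; have c0 : 0 < f beta n := msg_mean_gt0 H hb n.
apply: (le_trans (hK beta n hb)).
rewrite -(mulr_powRB1 (ltW c0) p_gt0) mulrCA mulrC ler_wpM2r ?(ltW c0) //.
rewrite -ler_pdivlMl // mulrC.
have -> : eta / K = ((eta / K) `^ (p - 1)^-1) `^ (p - 1).
  by rewrite -powRrM mulVf ?gt_eqF // powRr1 // ltW // divr_gt0.
by rewrite ge0_ler_powR ?nnegrE ?powR_ge0 ?(ltW p10) ?(ltW c0).
Qed.

(** The recursion for the moments contracts by a factor at most close to
    [m^-1], while [Phi] of the mean message varies slowly: the ratio of the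
    two remains bounded. *)
Lemma msg_moment_bound : exists eps0 Cv : R, [/\ 0 < eps0, eps0 <= 1, 0 < Cv &
  forall (beta : R) n, betac <= beta -> beta <= betac + eps0 ->
    msg_moment beta n <= Cv * Phi (f beta n)].
Proof.
have [b1' [b2' [b10 b20 hb12]]] := growth_linear (ct_q H) (ct_mean H) (ct_crit H).
have [r [r0 r1 hr]] := transfer_lower (ct_q H) (ct_mean H) (ct_crit H).
(* For [u <= 1], [(1 + u) ^ 6 <= 1 + 63 * u], hence at most [(1 + m) / 2]. *)
pose u := Num.min 1 ((m - 1) / 126).
have m10 : 0 < m - 1 by rewrite subr_gt0.
have u0 : 0 < u by rewrite lt_min ltr01 divr_gt0.
have u1 : u <= 1 by rewrite ge_min lexx.
have um : u <= (m - 1) / 126 by rewrite ge_min lexx orbT.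
pose Lam := (1 + u) ^+ 6 / m.
have Lam1 : Lam < 1.
  rewrite ltr_pdivrMr // mul1r; apply: (@le_lt_trans _ _ (1 + 63 * u)); last by lra.
  have uu : 0 <= u * (1 - u) by rewrite mulr_ge0 ?subr_ge0 // ltW.
  move: u u0 u1 uu {um Lam} => z z0 z1 zz.
  have e2 : z ^+ 2 <= z by rewrite expr2; nra.
  have ek k : z ^+ k.+1 <= z.
    elim: k => [|k IHk]; first by rewrite expr1.
    by rewrite exprS; apply: le_trans IHk; rewrite ler_piMl ?exprn_ge0 // ltW.
  have := ek 1%N; have := ek 2%N; have := ek 3%N; have := ek 4%N; have := ek 5%N.
  have -> : (1 + z) ^+ 6 = 1 + 6 * z + 15 * z ^+ 2 + 20 * z ^+ 3 + 15 * z ^+ 4 +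
    6 * z ^+ 5 + z ^+ 6 by ring.
  by lra.
have [C C0 hC] := msg_moment_step u0.
have w0 : 0 < 1 + u by rewrite addr_gt0.
have eta0 : 0 < u / (1 + u) by exact: divr_gt0.
have [delta d0 hd] := msg_mean_slow eta0.
pose eps0 := Num.min 1 (u / b2').
pose A1 := C * (1 + u) ^+ 3 / (1 - Lam).
pose A2 := bmax ^+ s.+1 / Num.min (r * delta) 1 ^+ s.+1.
pose A3 := bmax ^+ s.+1 / Num.min betac 1 ^+ s.+1.
have L0 : 0 < 1 - Lam by rewrite subr_gt0.
have A10 : 0 < A1 by rewrite divr_gt0 // mulr_gt0 // exprn_gt0.
have mr0 : 0 < Num.min (r * delta) 1 by rewrite lt_min ltr01 mulr_gt0.
have mb0 : 0 < Num.min betac 1 by rewrite lt_min ltr01 bc0.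
have A20 : 0 < A2 by rewrite divr_gt0 ?exprn_gt0.
have A30 : 0 < A3 by rewrite divr_gt0 ?exprn_gt0.
exists eps0, (A1 + A2 + A3); split.
- by rewrite lt_min ltr01 divr_gt0.
- by rewrite ge_min lexx.
- by rewrite !addr_gt0.
move=> beta n b1 b2.
have hb : inrange beta.
  by rewrite b1 (le_trans b2) // lerD2l ge_min lexx.
have /andP[_ bm] := hb; have b0 := pos_beta hb; have q1 := ct_q H.
have Vmax k : msg_moment beta k <= bmax ^+ s.+1.
  rewrite -[leRHS](Ex_cst Q); apply: le_Ex.
  - exact: (Itg_message_exp H hb).
  - exact: Itg_cst.
  - move=> x; have [h0 h1] := message_bounds H hb k x.
    by rewrite lerXn2r ?nnegrE ?(ltW bmax0) // (le_trans h1).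
have big (c d : R) : 0 < d -> d <= c ->
    bmax ^+ s.+1 / Num.min d 1 ^+ s.+1 <= A1 + A2 + A3 -> forall k,
    f beta k = c -> msg_moment beta k <= (A1 + A2 + A3) * Phi (f beta k).
  move=> dd dc hA k ->; have md0 : 0 < Num.min d 1 by rewrite lt_min ltr01 dd.
  have h := Phi_ge (ltW (lt_le_trans dd dc)).
  have h' : Num.min d 1 ^+ s.+1 <= Phi c.
    apply: le_trans h; rewrite lerXn2r ?nnegrE ?(ltW md0) //.
      by rewrite le_min ler01 (ltW (lt_le_trans dd dc)).
    by rewrite le_min !ge_min dc lexx orbT.
  apply: (le_trans (Vmax k)); rewrite ler_pdivrMr ?exprn_gt0 // in hA.
  apply: (le_trans hA); rewrite ler_wpM2l //.
  by rewrite !addr_ge0 // ltW.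
elim: n => [|n IHn].
  apply: (@big beta betac) => //; last by rewrite /msg_mean /= Ex_cst.
  by rewrite -/A3 lerDr addr_ge0 // ltW.
have c0 : 0 < f beta n := msg_mean_gt0 H hb n.
have hrn := msg_mean_lower H hb (fun x x0 xb => hr beta x b1 bm x0 xb) n.
have [fd|fd] := leP (f beta n) delta; last first.
  apply: (@big (f beta n.+1) (r * delta)) => //; first exact: mulr_gt0.
    by apply: le_trans hrn; rewrite ler_wpM2l // ltW.
  by rewrite -/A2 addrAC lerDr addr_ge0 // ltW.
have [g1 g2] := hb12 _ b1 bm.
have e0 : 0 <= beta - betac by rewrite subr_ge0.
have mpsi1 : 1 <= m * psi q beta.
  by rewrite -subr_ge0 (le_trans _ g1) // mulr_ge0 // ltW.
have mpsi2 : m * psi q beta <= 1 + u.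
  rewrite -lerBlDl (le_trans g2) // mulrC -ler_pdivlMr // lerBlDl (le_trans b2) //.
  by rewrite lerD2l ge_min lexx orbT.
have ratio : f beta n <= (1 + u) * f beta n.+1.
  rewrite mulrC -ler_pdivrMr // (msg_meanS H hb) -/m.
  have := hd beta n hb fd; move: (E _) => D hD.
  apply: (@le_trans _ _ (f beta n - u / (1 + u) * f beta n)).
    by rewrite -subr_ge0 (_ : _ - _ = 0) //; field; rewrite gt_eqF.
  by apply: lerB => //; rewrite ler_peMl // ltW.
have f1 : 0 < f beta n.+1 := msg_mean_gt0 H hb n.+1.
have PhiR : Phi (f beta n) <= (1 + u) ^+ 3 * Phi (f beta n.+1).
  apply: (le_trans (Phi_mono (ltW c0) ratio)).
  apply: (le_trans (Phi_scale _ (ltW f1))); first by rewrite lerDl ltW.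
  rewrite ler_wpM2r ?(ltW (Phi_gt0 f1)) // ler_weXn2l ?lerDl ?(ltW u0) //.
  by case: crit_expP => ->.
have lam : (1 + u) * (m * psi q beta ^+ s.+1) <= (1 + u) ^+ 3 / m.
  have p0 := ltW (psi_gt0 q1 b0); have p1 := ltW (psi_lt1 q1 b0).
  have h1 : psi q beta ^+ s.+1 <= psi q beta ^+ 2.
    by rewrite ler_wiXn2l //; case: crit_expP => ->.
  have h2 : m * psi q beta ^+ 2 <= (1 + u) ^+ 2 / m.
    rewrite ler_pdivlMr //; have -> : m * psi q beta ^+ 2 * m = (m * psi q beta) ^+ 2 by ring.
    by rewrite lerXn2r ?nnegrE ?(le_trans ler01) // lerDl ltW.
  rewrite (_ : (1 + u) ^+ 3 / m = (1 + u) * ((1 + u) ^+ 2 / m)); last by ring.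
  rewrite ler_wpM2l ?(ltW w0) //; apply: le_trans h2.
  by rewrite ler_wpM2l // ltW.
have V0 : 0 <= msg_moment beta n.
  by apply: Ex_ge0 => x; rewrite exprn_ge0 // (message_ge0 H hb).
have P0 := ltW (Phi_gt0 c0); have P1 := ltW (Phi_gt0 f1).
apply: (le_trans (hC beta n hb)).
pose Cv := A1 + A2 + A3; rewrite -/Cv in IHn *.
have Cv0 : 0 <= Cv by rewrite !addr_ge0 // ltW.
have l0 : 0 <= (1 + u) ^+ 3 / m by rewrite divr_ge0 ?exprn_ge0 // ltW.
apply: (@le_trans _ _ ((1 + u) ^+ 3 / m * (Cv * Phi (f beta n)) + C * Phi (f beta n))).
  by rewrite lerD2r; apply: ler_pM => //; rewrite !mulr_ge0 ?exprn_ge0 ?(ltW w0) ?(ltW (psi_gt0 q1 b0)) // ltW.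
rewrite mulrA -mulrDl.
have k0 : 0 <= (1 + u) ^+ 3 / m * Cv + C.
  by apply: addr_ge0 (ltW C0); exact: mulr_ge0.
apply: (le_trans (ler_wpM2l k0 PhiR)); rewrite mulrA ler_wpM2r //.
have -> : ((1 + u) ^+ 3 / m * Cv + C) * (1 + u) ^+ 3 = Lam * Cv + C * (1 + u) ^+ 3.
  by rewrite /Lam; ring.
have hA : A1 <= Cv by rewrite /Cv -addrA lerDl addr_ge0 // ltW.
have eA : A1 * (1 - Lam) = C * (1 + u) ^+ 3 by rewrite /A1 divfK ?gt_eqF.
have := ler_wpM2r (ltW L0) hA; rewrite eA mulrBr mulr1.
by rewrite lerBrDr addrC (mulrC Lam).
Qed.

End PowerMoment.
End UniformBounds.

(** * The drift of the mean messages *)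

Section Drift.
Variables (R : realType) (mu : probability nat R).
Variable Q : probability (tree_space setT) R.
Variables (q betac : R).
Hypothesis H : critical_tree mu Q q betac.
Let m := mean_children Q.
Let QE : tree_law mu Q := ct_law H.
Let Zi := ct_Itg H.
Let m_gt1 : 1 < m := ct_mean H.
Let m_gt0 : 0 < m. Proof. exact: lt_trans ltr01 m_gt1. Qed.
Let s := crit_exp q.
Let bc0 : 0 < betac. Proof. exact: (betac_gt0 (ct_q H) (ct_mean H) (ct_crit H)). Qed.
Let s12 : s = 1%N \/ s = 2%N := crit_expP q.

Notation E := (Ex Q).
Notation Itg := (Itg Q).
Notation msg := (message q).
Notation inrange beta := (betac <= beta <= betac + 1).
Notation f := (msg_mean Q q).
Notation Phi := (Phi Q q).
Notation pull := (pull Q q).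
Notation trunc_root := (@trunc_root R).

Variable p : R.
Hypothesis p_range : 1 < p < 2.
Hypothesis Zp : Itg (fun x => (x [::])%:R `^ p).
Let p_gt1 : 1 < p. Proof. by have /andP[] := p_range. Qed.
Let p_gt0 : 0 < p. Proof. exact: lt_trans ltr01 p_gt1. Qed.

Let pos_beta (beta : R) : inrange beta -> 0 < beta.
Proof. by move=> /andP[b _]; exact: lt_le_trans bc0 b. Qed.

Let sum_ge0 (beta : R) n N x : inrange beta -> 0 <= child_sum (msg beta n) N x.
Proof. by move=> hb; apply: child_sum_ge0 => y; exact: (message_ge0 H hb). Qed.

Let defect_sum (beta : R) n N : inrange beta ->
  [/\ meas nonroot (fun x => defect q beta (child_sum (msg beta n) N x)),
      Itg (fun x => defect q beta (child_sum (msg beta n) N x)) &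
      forall x, 0 <= defect q beta (child_sum (msg beta n) N x)].
Proof.
move=> hb; have b0 := pos_beta hb; have q1 := ct_q H.
have S0 x : 0 <= child_sum (msg beta n) N x by exact: sum_ge0.
have D0 x : 0 <= defect q beta (child_sum (msg beta n) N x) by exact: defect_ge0.
have M : meas nonroot (fun x => defect q beta (child_sum (msg beta n) N x)).
  apply: (@meas_mono _ _ (defect q beta)) => //.
    by move=> x y x0 xy; exact: defect_mono.
  by apply: meas_child_sum_nonroot; exact: (meas_message H hb n).
split => //; apply: (Itg_le _ _ (Itg_child_sum QE N (Itg_message H hb n))).
  exact: (@meas_sub _ nonroot).
by move=> x; rewrite ger0_norm //; exact: defect_le_id.
Qed.

(** The defect is at most of order [x ^ (s + 1)] and at most [x]; the sum over
    the children is compared with its moment of order [s + 1] or with its mean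
    according to the number of children. *)
Lemma defect_mean_upper : exists eps0 K : R, [/\ 0 < eps0, eps0 <= 1, 0 < K &
  forall (beta : R) n, betac <= beta -> beta <= betac + eps0 ->
    E (fun x => defect q beta (tot (msg beta n) x)) <= K * (f beta n * pull (f beta n))].
Proof.
have [K1 K10 hK] := defect_upper (ct_q H) (ct_mean H) (ct_crit H).
have [C0 C00 hC] := child_sum_exp H (ltr01 : 0 < (1 : R)).
have [eps0 [Cv [e0 e1 Cv0 hV]]] := msg_moment_bound H p_range Zp.
exists eps0, (2 * K1 * Cv * m + (K1 * C0 + 1)); split => //.
  by rewrite !(addr_gt0, mulr_gt0).
move=> beta n b1 b2.
have hb : inrange beta by rewrite b1 (le_trans b2) // lerD2l.
have /andP[_ bm] := hb; have c0 : 0 < f beta n := msg_mean_gt0 H hb n.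
set V := msg_moment Q q beta n; set a := f beta n in c0 *.
pose c N := 2 * K1 * V * N%:R + (K1 * C0 + 1) * a * (N%:R * trunc_root a N ^+ s).
have i1 := ItgZ (2 * K1 * V) Zi.
have i2 := ItgZ ((K1 * C0 + 1) * a) (Itg_pull H (ltW c0)).
have ci : Itg (fun x => c (x [::])) by exact: (ItgD i1 i2).
have V0 : 0 <= V.
  by apply: Ex_ge0 => x; rewrite exprn_ge0 // (message_ge0 H hb).
have KV : 0 <= 2 * K1 * V by rewrite !mulr_ge0 // ltW.
have KC : 0 <= K1 * C0 by rewrite mulr_ge0 // ltW.
have gc N : E (fun x => defect q beta (child_sum (msg beta n) N x)) <= c N.
  have [mD iD D0] := defect_sum n N hb.
  have [iS eS] := hC (msg beta n) N (message_ge0 H hb n) (msg_mean_gt0 H hb n)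
    (fun k _ => Itg_message_exp H hb n k).
  have N0 : 0 <= N%:R :> R by exact: ler0n.
  have [Nc|Nc] := leP (N%:R * a) 1.
    have tE : trunc_root a N = N%:R * a by apply/min_idPl.
    apply: (@le_trans _ _ (K1 * E (fun x => child_sum (msg beta n) N x ^+ s.+1))).
      rewrite -(ExZ _ iS); apply: le_Ex => //; first exact: ItgZ.
      by move=> x; apply: hK => //; exact: sum_ge0.
    apply: (le_trans (ler_wpM2l (ltW K10) eS)); rewrite /c tE.
    rewrite -[E (msg beta n)]/a -[E _]/V.
    have h : 0 <= a * (N%:R * (N%:R * a) ^+ s).
      by rewrite !(mulr_ge0, exprn_ge0) // ltW.
    rewrite -subr_ge0 (_ : _ - _ = a * (N%:R * (N%:R * a) ^+ s)) //.
    by rewrite exprS -[1 + 1]/(2 : R); ring.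
  have tE : trunc_root a N = 1 by apply/min_idPr; exact: ltW.
  rewrite /c tE expr1n mulr1; apply: (@le_trans _ _ (N%:R * a)).
    rewrite -(Ex_child_sum QE N (Itg_message H hb n)); apply: le_Ex => //.
      exact: (Itg_child_sum QE N (Itg_message H hb n)).
    by move=> x; apply: (defect_le_id (ct_q H) (pos_beta hb)); exact: sum_ge0.
  have h : 0 <= 2 * K1 * V * N%:R + K1 * C0 * (a * N%:R).
    by rewrite addr_ge0 // mulr_ge0 // mulr_ge0 // ltW.
  rewrite -subr_ge0 (_ : _ - _ = 2 * K1 * V * N%:R + K1 * C0 * (a * N%:R)) //.
  by ring.
have [_ le1] := @Ex_root_le _ _ _ QE
  (fun N x => defect q beta (child_sum (msg beta n) N x)) c
  (fun N => let: And3 h _ _ := defect_sum n N hb in h)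
  (fun N x => let: And3 _ _ h := defect_sum n N hb in h x)
  (fun N => let: And3 _ h _ := defect_sum n N hb in h) gc ci.
apply: (le_trans le1); rewrite /c (ExD i1 i2) (ExZ _ Zi) (ExZ _ (Itg_pull H (ltW c0))).
have hV2 : V <= Cv * (a * pull a).
  by apply: (le_trans (hV _ n b1 b2)); apply: (ler_wpM2l (ltW Cv0) (Phi_le_pull H (ltW c0))).
have w : 0 <= 2 * K1 * m by rewrite !mulr_ge0 // ltW.
have := ler_wpM2l w hV2; rewrite -[E (fun x => (x [::])%:R * _ ^+ _)]/(pull a) -[E _]/m.
move: (pull a) => z hz; rewrite -subr_ge0.
rewrite (_ : _ - _ = 2 * K1 * m * (Cv * (a * z)) - 2 * K1 * m * V); last by ring.
by rewrite subr_ge0.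
Qed.

(** The messages do not concentrate near zero relative to their mean: a
    variable whose normalized moment of order [p > 1] is bounded carries its
    mean on values of the order of the mean. *)
Lemma message_spread : exists e : R, [/\ 0 < e, e <= 1 & forall (beta : R) n, inrange beta ->
  e <= E (fun x => (f beta n / 2 <= msg beta n x)%R%:R)].
Proof.
have [C C0 hC] := message_powR_bound H p_range Zp.
have p10 : 0 < p - 1 by rewrite subr_gt0.
(* Values above [L] times the mean carry at most a quarter of the mean. *)
pose L0 := (4 * C) `^ (p - 1)^-1; pose L := Num.max L0 1.
have L00 : 0 < L0 by rewrite powR_gt0 // mulr_gt0.
have L1 : 1 <= L by rewrite /L le_max lexx orbT.
have L_gt0 : 0 < L := lt_le_trans ltr01 L1.
have Lp : 4 * C <= L `^ (p - 1).
  have -> : 4 * C = L0 `^ (p - 1).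
    by rewrite /L0 -powRrM mulVf ?gt_eqF // powRr1 // mulr_ge0 // ltW.
  by rewrite ge0_ler_powR ?nnegrE ?(ltW p10) ?(ltW L00) ?(ltW L_gt0) // /L le_max lexx.
exists (4 * L)^-1; split; first by rewrite invr_gt0 mulr_gt0.
  have h4 (z : R) : 1 <= z -> 1 <= 4 * z by move=> ?; lra.
  by rewrite invf_le1 ?mulr_gt0 // h4.
move=> beta n hb; have c0 : 0 < f beta n := msg_mean_gt0 H hb n.
have Y0 := message_ge0 H hb n; have Yi := Itg_message H hb n.
have Yp := Itg_message_powR H hb n p_gt0; have hCn := hC beta n hb.
have mI : meas setT (fun x => (f beta n / 2 <= msg beta n x)%R%:R : R).
  apply: (@meas_mono _ setT (fun z => (f beta n / 2 <= z)%R%:R)) => //.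
    move=> x y _ xy; rewrite ler_nat; case: (leP _ x) => // h.
    by rewrite (le_trans h xy).
  exact: (meas_message H hb n).
have Ii : Itg (fun x => (f beta n / 2 <= msg beta n x)%R%:R).
  by apply: (Itg_bounded Q mI (c := 1)) => x; rewrite ger0_norm // lern1 leq_b1.
set a := f beta n in c0 mI Ii hCn *.
pose w := (L * a) `^ (p - 1).
have La : 0 < L * a by exact: mulr_gt0.
have w0 : 0 < w by exact: powR_gt0.
have i1 := ItgD (Itg_cst Q (a / 2)) (ItgZ (L * a) Ii).
have i2 := ItgZ w^-1 Yp.
have := le_Ex Yi (ItgD i1 i2); have -> : E (msg beta n) = a by [].
rewrite (ExD i1 i2) (ExD (Itg_cst Q _) (ItgZ (L * a) Ii)) Ex_cst (ExZ _ Ii) (ExZ _ Yp).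
have pt x : msg beta n x <= a / 2 + L * a * (a / 2 <= msg beta n x)%R%:R +
    w^-1 * msg beta n x `^ p.
  move: (msg beta n x) (Y0 x) => y y0.
  have t0 : 0 <= w^-1 * y `^ p by rewrite mulr_ge0 ?powR_ge0 // invr_ge0 ltW.
  have [h|h] := leP (a / 2) y; last first.
    by rewrite mulr0 addr0; apply: (le_trans (ltW h)); rewrite lerDl.
  rewrite mulr1; have a2 : 0 <= a / 2 by rewrite divr_ge0 // ltW.
  have [h2|h2] := leP y (L * a).
    by apply: (le_trans h2); rewrite addrAC lerDr addr_ge0.
  apply: (@le_trans _ _ (w^-1 * y `^ p)); last by rewrite lerDr addr_ge0 // ltW.
  rewrite mulrC ler_pdivlMr // -(mulr_powRB1 y0 p_gt0) ler_wpM2l //.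
  by rewrite ge0_ler_powR ?nnegrE ?(ltW p10) ?(ltW La) ?(ltW h2).
move/(_ pt); move: (E _) => e' hE.
have hw : w^-1 * E (fun x => msg beta n x `^ p) <= a / 4.
  rewrite mulrC ler_pdivrMr //; apply: (le_trans hCn).
  rewrite -(mulr_powRB1 (ltW c0) p_gt0) /w powRM ?(ltW L_gt0) ?(ltW c0) //.
  move: (a `^ (p - 1)) (powR_ge0 a (p - 1)) => z z0.
  have := ler_wpM2l (mulr_ge0 (ltW c0) z0) Lp; move: (L `^ _) => l hl.
  have -> : C * (a * z) = 4^-1 * (a * z * (4 * C)) by field.
  have -> : a / 4 * (l * z) = 4^-1 * (a * z * l) by field.
  by apply: ler_wpM2l hl; rewrite invr_ge0.
have h4 : a / 4 <= L * a * e'.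
  move: (w^-1 * _) hw hE => z hz hE; lra.
rewrite -(ler_pM2l La); have -> : L * a * (4 * L)^-1 = a / 4 by field; rewrite gt_eqF.
exact: h4.
Qed.

(** A positive proportion of the children have messages of the order of the
    mean; on the truncated number of these children, Jensen's inequality
    bounds the convex defect from below. *)
Lemma defect_mean_lower : exists2 k : R, 0 < k & forall (beta : R) n, inrange beta ->
  k * Phi (f beta n) <= E (fun x => defect q beta (tot (msg beta n) x)).
Proof.
have [k0 k00 hk] := defect_lower (ct_q H) (ct_mean H) (ct_crit H).
have [e [e0 e1 he]] := message_spread.
pose k := k0 * (e / 2) ^+ s.+1.
have k_gt0 : 0 < k by rewrite mulr_gt0 // exprn_gt0 // divr_gt0.
exists k => // beta n hb; have c0 : 0 < f beta n := msg_mean_gt0 H hb n.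
have /andP[b1 bm] := hb; have heb := he beta n hb.
have Y0 := message_ge0 H hb n.
have mI : meas setT (fun x => (f beta n / 2 <= msg beta n x)%R%:R : R).
  apply: (@meas_mono _ setT (fun z => (f beta n / 2 <= z)%R%:R)) => //.
    move=> x y _ xy; rewrite ler_nat; case: (leP _ x) => // h.
    by rewrite (le_trans h xy).
  exact: (meas_message H hb n).
have Ii : Itg (fun x => (f beta n / 2 <= msg beta n x)%R%:R).
  by apply: (Itg_bounded Q mI (c := 1)) => x; rewrite ger0_norm // lern1 leq_b1.
pose I x : R := (f beta n / 2 <= msg beta n x)%R%:R.
rewrite -[X in e <= X]/(E I) in heb; rewrite -/I in Ii.
set a := f beta n in c0 *.
have T0 N : 0 <= trunc_root a N by apply: trunc_root_ge0; exact: ltW.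
pose c N := k * trunc_root a N ^+ s.+1.
have gc N : c N <= E (fun x => defect q beta (child_sum (msg beta n) N x)).
  have [mD iD D0] := defect_sum n N hb.
  case: N mD iD D0 => [|N] mD iD D0.
    rewrite /c /trunc_root mul0r min_l ?ler01 // exprS mul0r mulr0.
    exact: Ex_ge0.
  have N0 : 0 < N.+1%:R :> R by rewrite ltr0n.
  pose M := Num.min (N.+1%:R * a / 2) 1.
  have M0 : 0 <= M by rewrite le_min ler01 divr_ge0 // mulr_ge0 ?(ltW c0) // ltW.
  have hM : trunc_root a N.+1 / 2 <= M.
    rewrite /M /trunc_root le_min ler_pM2r ?invr_gt0 // ge_min lexx /=.
    by rewrite ler_pdivrMr // mul1r ge_min ler1n orbT.
  pose J := child_sum I N.+1; have Ji : Itg J := Itg_child_sum QE N.+1 Ii.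
  have EJ : E J = N.+1%:R * E I := Ex_child_sum QE N.+1 Ii.
  pose t x := M / N.+1%:R * J x; have ti : Itg t := ItgZ _ Ji.
  have Et : E t = M * E I.
    by rewrite /t (ExZ _ Ji) EJ mulrA divfK // gt_eqF.
  pose b := M * E I.
  have b0 : 0 <= b by rewrite mulr_ge0 // (le_trans (ltW e0)).
  have J0 x : 0 <= J x by apply: child_sum_ge0 => y; exact: ler0n.
  have t0 x : 0 <= t x by rewrite /t mulr_ge0 // divr_ge0 // ltW.
  have JS x : a / 2 * J x <= child_sum (msg beta n) N.+1 x.
    rewrite /J /child_sum mulr_sumr; apply: ler_sum => i _; rewrite /I -/a.
    by have [h|h] := leP (a / 2); rewrite ?mulr1 // mulr0.
  have JN x : J x <= N.+1%:R.
    apply: (@le_trans _ _ (\sum_(i < N.+1) 1)); last by rewrite sumr_const card_ord.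
    by apply: ler_sum => i _; rewrite /I lern1 leq_b1.
  have tS x : t x <= Num.min (child_sum (msg beta n) N.+1 x) 1.
    rewrite le_min; apply/andP; split.
      apply: le_trans (JS x); rewrite ler_wpM2r // ler_pdivrMr //.
      by rewrite /M ge_min; apply/orP; left; rewrite [leRHS]mulrC mulrA.
    rewrite /t mulrAC ler_pdivrMr // mul1r; apply: le_trans (JN x).
    by rewrite ler_piMl // /M ge_min lexx orbT.
  have pt x : k0 * (s.+1%:R * b ^+ s * t x - s%:R * b ^+ s.+1) <=
      defect q beta (child_sum (msg beta n) N.+1 x).
    apply: le_trans (hk _ _ b1 bm (sum_ge0 _ _ _ hb)); apply: (ler_wpM2l (ltW k00)).
    apply: (@le_trans _ _ (t x ^+ s.+1)); last first.
      by rewrite lerXn2r ?nnegrE // (le_trans (t0 x)).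
    move: (t x) (t0 x) => z z0; rewrite -subr_ge0; case: s12 => ->.
      by rewrite (_ : _ - _ = (z - b) ^+ 2) ?sqr_ge0 //; ring.
    rewrite (_ : _ - _ = (z - b) ^+ 2 * (z + 2 * b)); last by ring.
    by rewrite mulr_ge0 ?sqr_ge0 // addr_ge0 // mulr_ge0.
  have j1 := ItgZ (s.+1%:R * b ^+ s) ti.
  have j2 := ItgB j1 (Itg_cst Q (s%:R * b ^+ s.+1)).
  have := le_Ex (ItgZ k0 j2) iD pt.
  rewrite (ExZ k0 j2) (ExB j1 (Itg_cst Q _)) (ExZ _ ti) Ex_cst Et -/b; apply: le_trans.
  have -> : s.+1%:R * b ^+ s * b - s%:R * b ^+ s.+1 = b ^+ s.+1.
    by rewrite exprS -(natr1 s); ring.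
  rewrite /c /k -mulrA -exprMn; apply: (ler_wpM2l (ltW k00)).
  have et0 : 0 <= e / 2 * trunc_root a N.+1 by rewrite mulr_ge0 // divr_ge0 // ltW.
  suff h : e / 2 * trunc_root a N.+1 <= b by rewrite lerXn2r ?nnegrE.
  have -> : e / 2 * trunc_root a N.+1 = trunc_root a N.+1 / 2 * e by ring.
  by apply: ler_pM => //; [exact: divr_ge0 | exact: ltW].
have [_ le1] := @Ex_root_ge _ _ _ QE
  (fun N x => defect q beta (child_sum (msg beta n) N x)) c
  (fun N => let: And3 h _ _ := defect_sum n N hb in h)
  (fun N x => let: And3 _ _ h := defect_sum n N hb in h x)
  (fun N => let: And3 _ h _ := defect_sum n N hb in h) gc
  (fun N => mulr_ge0 (ltW k_gt0) (exprn_ge0 _ (T0 N)))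
  (Itg_defect H hb n).
by apply: le_trans le1; rewrite /c (ExZ _ (Itg_Phi Q q (ltW c0))); exact: lexx.
Qed.

(** The mean message grows linearly with the distance of the parameter to its
    critical value and is pulled down by the defect; the last bound keeps it
    from jumping over a level. *)
Lemma drift : exists eps0 b1 b2 k K r : R,
  [/\ 0 < eps0 /\ eps0 <= 1, 0 < b1 /\ 0 < b2, 0 < k /\ 0 < K, 0 < r /\ r <= 1 &
  forall (beta : R) n, betac <= beta -> beta <= betac + eps0 ->
  [/\ f beta n.+1 <= f beta n * (1 + b2 * (beta - betac)) - k * Phi (f beta n),
      f beta n * (1 + b1 * (beta - betac)) - K * (f beta n * pull (f beta n)) <= f beta n.+1 &
      r * f beta n <= f beta n.+1]].
Proof.
have [eps0 [K [e0 e1 K0 hK]]] := defect_mean_upper.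
have [k k0 hk] := defect_mean_lower.
have [r [r0 r1 hr]] := transfer_lower (ct_q H) (ct_mean H) (ct_crit H).
have [b1 [b2 [b10 b20 hg]]] := growth_linear (ct_q H) (ct_mean H) (ct_crit H).
exists eps0, b1, b2, k, K, r; split => // beta n h1 h2.
have hb : inrange beta by rewrite h1 (le_trans h2) // lerD2l.
have /andP[_ bm] := hb; have c0 : 0 < f beta n := msg_mean_gt0 H hb n.
have [g1 g2] := hg _ h1 bm.
have D1 := hK _ n h1 h2; have D2 := hk _ n hb.
have hrn := msg_mean_lower H hb (fun x x0 xb => hr beta x h1 bm x0 xb) n.
split; last exact: hrn.
- rewrite (msg_meanS H hb) -/m; apply: lerB => //.
  by rewrite mulrC; apply: (ler_wpM2l (ltW c0)); rewrite -lerBlDl.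
- rewrite (msg_meanS H hb) -/m; apply: lerB => //.
  by rewrite [leRHS]mulrC; apply: (ler_wpM2l (ltW c0)); rewrite -lerBrDl.
Qed.

End Drift.

(** * Limit theorems for expectations *)

Section ExpectationLimits.
Variables (R : realType) (Q : probability (tree_space setT) R).
Notation E := (Ex Q).
Notation Itg := (Itg Q).
Implicit Types F : nat -> (seq nat -> nat) -> R.
Implicit Types G h : (seq nat -> nat) -> R.

Lemma Ex_dominated F G h : (forall n, meas setT (F n)) -> meas setT G ->
  {ae Q, forall x, F n x @[n --> \oo] --> G x} ->
  (forall n x, `|F n x| <= h x) -> Itg h ->
  E (F n) @[n --> \oo] --> E G.
Proof.
move=> mF mG FG Fh hi.
have [||||| Gi _ cv] := @dominated_convergence _ (tree_space setT) R Q setT measurableT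
  (fun n x => (F n x)%:E) (fun x => (G x)%:E) (fun x => (h x)%:E).
- by move=> n; apply/measurable_EFinP; exact: mF.
- by apply/measurable_EFinP; exact: mG.
- by apply: aeS FG => x Fx _; apply: cvg_EFin => //; exact: nearW.
- exact: hi.
- by apply: aeW => x n _; rewrite /= lee_fin.
have Fi n : Itg (F n) by apply: (Itg_le (mF n) (Fh n) hi).
have -> : (fun n => E (F n)) = fine \o (fun n => \int[Q]_x (F n x)%:E)%E by [].
by apply: fine_cvg; rewrite /Ex fineK // integrable_fin_num.
Qed.

Lemma Ex_fatou F G (C : R) : (forall n, Itg (F n)) -> (forall n x, 0 <= F n x) ->
  (forall n, E (F n) <= C) -> meas setT G -> (forall x, 0 <= G x) ->
  {ae Q, forall x, F n x @[n --> \oo] --> G x} ->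
  Itg G /\ E G <= C.
Proof.
move=> Fi F0 FC mG G0 FG.
have mF n : measurable_fun setT (fun x : tree_space setT => (F n x)%:E).
  exact: (measurable_int Q (Fi n)).
have le1 : (\int[Q]_x (G x)%:E <= C%:E)%E.
  apply: (@le_trans _ _ (\int[Q]_x (limn_einf (fun n => (F n x)%:E)))%E).
    apply: ae_ge0_le_integral => //.
    - by move=> x _; rewrite lee_fin.
    - exact/measurable_EFinP.
    - move=> x _; rewrite limn_einf_lim; apply: lime_ge; first exact: is_cvg_einfs.
      by apply: nearW => n; apply: le_ereal_inf_tmp => _ [k _ <-]; rewrite lee_fin.
    - apply: (@measurableT_comp _ _ _ _ _ _ (@oppe R)); first exact: oppe_measurable.
      apply: (@measurable_fun_limn_esup _ (tree_space setT) R setT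
        (fun n (x : tree_space setT) => - (F n x)%:E)%E) => n.
      by apply: (@measurableT_comp _ _ _ _ _ _ (@oppe R)); first exact: oppe_measurable.
    - apply: aeS FG => x Fx _.
      have Fx' : (F n x)%:E @[n --> \oo] --> (G x)%:E by apply: cvg_EFin => //; exact: nearW.
      by have [-> _] := cvg_limn_einf_sup Fx'.
  apply: (le_trans (fatou Q measurableT mF _)); first by move=> n x _; rewrite lee_fin.
  rewrite limn_einf_lim; apply: lime_le; first exact: is_cvg_einfs.
  apply: nearW => n; apply: (@le_trans _ _ (\int[Q]_x (F n x)%:E)%E).
    by apply: ereal_inf_lbound; exists n => /=.
  by rewrite -ExE // lee_fin.
have Gi : Itg G.
  apply: ItgP => //; rewrite (eq_integral (fun x : tree_space setT => (G x)%:E)) ?(le_lt_trans le1) ?ltry //.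
  by move=> x _; rewrite ger0_norm.
by split => //; rewrite -lee_fin ExE.
Qed.

(** A nonnegative series with summable means has a finite integral, hence a
    finite sum almost everywhere. *)
Lemma ae_cvg_series F (C : R) : (forall n, Itg (F n)) -> (forall n x, 0 <= F n x) ->
  (forall n, \sum_(0 <= k < n) E (F k) <= C) ->
  {ae Q, forall x, cvgn (series (F^~ x))}.
Proof.
move=> Fi F0 FC.
have mF n : measurable_fun setT (fun x : tree_space setT => (F n x)%:E).
  exact: (measurable_int Q (Fi n)).
have FE0 n x : setT x -> (0 <= (F n x)%:E)%E by move=> _; rewrite lee_fin.
have S0 x : (0 <= \sum_(n <oo) (F n x)%:E)%E by apply: nneseries_ge0 => n _ _; rewrite lee_fin.
have le1 : (\int[Q]_x (\sum_(n <oo) (F n x)%:E) <= C%:E)%E.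
  rewrite (integral_nneseries Q measurableT mF FE0).
  apply: lime_le; first by apply: is_cvg_nneseries => n _ _; apply: integral_ge0 => x _; rewrite lee_fin.
  apply: nearW => n; rewrite (eq_bigr (fun k => (E (F k))%:E)); last by move=> k _; rewrite ExE.
  by rewrite sumEFin lee_fin.
have Si : Q.-integrable setT (fun x : tree_space setT => \sum_(n <oo) (F n x)%:E)%E.
  apply/integrableP; split; first exact: (@ge0_emeasurable_sum _ (tree_space setT) R setT
    (fun n (x : tree_space setT) => (F n x)%:E) xpredT (fun k x Dx _ => FE0 k x Dx)
    (fun k _ => mF k)).
  rewrite (eq_integral (fun x : tree_space setT => \sum_(n <oo) (F n x)%:E)%E) ?(le_lt_trans le1) ?ltry //.
  by move=> x _; rewrite gee0_abs.
have := integrable_ae measurableT Si; apply: aeS => x /(_ I) Sx.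
apply: nondecreasing_is_cvgn; first by apply: nondecreasing_series => k _ _.
exists (fine (\sum_(n <oo) (F n x)%:E)%E) => _ [n _ <-].
rewrite -lee_fin fineK // /series /= -sumEFin.
by apply: nneseries_lim_ge => k _; rewrite lee_fin.
Qed.

Lemma ae_cvg0 F (C : R) : (forall n, Itg (F n)) -> (forall n x, 0 <= F n x) ->
  (forall n, \sum_(0 <= k < n) E (F k) <= C) ->
  {ae Q, forall x, F n x @[n --> \oo] --> 0}.
Proof.
move=> Fi F0 FC; apply: aeS (ae_cvg_series Fi F0 FC) => x.
exact: cvg_series_cvg_0.
Qed.

End ExpectationLimits.

(** * The order of magnitude of the mean messages *)

(** A sequence that decreases at a rate [Hf] that is itself comparable to a
    power of the sequence satisfies [n * Hf (g n) = O(1)]: along the sequence,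
    [g ^ (- delta)] increases by at least a fixed multiple of [g n ^ (- delta)
    * Hf (g n)] at each step. *)
Lemma decay_bound (R : realType) (g : nat -> R) (Hf : R -> R) (kappa delta C : R) n :
  0 < kappa -> 0 < delta -> 0 < C -> (forall j, 0 < g j) -> (forall j, 0 <= Hf (g j)) ->
  (forall j, (j < n)%N -> g j.+1 <= g j * (1 - kappa * Hf (g j))) ->
  (forall j, (j < n)%N -> Hf (g n) * g j `^ delta <= C * g n `^ delta * Hf (g j)) ->
  n%:R * Hf (g n) <= C / (kappa * delta).
Proof.
move=> k0 d0 C0 g0 H0 hs hH; pose u j := (g j `^ delta)^-1.
have v0 j : 0 < g j `^ delta by exact: powR_gt0.
have u0 j : 0 < u j by rewrite invr_gt0.
have step j : (j < n)%N -> u j * (1 + delta * (kappa * Hf (g j))) <= u j.+1.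
  move=> jn; have := hs j jn; set x := kappa * Hf (g j) => hx.
  have x0 : 0 <= x by rewrite mulr_ge0 // ltW.
  have x1 : 0 < 1 - x by rewrite -(pmulr_rgt0 _ (g0 j)) (lt_le_trans (g0 j.+1)).
  have h1 : g j.+1 `^ delta <= g j `^ delta * (1 - x) `^ delta.
    rewrite -powRM ?(ltW (g0 _)) ?(ltW x1) // ge0_ler_powR ?nnegrE ?(ltW d0) ?(ltW (g0 _)) //.
    by rewrite mulr_ge0 // ltW.
  have h2 : (1 - x) `^ delta <= expR (- (delta * x)).
    have hl : ln (1 - x) <= - x.
      by rewrite -[leRHS]expRK ler_ln ?posrE ?expR_gt0 // expR_ge1Dx.
    have := ler_wpM2l (ltW d0) hl; rewrite mulrN => hl2.
    by rewrite /powR gt_eqF // ler_expR.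
  have h3 : 1 + delta * x <= expR (delta * x) by exact: expR_ge1Dx.
  rewrite /u -[leRHS]mul1r ler_pdivlMr //.
  have -> : (g j `^ delta)^-1 * (1 + delta * x) * g j.+1 `^ delta =
    (1 + delta * x) * g j.+1 `^ delta / g j `^ delta by ring.
  rewrite ler_pdivrMr // mul1r.
  have dx : 0 <= delta * x by rewrite mulr_ge0 // ltW.
  have h4 : g j.+1 `^ delta <= g j `^ delta * expR (- (delta * x)).
    by apply: (le_trans h1); rewrite ler_pM2l.
  have := ler_pM (addr_ge0 ler01 dx) (ltW (v0 j.+1)) h3 h4.
  by rewrite [leRHS]mulrC expRN divfK ?gt_eqF ?expR_gt0.
have low j : (j < n)%N -> u n * Hf (g n) / C <= u j * Hf (g j).
  move=> jn; rewrite ler_pdivrMr // /u mulrC ler_pdivrMr //.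
  have -> : (g j `^ delta)^-1 * Hf (g j) * C * g n `^ delta =
    C * g n `^ delta * Hf (g j) / g j `^ delta by ring.
  by rewrite ler_pdivlMr //; exact: hH.
have sum j : (j <= n)%N -> j%:R * (delta * kappa * (u n * Hf (g n) / C)) <= u j.
  elim: j => [|j IHj] jn; first by rewrite mul0r ltW.
  apply: le_trans (step j jn); rewrite -(natr1 j) mulrDl mul1r mulrDr mulr1.
  apply: lerD; first exact: IHj (ltnW jn).
  have -> : u j * (delta * (kappa * Hf (g j))) = delta * kappa * (u j * Hf (g j)) by ring.
  by apply: ler_wpM2l (low j jn); rewrite mulr_ge0 // ltW.
have := sum n (leqnn n).
have -> : n%:R * (delta * kappa * (u n * Hf (g n) / C)) =
  u n * (n%:R * Hf (g n) / (C / (kappa * delta))) by field; rewrite !gt_eqF.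
rewrite -[leRHS]mulr1 ler_pM2l // ler_pdivrMr ?mul1r //.
by rewrite divr_gt0 // mulr_gt0.
Qed.

Lemma pow_half_small (R : realType) (x : R) : 0 < x -> exists i, 2^-1 ^+ i <= x.
Proof.
move=> x0; exists (Num.bound x^-1).
have h : x^-1 < (Num.bound x^-1)%:R by apply: archi_boundP; rewrite invr_ge0 ltW.
rewrite exprVn -[leRHS]invrK lef_pV2 ?posrE ?invr_gt0 ?exprn_gt0 //.
apply: (le_trans (ltW h)); rewrite -natrX ler_nat; exact: ltnW (ltn_expl _ _).
Qed.

Section Scale.
Variables (R : realType) (mu : probability nat R).
Variable Q : probability (tree_space setT) R.
Variables (q betac : R).
Hypothesis H : critical_tree mu Q q betac.
Let m := mean_children Q.
Let Zi := ct_Itg H.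
Let m_gt1 : 1 < m := ct_mean H.
Let s := crit_exp q.
Let bmax := betac + 1.
Let bc0 : 0 < betac. Proof. exact: (betac_gt0 (ct_q H) (ct_mean H) (ct_crit H)). Qed.
Let bmax0 : 0 < bmax. Proof. by rewrite /bmax addr_gt0. Qed.

Notation E := (Ex Q).
Notation Itg := (Itg Q).
Notation f := (msg_mean Q q).
Notation Phi := (Phi Q q).
Notation pull := (pull Q q).
Notation trunc_root := (@trunc_root R).
Notation "'E_Z' c" := (E (fun x => c (x [::]))) (at level 10).

(** The truncated moments of the offspring law decay faster than linearly
    along dyadic scales: the order of magnitude of the mean messages depends
    on the regularity of the tails through this property alone. *)
Definition regular_tail : Prop := exists A rho c0 : R,
  [/\ 0 < A, 0 < rho /\ rho < 2^-1, 0 < c0 & forall (c : R) j, 0 < c -> c <= c0 ->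
      Phi (2^-1 ^+ j * c) <= A * rho ^+ j * Phi c].

Hypothesis reg : regular_tail.

Let half_pow j : 0 < 2^-1 ^+ j :> R. Proof. by rewrite exprn_gt0 // invr_gt0. Qed.
Let half_pow1 j : 2^-1 ^+ j <= 1 :> R.
Proof. by rewrite exprn_ile1 ?invr_ge0 // invf_le1 // ler1n. Qed.

Lemma regular_up_to (M : R) : 0 < M -> exists A rho : R,
  [/\ 0 < A, 0 < rho, rho < 2^-1 & forall (c : R) j, 0 < c -> c <= M ->
      Phi (2^-1 ^+ j * c) <= A * rho ^+ j * Phi c].
Proof.
move=> M0; have [A [rho [c0 [A0 [r0 r1] c00 hA]]]] := reg.
have [i hi] := pow_half_small (divr_gt0 c00 M0).
have ri0 : 0 < rho ^+ i by exact: exprn_gt0.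
exists ((A + 1) / rho ^+ i), rho; split => //; first by rewrite divr_gt0 // addr_gt0.
move=> c j cc cM; have P0 : 0 < Phi c := Phi_gt0 H cc.
have [ij|ji] := leqP i j.
  have ci : 2^-1 ^+ i * c <= c0.
    by apply: le_trans (ler_pM (ltW (half_pow i)) (ltW cc) hi cM) _; rewrite divfK ?gt_eqF.
  rewrite -{1}(subnK ij) exprD -mulrA.
  have ci0 : 0 < 2^-1 ^+ i * c by exact: mulr_gt0.
  apply: (le_trans (hA _ (j - i)%N ci0 ci)).
  have hP : Phi (2^-1 ^+ i * c) <= Phi c.
    by apply: Phi_mono => //; [exact: ltW | rewrite ler_piMl // ltW].
  apply: (@le_trans _ _ (A * rho ^+ (j - i) * Phi c)).
    by apply: ler_wpM2l hP; rewrite mulr_ge0 ?exprn_ge0 // ltW.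
  apply: ler_wpM2r; first exact: ltW.
  have -> : (A + 1) / rho ^+ i * rho ^+ j = (A + 1) * rho ^+ (j - i).
    by rewrite -{1}(subnK ij) exprD mulrA mulrAC divfK ?gt_eqF.
  by rewrite ler_wpM2r ?exprn_ge0 ?(ltW r0) // lerDl.
apply: (@le_trans _ _ (Phi c)).
  apply: Phi_mono; first by rewrite mulr_ge0 // ltW.
  by rewrite ler_piMl // ltW.
rewrite ler_peMl ?(ltW P0) // mulrAC ler_pdivlMr // mul1r.
have h : rho ^+ i <= rho ^+ j.
  by rewrite ler_wiXn2l ?(ltW r0) ?(ltnW ji) // (le_trans (ltW r1) (half_pow1 1)).
by apply: (le_trans h); rewrite ler_peMl ?exprn_ge0 ?(ltW r0) // lerDr ltW.
Qed.

Let excess (c d : R) : R := E_Z (fun N => Num.max (N%:R * c - d) 0).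

Let excess_pt (N : nat) (c d : R) : 0 <= c -> 0 <= d ->
  0 <= Num.max (N%:R * c - d) 0 <= N%:R * c.
Proof.
move=> c0 d0; rewrite le_max lexx orbT ge_max mulr_ge0 // andbT.
by rewrite lerBlDr lerDl.
Qed.

Let Itg_excess (c d : R) : 0 <= c -> 0 <= d -> Itg (fun x => Num.max ((x [::])%:R * c - d) 0).
Proof.
move=> c0 d0; apply: (Itg_le (meas_root (fun N => Num.max (N%:R * c - d) 0)) _ (ItgZ c Zi)).
by move=> x; have /andP[h0 h1] := excess_pt (x [::]) c0 d0; rewrite ger0_norm // (mulrC c).
Qed.

Let excess_halve (c : R) : 0 <= c -> excess c 1 <= 2 * excess (2^-1 * c) 1 + Phi c.
Proof.
move=> c0; have h0 : 0 <= 2^-1 * c by rewrite mulr_ge0 ?invr_ge0.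
have i0 := Itg_excess h0 ler01; have i1 := ItgZ 2 i0; have i2 := Itg_Phi Q q c0.
rewrite /excess -(ExZ _ i0) -(ExD i1 i2).
apply: le_Ex; [exact: (Itg_excess c0 ler01) | exact: ItgD |] => x.
rewrite mulrCA; have : 0 <= (x [::])%:R * c by rewrite mulr_ge0.
rewrite /trunc_root; move: ((x [::])%:R * c) => z z0.
have [h1|h1] := leP z 1.
  rewrite max_r ?subr_le0 // addr_ge0 ?exprn_ge0 // mulr_ge0 // le_max lexx orbT //.
rewrite expr1n max_l ?subr_ge0 ?(ltW h1) // -lerBlDr.
apply: (@le_trans _ _ (2 * (2^-1 * z - 1))); first by rewrite mulrBr mulVKf //; lra.
by rewrite ler_wpM2l // le_max lexx.
Qed.

Let excess_cvg (c : R) : 0 <= c -> 2 ^+ J * excess (2^-1 ^+ J * c) 1 @[J --> \oo] --> (0 : R).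
Proof.
move=> c0.
have e J : 2 ^+ J * excess (2^-1 ^+ J * c) 1 =
    E (fun x => Num.max ((x [::])%:R * c - 2 ^+ J) 0).
  have h0 : 0 <= 2^-1 ^+ J * c by rewrite mulr_ge0 // ltW.
  rewrite -(ExZ _ (Itg_excess h0 ler01)); apply: eq_Ex => x.
  have p0 : 0 < 2 ^+ J :> R by rewrite exprn_gt0.
  rewrite maxr_pMr ?(ltW p0) // mulr0 mulrBr mulr1; congr (Num.max (_ - _) _).
  by rewrite exprVn mulrCA mulVKf ?gt_eqF // mulrC.
rewrite (eq_cvg _ _ e); suff : E (fun x => Num.max ((x [::])%:R * c - 2 ^+ J) 0)
    @[J --> \oo] --> E (fun=> (0 : R)) by rewrite Ex_cst.
apply: (Ex_dominated (h := fun x => c * (x [::])%:R)).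
- by move=> n; exact: (meas_root (fun N => Num.max (N%:R * c - 2 ^+ n) 0)).
- exact: meas_cst.
- apply: aeW => x; apply: cvg_near_cst.
  have h0 : 0 < ((x [::])%:R * c + 1)^-1 by rewrite invr_gt0 ltr_wpDl // mulr_ge0.
  have [i hi] := pow_half_small h0.
  exists i => // n /= ni; apply/max_idPr; rewrite subr_le0.
  have z0 : 0 <= (x [::])%:R * c by rewrite mulr_ge0.
  move: hi; rewrite exprVn lef_pV2 ?posrE ?exprn_gt0 ?ltr_wpDl // => hi.
  apply: (@le_trans _ _ (2 ^+ i)); first by apply: le_trans hi; rewrite lerDl.
  by rewrite ler_weXn2l // ler1n.
- move=> n x; have p0 : 0 <= 2 ^+ n :> R by rewrite exprn_ge0.
  by have /andP[h0 h1] := excess_pt (x [::]) c0 p0; rewrite ger0_norm // (mulrC c).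
- exact: ItgZ.
Qed.

(** Beyond the truncation level, the mean is a sum of truncated moments over
    dyadic scales, which is dominated by its first term. *)
Lemma pull_le_Phi (M : R) : 0 < M -> exists2 B : R, 0 < B &
  forall c : R, 0 < c -> c <= M -> c * pull c <= B * Phi c.
Proof.
move=> M0; have [A [rho [A0 r0 r1 hA]]] := regular_up_to M0.
have d0 : 0 < 1 - 2 * rho by lra.
exists (1 + A / (1 - 2 * rho)); first by rewrite addr_gt0 // divr_gt0.
move=> c c0 cM; have P0 : 0 < Phi c := Phi_gt0 H c0.
have e : c * pull c = Phi c + excess c 1.
  rewrite -(ExZ _ (Itg_pull H (ltW c0))) -(ExD (Itg_Phi Q q (ltW c0)) (Itg_excess (ltW c0) ler01)).
  apply: eq_Ex => x; rewrite mulrA (mulrC c);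
  rewrite /trunc_root; move: ((x [::])%:R * c) => z; have [h1|h1] := leP z 1.
    by rewrite max_r ?subr_le0 // addr0 exprS.
  by rewrite !expr1n max_l ?subr_ge0 ?(ltW h1) // mulr1 addrC subrK.
rewrite e mulrDl mul1r lerD2l.
have it J : excess c 1 <= 2 ^+ J * excess (2^-1 ^+ J * c) 1 +
    A * Phi c * \sum_(j < J) (2 * rho) ^+ j.
  elim: J => [|J IHJ]; first by rewrite big_ord0 mulr0 addr0 !expr0 !mul1r.
  have h0 : 0 <= 2^-1 ^+ J * c by rewrite mulr_ge0 // ltW.
  have := excess_halve h0; rewrite mulrA -exprS => hJ.
  have p0 : 0 < 2 ^+ J :> R by rewrite exprn_gt0.
  have := ler_wpM2l (ltW p0) hJ; have := ler_wpM2l (ltW p0) (hA c J c0 cM).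
  rewrite big_ord_recr /= mulrDr => h1 h2; apply: (le_trans IHJ).
  apply: (le_trans (lerD h2 (lexx _))).
  apply: (le_trans (lerD (lerD (lexx _) h1) (lexx _))).
  by rewrite exprMn (exprS (2 : R) J) le_eqVlt; apply/orP; left; apply/eqP; ring.
have geo J : \sum_(j < J) (2 * rho) ^+ j <= (1 - 2 * rho)^-1.
  have g0 : 0 <= (2 * rho) ^+ J by rewrite exprn_ge0 // mulr_ge0 // ltW.
  have := subrX1 (2 * rho) J; move: (\sum_(j < J) _) => S hS.
  rewrite -[leRHS]mul1r ler_pdivlMr //.
  have -> : S * (1 - 2 * rho) = 1 - (2 * rho) ^+ J by rewrite -[RHS]opprB hS; ring.
  by rewrite gerBl.
have it2 J : excess c 1 - A / (1 - 2 * rho) * Phi c <= 2 ^+ J * excess (2^-1 ^+ J * c) 1.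
  rewrite lerBlDr; apply: (le_trans (it J)); rewrite lerD2l.
  by rewrite [leRHS]mulrAC; apply: ler_wpM2l (geo J); rewrite mulr_ge0 // ltW.
rewrite -subr_le0.
have cv := excess_cvg (ltW c0); rewrite -(cvg_lim _ cv) //; apply: limr_ge.
  exact: cvgP cv.
exact: nearW.
Qed.

(** The decay along dyadic scales bounds the tail by a power of exponent
    larger than one. *)
Lemma regular_moment : exists p : R, 1 < p < 2 /\ Itg (fun x => (x [::])%:R `^ p).
Proof.
have [A [rho [A0 r0 r1 hA]]] := regular_up_to ltr01.
have l2 : 0 < ln (2 : R) by rewrite ln_gt0 // ltr1n.
have th0 : 0 < 2 * rho by rewrite mulr_gt0.
have th1 : 2 * rho < 1 by lra.
have lth : ln (2 * rho) < 0 by rewrite ln_lt0 // th0.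
pose dl := Num.min 2^-1 (- ln (2 * rho) / (2 * ln 2)).
have dl0 : 0 < dl by rewrite lt_min invr_gt0 ltr0n /= divr_gt0 ?oppr_gt0 ?mulr_gt0.
have dl1 : dl <= 2^-1 by rewrite ge_min lexx.
have dl2 : dl <= - ln (2 * rho) / (2 * ln 2) by rewrite ge_min lexx orbT.
pose p := 1 + dl; have p1 : 1 < p by rewrite ltrDl.
have p2 : p < 2 by rewrite /p; lra.
have p0 : 0 < p by rewrite (lt_trans ltr01).
exists p; split; first by rewrite p1 p2.
pose w : R := 2 `^ p; have w0 : 0 < w by exact: powR_gt0.
have wr : w * rho < 1.
  have -> : w * rho = expR (dl * ln 2 + ln (2 * rho)).
    rewrite expRD lnK ?posrE // /w /powR pnatr_eq0 /= /p mulrDl mul1r expRD lnK ?posrE //.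
    by ring.
  rewrite -[X in _ < X]expR0 ltr_expR; move: dl2; rewrite ler_pdivlMr ?mulr_gt0 //.
  have arith (y l z : R) : 0 < z -> 0 < l -> y < 0 -> z * (2 * l) <= - y -> z * l + y < 0.
    by move=> z0 l0 y0 h; have := mulr_gt0 z0 l0; lra.
  exact: arith.
have wr0 : 0 < w * rho by exact: mulr_gt0.
pose G J (x : seq nat -> nat) : R := Num.min ((x [::])%:R) (2 ^+ J) `^ p.
have pw J : (2 ^+ J) `^ p = w ^+ J :> R.
  elim: J => [|J IHJ]; first by rewrite !expr0 powR1.
  by rewrite !exprS powRM ?exprn_ge0 // IHJ.
have mn0 J (x : seq nat -> nat) : 0 <= Num.min ((x [::])%:R) (2 ^+ J) :> R.
  by rewrite le_min ler0n exprn_ge0.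
have Gi J : Itg (G J).
  apply: (@Itg_bounded _ Q _ (w ^+ J)).
    exact: (meas_root (fun N => Num.min N%:R (2 ^+ J) `^ p)).
  move=> x; rewrite ger0_norm ?powR_ge0 // -pw ge0_ler_powR ?nnegrE ?(ltW p0) ?exprn_ge0 //.
  by rewrite ge_min lexx orbT.
have GS J : E (G J.+1) <= E (G J) + w * A * Phi 1 * (w * rho) ^+ J.
  have h0 : 0 <= 2^-1 ^+ J * 1 :> R by rewrite mulr1 ltW.
  have iP := Itg_Phi Q q h0; have i1 := ItgZ (w ^+ J.+1) iP.
  apply: (@le_trans _ _ (E (G J) + w ^+ J.+1 * Phi (2^-1 ^+ J * 1))).
    rewrite -(ExZ _ iP) -(ExD (Gi J) i1); apply: le_Ex => //; first exact: ItgD.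
    move=> x; rewrite /G /trunc_root mulr1; move: ((x [::])%:R) (ler0n R (x [::])) => z z0.
    have J0 : 0 < 2 ^+ J :> R by rewrite exprn_gt0.
    have [h|h] := leP z (2 ^+ J).
      rewrite (min_idPl _) ?lerDl; last by rewrite (le_trans h) // ler_weXn2l // ler1n.
      by rewrite mulr_ge0 ?exprn_ge0 ?(ltW w0) // le_min ler01 mulr_ge0 // ltW.
    have -> : Num.min (z * 2^-1 ^+ J) 1 = 1.
      by apply/min_idPr; rewrite exprVn ler_pdivlMr // mul1r ltW.
    rewrite expr1n mulr1 -pw; apply: (@le_trans _ _ ((2 ^+ J.+1) `^ p)).
      rewrite ge0_ler_powR ?nnegrE ?(ltW p0) ?exprn_ge0 ?le_min ?z0 ?exprn_ge0 //.
      by rewrite ge_min lexx orbT.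
    by rewrite lerDr powR_ge0.
  rewrite lerD2l; have := ler_wpM2l (exprn_ge0 J.+1 (ltW w0)) (hA 1 J ltr01 (lexx 1)).
  move=> h; apply: (le_trans h); rewrite exprMn exprS le_eqVlt; apply/orP; left.
  by apply/eqP; ring.
have d0 : 0 < 1 - w * rho by rewrite subr_gt0.
pose K := w * A * Phi 1 / (1 - w * rho).
have P10 : 0 < Phi 1 := Phi_gt0 H ltr01.
have GB J : E (G J) <= 1 + K * (1 - (w * rho) ^+ J).
  elim: J => [|J IHJ].
    rewrite expr0 subrr mulr0 addr0 -[leRHS](Ex_cst Q).
    apply: le_Ex => //; first exact: Itg_cst.
    move=> x; have e1 : 1 `^ p = 1 :> R by rewrite powR1.
    have h0 : 0 <= Num.min ((x [::])%:R) 1 :> R by rewrite le_min ler0n ler01.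
    have h1 : Num.min ((x [::])%:R) 1 <= 1 :> R by rewrite ge_min lexx orbT.
    by rewrite /G expr0 -[X in _ <= X]e1 ge0_ler_powR ?nnegrE ?(ltW p0).
  apply: (le_trans (GS J)); apply: (le_trans (lerD IHJ (lexx _))).
  rewrite exprS /K le_eqVlt; apply/orP; left; apply/eqP; field.
  by rewrite gt_eqF.
have [] := @Ex_fatou R Q G (fun x => (x [::])%:R `^ p) (1 + K).
- exact: Gi.
- by move=> n x; exact: powR_ge0.
- move=> n; apply: (le_trans (GB n)); rewrite lerD2l ler_piMr //.
    by rewrite divr_ge0 ?mulr_ge0 // ltW.
  by rewrite gerBl exprn_ge0 // ltW.
- exact: (meas_root (fun N => N%:R `^ p)).
- by move=> x; exact: powR_ge0.
- apply: aeW => x; apply: cvg_near_cst; exists (x [::]) => // n /= xn.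
  rewrite /G (min_idPl _) // -natrX ler_nat (leq_trans xn) // ltnW // ltn_expl //.
- by [].
Qed.

(** The exponent [delta] comes from the strict inequality on the rate of
    decay, and is what allows the telescoping argument to sum over the
    heights. *)
Lemma pull_power (M : R) : 0 < M -> exists delta C : R, [/\ 0 < delta, 0 < C &
  forall c d : R, 0 < d -> d <= c -> c <= M ->
    pull d * c `^ delta <= C * d `^ delta * pull c].
Proof.
move=> M0; have [A [rho [A0 r0 r1 hA]]] := regular_up_to M0.
have [B B0 hB] := pull_le_Phi M0.
pose th := 2 * rho; have th0 : 0 < th by rewrite mulr_gt0.
have th1 : th < 1 by rewrite /th; lra.
have l2 : 0 < ln (2 : R) by rewrite ln_gt0 // ltr1n.
pose delta := - ln th / ln 2.
have lth : ln th < 0 by rewrite ln_lt0 // th0.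
have de0 : 0 < delta by rewrite divr_gt0 // oppr_gt0.
have hd : (2^-1 : R) `^ delta = th.
  rewrite /powR gt_eqF ?invr_gt0 // lnV ?posrE // /delta.
  by rewrite mulrN divfK ?gt_eqF // opprK lnK.
have hdk k : (2^-1 ^+ k : R) `^ delta = th ^+ k.
  elim: k => [|k IHk]; first by rewrite !expr0 powR1.
  by rewrite !exprS powRM ?invr_ge0 ?(ltW (half_pow k)) // hd IHk.
exists delta, (B * A / th); split => //; first by rewrite divr_gt0 // mulr_gt0.
move=> c d d0 dc cM; have c0 : 0 < c := lt_le_trans d0 dc.
have ex : exists i, 2^-1 ^+ i.+1 * c < d.
  have [i hi] := pow_half_small (divr_gt0 d0 c0); exists i.
  move: hi; rewrite ler_pdivlMr // => hi; apply: lt_le_trans hi.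
  by rewrite exprS -mulrA gtr_pMl ?mulr_gt0 // invf_lt1 // ltr1n.
case: (ex_minnP ex) => i hi mini.
have di : d <= 2^-1 ^+ i * c.
  case: i hi mini => [|i] hi mini; first by rewrite expr0 mul1r.
  by rewrite leNgt; apply/negP => /mini; rewrite ltnn.
have p0 := half_pow i.
have ic0 : 0 < 2^-1 ^+ i * c by exact: mulr_gt0.
have icM : 2^-1 ^+ i * c <= M by apply: le_trans cM; rewrite ler_piMl // ltW.
have h1 : pull d <= pull (2^-1 ^+ i * c) by apply: (pull_mono H) => //; exact: ltW.
have h2 := hB _ ic0 icM; have h3 := hA c i c0 cM.
have h4 : Phi c <= c * pull c := Phi_le_pull H (ltW c0).
have h5 : pull (2^-1 ^+ i * c) <= B * A * th ^+ i * pull c.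
  rewrite -(ler_pM2l ic0); apply: (le_trans h2).
  apply: (le_trans (ler_wpM2l (ltW B0) h3)).
  have w : 0 <= B * (A * rho ^+ i) by rewrite !mulr_ge0 ?exprn_ge0 // ltW.
  rewrite mulrA; apply: (le_trans (ler_wpM2l w h4)).
  rewrite /th exprMn le_eqVlt; apply/orP; left; apply/eqP.
  have -> : 2^-1 ^+ i * c * (B * A * (2 ^+ i * rho ^+ i) * pull c) =
    (2^-1 ^+ i * 2 ^+ i) * (B * (A * rho ^+ i) * (c * pull c)) by ring.
  by rewrite -exprMn mulVf ?pnatr_eq0 // expr1n mul1r.
have h6 : th ^+ i.+1 * c `^ delta <= d `^ delta.
  rewrite -hdk -powRM ?(ltW (half_pow _)) ?(ltW c0) //.
  by rewrite ge0_ler_powR ?nnegrE ?(ltW de0) ?mulr_ge0 ?(ltW (half_pow _)) ?(ltW c0) ?(ltW d0) ?(ltW hi).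
have pl0 : 0 <= pull c.
  by apply: Ex_ge0 => x; rewrite mulr_ge0 // exprn_ge0 // trunc_root_ge0 // ltW.
apply: (le_trans (ler_wpM2r (powR_ge0 _ _) (le_trans h1 h5))).
have w : 0 <= B * A / th * pull c by rewrite !mulr_ge0 ?invr_ge0 // ltW.
have := ler_wpM2l w h6; rewrite exprS => h7.
have -> : B * A * th ^+ i * pull c * c `^ delta =
    B * A / th * pull c * (th * th ^+ i * c `^ delta) by field; rewrite gt_eqF.
by apply: (le_trans h7); rewrite le_eqVlt; apply/orP; left; apply/eqP; ring.
Qed.

Lemma msg_mean_le (beta : R) i j : betac <= beta <= bmax -> (i <= j)%N -> f beta j <= f beta i.
Proof.
move=> hb; elim: j => [|j IHj]; first by rewrite leqn0 => /eqP ->.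
rewrite leq_eqVlt => /predU1P[-> //|]; rewrite ltnS => /IHj.
by apply: le_trans; exact: (msg_mean_anti H hb).
Qed.

(** The mean message is of the order of the solution [y] of [pull y = beta - betac]:
    below this level it would grow, above it decreases, and a time of order
    [1 / (beta - betac)] suffices to come down from any level. *)
Lemma msg_mean_scale : exists eps0 k1 k2 r C : R,
  [/\ 0 < eps0 /\ eps0 <= 1, 0 < k1 /\ 0 < k2, 0 < r /\ r <= 1, 0 < C &
  forall (beta : R) n, betac < beta -> beta <= betac + eps0 ->
  (forall y, 0 < y -> y <= betac -> pull y <= k1 * (beta - betac) -> r * y <= f beta n) /\
  (forall y, 0 < y -> k2 * (beta - betac) <= pull y ->
     f beta n <= y \/ n%:R * (beta - betac) <= C)].
Proof.
have [p [p_range Zp]] := regular_moment.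
have [eps0 [b1 [b2 [k [K [r [[e0 e1] [b10 b20] [k0 K0] [r0 r1] hd]]]]]]] := drift H p_range Zp.
have [B B0 hB] := pull_le_Phi bmax0.
have [delta [C [de0 C0 hC]]] := pull_power bmax0.
pose kappa := k / (2 * B); have ka0 : 0 < kappa by rewrite divr_gt0 // mulr_gt0.
pose k2 := b2 / kappa; have k20 : 0 < k2 by rewrite divr_gt0.
exists eps0, (b1 / K), k2, r, (C / (kappa * delta) / k2); split => //.
- by split => //; rewrite divr_gt0.
- by rewrite !divr_gt0 // mulr_gt0.
move=> beta n h1 h2.
have hb : betac <= beta <= betac + 1 by rewrite (ltW h1) (le_trans h2) // lerD2l.
have /andP[_ bm] := hb.
have f0 j : 0 < f beta j := msg_mean_gt0 H hb j.
have ep0 : 0 < beta - betac by rewrite subr_gt0.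
have fM j : f beta j <= bmax.
  apply: le_trans (msg_mean_le hb (leq0n j)) _; rewrite /msg_mean /= Ex_cst //.
split.
  move=> y y0 yc hy; elim: n => [|n IHn].
    rewrite [leRHS](_ : _ = beta); last by rewrite /msg_mean /= Ex_cst.
    by apply: le_trans (ltW h1); apply: le_trans yc; rewrite ler_piMl // ltW.
  have [_ lo rr] := hd _ n (ltW h1) h2.
  have [fy|fy] := leP (f beta n) y; last first.
    by apply: le_trans rr; rewrite ler_pM2l // ltW.
  apply: (le_trans IHn); apply: le_trans lo.
  rewrite mulrDr mulr1 -addrA lerDl subr_ge0 mulrCA ler_wpM2l ?(ltW (f0 n)) //.
  rewrite -ler_pdivlMl // mulrA (mulrC K^-1).
  by apply: le_trans hy; apply: (pull_mono H) => //; exact: ltW.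
move=> y y0 hy; have [fy|fy] := leP (f beta n) y; [by left | right].
have big j : (j <= n)%N -> k2 * (beta - betac) <= pull (f beta j).
  move=> jn; apply: (le_trans hy); apply: (pull_mono H); first exact: ltW.
  by apply: (le_trans (ltW fy)); exact: msg_mean_le.
have dec : n%:R * pull (f beta n) <= C / (kappa * delta).
  apply: (decay_bound (g := f beta) ka0 de0 C0 f0).
  - move=> j; apply: Ex_ge0 => x; rewrite mulr_ge0 // exprn_ge0 // trunc_root_ge0 // ltW //.
  - move=> j jn; have [up _ _] := hd _ j (ltW h1) h2; apply: (le_trans up).
    have hBj := hB _ (f0 j) (fM j); have bj := big j (ltnW jn).
    have bj' : b2 * (beta - betac) <= kappa * pull (f beta j).
      by rewrite -ler_pdivrMl // mulrA (mulrC kappa^-1).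
    have kB : k / B * (f beta j * pull (f beta j)) <= k * Phi (f beta j).
      rewrite -mulrA; apply: (ler_wpM2l (ltW k0)); rewrite mulrC ler_pdivrMr // mulrC.
      by rewrite mulrC [leRHS]mulrC; exact: hBj.
    have := ler_wpM2l (ltW (f0 j)) bj'.
    have kk : k / B = 2 * kappa by rewrite /kappa; field; rewrite gt_eqF.
    have arith (z1 z2 z3 ee : R) : 2 * kappa * (z1 * z2) <= k * z3 ->
        z1 * (b2 * ee) <= z1 * (kappa * z2) ->
        z1 * (1 + b2 * ee) - k * z3 <= z1 * (1 - kappa * z2).
      by move=> ? ?; lra.
    by rewrite kk in kB; exact: arith.
  - by move=> j jn; exact: (hC _ _ (f0 n) (msg_mean_le hb (ltnW jn)) (fM j)).
rewrite ler_pdivlMr //; apply: le_trans dec; rewrite -mulrA ler_wpM2l //.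
by rewrite mulrC; exact: big.
Qed.

End Scale.

(** * Tightness of the log odds at the root *)

Lemma message_mono_beta (R : realType) (q beta beta' : R) n x :
  0 < q <= 2 -> 0 < beta -> beta <= beta' ->
  0 <= message q beta n x <= message q beta' n x.
Proof.
move=> q1 b0 bb; have b0' : 0 < beta' := lt_le_trans b0 bb.
elim: n x => [|n IHn] x; first by rewrite /= bb ltW.
have S0 : 0 <= tot (message q beta n) x.
  by apply: sumr_ge0 => i _; have /andP[] := IHn (shift i x).
apply/andP; split; first exact: transfer_ge0.
apply: (@le_trans _ _ (transfer q beta' (tot (message q beta n) x))).
  exact: transfer_mono_beta.
apply: transfer_mono => //; apply: ler_sum => i _.
by have /andP[] := IHn (shift i x).
Qed.

Section Tightness.
Variables (R : realType) (mu : probability nat R).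
Variable Q : probability (tree_space setT) R.
Variables (q betac : R).
Hypothesis H : critical_tree mu Q q betac.
Let m := mean_children Q.
Let QE : tree_law mu Q := ct_law H.
Let m_gt0 : 0 < m. Proof. exact: lt_trans ltr01 (ct_mean H). Qed.
Let bmax := betac + 1.
Let bc0 : 0 < betac. Proof. exact: (betac_gt0 (ct_q H) (ct_mean H) (ct_crit H)). Qed.
Let q_gt0 : 0 < q. Proof. by have /andP[] := ct_q H. Qed.

Notation E := (Ex Q).
Notation Itg := (Itg Q).
Notation msg := (message q).
Notation f := (msg_mean Q q).
Notation inrange beta := (betac <= beta <= betac + 1).
Notation "'E_Z' c" := (E (fun x => c (x [::]))) (at level 10).

(** Every vertex has a child, so the messages along one line of descent bound
    the log odds from below. *)
Lemma log_odds_pos_ae (beta : R) n : betac <= beta ->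
  exists2 c : R, 0 < c & {ae Q, forall x, c <= tot (msg beta n) x}.
Proof.
move=> hb; have q1 := ct_q H.
have [r [r0 r1 hr]] := transfer_lower (ct_q H) (ct_mean H) (ct_crit H).
have hc : inrange betac by rewrite lexx lerDl ler01.
suff [c c0 hcx] : exists2 c : R, 0 < c & {ae Q, forall x, c <= tot (msg betac n) x}.
  exists c => //; apply: aeS hcx => x h; apply: (le_trans h).
  by apply: ler_sum => i _; have /andP[] := message_mono_beta n (shift i x) q1 bc0 hb.
have toY : forall c : R, {ae Q, forall x, c <= msg betac n x} ->
    {ae Q, forall x, c <= tot (msg betac n) x}.
  move=> c hx; apply: aeS (aeI (ct_pos H) (ae_shift H 0 hx)) => x [x0 h].
  apply: (le_trans h); rewrite /tot /child_sum; case: (x [::]) x0 => // N _.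
  by rewrite big_ord_recl lerDl; apply: sumr_ge0 => i _; exact: (message_ge0 H hc).
suff [c c0 hx] : exists2 c : R, 0 < c & {ae Q, forall x, c <= msg betac n x}.
  by exists c => //; exact: toY.
elim: n {toY} => [|n [c c0 IHn]]; first by exists betac => //; exact: aeW.
pose d := Num.min c bmax; have d0 : 0 < d by rewrite lt_min c0 addr_gt0.
have db : d <= bmax by rewrite ge_min lexx orbT.
exists (r * d); first exact: mulr_gt0.
apply: aeS (aeI (message_child H hc) (ae_shift H 0 IHn)) => x [/(_ n) h1 h2].
apply: le_trans h1; apply: (@le_trans _ _ (transfer q betac d)).
  by apply: hr => //; [rewrite lerDl ler01 | exact: ltW].
by apply: transfer_mono => //; [exact: ltW | rewrite /d ge_min h2].
Qed.

Hypothesis single_child : E_Z (fun N => (N == 1%N)%:R) < 1.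
Let u1 := E_Z (fun N => (N == 1%N)%:R : R).
Let u1_ge0 : 0 <= u1. Proof. exact: Ex_ge0. Qed.

Variable p : R.
Hypothesis p_range : 1 < p < 2.
Hypothesis Zp : Itg (fun x => (x [::])%:R `^ p).

Let small (beta : R) n (z : R) (x : seq nat -> nat) : R :=
  1 - (z <= tot (msg beta n) x)%R%:R.

Let small01 beta n z x : 0 <= small beta n z x <= 1.
Proof. by rewrite /small; case: (z <= _); rewrite ?subrr ?subr0 ?lexx ?ler01. Qed.

Let meas_small beta n z : inrange beta -> meas setT (small beta n z).
Proof.
move=> hb; apply: measurable_funB; first exact: meas_cst.
apply: (@meas_mono _ setT (fun y => (z <= y)%R%:R)).
- move=> x y _ xy; rewrite ler_nat; case: (leP z x) => // h.
  by rewrite (le_trans h xy).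
- exact: (tot_ge0 H hb).
- by apply: meas_tot; exact: (meas_message H hb).
Qed.

Let Itg_small beta n z : inrange beta -> Itg (small beta n z).
Proof.
move=> hb; apply: (Itg_bounded Q (meas_small n z hb) (c := 1)) => x.
by have /andP[h0 h1] := small01 beta n z x; rewrite ger0_norm.
Qed.

(** The log odds are small at the root only if they are small at all its
    children, and with positive probability there are two of them. *)
Let small_step (r : R) : 0 < r ->
  (forall beta x, betac <= beta -> beta <= bmax -> 0 <= x -> x <= bmax ->
    r * x <= transfer q beta x) ->
  forall beta n z, inrange beta -> 0 < z -> z <= bmax ->
  E (small beta n.+1 (r * z)) <=
    E (small beta n z) * (u1 + (1 - u1) * E (small beta n z)).
Proof.
move=> r0 hr beta n z hb z0 zb; have /andP[b1 b2] := hb.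
have b0 : 0 < beta := lt_le_trans bc0 b1.
have Ii := Itg_small n z hb; have mI := meas_small n z hb.
pose J i (x : seq nat -> nat) := small beta n z (shift i x).
have J01 i x : 0 <= J i x <= 1 by exact: small01.
pose g N (x : seq nat -> nat) : R := if N is 0 then 0 else
  if N is 1 then J 0 x else J 0 x * J 1 x.
set e := E (small beta n z).
pose c N : R := (e - e ^+ 2) * (N == 1%N)%:R + e ^+ 2.
have bn i : below i `<=` nonroot by move=> v [u ->]; rewrite /nonroot /=; case: u.
have mJ i : meas nonroot (J i) by apply: (meas_sub (@bn i)); exact: meas_shift.
have iJ i : Itg (J i) by exact: (Itg_shift QE i Ii).
have eJ i : E (J i) = e by exact: (Ex_shift QE i Ii).
have disj : below 0 `&` below 1 = set0.
  by rewrite -subset0 => v [[u ->] [w /rcons_inj[]]].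
have [iJJ eJJ] := Ex_indep QE disj (meas_shift (i := 0%N) mI) (meas_shift (i := 1%N) mI) (iJ 0) (iJ 1).
have e0 : 0 <= e by apply: Ex_ge0 => x; have /andP[] := small01 beta n z x.
have u1i : Itg (fun x => (x [::] == 1%N)%:R : R).
  apply: (@Itg_bounded _ Q _ 1); first exact: (meas_root (fun N => (N == 1%N)%:R)).
  by move=> x; rewrite ger0_norm // lern1 leq_b1.
have i1 := ItgZ (e - e ^+ 2) u1i.
have ci : Itg (fun x => c (x [::])) by exact: (ItgD i1 (Itg_cst Q _)).
have [|||| gi le1] := @Ex_root_le _ _ _ QE g c _ _ _ _ ci.
- case=> [|[|N]]; [exact: meas_cst | exact: mJ | exact: (measurable_funM (mJ 0%N) (mJ 1%N))].
- move=> [|[|N]] x //; have /andP[h0 _] := J01 0 x; have /andP[h1 _] := J01 1%N x => //.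
  exact: mulr_ge0.
- by case=> [|[|N]]; [exact: Itg_cst | exact: iJ | exact: iJJ].
- case=> [|[|N]]; rewrite /c /=.
  + by rewrite mulr0 add0r Ex_cst sqr_ge0.
  + by rewrite mulr1 subrK eJ.
  + have -> : E (fun x => J 0 x * J 1 x) = e * e.
      by rewrite -{1}(eJ 0%N) -(eJ 1%N); exact: eJJ.
    by rewrite mulr0 add0r expr2.
have -> : e * (u1 + (1 - u1) * e) = E (fun x => c (x [::])).
  by rewrite /c (ExD i1 (Itg_cst Q _)) (ExZ _ u1i) Ex_cst -/u1; ring.
apply: le_trans le1; apply: le_Ex_ae => //; first exact: Itg_small.
apply: aeS (ct_pos H) => x x0; rewrite /small; case: (leP (r * z)) => hX.
  rewrite subrr /g; case: (x [::]) => [|[|N]] //; have /andP[h0 _] := J01 0 x; have /andP[h1 _] := J01 1%N x => //.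
  exact: mulr_ge0.
have Ji i : (i < x [::])%N -> J i x = 1.
  move=> ix; rewrite /J /small; case: (leP z) => // hz; last by rewrite subr0.
  have : msg beta n.+1 (shift i x) <= tot (msg beta n.+1) x.
    rewrite /tot /child_sum (bigD1 (Ordinal ix)) //= lerDl; apply: sumr_ge0 => j _.
    exact: (message_ge0 H hb n.+1).
  move=> h; have := lt_le_trans (le_lt_trans h hX) (hr _ _ b1 b2 (ltW z0) zb).
  by rewrite ltNge => /negP; case; apply: transfer_mono => //; [exact: (ct_q H) | exact: ltW].
rewrite subr0 /g; case: (x [::]) x0 Ji => [|[|N]] // _ Ji; first by rewrite Ji.
by rewrite !Ji // mulr1.
Qed.

(** The probability that the log odds are below a small fraction of their mean
    is bounded away from one by [message_spread], and goes to zero when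
    [small_step] is iterated. *)
Lemma lower_tail (eta : R) : 0 < eta -> exists (w : R) (i : nat), 0 < w /\
  forall beta n, inrange beta -> (i <= n)%N ->
  E (fun x => (w * f beta n <= tot (msg beta n) x)%R%:R) >= 1 - eta.
Proof.
move=> eta0.
have [r [r0 r1 hr]] := transfer_lower (ct_q H) (ct_mean H) (ct_crit H).
have [e [e0 e1 he]] := message_spread H p_range Zp.
pose th := u1 + (1 - u1) * (1 - e).
have u1l : 0 < 1 - u1 by rewrite subr_gt0.
have th0 : 0 <= th by rewrite addr_ge0 // mulr_ge0 ?subr_ge0 // ltW.
have th1 : th < 1.
  rewrite -subr_gt0 /th (_ : _ - _ = (1 - u1) * e); last by ring.
  exact: mulr_gt0.
have [i hi] : exists i, th ^+ i <= eta.
  have cv : th ^+ i @[i --> \oo] --> (0 : R) by apply: cvg_expr; rewrite ger0_norm.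
  move/cvgrPdist_le : cv => /(_ _ eta0)[i _ hi]; exists i.
  by have := hi i (leqnn i); rewrite /= sub0r normrN ger0_norm ?exprn_ge0.
exists (r ^+ i / 2), i; split; first by rewrite divr_gt0 // exprn_gt0.
move=> beta n hb ni; have /andP[b1 b2] := hb.
have fpos j : 0 < f beta j := msg_mean_gt0 H hb j.
have fM j : f beta j <= bmax.
  have h := msg_mean_le H hb (leq0n j); apply: (le_trans h).
  by rewrite /msg_mean /= Ex_cst.
pose y := f beta (n - i) / 2.
have y0 : 0 < y by rewrite divr_gt0.
have yM : y <= bmax.
  apply: le_trans (fM (n - i)%N); rewrite /y ler_pdivrMr // ler_peMr ?(ltW (fpos _)) //.
  by rewrite ler1n.
have rj k : 0 < r ^+ k * y /\ r ^+ k * y <= bmax.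
  split; first by rewrite mulr_gt0 // exprn_gt0.
  by apply: le_trans yM; rewrite ler_piMl ?(ltW y0) // exprn_ile1 // ltW.
have base : E (small beta (n - i) y) <= 1 - e.
  have h := he beta (n - i)%N hb; rewrite lerBrDr -lerBrDl; apply: (le_trans h).
  rewrite -[X in X - _](Ex_cst Q) -ExB; [|exact: Itg_cst | exact: Itg_small].
  have iI : Itg (fun x => (f beta (n - i) / 2 <= msg beta (n - i) x)%R%:R).
    apply: (@Itg_bounded _ Q _ 1); last by move=> x; rewrite ger0_norm // lern1 leq_b1.
    apply: (@meas_mono _ setT (fun v => (f beta (n - i) / 2 <= v)%R%:R)).
    + move=> v v' _ vv; rewrite ler_nat; case: (leP _ v) => // h'.
      by rewrite (le_trans h' vv).
    + exact: (message_ge0 H hb).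
    + exact: (meas_message H hb).
  rewrite -(Ex_shift QE 0 iI); apply: le_Ex_ae.
  + exact: (Itg_shift QE 0 iI).
  + by apply: ItgB; [exact: Itg_cst | exact: Itg_small].
  apply: aeS (ct_pos H) => x x0; rewrite /small opprB addrC subrK ler_nat /=.
  case: (leP (f beta (n - i) / 2)) => // h'; rewrite lt0b; apply: (le_trans h').
  rewrite /tot /child_sum; case: (x [::]) x0 => // N _.
  by rewrite big_ord_recl lerDl; apply: sumr_ge0 => j _; exact: (message_ge0 H hb).
have it k : E (small beta (n - i + k) (r ^+ k * y)) <= th ^+ k * (1 - e).
  elim: k => [|k IHk]; first by rewrite addn0 !expr0 !mul1r.
  have [z0 zM] := rj k; rewrite addnS [in r ^+ k.+1]exprS -mulrA.
  apply: (le_trans (small_step r0 hr _ hb z0 zM)).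
  have t0 : 0 <= E (small beta (n - i + k) (r ^+ k * y)).
    by apply: Ex_ge0 => x; have /andP[] := small01 beta (n - i + k) (r ^+ k * y) x.
  rewrite exprSr mulrAC; apply: ler_pM => //.
    by rewrite addr_ge0 // mulr_ge0 // ltW.
  rewrite /th lerD2l; apply: ler_wpM2l; first exact: ltW.
  have thk : th ^+ k <= 1 by apply: exprn_ile1 => //; exact: ltW.
  by apply: (le_trans IHk); rewrite ler_piMl ?subr_ge0.
have := it i; rewrite subnK // => iti.
have h1 : E (small beta n (r ^+ i / 2 * f beta n)) <= eta.
  apply: (@le_trans _ _ (E (small beta n (r ^+ i * y)))).
    apply: le_Ex; [exact: Itg_small | exact: Itg_small |] => x; rewrite /small lerD2l lerN2 ler_nat.
    case: (leP (r ^+ i * y)) => // h; rewrite lt0b; apply: le_trans h.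
    rewrite /y mulrAC mulrA ler_wpM2r ?invr_ge0 // ler_wpM2l ?exprn_ge0 ?(ltW r0) //.
    by apply: (msg_mean_le H hb); exact: leq_subr.
  apply: (le_trans iti); apply: le_trans hi.
  by rewrite ler_piMr ?exprn_ge0 // lerBlDr lerDl ltW.
have is0 := Itg_small n (r ^+ i / 2 * f beta n) hb.
rewrite lerBlDr -lerBlDl; apply: le_trans h1.
rewrite (_ : E (fun x => _) = 1 - E (small beta n (r ^+ i / 2 * f beta n))).
  by rewrite opprB addrC subrK.
rewrite -[X in _ = X - _](Ex_cst Q) -(ExB (Itg_cst Q 1) is0).
by apply: eq_Ex => x; rewrite /small opprB addrC subrK.
Qed.

Lemma upper_tail (beta b : R) n : inrange beta -> 0 < b ->
  E (fun x => (tot (msg beta n) x <= b * f beta n)%R%:R) >= 1 - m / b.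
Proof.
move=> hb b0; have f0 : 0 < f beta n := msg_mean_gt0 H hb n.
have Xi := Itg_tot H hb n; have eX := Ex_tot_message H hb n.
have bf : 0 < b * f beta n by exact: mulr_gt0.
have i1 := ItgB (Itg_cst Q 1) (ItgZ (b * f beta n)^-1 Xi).
have -> : 1 - m / b = E (fun x => 1 - (b * f beta n)^-1 * tot (msg beta n) x).
  rewrite (ExB (Itg_cst Q 1) (ItgZ _ Xi)) Ex_cst (ExZ _ Xi) eX -/m.
  by congr (1 - _); field; rewrite !gt_eqF.
apply: le_Ex => //.
  apply: (@Itg_bounded _ Q _ 1); last by move=> x; rewrite ger0_norm // lern1 leq_b1.
  have -> : (fun x => (tot (msg beta n) x <= b * f beta n)%R%:R : R) =
    (fun x => (fun y : R => 1 - (b * f beta n < y)%R%:R) (tot (msg beta n) x)).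
    by apply/funext => x /=; case: ltP; rewrite ?subrr ?subr0.
  apply: measurable_funB; first exact: meas_cst.
  apply: (@meas_mono _ setT (fun y => (b * f beta n < y)%R%:R)).
  - move=> x y _ xy; rewrite ler_nat; case: (ltP _ x) => // h.
    by rewrite (lt_le_trans h xy).
  - exact: (tot_ge0 H hb).
  - by apply: meas_tot; exact: (meas_message H hb).
move=> x; case: (leP (tot (msg beta n) x) (b * f beta n)) => h.
  by rewrite gerBl mulr_ge0 ?invr_ge0 ?(ltW bf) // (tot_ge0 H hb).
by rewrite subr_le0 mulrC ler_pdivlMr // mul1r ltW.
Qed.

(** If the mean messages are of order [y n], then so are the connection
    probabilities at the root: Markov's inequality above, the iterated
    recursion for small values below. *)
Lemma psi_tight (b y : nat -> R) (c1 c2 : R) n0 : 0 < c1 -> 0 < c2 ->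
  (forall n, (n0 <= n)%N -> [/\ inrange (b n), 0 < y n & c1 * y n <= f (b n) n <= c2 * y n]) ->
  y n @[n --> \oo] --> (0 : R) ->
  forall eta : R, 0 < eta -> exists (lo hi : R) (n1 : nat), [/\ 0 < lo, lo <= hi &
    forall n, (n1 <= n)%N ->
    1 - eta <= E (fun x => (lo <= psi q (tot (msg (b n) n) x) / y n <= hi)%R%:R)].
Proof.
move=> c10 c20 hf y0 eta eta0.
have eta2 : 0 < eta / 2 by rewrite divr_gt0.
have [w [i [w0 hw]]] := lower_tail eta2.
pose bb := 2 * m / eta; have bb0 : 0 < bb by rewrite divr_gt0 // mulr_gt0.
pose lo := w * c1 / (2 * q); pose hi := Num.max lo (bb * c2 / q).
have lo0 : 0 < lo by rewrite divr_gt0 // mulr_gt0.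
have d0 : 0 < q / (2 * (w * c2)) by rewrite divr_gt0 // !mulr_gt0.
have [n2 _ hn2] : \forall n \near \oo, y n <= q / (2 * (w * c2)).
  move/cvgrPdist_le : y0 => /(_ _ d0)[k _ hk]; exists k => // n /= kn.
  by have := hk n kn; rewrite /= sub0r normrN => /(le_trans (ler_norm _)).
exists lo, hi, (maxn n0 (maxn i n2)); split => //; first by rewrite /hi le_max lexx.
move=> n; rewrite !geq_max => /and3P[nn0 ni nn2].
have [hb yn0 /andP[f1 f2]] := hf n nn0; have yn := hn2 n nn2.
have f0 : 0 < f (b n) n := msg_mean_gt0 H hb n.
have U := upper_tail n hb bb0; have L := hw _ n hb ni.
have mb : m / bb = eta / 2 by rewrite /bb; field; rewrite !gt_eqF.
have mX : meas setT (tot (msg (b n) n)) by apply: meas_tot; exact: (meas_message H hb).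
have mI (P : R -> bool) : measurable_fun setT (fun v : R => (P v)%:R : R) ->
    Itg (fun x => (P (tot (msg (b n) n) x))%:R).
  move=> mP; apply: (@Itg_bounded _ Q _ 1); last by move=> x; rewrite ger0_norm // lern1 leq_b1.
  exact: (meas_comp mP mX).
have mle (c : R) : measurable_fun setT (fun v : R => (c <= v)%R%:R : R).
  apply: nondecreasing_measurable => // v v' vv; rewrite ler_nat; case: (leP c v) => // h.
  by rewrite (le_trans h vv).
have mge (c : R) : measurable_fun setT (fun v : R => (v <= c)%R%:R : R).
  have -> : (fun v : R => (v <= c)%R%:R) = (fun v : R => 1 - (c < v)%R%:R : R).
    by apply/funext => v; case: ltP; rewrite ?subrr ?subr0.
  apply: measurable_funB; first exact: measurable_cst.
  apply: nondecreasing_measurable => // v v' vv; rewrite ler_nat; case: (ltP c v) => // h.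
  by rewrite (lt_le_trans h vv).
have iU := mI (fun v => v <= bb * f (b n) n) (mge _).
have iL := mI (fun v => w * f (b n) n <= v) (mle _).
have mpsi : measurable_fun setT (fun v : R => psi q (Num.max v 0)).
  apply: nondecreasing_measurable => // v v' vv.
  have [h|h] := leP v 0.
    rewrite /psi expR0 subrr mul0r divr_ge0 //.
      by rewrite subr_ge0 -expR0 ler_expR le_max lexx orbT.
    by rewrite -addrA addrCA addr_ge0 ?(ltW q_gt0) // subr_ge0 -expR0 ler_expR le_max lexx orbT.
  have -> : Num.max v' 0 = v' by apply/max_idPl; rewrite (le_trans (ltW h)).
  exact: (psi_mono (ct_q H)).
have iP : Itg (fun x => (lo <= psi q (tot (msg (b n) n) x) / y n <= hi)%R%:R).
  have -> : (fun x => (lo <= psi q (tot (msg (b n) n) x) / y n <= hi)%R%:R) =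
      (fun x => ((fun v : R => (lo <= v)%R%:R * (v <= hi)%R%:R) \o
         (fun v : R => psi q (Num.max v 0) / y n)) (tot (msg (b n) n) x)) :> (_ -> R).
    apply/funext => x /=; rewrite (max_idPl (tot_ge0 H hb n x)).
    by case: (lo <= _); case: (_ <= hi); rewrite ?mulr1 ?mulr0.
  apply: (@Itg_bounded _ Q _ 1); last first.
    by move=> x /=; case: (lo <= _); case: (_ <= hi); rewrite ?mulr1 ?mulr0 ?normr1 ?normr0.
  apply: (meas_comp (g := (fun v : R => (lo <= v)%R%:R * (v <= hi)%R%:R) \o
         (fun v : R => psi q (Num.max v 0) / y n))) => //.
  apply: measurableT_comp; first exact: measurable_funM.
  exact: measurable_funM.
have i3 := ItgB (ItgD iU iL) (Itg_cst Q 1).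
apply: (@le_trans _ _ (E (fun x => (tot (msg (b n) n) x <= bb * f (b n) n)%R%:R +
  (w * f (b n) n <= tot (msg (b n) n) x)%R%:R - 1))).
  rewrite (ExB (ItgD iU iL) (Itg_cst Q 1)) (ExD iU iL) Ex_cst.
  rewrite mb in U; move: (E _) (E _) U L => a1 a2 U L; lra.
apply: le_Ex => // x; have X0 := tot_ge0 H hb n x.
have [hU|hU] := leP (tot (msg (b n) n) x); last first.
  rewrite mulr0n add0r; apply: (@le_trans _ _ 0); last exact: ler0n.
  by rewrite subr_le0 lern1 leq_b1.
have [hL|hL] := leP (w * f (b n) n); last by rewrite mulr0n addr0 subrr.
have wf0 : 0 < w * f (b n) n by exact: mulr_gt0.
rewrite mulr1n addrK; move: (tot _ x) X0 hU hL => v v0 hU hL.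
rewrite ler1n lt0b; apply/andP; split.
  rewrite ler_pdivlMr //; apply: (@le_trans _ _ (psi q (w * f (b n) n))); last first.
    exact: (psi_mono (ct_q H)).
  have [_ _ qq] := psi_quad (ct_q H) (ltW wf0).
  have wfq : w * f (b n) n <= q / 2.
    apply: (@le_trans _ _ (w * (c2 * y n))); first by rewrite ler_pM2l.
    by move: yn; rewrite ler_pdivlMr ?mulr_gt0 // => h; rewrite ler_pdivlMr //; move: h; lra.
  have h2 : (w * f (b n) n) ^+ 2 / q ^+ 2 <= w * f (b n) n / (2 * q).
    have -> : (w * f (b n) n) ^+ 2 / q ^+ 2 = w * f (b n) n / q ^+ 2 * (w * f (b n) n) by ring.
    have -> : w * f (b n) n / (2 * q) = w * f (b n) n / q ^+ 2 * (q / 2).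
      by field; rewrite gt_eqF.
    by rewrite ler_wpM2l // divr_ge0 ?sqr_ge0 // ltW.
  apply: (@le_trans _ _ (w * f (b n) n / (2 * q))).
    rewrite /lo mulrAC ler_pM2r ?invr_gt0 ?mulr_gt0 // -mulrA ler_pM2l //.
  have h3 : w * f (b n) n / q = w * f (b n) n / (2 * q) + w * f (b n) n / (2 * q).
    by field; rewrite gt_eqF.
  rewrite h3 in qq; move: (w * f (b n) n / (2 * q)) (_ / q ^+ 2) (psi _ _) h2 qq => a1 a2 a3; lra.
have [_ qq _] := psi_quad (ct_q H) v0.
rewrite ler_pdivrMr //; apply: (le_trans qq); apply: (@le_trans _ _ (bb * c2 / q * y n)).
  rewrite mulrAC ler_pM2r ?invr_gt0 //; apply: (le_trans hU).
  by apply: le_trans (ler_wpM2l (ltW bb0) f2) _; rewrite mulrA.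
by rewrite ler_pM2r // /hi le_max lexx orbT.
Qed.

End Tightness.

(** * Branching sums and the limit of the normalized generation sizes *)

(** Defined through the subtrees of the children, so that bounds on [tot]
    iterate over the generations. *)
Fixpoint gen_sum (R : realType) k (Y : (seq nat -> nat) -> R) (x : seq nat -> nat) : R :=
  if k is k'.+1 then tot (gen_sum k' Y) x else Y x.

Lemma gen_sum_size (R : realType) k x :
  gen_sum k (fun=> 1 : R) x = (size (generation x k))%:R.
Proof.
elim: k x => [|k IHk] x //; rewrite size_generationS natr_sum.
by apply: eq_bigr => i _; exact: IHk.
Qed.

Lemma gen_sum_add (R : realType) k l (Y : (seq nat -> nat) -> R) x :
  gen_sum (k + l) Y x = gen_sum k (gen_sum l Y) x.
Proof. by elim: k x => [|k IHk] x //=; apply: eq_bigr => i _; exact: IHk. Qed.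

Lemma gen_sum_affine (R : realType) k (c a : R) (Y : (seq nat -> nat) -> R) x :
  gen_sum k (fun y => c * Y y - a) x = c * gen_sum k Y x - a * gen_sum k (fun=> 1) x.
Proof.
elim: k x => [|k IHk] x /=; first by rewrite mulr1.
rewrite /tot /child_sum !mulr_sumr -sumrB; apply: eq_bigr => i _; exact: IHk.
Qed.

Lemma totZ (R : realType) (c : R) (Y : (seq nat -> nat) -> R) x :
  tot (fun y => c * Y y) x = c * tot Y x.
Proof. by rewrite /tot /child_sum mulr_sumr. Qed.

Lemma gen_sum_ge0 (R : realType) k (Y : (seq nat -> nat) -> R) x :
  (forall y, 0 <= Y y) -> 0 <= gen_sum k Y x.
Proof. by move=> Y0; elim: k x => [|k IHk] x //=; apply: sumr_ge0 => i _; exact: IHk. Qed.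

Lemma add_expr_le (R : realType) (x y : R) k : 0 <= x -> 0 <= y ->
  (x + y) ^+ k <= 2 ^+ k * (x ^+ k + y ^+ k).
Proof.
move=> x0 y0; wlog xy : x y x0 y0 / x <= y => [hw|].
  by have [h|/ltW h] := leP x y; [exact: hw | rewrite (addrC x) (addrC (x ^+ k)); exact: hw].
apply: (@le_trans _ _ ((2 * y) ^+ k)).
  by rewrite lerXn2r ?nnegrE ?addr_ge0 ?mulr_ge0 //; lra.
by rewrite exprMn ler_wpM2l ?exprn_ge0 // lerDr exprn_ge0.
Qed.

Lemma nat_expr_le (R : realType) (th : R) k : 0 < th -> th < 1 ->
  k%:R * th ^+ k <= (1 - th)^-1.
Proof.
move=> th0 th1; have t1 : 0 < 1 - th by rewrite subr_gt0.
have h j : j%:R * (1 - th) * th ^+ j <= 1 - th ^+ j.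
  elim: j => [|j IHj]; first by rewrite !mul0r expr0 subrr.
  have p0 : 0 <= th ^+ j by rewrite exprn_ge0 // ltW.
  have p1 : th ^+ j <= 1 by apply: exprn_ile1 => //; exact: ltW.
  have n0 : 0 <= j%:R * (1 - th) * th ^+ j by rewrite !mulr_ge0 // ltW.
  rewrite -(natr1 j) exprS; move: (th ^+ j) (j%:R) p0 p1 n0 IHj => z n p0 p1 n0 IHj.
  have -> : (n + 1) * (1 - th) * (th * z) = th * (n * (1 - th) * z) + (1 - th) * (th * z) by ring.
  have h1 := ler_wpM2l (ltW th0) IHj.
  have h2 : 0 <= (1 - th) * (1 - th * z).
    by rewrite mulr_ge0 ?(ltW t1) // subr_ge0 -[leRHS]mulr1 ler_pM // ltW.
  move: h1 h2; lra.
have := h k; rewrite mulrAC -ler_pdivlMr // => h'; apply: (le_trans h').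
by rewrite -[leRHS]mul1r ler_wpM2r ?invr_ge0 ?(ltW t1) // gerBl exprn_ge0 // ltW.
Qed.

Lemma geo_sum_le (R : realType) (th : R) n : 0 < th -> th < 1 ->
  \sum_(0 <= k < n) th ^+ k <= (1 - th)^-1.
Proof.
move=> th0 th1; have t1 : 0 < 1 - th by rewrite subr_gt0.
have := subrX1 th n; rewrite big_mkord; move: (\sum_(i < n) _) => S hS.
have g0 : 0 <= th ^+ n by rewrite exprn_ge0 // ltW.
rewrite -[leRHS]mul1r ler_pdivlMr //.
have -> : S * (1 - th) = 1 - th ^+ n by rewrite -[RHS]opprB hS; ring.
by rewrite gerBl.
Qed.

Section Branching.
Variables (R : realType) (mu : probability nat R).
Variable Q : probability (tree_space setT) R.
Variables (q betac : R).
Hypothesis H : critical_tree mu Q q betac.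
Let m := mean_children Q.
Let QE : tree_law mu Q := ct_law H.
Let Zi := ct_Itg H.
Let m_gt1 : 1 < m := ct_mean H.
Let m_gt0 : 0 < m. Proof. exact: lt_trans ltr01 m_gt1. Qed.
Let s := crit_exp q.
Let s12 : s = 1%N \/ s = 2%N := crit_expP q.

Notation E := (Ex Q).
Notation Itg := (Itg Q).
Notation "'E_Z' c" := (E (fun x => c (x [::]))) (at level 10).
Implicit Types Y : (seq nat -> nat) -> R.

Lemma gen_sum_mean k Y : Itg Y -> Itg (gen_sum k Y) /\ E (gen_sum k Y) = m ^+ k * E Y.
Proof.
move=> Yi; elim: k => [|k [Si Se]]; first by rewrite mul1r.
have [ti te] := Ex_tot QE Zi Si; split; first exact: ti.
by rewrite -[LHS]/(E (tot (gen_sum k Y))) te Se mulrA exprS.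
Qed.

Let meas_sum_exp (h : R -> R) Y N : measurable_fun setT h -> Itg Y ->
  meas nonroot (fun x => h (child_sum Y N x)).
Proof.
move=> mh Yi; apply: (meas_comp mh); apply: meas_child_sum_nonroot; exact: Itg_meas Yi.
Qed.

Lemma tot_centered2 Y : Itg Y -> Itg (fun x => Y x ^+ 2) -> E Y = 0 ->
  Itg (fun x => tot Y x ^+ 2) /\ E (fun x => tot Y x ^+ 2) <= m * E (fun x => Y x ^+ 2).
Proof.
move=> Yi Y2 e0; set v := E (fun x => Y x ^+ 2).
have S N : Itg (fun x => child_sum Y N x ^+ 2) /\
    E (fun x => child_sum Y N x ^+ 2) <= v * N%:R.
  have [i e] := Ex_child_sum2 QE N Yi Y2; split => //.
  by rewrite e e0 expr0n mulr0 addr0 mulrC.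
have [||||i h] := @Ex_root_le _ _ _ QE (fun N x => child_sum Y N x ^+ 2)
  (fun N => v * N%:R) _ _ _ _ (ItgZ v Zi).
- by move=> N; apply: (meas_sum_exp (h := fun z => z ^+ 2)) => //; exact: exprn_measurable.
- by move=> N x; exact: sqr_ge0.
- by move=> N; have [] := S N.
- by move=> N; have [] := S N.
by split => //; apply: (le_trans h); rewrite (ExZ _ Zi) mulrC.
Qed.

(** Conditionally on the number of children, the sum is one of independent
    centered variables. *)
Lemma tot_centered3 Y : Itg (fun x => (x [::])%:R ^+ 2) ->
  Itg Y -> Itg (fun x => Y x ^+ 2) -> Itg (fun x => `|Y x| ^+ 3) -> E Y = 0 ->
  Itg (fun x => `|tot Y x| ^+ 3) /\
  E (fun x => `|tot Y x| ^+ 3) <= m * E (fun x => `|Y x| ^+ 3) +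
    3 * E_Z (fun N => N%:R ^+ 2) * (E (fun x => `|Y x|) * E (fun x => Y x ^+ 2)).
Proof.
move=> Z2 Yi Y2 Y3 e0; set w := E (fun x => `|Y x| ^+ 3).
set v := E (fun x => `|Y x|) * _.
have i1 := ItgZ w Zi; have i2 := ItgZ (3 * v) Z2.
have S N : Itg (fun x => `|child_sum Y N x| ^+ 3) /\
    E (fun x => `|child_sum Y N x| ^+ 3) <= w * N%:R + 3 * v * N%:R ^+ 2.
  have [i e] := Ex_child_sum_abs3 QE N e0 Yi Y2 Y3; split => //.
  apply: (le_trans e); rewrite -/w mulrC lerD2l le_eqVlt; apply/orP; left; apply/eqP.
  by rewrite /v; ring.
have [||||i h] := @Ex_root_le _ _ _ QE (fun N x => `|child_sum Y N x| ^+ 3)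
  (fun N => w * N%:R + 3 * v * N%:R ^+ 2) _ _ _ _ (ItgD i1 i2).
- move=> N; apply: (meas_sum_exp (h := fun z => `|z| ^+ 3)) => //.
  by apply: (@measurableT_comp _ _ _ _ _ _ (fun z : R => z ^+ 3)) => //; exact: exprn_measurable.
- by move=> N x; rewrite exprn_ge0.
- by move=> N; have [] := S N.
- by move=> N; have [] := S N.
split => //; apply: (le_trans h); rewrite (ExD i1 i2) (ExZ _ Zi) (ExZ _ Z2).
rewrite -[E (fun x => (x [::])%:R)]/m (mulrC w) lerD2l le_eqVlt; apply/orP; left; apply/eqP.
by ring.
Qed.

Lemma Itg_exp_le Y k l : Itg Y -> (k <= l)%N -> Itg (fun x => `|Y x| ^+ l) ->
  Itg (fun x => `|Y x| ^+ k).
Proof.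
move=> Yi kl Yl; apply: (Itg_le _ _ (ItgD (Itg_cst Q 1) Yl)).
  apply: (meas_comp (g := fun z => `|z| ^+ k) _ (Itg_meas Yi)).
  by apply: (@measurableT_comp _ _ _ _ _ _ (fun z : R => z ^+ k)) => //; exact: exprn_measurable.
move=> x; rewrite ger0_norm ?exprn_ge0 //; move: `|Y x| (normr_ge0 (Y x)) => z z0.
have [z1|z1] := leP z 1.
  by apply: le_trans (exprn_ile1 k z0 z1) _; rewrite lerDl exprn_ge0.
by rewrite (le_trans (ler_weXn2l (ltW z1) kl)) // lerDr.
Qed.

(** Centered variables of scale [a]; the second moment is needed besides that
    of order [s + 1] in the induction over the generations when [s = 2]. *)
Definition centered (a : R) Y : Prop :=
  [/\ Itg Y, E Y = 0, Itg (fun x => Y x ^+ 2) /\ E (fun x => Y x ^+ 2) <= a ^+ 2 &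
      Itg (fun x => `|Y x| ^+ s.+1) /\ E (fun x => `|Y x| ^+ s.+1) <= a ^+ s.+1].

(** A nonnegative variable whose moment of order [s + 1] is of the order of
    that power of its mean has, once centered, the scale of its mean. *)
Lemma centered_sub (K a : R) X : 1 <= K -> 0 < a -> (forall x, 0 <= X x) -> Itg X ->
  E X = a -> Itg (fun x => X x ^+ s.+1) -> E (fun x => X x ^+ s.+1) <= K * a ^+ s.+1 ->
  centered (16 * K * a) (fun x => X x - a).
Proof.
move=> K1 a0 X0 Xi eX Xs hX; have K0 : 0 < K := lt_le_trans ltr01 K1.
have ia := Itg_cst Q a; have Yi : Itg (fun x => X x - a) by exact: ItgB.
have Y0 : E (fun x => X x - a) = 0 by rewrite (ExB Xi ia) Ex_cst eX subrr.
have sig : 1 <= 16 * K by move: K1 => h; lra.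
have Xabs : Itg (fun x => `|X x| ^+ s.+1).
  by apply: eq_Itg Xs => x; rewrite ger0_norm.
have bs : Itg (fun x => `|X x - a| ^+ s.+1) /\
    E (fun x => `|X x - a| ^+ s.+1) <= (16 * K * a) ^+ s.+1.
  have i2 := ItgZ (2 ^+ s.+1) (ItgD Xs (Itg_cst Q (a ^+ s.+1))).
  have pt x : `|X x - a| ^+ s.+1 <= 2 ^+ s.+1 * (X x ^+ s.+1 + a ^+ s.+1).
    apply: le_trans (add_expr_le _ (X0 x) (ltW a0)).
    rewrite lerXn2r ?nnegrE ?addr_ge0 // ?(ltW a0) //.
    by rewrite (le_trans (ler_normB _ _)) // !ger0_norm // ltW.
  have i1 : Itg (fun x => `|X x - a| ^+ s.+1).
    apply: (Itg_le _ _ i2).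
      apply: (meas_comp (g := fun z => `|z| ^+ s.+1) _ (Itg_meas Yi)).
      by apply: (@measurableT_comp _ _ _ _ _ _ (fun z : R => z ^+ s.+1)) => //; exact: exprn_measurable.
    by move=> x; rewrite ger0_norm ?exprn_ge0.
  split => //; apply: (le_trans (le_Ex i1 i2 pt)).
  rewrite (ExZ _ (ItgD Xs (Itg_cst Q _))) (ExD Xs (Itg_cst Q _)) Ex_cst !exprMn.
  have as0 : 0 < a ^+ s.+1 by exact: exprn_gt0.
  have h1 : E (fun x => X x ^+ s.+1) + a ^+ s.+1 <= 2 * K * a ^+ s.+1.
    by move: (a ^+ s.+1) as0 hX => z z0 hX; nra.
  apply: (le_trans (ler_wpM2l (exprn_ge0 s.+1 (ler0n R 2)) h1)).
  rewrite mulrA ler_wpM2r ?(ltW as0) // mulrA.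
  have h2 : (2 : R) ^+ s.+1 * 2 <= 16 ^+ s.+1.
    by rewrite -exprSr; case: s12 => ->; rewrite -!natrX ler_nat.
  apply: ler_pM => //; rewrite ?mulr_ge0 ?exprn_ge0 ?(ltW K0) //.
  by rewrite exprS ler_peMr ?(ltW K0) // exprn_ege1.
split => //; case: s12 => es; rewrite es in bs.
  by have [b1 b2] := bs; split; [apply: eq_Itg b1 | rewrite (@eq_Ex _ Q _ (fun x => `|X x - a| ^+ 2))] => // x; rewrite real_normK ?num_real.
have i3 : Itg (fun x => X x ^+ 3) by rewrite es in Xs.
have i2 : Itg (fun x => X x ^+ 2).
  have := Itg_exp_le Xi (isT : (2 <= 3)%N) _.
  by move=> /(_ (eq_Itg (fun x => esym (congr1 (fun z => z ^+ 3) (ger0_norm (X0 x)))) i3)); apply: eq_Itg => x; rewrite ger0_norm.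
have iY : Itg (fun x => (X x - a) ^+ 2).
  by apply: eq_Itg (Itg_exp_le Yi (isT : (2 <= 3)%N) bs.1) => x; rewrite real_normK ?num_real.
split => //; have j1 := ItgZ a^-1 i3; have j2 := ItgD j1 (Itg_cst Q (2 * a ^+ 2)).
apply: (@le_trans _ _ (E (fun x => a^-1 * X x ^+ 3 + 2 * a ^+ 2))).
  apply: le_Ex => // x; move: (X x) (X0 x) => z z0.
  have h : z ^+ 2 <= a^-1 * z ^+ 3 + a ^+ 2.
    have [za|za] := leP z a.
      apply: (@le_trans _ _ (a ^+ 2)); first by rewrite lerXn2r ?nnegrE // ltW.
      by rewrite lerDr mulr_ge0 ?invr_ge0 ?exprn_ge0 // ltW.
    apply: (@le_trans _ _ (a^-1 * z ^+ 3)); last by rewrite lerDl sqr_ge0.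
    by rewrite mulrC ler_pdivlMr // [leRHS]exprSr ler_wpM2l ?sqr_ge0 // ltW.
  have : 0 <= a * z by rewrite mulr_ge0 // ltW.
  move: (a^-1 * _) h => y h az; have -> : (z - a) ^+ 2 = z ^+ 2 + a ^+ 2 - 2 * (a * z) by ring.
  lra.
rewrite (ExD j1 (Itg_cst Q _)) (ExZ _ i3) Ex_cst; rewrite es in hX.
have h1 : a^-1 * E (fun x => X x ^+ 3) <= K * a ^+ 2.
  by rewrite mulrC ler_pdivrMr // -mulrA -exprSr.
have a2 : 0 < a ^+ 2 by exact: exprn_gt0.
apply: (le_trans (lerD h1 (lexx _))); rewrite exprMn -mulrDl ler_wpM2r ?(ltW a2) //.
by nra.
Qed.

(** The sum of independent centered variables over generation [k] is of the
    order of the square root of the size of the generation. A factor [g] per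
    generation with [g ^ 2 * m < 1] makes it exponentially small in mean of
    order [s + 1]. *)
Lemma gen_sum_small (th : R) : 0 < th -> th < 1 -> Itg (fun x => (x [::])%:R ^+ s.+1) ->
  exists2 C : R, 0 < C & forall (g a : R) Y k, 0 < g -> g ^+ 2 * m <= th ^+ 2 -> 0 < a ->
    centered a Y ->
    [/\ Itg (fun x => `|g ^+ k * gen_sum k Y x| ^+ s.+1),
        E (fun x => `|g ^+ k * gen_sum k Y x| ^+ s.+1) <= C * th ^+ k * a ^+ s.+1 &
        E (fun x => `|g ^+ k * gen_sum k Y x|) <= th ^+ k * a].
Proof.
move=> th0 th1 Zs; pose B := 3 * E_Z (fun N => N%:R ^+ 2 : R).
have B0 : 0 <= B by rewrite mulr_ge0 // Ex_ge0 // => x; exact: sqr_ge0.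
have t1 : 0 < 1 - th by rewrite subr_gt0.
exists (1 + B / (1 - th)); first by rewrite ltr_pwDl // divr_ge0 // ltW.
move=> g a Y k g0 gm a0 [Yi Y0 [Y2 hY2] [Ys hYs]].
have gth : g <= th.
  rewrite -(@ler_pXn2r _ 2) ?nnegrE ?(ltW g0) ?(ltW th0) //; apply: le_trans gm.
  by rewrite ler_peMr ?sqr_ge0 // ltW.
pose S k x := g ^+ k * gen_sum k Y x.
have SS k' x : S k'.+1 x = g * tot (S k') x.
  by rewrite /S totZ /= exprS mulrA.
have P k' : [/\ Itg (S k'), E (S k') = 0, Itg (fun x => S k' x ^+ 2) &
    E (fun x => S k' x ^+ 2) <= (th ^+ k' * a) ^+ 2].
  elim: k' => [|k' [i1 e1 i2 e2]].
    have e x : S 0 x = Y x by rewrite /S expr0 mul1r.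
    split; first exact: (eq_Itg (fun x => esym (e x)) Yi).
    - by rewrite (eq_Ex Q e).
    - by apply: eq_Itg Y2 => x; rewrite e.
    - by rewrite mul1r (@eq_Ex _ Q _ (fun x => Y x ^+ 2)) // => x; rewrite e.
  have [ti te] := Ex_tot QE Zi i1; have [t2i t2e] := tot_centered2 i1 i2 e1.
  have e x : S k'.+1 x ^+ 2 = g ^+ 2 * tot (S k') x ^+ 2 by rewrite SS exprMn.
  split.
  - exact: (eq_Itg (fun x => esym (SS k' x)) (ItgZ g ti)).
  - by rewrite (eq_Ex Q (SS k')) (ExZ g ti) te e1 !mulr0.
  - exact: (eq_Itg (fun x => esym (e x)) (ItgZ (g ^+ 2) t2i)).
  - rewrite (eq_Ex Q e) (ExZ _ t2i); apply: (le_trans (ler_wpM2l (sqr_ge0 g) t2e)).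
    have v0 : 0 <= E (fun x => S k' x ^+ 2) by apply: Ex_ge0 => x; exact: sqr_ge0.
    have gm0 : 0 <= g ^+ 2 * m by rewrite mulr_ge0 ?sqr_ge0 // ltW.
    have -> : (th ^+ k'.+1 * a) ^+ 2 = th ^+ 2 * (th ^+ k' * a) ^+ 2.
      by rewrite (exprS th k') -mulrA exprMn.
    by have := ler_pM gm0 v0 gm e2; rewrite -(mulrA (g ^+ 2)).
have ta k' : 0 < th ^+ k' * a by rewrite mulr_gt0 ?exprn_gt0.
have L1 k' : E (fun x => `|S k' x|) <= th ^+ k' * a.
  have [i1 e1 i2 e2] := P k'; set t := th ^+ k' * a in e2 *; have t0 : 0 < t := ta k'.
  have j := ItgZ (2 * t)^-1 i2; have j2 := ItgD (Itg_cst Q (t / 2)) j.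
  apply: (@le_trans _ _ (E (fun x => t / 2 + (2 * t)^-1 * S k' x ^+ 2))).
    apply: le_Ex; [exact: Itg_norm | exact: j2 |] => x; rewrite -[S k' x ^+ 2]real_normK ?num_real //.
    move: `|S k' x| => z; rewrite -subr_ge0 (_ : _ - _ = (2 * t)^-1 * (z - t) ^+ 2).
      by rewrite mulr_ge0 ?sqr_ge0 // invr_ge0 mulr_ge0 // ltW.
    by field; rewrite gt_eqF.
  rewrite (ExD (Itg_cst Q _) j) Ex_cst (ExZ _ i2).
  have w : 0 <= (2 * t)^-1 by rewrite invr_ge0 mulr_ge0 // ltW.
  apply: (le_trans (lerD (lexx _) (ler_wpM2l w e2))).
  by rewrite le_eqVlt; apply/orP; left; apply/eqP; field; rewrite gt_eqF.
have thk := nat_expr_le k th0 th1.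
have p0 : 0 <= th ^+ k by rewrite exprn_ge0 // ltW.
have p1 : th ^+ k <= 1 by apply: exprn_ile1 => //; exact: ltW.
have BC : 0 <= B / (1 - th) by rewrite divr_ge0 // ltW.
have L1k := L1 k.
suff [h1 h2] : Itg (fun x => `|S k x| ^+ s.+1) /\
    E (fun x => `|S k x| ^+ s.+1) <= (1 + B / (1 - th)) * th ^+ k * a ^+ s.+1 by split.
case: s12 => es; rewrite es in Ys hYs Zs *.
  have [i1 e1 i2 e2] := P k.
  split; first by apply: eq_Itg i2 => x; rewrite real_normK ?num_real.
  rewrite (@eq_Ex _ Q _ (fun x => S k x ^+ 2)); last by move=> x; rewrite real_normK ?num_real.
  apply: (le_trans e2); rewrite exprMn ler_wpM2r ?sqr_ge0 //.
  apply: (@le_trans _ _ (th ^+ k)); first by rewrite expr2 ler_piMl.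
  by rewrite ler_peMl // lerDl.
have Zn : Itg (fun x => (x [::])%:R ^+ 2).
  apply: (eq_Itg _ (Itg_exp_le Zi (isT : (2 <= 3)%N) (eq_Itg _ Zs))) => x; first by rewrite normr_nat.
  by rewrite normr_nat.
have P3 k' : Itg (fun x => `|S k' x| ^+ 3) /\
    E (fun x => `|S k' x| ^+ 3) <= (1 + k'%:R * B) * (th ^+ k' * a) ^+ 3.
  elim: k' => [|k' [i3 e3]].
    have e x : `|Y x| ^+ 3 = `|S 0 x| ^+ 3 by rewrite /S expr0 mul1r.
    split; first exact: (eq_Itg e Ys).
    by rewrite -(eq_Ex Q e) mul0r addr0 !mul1r.
  have [i1 e1 i2 e2] := P k'; have [ti te] := tot_centered3 Zn i1 i2 i3 e1.
  have e x : `|S k'.+1 x| ^+ 3 = g ^+ 3 * `|tot (S k') x| ^+ 3.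
    by rewrite SS normrM exprMn ger0_norm // ltW.
  split; first exact: (eq_Itg (fun x => esym (e x)) (ItgZ (g ^+ 3) ti)).
  rewrite (eq_Ex Q e) (ExZ _ ti).
  have g3 : 0 <= g ^+ 3 by rewrite exprn_ge0 // ltW.
  have L := L1 k'; have t0 := ta k'.
  rewrite (_ : th ^+ k'.+1 * a = th * (th ^+ k' * a)); last by rewrite exprS mulrA.
  move: (th ^+ k' * a) t0 L e2 e3 => t t0 L e2 e3.
  have h1 : E (fun x => `|S k' x|) * E (fun x => S k' x ^+ 2) <= t ^+ 3.
    rewrite exprS; apply: ler_pM => //; apply: Ex_ge0 => x //; exact: sqr_ge0.
  apply: (le_trans (ler_wpM2l g3 te)); rewrite -/B.
  apply: (@le_trans _ _ (g ^+ 3 * (m * ((1 + k'%:R * B) * t ^+ 3) + B * t ^+ 3))).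
    apply: ler_wpM2l => //; apply: lerD; first by apply: ler_wpM2l e3; exact: ltW.
    exact: ler_wpM2l.
  have k0 : 0 <= (1 + k'%:R * B) * t ^+ 3.
    exact: mulr_ge0 (addr_ge0 ler01 (mulr_ge0 (ler0n R k') B0)) (exprn_ge0 3 (ltW t0)).
  have Bt : 0 <= B * t ^+ 3 by exact: mulr_ge0 B0 (exprn_ge0 3 (ltW t0)).
  have q1 : g ^+ 3 * m <= th ^+ 3.
    rewrite (exprS g) -mulrA (exprS th); apply: ler_pM => //; first exact: ltW.
    by rewrite mulr_ge0 ?sqr_ge0 // ltW.
  have q2 : g ^+ 3 <= th ^+ 3 by rewrite lerXn2r ?nnegrE // ltW.
  rewrite mulrDr mulrA; apply: (le_trans (lerD (ler_wpM2r k0 q1) (ler_wpM2r Bt q2))).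
  rewrite -(natr1 k') le_eqVlt; apply/orP; left; apply/eqP; ring.
have [i3 e3] := P3 k; split => //; apply: (le_trans e3).
rewrite exprMn mulrA ler_wpM2r ?exprn_ge0 ?(ltW a0) //.
have -> : (1 + k%:R * B) * (th ^+ k) ^+ 3 =
  ((th ^+ k) ^+ 2 + B * (k%:R * th ^+ k * th ^+ k)) * th ^+ k by ring.
apply: ler_wpM2r => //; apply: lerD; first by apply: exprn_ile1.
rewrite ler_wpM2l //; apply: le_trans thk; rewrite ler_piMr //.
by rewrite mulr_ge0.
Qed.

(** ** The limit of the normalized generation sizes *)

Hypothesis Zs : Itg (fun x => (x [::])%:R ^+ s.+1).
Let EZs := E_Z (fun N => N%:R ^+ s.+1).
Let EZs0 : 0 <= EZs. Proof. by apply: Ex_ge0 => x; exact: exprn_ge0. Qed.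

Lemma tot_moment (theta : R) : 0 < theta -> exists2 C : R, 0 < C &
  forall Y, (forall x, 0 <= Y x) -> 0 < E Y -> Itg Y -> Itg (fun x => Y x ^+ s.+1) ->
    Itg (fun x => tot Y x ^+ s.+1) /\
    E (fun x => tot Y x ^+ s.+1) <=
      (1 + theta) * m * E (fun x => Y x ^+ s.+1) + C * E Y ^+ s.+1.
Proof.
move=> th0; have [C C0 hC] := child_sum_exp H th0.
exists (C * (EZs + 1)); first by rewrite mulr_gt0 // ltr_wpDl.
move=> Y Y0 f0 Yi Ys; set V := E (fun x => Y x ^+ s.+1); set f := E Y in f0 *.
have Yk k : (k <= s.+1)%N -> Itg (fun x => Y x ^+ k).
  move=> ks; apply: (eq_Itg _ (Itg_exp_le Yi ks (eq_Itg _ Ys))) => x; by rewrite ger0_norm.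
have i1 := ItgZ ((1 + theta) * V) Zi; have i2 := ItgZ (C * f ^+ s.+1) Zs.
have S N : Itg (fun x => child_sum Y N x ^+ s.+1) /\ E (fun x => child_sum Y N x ^+ s.+1) <=
    (1 + theta) * V * N%:R + C * f ^+ s.+1 * N%:R ^+ s.+1.
  have [i e] := hC Y N Y0 f0 Yk; split => //; apply: (le_trans e).
  by rewrite exprMn le_eqVlt; apply/orP; left; apply/eqP; rewrite -/V -/f; ring.
have [||||i h] := @Ex_root_le _ _ _ QE (fun N x => child_sum Y N x ^+ s.+1)
  (fun N => (1 + theta) * V * N%:R + C * f ^+ s.+1 * N%:R ^+ s.+1) _ _ _ _ (ItgD i1 i2).
- by move=> N; apply: (meas_sum_exp (h := fun z => z ^+ s.+1)) => //; exact: exprn_measurable.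
- by move=> N x; rewrite exprn_ge0 // child_sum_ge0.
- by move=> N; have [] := S N.
- by move=> N; have [] := S N.
split => //; apply: (le_trans h); rewrite (ExD i1 i2) (ExZ _ Zi) (ExZ _ Zs) -/EZs.
rewrite -[E (fun x => (x [::])%:R)]/m; apply: lerD.
  by rewrite le_eqVlt; apply/orP; left; apply/eqP; ring.
rewrite [leRHS](_ : _ = C * f ^+ s.+1 * (EZs + 1)); last by ring.
by rewrite ler_wpM2l ?lerDl // mulr_ge0 ?exprn_ge0 // ltW.
Qed.

Definition gw k (x : seq nat -> nat) : R := gen_sum k (fun=> 1) x / m ^+ k.

Lemma gw_ge0 k x : 0 <= gw k x.
Proof. by rewrite divr_ge0 ?gen_sum_ge0 // exprn_ge0 // ltW. Qed.

Lemma gwE k x : gw k x = m^-1 ^+ k * gen_sum k (fun=> 1) x.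
Proof. by rewrite /gw exprVn mulrC. Qed.

Lemma gwS k x : gw k.+1 x = m^-1 * tot (gw k) x.
Proof.
rewrite (_ : tot (gw k) x = tot (fun y => m^-1 ^+ k * gen_sum k (fun=> 1) y) x).
  by rewrite totZ gwE /= exprS mulrA.
by apply: eq_bigr => i _; exact: gwE.
Qed.

Lemma gw_mean k : Itg (gw k) /\ E (gw k) = 1.
Proof.
have [i e] := gen_sum_mean k (Itg_cst Q 1); have j := ItgZ (m^-1 ^+ k) i.
split; first exact: (eq_Itg (fun x => esym (gwE k x)) j).
by rewrite (eq_Ex Q (gwE k)) (ExZ _ i) e Ex_cst mulr1 -exprMn mulVf ?expr1n // gt_eqF.
Qed.

Lemma gw_moment : exists2 K : R, 1 <= K &
  forall k, Itg (fun x => gw k x ^+ s.+1) /\ E (fun x => gw k x ^+ s.+1) <= K.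
Proof.
have th0 : 0 < (m - 1) / 2 by rewrite divr_gt0 // subr_gt0.
have [C C0 hC] := tot_moment th0.
pose lam := (m + 1) / (2 * m).
have lam1 : lam < 1 by rewrite ltr_pdivrMr ?mulr_gt0 // mul1r; lra.
have d0 : 0 < 1 - lam by rewrite subr_gt0.
have CK : 0 < C / (1 - lam) by exact: divr_gt0.
have iv0 : 0 <= m^-1 by rewrite invr_ge0 ltW.
have iv1 : m^-1 <= 1 by rewrite invf_le1 // ltW.
exists (1 + C / (1 - lam)); first by rewrite lerDl ltW.
elim=> [|k [i e]].
  have e0 x : 1 = gw 0 x ^+ s.+1 by rewrite /gw /= expr0 divr1 expr1n.
  split; first exact: (eq_Itg e0 (Itg_cst Q 1)).
  by rewrite -(eq_Ex Q e0) Ex_cst lerDl ltW.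
have [gi ge] := gw_mean k; have E0 : 0 < E (gw k) by rewrite ge.
have [ti te] := hC (gw k) (gw_ge0 k) E0 gi i.
have eS x : gw k.+1 x ^+ s.+1 = m^-1 ^+ s.+1 * tot (gw k) x ^+ s.+1 by rewrite gwS exprMn.
split; first exact: (eq_Itg (fun x => esym (eS x)) (ItgZ _ ti)).
rewrite (eq_Ex Q eS) (ExZ _ ti); move: e te; rewrite ge expr1n mulr1.
set V := E (fun x => gw k x ^+ s.+1) => e te.
have V0 : 0 <= V by apply: Ex_ge0 => x; rewrite exprn_ge0 // gw_ge0.
apply: (le_trans (ler_wpM2l (exprn_ge0 _ iv0) te)).
have p2 : m^-1 ^+ s.+1 <= m^-1 ^+ 2 by rewrite ler_wiXn2l //; case: s12 => ->.
have p1 : m^-1 ^+ s.+1 <= 1 by apply: exprn_ile1.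
rewrite mulrDr; apply: (@le_trans _ _ (lam * V + C)).
  apply: lerD; last by rewrite ler_piMl // ltW.
  rewrite mulrA ler_wpM2r //.
  apply: (le_trans (ler_wpM2r _ p2)); first by rewrite mulr_ge0 ?addr_ge0 // ltW.
  by rewrite /lam le_eqVlt; apply/orP; left; apply/eqP; field; rewrite gt_eqF.
have lam0 : 0 <= lam by rewrite divr_ge0 ?addr_ge0 ?mulr_ge0 // ltW.
apply: (le_trans (lerD (ler_wpM2l lam0 e) (lexx C))).
rewrite mulrDr mulr1 -addrA; apply: lerD; first exact: ltW.
have -> : lam * (C / (1 - lam)) + C = C / (1 - lam) by field; rewrite gt_eqF.
by [].
Qed.

(* By the inequality of means [m^-1 < th ^ 2], the condition of
   [gen_sum_small] for the factor [m^-1] per generation. *)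
Let th := (1 + m^-1) / 2.
Let th_gt0 : 0 < th. Proof. by rewrite divr_gt0 // addr_gt0 // invr_gt0. Qed.
Let th_lt1 : th < 1.
Proof.
have : m^-1 < 1 by rewrite invf_lt1.
by rewrite /th; lra.
Qed.

Lemma rate_slack : m^-1 < th ^+ 2.
Proof.
have h : m^-1 < 1 by rewrite invf_lt1.
rewrite -subr_gt0 (_ : _ - _ = ((1 - m^-1) / 2) ^+ 2); last by rewrite /th; field; rewrite gt_eqF.
by rewrite exprn_gt0 // divr_gt0 // subr_gt0.
Qed.

(** The increments of the normalized generation sizes are centered sums over a
    generation. *)
Lemma gw_cauchy : exists2 C : R, 0 < C & forall k l,
  [/\ Itg (fun x => `|gw (k + l) x - gw k x| ^+ s.+1),
      E (fun x => `|gw (k + l) x - gw k x| ^+ s.+1) <= C * th ^+ k &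
      E (fun x => `|gw (k + l) x - gw k x|) <= C * th ^+ k].
Proof.
have [K K1 hK] := gw_moment; have [C C0 hC] := gen_sum_small th_gt0 th_lt1 Zs.
have K0 : 0 < K := lt_le_trans ltr01 K1.
have a0 : 0 < 16 * K * 1 by rewrite !mulr_gt0.
exists (C * (16 * K * 1) ^+ s.+1 + 16 * K * 1).
  by rewrite addr_gt0 // mulr_gt0 // exprn_gt0.
move=> k l; have [gi ge] := gw_mean l; have [gsi gse] := hK l.
have ce : centered (16 * K * 1) (fun x => gw l x - 1).
  by apply: centered_sub => //; [exact: gw_ge0 | rewrite expr1n mulr1].
have iv0 : 0 < m^-1 by rewrite invr_gt0.
have rate : m^-1 ^+ 2 * m <= th ^+ 2.
  by rewrite expr2 -mulrA mulVf ?gt_eqF // mulr1 ltW // rate_slack.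
have [h1 h2 h3] := hC m^-1 (16 * K * 1) _ k iv0 rate a0 ce.
have e x : m^-1 ^+ k * gen_sum k (fun x => gw l x - 1) x = gw (k + l) x - gw k x.
  have -> : gen_sum k (fun x => gw l x - 1) x =
      gen_sum k (fun y => m^-1 ^+ l * gen_sum l (fun=> 1) y - 1) x.
    by congr gen_sum; apply/funext => y; rewrite gwE.
  by rewrite gen_sum_affine mul1r !gwE gen_sum_add exprD; ring.
have t0 : 0 <= th ^+ k by rewrite exprn_ge0 // ltW.
split.
- by apply: eq_Itg h1 => x; rewrite e.
- rewrite -(@eq_Ex _ Q (fun x => `|m^-1 ^+ k * gen_sum k (fun x => gw l x - 1) x| ^+ s.+1) _).
    by apply: (le_trans h2); rewrite mulrAC ler_wpM2r // lerDl ltW.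
  by move=> x; rewrite e.
- rewrite -(@eq_Ex _ Q (fun x => `|m^-1 ^+ k * gen_sum k (fun x => gw l x - 1) x|) _).
    apply: (le_trans h3); rewrite mulrC ler_wpM2r // lerDr mulr_ge0 ?exprn_ge0 //; exact: ltW.
  by move=> x; rewrite e.
Qed.

Definition gw_lim (x : seq nat -> nat) : R := limn (gw ^~ x).

Lemma meas_gw k : meas setT (gw k).
Proof. by have [/Itg_meas] := gw_mean k. Qed.

Lemma gw_lim_ge0 x : 0 <= gw_lim x.
Proof.
rewrite /gw_lim; have [cv|ncv] := pselect (cvgn (gw ^~ x)).
  by apply: limr_ge => //; apply: nearW => n; exact: gw_ge0.
by rewrite (dvgP ncv).
Qed.

Lemma meas_gw_lim : meas setT gw_lim.
Proof.
pose A := [set x : tree_space setT | forall j, exists n, forall k, (n <= k)%N ->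
  `|gw k x - gw n x| <= j.+1%:R^-1].
have cvA (x : tree_space setT) : A x <-> cvgn (gw ^~ x).
  split=> [Ax|cv].
    apply/cauchy_cvgP; apply: cauchy_exP => e e0.
    have [j hj] : exists j, j.+1%:R^-1 <= e / 2 :> R.
      exists (Num.bound (e / 2)^-1); rewrite -[leRHS]invrK lef_pV2 ?posrE ?invr_gt0 ?divr_gt0 //.
      apply: (@le_trans _ _ (Num.bound (e / 2)^-1)%:R); last by rewrite ler_nat.
      by apply/ltW/archi_boundP; rewrite invr_ge0 divr_ge0 // ltW.
    have [n hn] := Ax j; exists (gw n x); exists n => // k nk; rewrite /ball /= distrC.
    apply: (le_lt_trans (le_trans (hn k nk) hj)).
    by rewrite ltr_pdivrMr // ltr_pMr // ltr1n.
  move=> j; have e0 : 0 < (2 * j.+1%:R)^-1 :> R by rewrite invr_gt0 mulr_gt0.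
  move/cvgrPdist_le : cv => /(_ _ e0)[n _ hn]; exists n => k nk.
  have := hn n (leqnn n); have := hn k nk; rewrite /=; set l := lim _; set a := gw k x; set b := gw n x.
  move=> q1 q2; rewrite (_ : a - b = (l - b) - (l - a)); last by ring.
  apply: (le_trans (ler_normB _ _)); apply: (le_trans (lerD q2 q1)).
  by rewrite le_eqVlt; apply/orP; left; apply/eqP; field; rewrite gt_eqF.
have mA : measurable A.
  have -> : A = \bigcap_j \bigcup_n \bigcap_(k in [set k | (n <= k)%N])
      [set x : tree_space setT | `|gw k x - gw n x| <= j.+1%:R^-1].
    apply/seteqP; split=> x /= h.
      by move=> j _; have [n hn] := h j; exists n => // k /= nk; exact: hn.
    by move=> j; have [n _ hn] := h j I; exists n => k nk; exact: hn.
  apply: bigcapT_measurable => j; apply: bigcupT_measurable => n.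
  apply: bigcap_measurable; first by exists n => /=.
  move=> k _; rewrite -[X in measurable X]setTI.
  have md : measurable_fun setT (fun x : tree_space setT => `|gw k x - gw n x|).
    by apply: measurableT_comp => //; apply: measurable_funB; exact: meas_gw.
  exact: (measurable_fun_le md (measurable_cst (j.+1%:R^-1 : R))) ||
  exact: (@measurable_le _ _ _ _ _ _ md (measurable_cst _)) ||
  (rewrite (_ : [set x | _] = (fun x : tree_space setT => `|gw k x - gw n x|) @^-1` `]-oo, (j.+1%:R^-1)]);
   [exact: md | by apply/seteqP; split=> x /=; rewrite in_itv /=]).
apply: (@measurable_fun_cvg _ (tree_space setT) R setT
   (fun k (x : tree_space setT) => gw k x * \1_A x) gw_lim).
  move=> k; apply: measurable_funM; first exact: meas_gw.
  exact: measurable_indic.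
move=> x _; rewrite /gw_lim; have [Ax|nAx] := pselect (A x).
  have -> : (fun k => gw k x * \1_A x) = (gw ^~ x).
    by apply/funext => k; rewrite indicE mem_set // mulr1.
  exact/cvA.
have -> : (fun k => gw k x * \1_A x) = fun=> 0.
  by apply/funext => k; rewrite indicE memNset // mulr0.
have /dvgP -> : ~ cvgn (gw ^~ x) by move/cvA.
exact: cvg_cst.
Qed.

Lemma gw_cvg : {ae Q, forall x, gw k x @[k --> \oo] --> gw_lim x}.
Proof.
have [C C0 hC] := gw_cauchy; have t1 : 0 < 1 - th by rewrite subr_gt0.
have Di k : Itg (fun x => `|gw k.+1 x - gw k x|).
  by apply: Itg_norm; apply: ItgB; [have [] := gw_mean k.+1 | have [] := gw_mean k].
have B n : \sum_(0 <= k < n) E (fun x => `|gw k.+1 x - gw k x|) <= C / (1 - th).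
  apply: (@le_trans _ _ (\sum_(0 <= k < n) C * th ^+ k)).
    by apply: ler_sum => k _; have [_ _] := hC k 1%N; rewrite addn1.
  rewrite -mulr_sumr ler_wpM2l ?(ltW C0) //.
  exact: geo_sum_le.
apply: aeS (ae_cvg_series Di (fun k x => normr_ge0 _) B) => x cv.
have cv2 : cvgn (series (fun k => gw k.+1 x - gw k x)) by apply: normed_cvg.
rewrite /gw_lim -[_ --> _]/(cvgn (gw ^~ x)).
have e : gw ^~ x = (fun k => gw 0 x + series (fun k => gw k.+1 x - gw k x) k).
  by apply/funext => k; rewrite /series /= telescope_sumr // addrC subrK.
by rewrite e; apply: is_cvgD => //; exact: is_cvg_cst.
Qed.

(** Fatou's lemma passes to the limit in the distance between two generations. *)
Lemma gw_lim_dist : exists2 C : R, 0 < C & forall k,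
  [/\ Itg (fun x => `|gw k x - gw_lim x| ^+ s.+1),
      E (fun x => `|gw k x - gw_lim x| ^+ s.+1) <= C * th ^+ k,
      Itg (fun x => `|gw k x - gw_lim x|) &
      E (fun x => `|gw k x - gw_lim x|) <= C * th ^+ k].
Proof.
have [C C0 hC] := gw_cauchy; exists C => // k.
have md : meas setT (fun x => gw k x - gw_lim x).
  by apply: measurable_funB; [exact: meas_gw | exact: meas_gw_lim].
have mn : meas setT (fun x => `|gw k x - gw_lim x|) by exact: measurableT_comp.
have cvn (x : seq nat -> nat) : gw n x @[n --> \oo] --> gw_lim x ->
    `|gw (k + l) x - gw k x| @[l --> \oo] --> `|gw k x - gw_lim x|.
  move=> cv; rewrite distrC; apply: cvg_norm; apply: cvgB; last exact: cvg_cst.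
  have -> : (fun l => gw (k + l) x) = (fun l => gw (l + k) x).
    by apply/funext => l; rewrite addnC.
  by rewrite (cvg_shiftn k (gw ^~ x)).
have Di l : Itg (fun x => `|gw (k + l) x - gw k x|).
  by apply: Itg_norm; apply: ItgB; [have [] := gw_mean (k + l) | have [] := gw_mean k].
have [||||||i1 e1] := @Ex_fatou R Q (fun l x => `|gw (k + l) x - gw k x| ^+ s.+1)
  (fun x => `|gw k x - gw_lim x| ^+ s.+1) (C * th ^+ k).
- by move=> l; have [] := hC k l.
- by move=> l x; exact: exprn_ge0.
- by move=> l; have [] := hC k l.
- by apply: (meas_comp (g := fun z => z ^+ s.+1)) => //; exact: exprn_measurable.
- by move=> x; exact: exprn_ge0.
- by apply: aeS gw_cvg => x /cvn cv; apply: (@cvg_comp _ _ _ _ (fun z : R => z ^+ s.+1) _ _ _ cv); exact: exprn_continuous.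
have [||||||i2 e2] := @Ex_fatou R Q (fun l x => `|gw (k + l) x - gw k x|)
  (fun x => `|gw k x - gw_lim x|) (C * th ^+ k) => //.
- by move=> l; have [] := hC k l.
- by apply: aeS gw_cvg => x /cvn.
Qed.

Lemma gw_lim_moments : [/\ Itg gw_lim, E gw_lim = 1 & Itg (fun x => gw_lim x ^+ s.+1)].
Proof.
have [C C0 hC] := gw_lim_dist; have [_ _ i1 _] := hC 0%N; have [i2 _ _ _] := hC 0%N.
have e0 x : gw 0 x = 1 by rewrite /gw /= expr0 divr1.
have iW : Itg gw_lim.
  apply: (Itg_le meas_gw_lim _ (ItgD i1 (Itg_cst Q 1))) => x.
  rewrite e0 distrC -[X in `|X| <= _](subrK 1).
  by rewrite (le_trans (ler_normD _ _)) // normr1.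
split => //.
  have cv : C * th ^+ k @[k --> \oo] --> (0 : R).
    by rewrite -[X in _ --> X](mulr0 C); apply: cvgMr; apply: cvg_expr; rewrite ger0_norm // ltW.
  apply/eqP; rewrite -subr_eq0 -normr_le0; apply/ler_addgt0Pr => e e_gt0; rewrite add0r.
  move/cvgrPdist_le : cv => /(_ _ e_gt0)[k _ /(_ k (leqnn k))].
  rewrite sub0r normrN ger0_norm; last by rewrite mulr_ge0 ?exprn_ge0 // ltW.
  apply: le_trans; have [_ _ i e3] := hC k; apply: le_trans e3; have [gi ge] := gw_mean k.
  by rewrite -ge distrC -(ExB gi iW); exact: (le_norm_Ex (ItgB gi iW)).
apply: (Itg_le _ _ (ItgZ (2 ^+ s.+1) (ItgD i2 (Itg_cst Q 1)))).
  by apply: (meas_comp (g := fun z => z ^+ s.+1)); [exact: exprn_measurable | exact: meas_gw_lim].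
move=> x; have W0 := gw_lim_ge0 x; rewrite ger0_norm ?exprn_ge0 //.
have := add_expr_le s.+1 (normr_ge0 (gw 0 x - gw_lim x)) ler01; rewrite expr1n.
apply: le_trans; rewrite lerXn2r ?nnegrE ?addr_ge0 // e0 distrC.
by rewrite -{1}(subrK 1 (gw_lim x)) lerD2r ler_norm.
Qed.

End Branching.

(** * Convergence of the normalized log odds at the root *)

(** The neighbourhoods, in the set of all pairs of a parameter and a height,
    of the regime of the theorem: the parameter decreases to its critical
    value slowly enough for its product with the height to diverge. Limits
    along this filter are uniform over all the sequences of the theorem, which
    permits to change the height and the parameter independently. *)
Definition scaling (R : realType) (betac : R) : set_system (R * nat) :=
  [set A | exists e0 M : R, 0 < e0 /\ forall (beta : R) n, betac < beta ->
     beta <= betac + e0 -> M <= n%:R * (beta - betac) -> A (beta, n)].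

Global Instance scaling_filter (R : realType) (betac : R) : Filter (scaling betac).
Proof.
split.
- by exists 1, 0.
- move=> A B [e1 [M1 [e10 h1]]] [e2 [M2 [e20 h2]]].
  exists (Num.min e1 e2), (Num.max M1 M2); split; first by rewrite lt_min e10.
  move=> b n bc be; rewrite ge_max => /andP[n1 n2]; split.
    by apply: h1 => //; apply: (le_trans be); rewrite lerD2l ge_min lexx.
  by apply: h2 => //; apply: (le_trans be); rewrite lerD2l ge_min lexx orbT.
- by move=> A B AB [e [M [e0 h]]]; exists e, M; split => // b n *; apply: AB; exact: h.
Qed.

Section ScalingFilter.
Variables (R : realType) (betac : R).
Notation sc := (scaling betac).
Implicit Types z : R * nat.

Lemma near_scaling (e C : R) : 0 < e ->
  \forall z \near sc, [/\ betac < z.1, z.1 <= betac + e & C <= z.2%:R * (z.1 - betac)].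
Proof. by move=> e0; exists e, C; split. Qed.

Lemma scaling_shift k : (z.1, (z.2 - k)%N) @[z --> sc] --> sc.
Proof.
move=> A [e [M [e0 h]]]; apply: filterS (near_scaling (M + k%:R) (_ : 0 < Num.min e 1)); last first.
  by rewrite lt_min e0 ltr01.
move=> [b n] /= [h1 h2 h3]; apply: h => //.
  by apply: (le_trans h2); rewrite lerD2l ge_min lexx.
have ep : 0 <= b - betac by rewrite subr_ge0 ltW.
have ep1 : b - betac <= 1 by rewrite lerBlDl (le_trans h2) // lerD2l ge_min lexx orbT.
have hn : n%:R - k%:R <= (n - k)%N%:R :> R.
  by rewrite lerBlDr -natrD ler_nat addnC -leq_subLR.
apply: le_trans (ler_wpM2r ep hn); rewrite mulrBl lerBrDr; apply: le_trans h3.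
by rewrite lerD2l ler_piMr.
Qed.

Lemma scaling_half : (z.1, z.2./2) @[z --> sc] --> sc.
Proof.
move=> A [e [M [e0 h]]]; apply: filterS (near_scaling (2 * M + 1) (_ : 0 < Num.min e 1)); last first.
  by rewrite lt_min e0 ltr01.
move=> [b n] /= [h1 h2 h3]; apply: h => //.
  by apply: (le_trans h2); rewrite lerD2l ge_min lexx.
have ep : 0 <= b - betac by rewrite subr_ge0 ltW.
have ep1 : b - betac <= 1 by rewrite lerBlDl (le_trans h2) // lerD2l ge_min lexx orbT.
have hn : n%:R <= 2 * n./2%:R + 1 :> R.
  rewrite -natrM -[1](_ : 1%:R = _) // -natrD ler_nat -{1}(odd_double_half n) addnC.
  by rewrite -mul2n leq_add2l leq_b1.
have arith (x y : R) : y <= 1 -> 2 * M + 1 <= (2 * x + 1) * y -> M <= x * y.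
  have -> : (2 * x + 1) * y = 2 * (x * y) + y by ring.
  by move: (x * y) => w; lra.
exact: arith ep1 (le_trans h3 (ler_wpM2r ep hn)).
Qed.

(** The sequences of the theorem converge along this filter. *)
Lemma scaling_seq (b : nat -> R) (N : nat -> nat) : b n @[n --> \oo] --> betac ->
  (N n)%:R * (b n - betac) @[n --> \oo] --> +oo -> (b n, N n) @[n --> \oo] --> sc.
Proof.
move=> cb cn A [e [M [e0 h]]].
move/cvgrPdist_le : cb => /(_ _ e0) cb; move/cvgryPge : cn => cn.
apply: filterS3 cb (cn M) (cn 1) => n h1 h2 h3.
have pos : betac < b n.
  rewrite -subr_gt0 ltNge; apply/negP => hle.
  have := mulr_ge0_le0 (ler0n R (N n)) hle; move: h3; move: (_ * _) => y; lra.
apply: h => //; rewrite -lerBlDl; apply: le_trans h1.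
by rewrite distrC ler_norm.
Qed.

End ScalingFilter.

Section PartOne.
Variables (R : realType) (mu : probability nat R).
Variable Q : probability (tree_space setT) R.
Variables (q betac : R).
Hypothesis H : critical_tree mu Q q betac.
Let m := mean_children Q.
Let m_gt1 : 1 < m := ct_mean H.
Let m_gt0 : 0 < m. Proof. exact: lt_trans ltr01 m_gt1. Qed.
Let s := crit_exp q.
Let bc0 : 0 < betac. Proof. exact: (betac_gt0 (ct_q H) (ct_mean H) (ct_crit H)). Qed.
Let s12 : s = 1%N \/ s = 2%N := crit_expP q.
Let s_gt0 : (0 < s)%N. Proof. by case: s12 => ->. Qed.

Notation E := (Ex Q).
Notation Itg := (Itg Q).
Notation msg := (message q).
Notation f := (msg_mean Q q).
Notation Phi := (Phi Q q).
Notation pull := (pull Q q).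
Notation sc := (scaling betac).
Notation W := (gw_lim Q).
Notation gw := (gw Q).
Notation inrange beta := (betac <= beta <= betac + 1).
Implicit Types z : R * nat.

Hypothesis Zs : Itg (fun x => (x [::])%:R ^+ s.+1).
Let EZs := E (fun x => (x [::])%:R ^+ s.+1).
Let EZs0 : 0 <= EZs. Proof. by apply: Ex_ge0 => x; exact: exprn_ge0. Qed.

Let Phi_le (c : R) : 0 <= c -> Phi c <= EZs * c ^+ s.+1.
Proof.
move=> c0; rewrite mulrC -(ExZ _ Zs); apply: le_Ex; [exact: Itg_Phi | exact: ItgZ |] => x.
rewrite -exprMn lerXn2r ?nnegrE ?trunc_root_ge0 ?mulr_ge0 //.
by rewrite (mulrC c) trunc_root_le.
Qed.

Let pull_le (c : R) : 0 <= c -> pull c <= EZs * c ^+ s.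
Proof.
move=> c0; rewrite mulrC -(ExZ _ Zs); apply: le_Ex; [exact: (Itg_pull H) | exact: ItgZ |] => x.
rewrite exprS mulrCA ler_wpM2l // -exprMn lerXn2r ?nnegrE ?trunc_root_ge0 ?mulr_ge0 //.
by rewrite (mulrC c) trunc_root_le.
Qed.

(** With a finite moment of order [s + 1], the truncated moment at scale [c]
    is of the order of [c ^ (s + 1)]. *)
Lemma regular_of_moment : regular_tail Q q.
Proof.
exists (EZs + 1), (2^-1 ^+ s.+1), 1; split => //; first by rewrite ltr_wpDl.
  split; first by rewrite exprn_gt0 // invr_gt0.
  apply: (@le_lt_trans _ _ (2^-1 ^+ 2)); last by rewrite expr2; lra.
  by rewrite ler_wiXn2l ?invr_ge0 ?invf_le1 ?ler1n //; case: s12 => ->.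
move=> c j c0 c1; have h0 : 0 <= 2^-1 ^+ j * c :> R by rewrite mulr_ge0 ?exprn_ge0 ?invr_ge0 // ltW.
apply: (le_trans (Phi_le h0)).
have hP : c ^+ s.+1 <= Phi c.
  by have := Phi_ge H (ltW c0); rewrite (min_idPl c1).
have p0 : 0 <= (2^-1 ^+ s.+1) ^+ j :> R by rewrite !exprn_ge0 // invr_ge0.
have -> : EZs * (2^-1 ^+ j * c) ^+ s.+1 = EZs * (2^-1 ^+ s.+1) ^+ j * c ^+ s.+1.
  by rewrite exprMn -!exprM (mulnC j) mulrA.
apply: ler_pM => //; rewrite ?mulr_ge0 ?exprn_ge0 ?(ltW c0) //.
by rewrite ler_wpM2r // lerDl.
Qed.

Definition root_eps z : R := (z.1 - betac) `^ (s%:R^-1).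

Lemma root_eps_expr z : betac < z.1 -> root_eps z ^+ s = z.1 - betac.
Proof.
move=> h; have e0 : 0 < z.1 - betac by rewrite subr_gt0.
rewrite -powR_mulrn ?powR_ge0 // -powRrM mulVf ?pnatr_eq0 -?lt0n //.
by rewrite powRr1 // ltW.
Qed.

Lemma root_eps_gt0 z : betac < z.1 -> 0 < root_eps z.
Proof. by move=> h; rewrite powR_gt0 // subr_gt0. Qed.

Lemma root_eps_cvg : root_eps z @[z --> sc] --> (0 : R).
Proof.
apply/cvgrPdist_le => e e0; have es : 0 < e ^+ s by exact: exprn_gt0.
apply: filterS (near_scaling betac 0 es) => z [h1 h2 _].
rewrite sub0r normrN ger0_norm ?powR_ge0 //.
rewrite -(@ler_pXn2r _ s) ?nnegrE ?powR_ge0 ?(ltW e0) // root_eps_expr //.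
by rewrite lerBlDl.
Qed.

(** With a finite moment of order [s + 1], [pull y] is of the order of [y ^
    s], and the stationary level of the order of the root of the distance to
    criticality. *)
Lemma msg_mean_order : exists c1 c2 : R, [/\ 0 < c1, 0 < c2 &
  \forall z \near sc, c1 * root_eps z <= f z.1 z.2 <= c2 * root_eps z].
Proof.
have [eps0 [k1 [k2 [r [C [[e0 e1] [k10 k20] [r0 r1] C0 hs]]]]]] := msg_mean_scale H regular_of_moment.
have EZ1 : 0 < EZs + 1 by rewrite ltr_wpDl.
pose c := Num.min 1 (k1 / (EZs + 1)).
have c0 : 0 < c by rewrite lt_min ltr01 divr_gt0.
have c1 : c <= 1 by rewrite ge_min lexx.
have ck : c <= k1 / (EZs + 1) by rewrite ge_min lexx orbT.
pose d := Num.max 1 k2.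
have d1 : 1 <= d by rewrite le_max lexx.
have d0 : 0 < d := lt_le_trans ltr01 d1.
have dk : k2 <= d by rewrite le_max lexx orbT.
exists (r * c), d; split => //; first exact: mulr_gt0.
have small : 0 < Num.min betac (d^-1) by rewrite lt_min bc0 invr_gt0.
move/cvgrPdist_le : root_eps_cvg => /(_ _ small) near1.
have cC : C < C + 1 by rewrite ltrDl.
apply: filterS2 near1 (near_scaling betac (C + 1) e0) => z; rewrite sub0r normrN ger0_norm ?powR_ge0 // le_min.
move=> /andP[hb hd] [h1 h2 h3]; have rp := root_eps_gt0 h1.
have [lo up] := hs z.1 z.2 h1 h2; apply/andP; split.
  rewrite -mulrA; apply: lo; first exact: mulr_gt0.
    by apply: le_trans hb; rewrite ler_piMl // ltW.
  apply: (le_trans (pull_le _)); first by rewrite mulr_ge0 // ltW.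
  rewrite exprMn root_eps_expr // mulrA; apply: ler_wpM2r; first by rewrite subr_ge0 ltW.
  apply: (@le_trans _ _ ((EZs + 1) * c)).
    apply: ler_pM => //; rewrite ?exprn_ge0 ?(ltW c0) ?lerDl //.
    by rewrite -[leRHS]expr1 ler_wiXn2l // ltW.
  by rewrite mulrC -ler_pdivlMr.
case: (up (d * root_eps z)) => [||//|h]; first exact: mulr_gt0.
  have dr1 : d * root_eps z <= 1 by rewrite -ler_pdivlMl // mulr1.
  have dr0 : 0 < d * root_eps z by exact: mulr_gt0.
  have hP : (d * root_eps z) ^+ s.+1 <= Phi (d * root_eps z).
    by have := Phi_ge H (ltW dr0); rewrite (min_idPl dr1).
  have := le_trans hP (Phi_le_pull H (ltW dr0)); rewrite exprS ler_pM2l //; apply: le_trans.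
  rewrite exprMn root_eps_expr // ler_wpM2r ?subr_ge0 ?(ltW h1) //.
  by apply: (le_trans dk); rewrite -[leLHS]expr1 ler_weXn2l.
by have := le_lt_trans h cC; rewrite ltNge h3.
Qed.

Lemma msg_mean_cvg0 : f z.1 z.2 @[z --> sc] --> (0 : R).
Proof.
have [c1 [c2 [c10 c20 hc]]] := msg_mean_order.
apply: (@squeeze_cvgr _ _ _ _ (fun=> 0) (fun z => c2 * root_eps z)).
- apply: filterS2 hc (near_scaling betac 0 ltr01) => z /andP[h1 h2] [h3 _ _]; rewrite h2 andbT.
  by apply: le_trans h1; rewrite mulr_ge0 ?powR_ge0 // ltW.
- exact: cvg_cst.
- by rewrite -[X in _ --> X](mulr0 c2); apply: cvgMr; exact: root_eps_cvg.
Qed.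

(** Over a number [k] of generations, the mean message is multiplied by [(m *
    psi q beta) ^ k] up to a relative correction [k * f ^ s], the accumulated
    defects. *)
Lemma msg_mean_linear : exists eps0 kappa : R, [/\ 0 < eps0, eps0 <= 1, 0 < kappa &
  forall beta n k, betac <= beta -> beta <= betac + eps0 ->
  [/\ 1 <= m * psi q beta, f beta (n + k) <= (m * psi q beta) ^+ k * f beta n &
      (m * psi q beta) ^+ k * f beta n * (1 - k%:R * (kappa * f beta n ^+ s)) <= f beta (n + k)]].
Proof.
have [p [p_range Zp]] := regular_moment H regular_of_moment.
have [eps0 [K [e0 e1 K0 hK]]] := defect_mean_upper H p_range Zp.
have [b1 [b2 [b10 b20 hg]]] := growth_linear (ct_q H) (ct_mean H) (ct_crit H).
exists eps0, (K * (EZs + 1)); split => //; first by rewrite mulr_gt0 // ltr_wpDl.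
move=> beta n k h1 h2.
have hb : inrange beta by rewrite h1 (le_trans h2) // lerD2l.
have /andP[_ bm] := hb.
have f0 j : 0 < f beta j := msg_mean_gt0 H hb j.
have M1 : 1 <= m * psi q beta.
  have [g1 _] := hg _ h1 bm; rewrite -subr_ge0; apply: le_trans g1.
  by rewrite mulr_ge0 ?subr_ge0 // ltW.
set M := m * psi q beta in M1 *; have M0 : 0 < M := lt_le_trans ltr01 M1.
have D0 j : 0 <= E (fun x => defect q beta (tot (msg beta j) x)).
  apply: Ex_ge0 => x; apply: (defect_ge0 (ct_q H) (lt_le_trans bc0 h1)).
  exact: (tot_ge0 H hb).
split => //.
  elim: k => [|k IHk]; first by rewrite addn0 mul1r.
  rewrite addnS (msg_meanS H hb) -/m -/M exprS -mulrA.
  apply: (@le_trans _ _ (M * f beta (n + k))); first by rewrite gerBl.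
  by rewrite ler_pM2l.
set x := K * (EZs + 1) * f beta n ^+ s.
have x0 : 0 <= x by rewrite !mulr_ge0 ?addr_ge0 ?exprn_ge0 // ltW.
elim: k => [|k IHk]; first by rewrite addn0 mul0r subr0 mulr1 mul1r.
have [x1|x1] := leP x 1; last first.
  apply: (@le_trans _ _ 0); last exact: ltW.
  rewrite mulr_ge0_le0 ?mulr_ge0 ?exprn_ge0 ?(ltW M0) ?(ltW (f0 n)) // subr_le0.
  rewrite -(natr1 k) mulrDl mul1r; have kx : 0 <= k%:R * x by rewrite mulr_ge0.
  by move: (k%:R * x) kx x1 => y y0 y1; apply: (le_trans (ltW y1)); rewrite lerDr.
have step : M * f beta (n + k) * (1 - x) <= f beta (n + k.+1).
  rewrite addnS (msg_meanS H hb) -/m -/M mulrBr mulr1; apply: lerB => //.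
  apply: (le_trans (hK _ _ h1 h2)).
  have fk : f beta (n + k) <= f beta n by apply: (msg_mean_le H hb); exact: leq_addr.
  have pl : K * pull (f beta (n + k)) <= x.
    rewrite /x -mulrA; apply: (ler_wpM2l (ltW K0)).
    apply: (le_trans (pull_le (ltW (f0 _)))).
    apply: ler_pM; rewrite ?exprn_ge0 ?(ltW (f0 _)) //; first by rewrite lerDl.
    by rewrite lerXn2r ?nnegrE ?(ltW (f0 _)).
  rewrite mulrCA -mulrA; apply: (@le_trans _ _ (f beta (n + k) * x)).
    by rewrite ler_pM2l.
  by rewrite ler_peMl // mulr_ge0 // ltW.
apply: le_trans step; rewrite exprS -(natr1 k).
have y1 : 0 <= 1 - x by rewrite subr_ge0.
have := ler_wpM2r y1 (ler_wpM2l (ltW M0) IHk); apply: le_trans.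
have A0 : 0 <= M * (M ^+ k * f beta n).
  exact: mulr_ge0 (ltW M0) (mulr_ge0 (exprn_ge0 k (ltW M0)) (ltW (f0 n))).
have -> : M * M ^+ k * f beta n * (1 - (k%:R + 1) * x) = M * (M ^+ k * f beta n) * (1 - (k%:R + 1) * x) by ring.
have -> : M * (M ^+ k * f beta n * (1 - k%:R * x)) * (1 - x) =
  M * (M ^+ k * f beta n) * ((1 - k%:R * x) * (1 - x)) by ring.
apply: (ler_wpM2l A0); rewrite -subr_ge0 (_ : _ - _ = k%:R * x ^+ 2); last by ring.
by rewrite mulr_ge0 ?sqr_ge0.
Qed.

(** ** Comparison with the linear recursion *)

(** The transfer function lies below its tangent at the origin, so that
    iterating the linear recursion over the last [k] generations gives an
    upper bound. *)
Lemma tot_le_gen_sum beta n k x : inrange beta ->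
  tot (msg beta (n + k)) x <= psi q beta ^+ k * gen_sum k (tot (msg beta n)) x.
Proof.
move=> hb; have /andP[h1 _] := hb; have b0 : 0 < beta := lt_le_trans bc0 h1.
have p0 := psi_gt0 (ct_q H) b0.
elim: k x => [|k IHk] x; first by rewrite addn0 mul1r.
rewrite addnS /= -totZ; apply: ler_sum => i _.
apply: (le_trans (transfer_le_psi H hb (tot_ge0 H hb _ _))).
by rewrite exprS -mulrA ler_pM2l // IHk.
Qed.

Let th := (1 + m^-1) / 2.

(** Over the last [k] generations the log odds lie below the iterated linear
    recursion [T], and the means differ only by the accumulated defects, so
    that the distance in mean is at most [rho - 1]. The linear recursion is a
    sum of independent variables over generation [k], close to [gw k] up to an
    error exponentially small in [k]. *)
Lemma tot_dist : exists eps0 C : R, [/\ 0 < eps0, eps0 <= 1, 0 < C &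
  forall beta n k, betac <= beta -> beta <= betac + eps0 ->
  let a := m * f beta (n + k) in
  let rho := (m * psi q beta) ^+ k * f beta n / f beta (n + k) in
  let T x := psi q beta ^+ k * gen_sum k (tot (msg beta n)) x in
  [/\ 1 <= rho,
      E (fun x => `|tot (msg beta (n + k)) x / a - gw k x|) <= 2 * (rho - 1) + C * rho * th ^+ k,
      Itg (fun x => `|T x / a - W x| ^+ s.+1) &
      E (fun x => `|T x / a - W x| ^+ s.+1) <= C * (rho ^+ s.+1 * th ^+ k + (rho - 1) ^+ s.+1)]].
Proof.
have [p [p_range Zp]] := regular_moment H regular_of_moment.
have [ev [Cv [ev0 ev1 Cv0 hV]]] := msg_moment_bound H p_range Zp.
have [el [kappa [el0 el1 ka0 hl]]] := msg_mean_linear.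
have [Ct Ct0 hT] := tot_moment H Zs ltr01.
have [Kg Kg1 hgw] := gw_moment H Zs.
have [Cg Cg0 hgd] := gw_lim_dist H Zs.
have [b1 [b2 [b10 b20 hg]]] := growth_linear (ct_q H) (ct_mean H) (ct_crit H).
have iv1 : m^-1 < 1 by rewrite invf_lt1.
have th0 : 0 < th by rewrite divr_gt0 // addr_gt0 // invr_gt0.
have th1 : th < 1 by rewrite /th; lra.
have sl : 0 < m * th ^+ 2 - 1.
  have := rate_slack H; rewrite -/m -/th -(ltr_pM2l m_gt0) mulfV ?gt_eqF // => h.
  by rewrite subr_gt0.
have [Cs Cs0 hS] := gen_sum_small H th0 th1 Zs.
pose er := Num.min 1 ((m * th ^+ 2 - 1) / 3) / b2.
have er0 : 0 < er by rewrite divr_gt0 // lt_min ltr01 divr_gt0.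
pose eps0 := Num.min (Num.min ev el) er.
pose K0 := 2 * m * (Cv * EZs) + Ct; pose K := K0 + 1.
have K00 : 0 <= K0 by rewrite addr_ge0 ?mulr_ge0 // ltW.
have K1 : 1 <= K by rewrite lerDr.
have Kp : 0 < K := lt_le_trans ltr01 K1.
pose C := 4 ^+ s.+1 * (Cs * (16 * K) ^+ s.+1 + Kg + Cg) + 16 * K.
have K16 : 0 < 16 * K by exact: mulr_gt0.
have Kgp : 0 < Kg := lt_le_trans ltr01 Kg1.
have CK : 0 < Cs * (16 * K) ^+ s.+1 := mulr_gt0 Cs0 (exprn_gt0 _ K16).
have C4 : 0 < 4 ^+ s.+1 * (Cs * (16 * K) ^+ s.+1 + Kg + Cg).
  exact: mulr_gt0 (exprn_gt0 _ (ltr0Sn R 3)) (addr_gt0 (addr_gt0 CK Kgp) Cg0).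
have KC : 16 * K <= C by rewrite /C lerDr ltW.
have Cpos : 0 < C := lt_le_trans K16 KC.
exists eps0, C; split => //.
- by rewrite !lt_min ev0 el0.
- by rewrite !ge_min ev1.
move=> beta n k h1 h2.
have h2v : beta <= betac + ev by apply: (le_trans h2); rewrite lerD2l !ge_min lexx.
have h2l : beta <= betac + el by apply: (le_trans h2); rewrite lerD2l !ge_min lexx !orbT.
have h2r : beta <= betac + er by apply: (le_trans h2); rewrite lerD2l !ge_min lexx !orbT.
have hb : inrange beta by rewrite h1 (le_trans h2l) // lerD2l.
have /andP[_ bm] := hb; have b0 : 0 < beta := lt_le_trans bc0 h1.
have p0 := psi_gt0 (ct_q H) b0.
have [M1 up _] := hl beta n k h1 h2l.
have f0 j : 0 < f beta j := msg_mean_gt0 H hb j.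
set a := m * f beta (n + k); set rho := _ / f beta (n + k).
have a0 : 0 < a by rewrite mulr_gt0.
pose an := m * f beta n; have an0 : 0 < an by rewrite mulr_gt0.
have rho1 : 1 <= rho by rewrite ler_pdivlMr // mul1r.
have rho0 : 0 < rho := lt_le_trans ltr01 rho1.
have ana : an / a <= rho.
  rewrite /an /a /rho -mulf_div mulfV ?gt_eqF // mul1r ler_pM2r ?invr_gt0 //.
  by rewrite ler_peMl ?(ltW (f0 n)) // exprn_ege1.
have rate : psi q beta ^+ 2 * m <= th ^+ 2.
  have [_ g2] := hg _ h1 bm; set M := m * psi q beta in M1 g2 *.
  have x1 : b2 * (beta - betac) <= Num.min 1 ((m * th ^+ 2 - 1) / 3).
    by rewrite mulrC -ler_pdivlMr // lerBlDl.
  move: x1; rewrite le_min => /andP[x1 x2].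
  have MM : M ^+ 2 <= m * th ^+ 2.
    have y0 : 0 <= M - 1 by rewrite subr_ge0.
    have y1 := le_trans g2 x1; have y2 := le_trans g2 x2.
    have -> : M ^+ 2 = 1 + (M - 1) * (2 + (M - 1)) by ring.
    move: (M - 1) y0 y1 y2 => y y0 y1; rewrite ler_pdivlMr // => y2.
    have := ler_wpM2l y0 (lerD (lexx 2) y1); lra.
  have -> : psi q beta ^+ 2 * m = M ^+ 2 / m by rewrite /M; field; rewrite gt_eqF.
  by rewrite ler_pdivrMr // mulrC.
have Xi := Itg_tot H hb n; have eX : E (tot (msg beta n)) = an := Ex_tot_message H hb n.
have X0 x : 0 <= tot (msg beta n) x := tot_ge0 H hb n x.
have Yi := Itg_message H hb n.
have [Xs eXs] := hT (msg beta n) (message_ge0 H hb n) (f0 n) Yi (Itg_message_exp H hb n s.+1).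
have fs0 : 0 <= f beta n ^+ s.+1 by rewrite exprn_ge0 // ltW.
have hX : E (fun x => tot (msg beta n) x ^+ s.+1) <= K * an ^+ s.+1.
  apply: (le_trans eXs); apply: (@le_trans _ _ (K0 * f beta n ^+ s.+1)).
    rewrite /K0 [leRHS]mulrDl; apply: lerD; last exact: lexx.
    rewrite -!mulrA -[1 + 1]/(2 : R); apply: ler_wpM2l => //.
    apply: (ler_wpM2l (ltW m_gt0)); apply: (le_trans (hV _ n h1 h2v)).
    exact: (ler_wpM2l (ltW Cv0) (Phi_le (ltW (f0 n)))).
  rewrite /an exprMn mulrA ler_wpM2r //; apply: (@le_trans _ _ K); first by rewrite lerDl.
  by rewrite ler_peMr ?(ltW Kp) // exprn_ege1 // ltW.
have ce := centered_sub K1 an0 X0 Xi eX Xs hX.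
have Ka0 : 0 < 16 * K * an by rewrite !mulr_gt0.
have [S1 S2 S3] := hS (psi q beta) _ _ k p0 rate Ka0 ce.
pose T x := psi q beta ^+ k * gen_sum k (tot (msg beta n)) x.
pose U x := psi q beta ^+ k * gen_sum k (fun y => tot (msg beta n) y - an) x.
have eM : (m * psi q beta) ^+ k = m ^+ k * psi q beta ^+ k by exact: exprMn.
have TU x : T x / a = U x / a + rho * gw k x.
  have -> : U x = psi q beta ^+ k * (gen_sum k (tot (msg beta n)) x - an * gen_sum k (fun=> 1) x).
    rewrite /U -[gen_sum k (tot _) x]mul1r -gen_sum_affine; congr (_ * gen_sum k _ x).
    by apply/funext => y; rewrite mul1r.
  rewrite /T /rho /gw -/m /a /an eM; move: (gen_sum k (fun=> 1) x) (gen_sum k _ x) (psi q beta ^+ k) => g1 g2 pk.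
  have mk : m ^+ k != 0 by rewrite expf_neq0 // gt_eqF.
  move: (m ^+ k) mk (f beta (n + k)) (f0 (n + k)%N) => mk mk0 fk fp; field.
  by rewrite mk0 !gt_eqF.
have [Ti Te] := gen_sum_mean H k Xi.
have iT : Itg T by exact: ItgZ.
have eT : E T = psi q beta ^+ k * (m ^+ k * an) by rewrite /T (ExZ _ Ti) Te eX.
have Xki := Itg_tot H hb (n + k); have eXk : E (tot (msg beta (n + k))) = a := Ex_tot_message H hb (n + k).
have tk0 : 0 <= th ^+ k by rewrite exprn_ge0 // ltW.
have [gi ge] := gw_mean H k; have [_ _ iW _] := hgd k.
have Ui : Itg U.
  have i := ItgB Xi (Itg_cst Q an); have [Gi _] := gen_sum_mean H k i; exact: ItgZ.
have aV : 0 <= a^-1 by rewrite invr_ge0 ltW.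
have rm0 : 0 <= rho - 1 by rewrite subr_ge0.
have [part3 part4] : Itg (fun x => `|T x / a - W x| ^+ s.+1) /\
    E (fun x => `|T x / a - W x| ^+ s.+1) <= C * (rho ^+ s.+1 * th ^+ k + (rho - 1) ^+ s.+1).
  have [gs1 gs2] := hgw k; have [d1 d2 _ _] := hgd k.
  have k1 := ItgZ (a^-1 ^+ s.+1) S1; have k2 := ItgZ ((rho - 1) ^+ s.+1) gs1.
  have k3 := ItgD (ItgD k1 k2) d1; have k4 := ItgZ (4 ^+ s.+1) k3.
  have pt x : `|T x / a - W x| ^+ s.+1 <= 4 ^+ s.+1 *
     (a^-1 ^+ s.+1 * `|U x| ^+ s.+1 + (rho - 1) ^+ s.+1 * gw k x ^+ s.+1 + `|gw k x - W x| ^+ s.+1).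
    have g0 : 0 <= gw k x := gw_ge0 H k x.
    have -> : T x / a - W x = a^-1 * U x + ((rho - 1) * gw k x + (gw k x - W x)).
      by rewrite TU; ring.
    have n1 : `|a^-1 * U x| ^+ s.+1 = a^-1 ^+ s.+1 * `|U x| ^+ s.+1.
      by rewrite normrM (ger0_norm aV) exprMn.
    have n2 : `|(rho - 1) * gw k x| ^+ s.+1 = (rho - 1) ^+ s.+1 * gw k x ^+ s.+1.
      by rewrite (ger0_norm (mulr_ge0 rm0 g0)); exact: exprMn.
    rewrite -n1 -n2; move: (a^-1 * U x) ((rho - 1) * gw k x) (gw k x - W x) => u v w.
    apply: (@le_trans _ _ ((`|u| + (`|v| + `|w|)) ^+ s.+1)).
      rewrite lerXn2r ?nnegrE ?addr_ge0 //.
      by rewrite (le_trans (ler_normD _ _)) // lerD2l ler_normD.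
    apply: (le_trans (add_expr_le _ _ _)); rewrite ?addr_ge0 //.
    have -> : (4 : R) = 2 * 2 by rewrite -natrM.
    rewrite exprMn -mulrA ler_wpM2l ?exprn_ge0 // -addrA mulrDr; apply: lerD.
      by rewrite ler_peMl ?exprn_ge0 // exprn_ege1 // ler1n.
    exact: add_expr_le.
  have iD : Itg (fun x => `|T x / a - W x| ^+ s.+1).
    apply: (Itg_le _ _ k4); last by move=> x; rewrite ger0_norm ?exprn_ge0.
    apply: (meas_comp (g := fun y => `|y| ^+ s.+1)).
      by apply: (@measurableT_comp _ _ _ _ _ _ (fun y : R => y ^+ s.+1)) => //; exact: exprn_measurable.
    apply: measurable_funB; last exact: (meas_gw_lim H).
    by apply: measurable_funM; [exact: Itg_meas iT | exact: measurable_cst].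
  split => //; apply: (le_trans (le_Ex iD k4 pt)).
  rewrite (ExZ _ k3) (ExD (ItgD k1 k2) d1) (ExD k1 k2) (ExZ _ S1) (ExZ _ gs1).
  have r1s : 1 <= rho ^+ s.+1 by rewrite exprn_ege1.
  have t1 : a^-1 ^+ s.+1 * E (fun x => `|U x| ^+ s.+1) <= Cs * (16 * K) ^+ s.+1 * (rho ^+ s.+1 * th ^+ k).
    apply: (le_trans (ler_wpM2l (exprn_ge0 _ aV) S2)).
    have -> : a^-1 ^+ s.+1 * (Cs * th ^+ k * (16 * K * an) ^+ s.+1) =
      Cs * (16 * K) ^+ s.+1 * ((an / a) ^+ s.+1 * th ^+ k).
      by rewrite !exprMn; ring.
    apply: ler_wpM2l; first by rewrite mulr_ge0 ?exprn_ge0 ?mulr_ge0 // ltW.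
    apply: (ler_wpM2r tk0); rewrite lerXn2r ?nnegrE //.
      exact: divr_ge0 (ltW an0) (ltW a0).
    exact: ltW.
  have rs0 : 0 <= (rho - 1) ^+ s.+1 by exact: exprn_ge0.
  have t2 : (rho - 1) ^+ s.+1 * E (fun x => gw k x ^+ s.+1) <= Kg * (rho - 1) ^+ s.+1.
    by rewrite [leRHS]mulrC ler_wpM2l.
  have t3 : E (fun x => `|gw k x - W x| ^+ s.+1) <= Cg * (rho ^+ s.+1 * th ^+ k).
    by apply: (le_trans d2); rewrite ler_wpM2l ?(ltW Cg0) // ler_peMl.
  have rt0 : 0 <= rho ^+ s.+1 * th ^+ k by rewrite mulr_ge0 ?exprn_ge0 // ltW.
  have sum := lerD (lerD t1 t2) t3.
  apply: (le_trans (ler_wpM2l (exprn_ge0 s.+1 (ler0n R 4)) sum)).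
  have u1 : 0 <= Cs * (16 * K) ^+ s.+1 by rewrite mulr_ge0 ?exprn_ge0 ?mulr_ge0 // ltW.
  have Kg0 : 0 <= Kg := le_trans ler01 Kg1.
  rewrite /C; move: (rho ^+ s.+1 * th ^+ k) rt0 ((rho - 1) ^+ s.+1) rs0 (Cs * (16 * K) ^+ s.+1) u1.
  move=> y y0 v v0 u u0; have w0 : 0 <= 16 * K by rewrite mulr_ge0 // ltW.
  have w4 : 0 <= 4 ^+ s.+1 :> R by rewrite exprn_ge0.
  rewrite -subr_ge0 (_ : _ - _ = 4 ^+ s.+1 * (u * v + Kg * y + Cg * v) + 16 * K * (y + v)); last by ring.
  by rewrite addr_ge0 // mulr_ge0 // ?addr_ge0 ?mulr_ge0 // ltW.
split => //.
have j1 := ItgZ a^-1 (ItgB iT Xki); have j2 := ItgZ a^-1 (Itg_norm Ui).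
  have j3 := ItgZ (rho - 1) gi.
  apply: (@le_trans _ _ (E (fun x => a^-1 * (T x - tot (msg beta (n + k)) x) +
      (a^-1 * `|U x| + (rho - 1) * gw k x)))).
    apply: le_Ex; last first.
    - move=> x; have hTX : 0 <= T x - tot (msg beta (n + k)) x.
        by rewrite subr_ge0; exact: tot_le_gen_sum.
      have -> : tot (msg beta (n + k)) x / a - gw k x =
          - (a^-1 * (T x - tot (msg beta (n + k)) x)) + (a^-1 * U x + (rho - 1) * gw k x).
        rewrite mulrBr (mulrC a^-1 (T x)) TU; ring.
      apply: (le_trans (ler_normD _ _)); rewrite normrN (ger0_norm (mulr_ge0 aV hTX)) lerD2l.
      apply: (le_trans (ler_normD _ _)); rewrite normrM (ger0_norm aV) lerD2l.
      by rewrite ger0_norm // mulr_ge0 // (gw_ge0 H).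
    - exact: ItgD j1 (ItgD j2 j3).
    - apply: Itg_norm; apply: ItgB gi.
      by apply: eq_Itg (ItgZ a^-1 Xki) => x; rewrite mulrC.
  rewrite (ExD j1 (ItgD j2 j3)) (ExD j2 j3) (ExZ _ (ItgB iT Xki)) (ExB iT Xki) (ExZ _ (Itg_norm Ui)).
  rewrite (ExZ _ gi) ge mulr1 eXk eT.
  have -> : a^-1 * (psi q beta ^+ k * (m ^+ k * an) - a) = rho - 1.
    rewrite /rho /a /an eM; move: (psi q beta ^+ k) (m ^+ k) (f beta (n + k)) (f0 (n + k)%N) => u v fk fp; field.
    by rewrite !gt_eqF.
  have h3 : a^-1 * E (fun x => `|U x|) <= C * rho * th ^+ k.
    apply: (le_trans (ler_wpM2l aV S3)).
    have -> : a^-1 * (th ^+ k * (16 * K * an)) = 16 * K * (an / a) * th ^+ k by ring.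
    apply: (ler_wpM2r tk0).
    exact: (ler_pM (ltW K16) (divr_ge0 (ltW an0) (ltW a0)) KC ana).
  have -> : 2 * (rho - 1) + C * rho * th ^+ k = (rho - 1) + (C * rho * th ^+ k + (rho - 1)) by ring.
  by rewrite lerD2l lerD2r.
Qed.

End PartOne.

(** * Sharp asymptotics of the mean messages *)

(** For powers of order [k], closeness in mean of order [k] suffices, since
    the factor of [W ^ k] is arbitrarily small. *)
Lemma expr_close (R : realType) (k : nat) (eta : R) : 0 < eta -> exists2 C : R, 0 < C &
  forall A W : R, 0 <= A -> 0 <= W -> `|A ^+ k - W ^+ k| <= eta * W ^+ k + C * `|A - W| ^+ k.
Proof.
move=> eta0; have t0 : 0 < 3 ^+ k :> R by rewrite exprn_gt0.
pose ka := Num.min 1 (eta / 3 ^+ k); have ka0 : 0 < ka by rewrite lt_min ltr01 divr_gt0.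
have ka1 : ka <= 1 by rewrite ge_min lexx.
have ka2 : 3 ^+ k * ka <= eta by rewrite mulrC -ler_pdivlMr // ge_min lexx orbT.
have up j : (1 + ka) ^+ j <= 1 + 3 ^+ j * ka.
  elim: j => [|j IHj]; first by rewrite !expr0 mul1r lerDl ltW.
  have p1 : 1 <= 3 ^+ j :> R by rewrite exprn_ege1 // ler1n.
  have k1 : 0 <= 1 + ka by rewrite addr_ge0 // ltW.
  rewrite !exprS; apply: (le_trans (ler_wpM2l k1 IHj)); move: (3 ^+ j) p1 => p p1.
  rewrite -subr_ge0 (_ : _ - _ = ka * ((p - 1) + p * (1 - ka))); last by ring.
  by rewrite mulr_ge0 ?(ltW ka0) // addr_ge0 ?mulr_ge0 ?subr_ge0 // (le_trans ler01).
have lo j : 1 - 3 ^+ j * ka <= (1 - ka) ^+ j.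
  elim: j => [|j IHj]; first by rewrite !expr0 mul1r gerBl ltW.
  have p1 : 1 <= 3 ^+ j :> R by rewrite exprn_ege1 // ler1n.
  have k0 : 0 <= 1 - ka by rewrite subr_ge0.
  have k1 : (1 - ka) ^+ j <= 1 by rewrite exprn_ile1 // gerBl ltW.
  have h := ler_wpM2l (ltW ka0) k1; rewrite (exprS (1 - ka) j) mulrBl mul1r (exprS (3 : R) j).
  have arith (y p a b : R) : b <= a * 1 -> 1 - p * a <= y -> 1 <= p -> 0 < a ->
      1 - 3 * p * a <= y - b.
    by move=> q1 q2 q3 q4; have := ler_wpM2l (ltW q4) q3; lra.
  exact: arith h IHj p1 ka0.
exists ((1 + ka^-1) ^+ k); first by rewrite exprn_gt0 // addr_gt0 // invr_gt0.
move=> A W A0 W0; set d := `|A - W|; have d0 : 0 <= d by exact: normr_ge0.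
have C0 : 0 <= (1 + ka^-1) ^+ k * d ^+ k.
  by rewrite mulr_ge0 ?exprn_ge0 // addr_ge0 // invr_ge0 ltW.
have Wk : 0 <= W ^+ k by exact: exprn_ge0.
have Ad : A <= W + d by rewrite -lerBlDl ler_norm.
have Wd : W <= A + d by rewrite -lerBlDl /d distrC ler_norm.
have [h|h] := leP d (ka * W).
  apply: (@le_trans _ _ (eta * W ^+ k)); last by rewrite lerDl.
  rewrite ler_norml; apply/andP; split.
    rewrite lerBrDr addrC -[X in X - _]mul1r -mulrBl.
    apply: (@le_trans _ _ ((1 - ka) ^+ k * W ^+ k)).
      by apply: ler_wpM2r => //; apply: le_trans (lo k); rewrite lerD2l lerN2.
    rewrite -exprMn lerXn2r ?nnegrE ?mulr_ge0 ?subr_ge0 //.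
    by rewrite mulrBl mul1r lerBlDr (le_trans Wd) // lerD2l.
  rewrite lerBlDr -[X in _ + X]mul1r -mulrDl.
  apply: (@le_trans _ _ ((1 + ka) ^+ k * W ^+ k)).
    rewrite -exprMn lerXn2r ?nnegrE ?mulr_ge0 ?addr_ge0 ?(ltW ka0) //.
    by rewrite mulrDl mul1r (le_trans Ad) // lerD2l.
  by apply: ler_wpM2r => //; rewrite (addrC eta); apply: (le_trans (up k)); rewrite lerD2l.
have Wk2 : W <= ka^-1 * d by rewrite mulrC ler_pdivlMr // mulrC ltW.
have c1 : 0 <= 1 + ka^-1 by rewrite addr_ge0 // invr_ge0 ltW.
apply: (@le_trans _ _ ((1 + ka^-1) ^+ k * d ^+ k)); last by rewrite lerDr mulr_ge0 // ltW.
have hA : A ^+ k <= (1 + ka^-1) ^+ k * d ^+ k.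
  rewrite -exprMn lerXn2r ?nnegrE ?mulr_ge0 // mulrDl mul1r addrC.
  by apply: (le_trans Ad); rewrite lerD2r.
have hW : W ^+ k <= (1 + ka^-1) ^+ k * d ^+ k.
  rewrite -exprMn lerXn2r ?nnegrE ?mulr_ge0 // mulrDl mul1r.
  by apply: (le_trans Wk2); rewrite lerDr.
have Ak : 0 <= A ^+ k by exact: exprn_ge0.
by rewrite ler_norml; apply/andP; split; lra.
Qed.

Section Sharp.
Variables (R : realType) (mu : probability nat R).
Variable Q : probability (tree_space setT) R.
Variables (q betac : R).
Hypothesis H : critical_tree mu Q q betac.
Let m := mean_children Q.
Let m_gt1 : 1 < m := ct_mean H.
Let m_gt0 : 0 < m. Proof. exact: lt_trans ltr01 m_gt1. Qed.
Let s := crit_exp q.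
Let s12 : s = 1%N \/ s = 2%N := crit_expP q.
Let s_gt0 : (0 < s)%N. Proof. by case: s12 => ->. Qed.

Notation E := (Ex Q).
Notation Itg := (Itg Q).
Notation msg := (message q).
Notation f := (msg_mean Q q).
Notation sc := (scaling betac).
Notation W := (gw_lim Q).
Notation gw := (gw Q).
Notation inrange beta := (betac <= beta <= betac + 1).
Implicit Types z : R * nat.

Hypothesis Zs : Itg (fun x => (x [::])%:R ^+ s.+1).

Definition X z (x : seq nat -> nat) : R := tot (msg z.1 z.2) x.
Definition mean_X z : R := m * f z.1 z.2.


Lemma X_ge0 z x : inrange z.1 -> 0 <= X z x.
Proof. by move=> hb; exact: (tot_ge0 H hb). Qed.

Lemma mean_X_gt0 z : inrange z.1 -> 0 < mean_X z.
Proof. by move=> hb; rewrite mulr_gt0 // (msg_mean_gt0 H hb). Qed.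

Lemma mean_X_cvg0 : mean_X z @[z --> sc] --> (0 : R).
Proof.
by rewrite -[X in _ --> X](mulr0 m); apply: cvgMr; exact: (msg_mean_cvg0 H Zs).
Qed.

Lemma Itg_X z : inrange z.1 -> Itg (X z) /\ Itg (fun x => X z x ^+ s.+1).
Proof.
move=> hb; split; first exact: (Itg_tot H hb).
have [C C0 hC] := tot_moment H Zs ltr01.
have [] := hC (msg z.1 z.2) (message_ge0 H hb _) (msg_mean_gt0 H hb _)
  (Itg_message H hb _) (Itg_message_exp H hb _ _); by [].
Qed.

Let Wi : Itg W. Proof. by have [] := gw_lim_moments H Zs. Qed.
Let Wsi : Itg (fun x => W x ^+ s.+1). Proof. by have [] := gw_lim_moments H Zs. Qed.
Let W0 x : 0 <= W x. Proof. exact: (gw_lim_ge0 H). Qed.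

Definition dist_X k z : R := E (fun x => `|X z x / mean_X z - W x| ^+ k).

Let meas_dist z k : inrange z.1 -> meas setT (fun x => `|X z x / mean_X z - W x| ^+ k).
Proof.
move=> hb; apply: (meas_comp (g := fun y => `|y| ^+ k)).
  by apply: (@measurableT_comp _ _ _ _ _ _ (fun y : R => y ^+ k)) => //; exact: exprn_measurable.
apply: measurable_funB; last exact: (meas_gw_lim H).
by apply: measurable_funM; [exact: Itg_meas (Itg_X hb).1 | exact: measurable_cst].
Qed.

Lemma Itg_dist z : inrange z.1 ->
  Itg (fun x => `|X z x / mean_X z - W x|) /\ Itg (fun x => `|X z x / mean_X z - W x| ^+ s.+1).
Proof.
move=> hb; have [i1 i2] := Itg_X hb; have a0 := mean_X_gt0 hb.
split.
  by apply: Itg_norm; apply: ItgB Wi; apply: eq_Itg (ItgZ (mean_X z)^-1 i1) => x; rewrite mulrC.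
apply: (Itg_le (meas_dist s.+1 hb) _ (ItgZ (2 ^+ s.+1) (ItgD (ItgZ ((mean_X z)^-1 ^+ s.+1) i2) Wsi))).
move=> x; rewrite ger0_norm ?exprn_ge0 //.
have A0 : 0 <= X z x / mean_X z by rewrite divr_ge0 ?X_ge0 // ltW.
have -> : (mean_X z)^-1 ^+ s.+1 * X z x ^+ s.+1 = (X z x / mean_X z) ^+ s.+1.
  by rewrite exprMn mulrC.
apply: le_trans (add_expr_le _ A0 (W0 x)); rewrite lerXn2r ?nnegrE ?addr_ge0 //.
by rewrite (le_trans (ler_normB _ _)) // !ger0_norm.
Qed.

Let ratio_small (rho y : R) : 1 <= rho -> rho * (1 - y) <= 1 -> 0 <= y -> y <= 2^-1 ->
  rho - 1 <= 2 * y.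
Proof.
move=> r1 h y0 y1; have r2 : rho <= 2.
  have h2 : rho * 2^-1 <= 1.
    by apply: le_trans h; apply: ler_wpM2l; [exact: le_trans ler01 r1 | lra].
  by move: h2; lra.
have h3 := ler_wpM2r y0 r2; move: h; rewrite mulrBr mulr1; move: (rho * y) h3 => ry; lra.
Qed.

(** The accumulated loss of the mean over the last [k] generations, relative
    to linear growth. *)
Definition rho k z : R :=
  (m * psi q z.1) ^+ k * f z.1 (z.2 - k) / f z.1 z.2.

(** The lower bound on the mean over [k] generations, inverted. *)
Lemma rho_bound : exists eps0 kappa : R, [/\ 0 < eps0, eps0 <= 1, 0 < kappa &
  forall z k, betac <= z.1 -> z.1 <= betac + eps0 -> (k <= z.2)%N ->
    k%:R * (kappa * f z.1 (z.2 - k) ^+ s) <= 2^-1 ->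
    1 <= rho k z /\ rho k z - 1 <= 2 * (k%:R * (kappa * f z.1 (z.2 - k) ^+ s))].
Proof.
have [el [kappa [el0 el1 ka0 hl]]] := msg_mean_linear H Zs.
exists el, kappa; split => // z k h1 h2 kn hy.
have hb : inrange z.1 by rewrite h1 (le_trans h2) // lerD2l.
have [M1 up lo] := hl z.1 (z.2 - k)%N k h1 h2; rewrite subnK // in up lo.
have f0 j : 0 < f z.1 j := msg_mean_gt0 H hb j.
have r1 : 1 <= rho k z by rewrite ler_pdivlMr // mul1r.
split => //; apply: ratio_small => //.
  by rewrite /rho mulrAC ler_pdivrMr // mul1r.
by rewrite mulr_ge0 // mulr_ge0 ?exprn_ge0 // ltW.
Qed.

Lemma near_rho k (e : R) : 0 < e ->
  \forall z \near sc, [/\ (k <= z.2)%N, inrange z.1, 1 <= rho k z & rho k z - 1 <= e].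
Proof.
move=> e0; have [el [kappa [el0 el1 ka0 hl]]] := rho_bound.
have cv : k%:R * (kappa * f z.1 (z.2 - k) ^+ s) @[z --> sc] --> (0 : R).
  have c0 : f z.1 (z.2 - k) @[z --> sc] --> (0 : R).
    exact: (cvg_comp (fun z => (z.1, (z.2 - k)%N)) (fun z => f z.1 z.2)
      (@scaling_shift R betac k) (msg_mean_cvg0 H Zs)).
  have -> : (0 : R) = k%:R * (kappa * 0 ^+ s) by rewrite expr0n eqn0Ngt s_gt0 !mulr0.
  apply: cvgMr; apply: cvgMr; apply: (cvg_comp _ (fun y : R => y ^+ s) c0).
  exact: exprn_continuous.
have e2 : 0 < Num.min (2^-1) (e / 2) by rewrite lt_min invr_gt0 ltr0n divr_gt0.
move/cvgrPdist_le : cv => /(_ _ e2) cv.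
apply: filterS2 cv (near_scaling betac k%:R el0) => z hy [h1 h2 h3].
have hb : inrange z.1 by rewrite (ltW h1) (le_trans h2) // lerD2l.
have ep1 : z.1 - betac <= 1 by rewrite lerBlDl (le_trans h2) // lerD2l.
have kn : (k <= z.2)%N.
  rewrite -(ler_nat R); apply: (le_trans h3); rewrite ler_piMr //.
have f0 j : 0 < f z.1 j := msg_mean_gt0 H hb j.
move: hy; rewrite sub0r normrN ger0_norm; last by rewrite mulr_ge0 // mulr_ge0 ?exprn_ge0 // ltW.
rewrite le_min => /andP[y1 y2].
have [r1 r2] := hl z k (ltW h1) h2 kn y1.
split => //; apply: (le_trans r2); rewrite mulrC -ler_pdivlMr //.
Qed.

Let th := (1 + m^-1) / 2.
Let iv1 : m^-1 < 1. Proof. by rewrite invf_lt1. Qed.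
Let th0 : 0 < th. Proof. by rewrite divr_gt0 // addr_gt0 // invr_gt0. Qed.
Let th1 : th < 1. Proof. by have h := iv1; rewrite /th; lra. Qed.

Let small_pow (e : R) : 0 < e -> exists k, th ^+ k <= e.
Proof.
move=> e0; have cv : th ^+ i @[i --> \oo] --> (0 : R) by apply: cvg_expr; rewrite ger0_norm // ltW.
move/cvgrPdist_le : cv => /(_ _ e0)[i _ hi]; exists i.
by have := hi i (leqnn i); rewrite /= sub0r normrN ger0_norm ?exprn_ge0 // ltW.
Qed.

Let tail K := E (fun x => W x ^+ s.+1 * (K%:R < W x)%R%:R).

Let Itg_tail K : Itg (fun x => W x ^+ s.+1 * (K%:R < W x)%R%:R).
Proof.
apply: (Itg_le _ _ Wsi).
  apply: measurable_funM; first exact: Itg_meas Wsi.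
  apply: (@meas_mono _ setT (fun y : R => (K%:R < y)%R%:R)) => //; last exact: (meas_gw_lim H).
  move=> x y _ xy; rewrite ler_nat; case: (ltP _ x) => // h; by rewrite (lt_le_trans h xy).
move=> x; rewrite ger0_norm ?mulr_ge0 ?exprn_ge0 //.
by rewrite ler_piMr ?exprn_ge0 // lern1 leq_b1.
Qed.

Let tail_small (e : R) : 0 < e -> exists K : nat, tail K <= e.
Proof.
move=> e0.
have : tail K @[K --> \oo] --> E (fun=> (0 : R)).
  apply: (Ex_dominated (h := fun x => W x ^+ s.+1)) => //.
  - by move=> n; exact: Itg_meas (Itg_tail n).
  - exact: meas_cst.
  - apply: aeW => x; apply: cvg_near_cst; exists (Num.bound (W x)) => // n /= hn.
    have h : W x <= n%:R.
      by apply: (le_trans (ltW (archi_boundP (W0 x)))); rewrite ler_nat.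
    by rewrite ltNge h mulr0.
  - move=> n x; rewrite ger0_norm ?mulr_ge0 ?exprn_ge0 //.
    by rewrite ler_piMr ?exprn_ge0 // lern1 leq_b1.
rewrite Ex_cst => /cvgrPdist_le /(_ _ e0)[i _ hi]; exists i.
have := hi i (leqnn i); rewrite /= sub0r normrN; apply: le_trans; exact: ler_norm.
Qed.

(** For fixed [k] the loss over the last [k] generations vanishes in the
    limit; then [k] goes to infinity. *)
Lemma dist_X_cvg1 : dist_X 1 z @[z --> sc] --> (0 : R).
Proof.
have [el [C [el0 el1 C0 hl]]] := tot_dist H Zs.
have [Cg Cg0 hgd] := gw_lim_dist H Zs.
apply/cvgrPdist_le => e e0.
have d0 : 0 < e / (2 * (2 * C + Cg)) by rewrite divr_gt0 // mulr_gt0 // addr_gt0 // mulr_gt0.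
have [k hk] := small_pow d0.
have e4 : 0 < Num.min 1 (e / 4) by rewrite lt_min ltr01 divr_gt0.
apply: filterS2 (near_rho k e4) (near_scaling betac 0 el0) => z [kn hb r1 r2] [h1 h2 _].
have [_ d1 _ _] := hl z.1 (z.2 - k)%N k (ltW h1) h2; rewrite subnK // in d1.
rewrite -/m -/(rho k z) -/(X z) in d1.
have [_ _ ig eg] := hgd k; have [i1 _] := Itg_dist hb; have [gi _] := gw_mean H k.
have [Xi _] := Itg_X hb.
have iA : Itg (fun x => X z x / mean_X z) by apply: eq_Itg (ItgZ (mean_X z)^-1 Xi) => x; rewrite mulrC.
have i2 := Itg_norm (ItgB iA gi).
move: r2; rewrite le_min => /andP[r2 r3].
rewrite sub0r normrN ger0_norm; last by apply: Ex_ge0 => x; exact: exprn_ge0.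
apply: (@le_trans _ _ (E (fun x => `|X z x / mean_X z - gw k x| + `|gw k x - W x|))).
  apply: le_Ex; [by apply: eq_Itg i1 => x; rewrite expr1 | exact: ItgD |] => x; rewrite expr1.
  rewrite (_ : X z x / _ - W x = (X z x / mean_X z - gw k x) + (gw k x - W x)); last by ring.
  exact: ler_normD.
rewrite (ExD i2 ig); apply: (le_trans (lerD d1 eg)).
have t0 : 0 <= th ^+ k by rewrite exprn_ge0 // ltW.
have rr : rho k z <= 2 by move: r2; lra.
have h3 : C * rho k z * th ^+ k <= C * 2 * th ^+ k.
  by apply: (ler_wpM2r t0); apply: ler_wpM2l => //; exact: ltW.
move: hk; rewrite -/th ler_pdivlMr; last by rewrite mulr_gt0 // addr_gt0 // mulr_gt0.
move: h3; rewrite -/th; move: (rho k z) r3 => r r3; move: (th ^+ k) => t; move: e0 => _.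
have -> : C * 2 * t = 2 * (C * t) by ring.
have -> : t * (2 * (2 * C + Cg)) = 4 * (C * t) + 2 * (Cg * t) by ring.
by move: (C * r * t) (C * t) (Cg * t) => u v w; lra.
Qed.

(** Above the limit the log odds are dominated by the linear recursion, which
    converges in mean of order [s + 1]; below it, the distance is at most the
    limit itself, and convergence in mean and dominated convergence suffice. *)
Lemma dist_X_cvg : dist_X s.+1 z @[z --> sc] --> (0 : R).
Proof.
have [el [C [el0 el1 C0 hl]]] := tot_dist H Zs.
apply/cvgrPdist_le => e e0.
have e3 : 0 < e / 3 by rewrite divr_gt0.
have [K hK] := tail_small e3.
have d0 : 0 < e / (6 * (C * 2 ^+ s.+1)) by rewrite divr_gt0 // !mulr_gt0 ?exprn_gt0.
have [k hk] := small_pow d0.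
have e4 : 0 < Num.min 1 (e / (6 * C)) by rewrite lt_min ltr01 divr_gt0 // mulr_gt0.
pose KK : R := K%:R ^+ s + 1.
have KK0 : 0 < KK by rewrite ltr_wpDl // exprn_ge0.
have e5 : 0 < e / (3 * KK) by rewrite divr_gt0 // mulr_gt0.
move/cvgrPdist_le : dist_X_cvg1 => /(_ _ e5) near1.
apply: filterS3 (near_rho k e4) (near_scaling betac 0 el0) near1 => z [kn hb r1 r2] [h1 h2 _] hd1.
have [_ _ iT eT] := hl z.1 (z.2 - k)%N k (ltW h1) h2; rewrite subnK // in iT eT.
rewrite -/m -/(rho k z) -/(mean_X z) in iT eT; pose T x := psi q z.1 ^+ k * gen_sum k (tot (msg z.1 (z.2 - k))) x.
rewrite -/(T _) in iT eT.
have [i1 i2] := Itg_dist hb; have a0 := mean_X_gt0 hb.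
move: hd1; rewrite sub0r normrN ger0_norm; last by apply: Ex_ge0 => x; exact: exprn_ge0.
rewrite /dist_X (@eq_Ex _ Q _ (fun x => `|X z x / mean_X z - W x|)); last by move=> x; rewrite expr1.
move=> hd1; rewrite sub0r normrN ger0_norm; last by apply: Ex_ge0 => x; exact: exprn_ge0.
have j1 := ItgZ KK i1; have j2 := ItgD (ItgD iT j1) (Itg_tail K).
apply: (@le_trans _ _ (E (fun x => `|T x / mean_X z - W x| ^+ s.+1 +
   KK * `|X z x / mean_X z - W x| + W x ^+ s.+1 * (K%:R < W x)%R%:R))).
  apply: le_Ex => // x; set A := X z x / mean_X z.
  have A0 : 0 <= A by rewrite divr_ge0 ?X_ge0 // ltW.
  have AT : A <= T x / mean_X z.
    rewrite ler_pM2r ?invr_gt0 //; have := tot_le_gen_sum H (z.2 - k) k x hb; by rewrite subnK.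
  have t1 : 0 <= `|T x / mean_X z - W x| ^+ s.+1 by exact: exprn_ge0.
  have t2 : 0 <= KK * `|A - W x| by rewrite mulr_ge0 // ltW.
  have t3 : 0 <= W x ^+ s.+1 * (K%:R < W x)%R%:R by rewrite mulr_ge0 ?exprn_ge0.
  have [AW|AW] := leP (W x) A.
    apply: (@le_trans _ _ (`|T x / mean_X z - W x| ^+ s.+1)); last by rewrite -addrA lerDl addr_ge0.
    by rewrite lerXn2r ?nnegrE // !ger0_norm ?subr_ge0 ?(le_trans AW) // lerD2r.
  have n1 : `|A - W x| = W x - A by rewrite distrC ger0_norm // subr_ge0 ltW.
  have w1 : `|A - W x| <= W x by rewrite n1 gerBl.
  have [WK|WK] := ltP K%:R (W x).
    rewrite mulr1; apply: (@le_trans _ _ (W x ^+ s.+1)); first by rewrite lerXn2r ?nnegrE.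
    by rewrite lerDr addr_ge0.
  rewrite mulr0 addr0; apply: (@le_trans _ _ (KK * `|A - W x|)); last by rewrite lerDr.
  rewrite exprSr ler_wpM2r //; apply: (@le_trans _ _ (K%:R ^+ s)); last by rewrite lerDl.
  by rewrite lerXn2r ?nnegrE // (le_trans w1).
rewrite (ExD (ItgD iT j1) (Itg_tail K)) (ExD iT j1) (ExZ _ i1) -/(tail K).
move: r2; rewrite le_min => /andP[r2 r3].
have b1 : C * (rho k z ^+ s.+1 * th ^+ k + (rho k z - 1) ^+ s.+1) <= e / 6 + e / 6.
  rewrite mulrDr; apply: lerD.
    have rr : rho k z ^+ s.+1 <= 2 ^+ s.+1.
      rewrite lerXn2r ?nnegrE ?(le_trans ler01 r1) //; move: r2; lra.
    apply: (@le_trans _ _ (C * (2 ^+ s.+1 * (e / (6 * (C * 2 ^+ s.+1)))))).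
      apply: (ler_wpM2l (ltW C0)); apply: ler_pM => //; rewrite exprn_ge0 ?(le_trans ler01 r1) //.
      exact: ltW.
    rewrite le_eqVlt; apply/orP; left; apply/eqP; field.
    by apply/andP; split; [rewrite expf_neq0 // pnatr_eq0 | rewrite gt_eqF].
  apply: (@le_trans _ _ (C * (e / (6 * C)))).
    apply: (ler_wpM2l (ltW C0)); apply: le_trans r3.
    by rewrite -[leRHS]expr1 ler_wiXn2l // subr_ge0.
  by rewrite le_eqVlt; apply/orP; left; apply/eqP; field; rewrite gt_eqF.
have b2 : KK * E (fun x => `|X z x / mean_X z - W x|) <= e / 3.
  by rewrite mulrC -ler_pdivlMr // -mulrA -invfM.
apply: (le_trans (lerD (lerD (le_trans eT b1) b2) hK)).
by rewrite le_eqVlt; apply/orP; left; apply/eqP; field.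
Qed.

(** Means of functionals of the log odds that behave like a power at zero:
    convergence in mean of order [s + 1] of the normalized log odds gives the
    limit on small values, and uniform integrability removes the others. *)
Lemma power_functional (G : R -> R -> R) (c C : R) : 0 <= c -> 0 < C ->
  (forall z, inrange z.1 -> meas setT (fun x => G z.1 (X z x))) ->
  (forall beta y, inrange beta -> 0 <= y -> `|G beta y| <= C * y ^+ s.+1) ->
  (forall eta : R, 0 < eta -> exists2 delta : R, 0 < delta & forall beta y,
     betac <= beta -> beta <= betac + delta -> 0 <= y -> y <= delta ->
     `|G beta y - c * y ^+ s.+1| <= eta * y ^+ s.+1) ->
  E (fun x => G z.1 (X z x)) / mean_X z ^+ s.+1 @[z --> sc] --> c * E (fun x => W x ^+ s.+1).
Proof.
move=> c0 C0 mG hC hc; apply/cvgrPdist_le => e e0.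
pose EW := E (fun x => W x ^+ s.+1).
have EW0 : 0 <= EW by apply: Ex_ge0 => x; exact: exprn_ge0.
pose p2 : R := 2 ^+ s.+1; have p20 : 0 < p2 by exact: exprn_gt0.
pose D := (p2 + c) * (EW + 1); have D0 : 0 < D := mulr_gt0 (ltr_pwDl p20 c0) (ltr_wpDl EW0 ltr01).
have e3 : 0 < e / 3 / D by rewrite !divr_gt0.
set eta := e / 3 / D in e3.
have [C' C'0 hC'] := expr_close s.+1 e3.
have [delta de0 hde] := hc eta e3.
have T0 : 0 < (C + c) * p2 := mulr_gt0 (ltr_pwDl C0 c0) p20.
have [K hK] := tail_small (divr_gt0 (divr_gt0 e0 (ltr0Sn R 2)) T0).
pose B := eta * p2 + (C + c) * p2 + c * C'.
have B0 : 0 < B.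
  rewrite /B -addrA; apply: ltr_pwDl; first exact: mulr_gt0.
  by apply: addr_ge0; [exact: ltW | rewrite mulr_ge0 // ltW].
have eB : 0 < e / 3 / B by rewrite !divr_gt0.
move/cvgrPdist_le : dist_X_cvg => /(_ _ eB) near1.
have dK : 0 < delta / (2 * (K%:R + 1)) by rewrite divr_gt0 // mulr_gt0 // ltr_wpDl.
move/cvgrPdist_le : mean_X_cvg0 => /(_ _ dK) near2.
have md : 0 < Num.min delta 1 by rewrite lt_min de0 ltr01.
apply: filterS3 near1 near2 (near_scaling betac 0 md) => z hd ha [h1 h2 _].
have hb : inrange z.1.
  by rewrite (ltW h1) (le_trans h2) // lerD2l ge_min lexx orbT.
have h2' : z.1 <= betac + delta by rewrite (le_trans h2) // lerD2l ge_min lexx.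
have a0 := mean_X_gt0 hb; set a := mean_X z in a0 ha *.
move: hd; rewrite sub0r normrN ger0_norm; last by apply: Ex_ge0 => x; exact: exprn_ge0.
move=> hd; move: ha; rewrite sub0r normrN gtr0_norm // => ha.
have [Xi Xs] := Itg_X hb; have [_ id] := Itg_dist hb.
have iG : Itg (fun x => G z.1 (X z x)).
  apply: (Itg_le (mG z hb) _ (ItgZ C Xs)) => x; apply: hC => //; exact: X_ge0.
have j1 := ItgZ (eta * (p2 + c)) Wsi; have j2 := ItgZ B id.
have j3 := ItgZ ((C + c) * p2) (Itg_tail K).
have iV := ItgZ (a ^+ s.+1)^-1 iG; have iW2 := ItgZ c Wsi.
have iD := ItgB iW2 iV.
rewrite -(ExZ c Wsi) (mulrC (E _)) -(ExZ _ iG) -(ExB iW2 iV).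
apply: (le_trans (le_norm_Ex iD)).
apply: (@le_trans _ _ (E (fun x => eta * (p2 + c) * W x ^+ s.+1 +
   B * `|X z x / a - W x| ^+ s.+1 + (C + c) * p2 * (W x ^+ s.+1 * (K%:R < W x)%R%:R)))).
  apply: le_Ex; [exact: Itg_norm | exact: ItgD (ItgD j1 j2) j3 |] => x.
  set y := X z x; have y0 : 0 <= y by exact: X_ge0.
  set A := y / a; have A0 : 0 <= A by rewrite divr_ge0 // ltW.
  set w := W x; have w0 : 0 <= w by exact: W0.
  have yA : y = a * A by rewrite /A mulrC divfK // gt_eqF.
  have as0 : 0 < a ^+ s.+1 by exact: exprn_gt0.
  have yS : y ^+ s.+1 = a ^+ s.+1 * A ^+ s.+1 by rewrite -exprMn -yA.
  have Ap := exprn_ge0 s.+1 A0; have wp := exprn_ge0 s.+1 w0.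
  set d := `|A - w|; have dd0 : 0 <= d by exact: normr_ge0.
  have dp := exprn_ge0 s.+1 dd0.
  have Adw : A <= w + d by rewrite -lerBlDl ler_norm.
  have A2 : A ^+ s.+1 <= p2 * (w ^+ s.+1 + d ^+ s.+1).
    by apply: le_trans (add_expr_le _ w0 dd0); rewrite lerXn2r ?nnegrE ?addr_ge0.
  have ind0 : 0 <= w ^+ s.+1 * (K%:R < w)%R%:R by rewrite mulr_ge0.
  have first : `|(a ^+ s.+1)^-1 * G z.1 y - c * A ^+ s.+1| <=
      eta * (p2 * (w ^+ s.+1 + d ^+ s.+1)) + (C + c) * p2 * (d ^+ s.+1 + w ^+ s.+1 * (K%:R < w)%R%:R).
    have -> : (a ^+ s.+1)^-1 * G z.1 y - c * A ^+ s.+1 =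
        (a ^+ s.+1)^-1 * (G z.1 y - c * y ^+ s.+1).
      by rewrite yS mulrBr (mulrCA _ c) mulKf // gt_eqF.
    rewrite normrM gtr0_norm ?invr_gt0 //.
    have [yd|yd] := leP y delta.
      apply: (@le_trans _ _ (eta * A ^+ s.+1)).
        have hd0 := hde z.1 y (ltW h1) h2' y0 yd.
        rewrite mulrC ler_pdivrMr //; apply: (le_trans hd0); rewrite yS.
        by rewrite le_eqVlt; apply/orP; left; apply/eqP; ring.
      apply: (@le_trans _ _ (eta * (p2 * (w ^+ s.+1 + d ^+ s.+1)))).
        by apply: ler_wpM2l A2; exact: ltW.
      by rewrite lerDl mulr_ge0 ?addr_ge0 // ltW.
    apply: (@le_trans _ _ ((C + c) * A ^+ s.+1)).
      rewrite mulrC ler_pdivrMr //; apply: (le_trans (ler_normB _ _)).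
      have -> : (C + c) * A ^+ s.+1 * a ^+ s.+1 = C * y ^+ s.+1 + c * y ^+ s.+1.
        by rewrite yS; ring.
      apply: lerD; first exact: hC.
      by rewrite ger0_norm // mulr_ge0 // exprn_ge0.
    apply: (@le_trans _ _ ((C + c) * p2 * (d ^+ s.+1 + w ^+ s.+1 * (K%:R < w)%R%:R))); last first.
      by rewrite lerDr mulr_ge0 ?(ltW e3) // mulr_ge0 ?addr_ge0 // ltW.
    rewrite -mulrA; apply: ler_wpM2l; first by rewrite addr_ge0 // ltW.
    have [dw|dw] := leP d w.
      have Aw : A <= 2 * w by move: Adw dw; lra.
      have Kw : K%:R < w.
        have h3 : 2 * (K%:R + 1) < A.
          rewrite /A ltr_pdivlMr //; apply: le_lt_trans yd.
          by move: ha; rewrite ler_pdivlMr ?mulr_gt0 ?ltr_wpDl // mulrC.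
        by move: h3 Aw; lra.
      rewrite Kw mulr1; apply: (@le_trans _ _ (p2 * w ^+ s.+1)); last first.
        by rewrite mulrDr lerDr mulr_ge0 // ltW.
      have w2 : 0 <= 2 * w by rewrite mulr_ge0.
      by rewrite /p2 -exprMn lerXn2r ?nnegrE.
    have Ad : A <= 2 * d by move: Adw dw; lra.
    apply: (@le_trans _ _ (p2 * d ^+ s.+1)); last by rewrite mulrDr lerDl mulr_ge0 // ltW.
    have d2 : 0 <= 2 * d by rewrite mulr_ge0.
    by rewrite /p2 -exprMn lerXn2r ?nnegrE.
  have second := ler_wpM2l c0 (hC' A w A0 w0); rewrite -/d in second.
  have -> : c * w ^+ s.+1 - (a ^+ s.+1)^-1 * G z.1 y =
     - ((a ^+ s.+1)^-1 * G z.1 y - c * A ^+ s.+1) - c * (A ^+ s.+1 - w ^+ s.+1) by ring.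
  apply: (le_trans (ler_normB _ _)); rewrite normrN (normrM c) (ger0_norm c0).
  apply: (le_trans (lerD first second)); rewrite -subr_ge0 /B.
  rewrite (_ : _ - _ = 0) //; ring.
rewrite (ExD (ItgD j1 j2) j3) (ExD j1 j2) (ExZ _ Wsi) (ExZ _ id) (ExZ _ (Itg_tail K)).
rewrite -/(tail K) -/EW -/(dist_X s.+1 z).
have b1 : eta * (p2 + c) * EW <= e / 3.
  have -> : e / 3 = eta * (p2 + c) * (EW + 1) by rewrite -mulrA -/D /eta divfK // gt_eqF.
  by rewrite ler_wpM2l ?lerDl // mulr_ge0 ?addr_ge0 // ltW.
have b2 : B * dist_X s.+1 z <= e / 3 by rewrite mulrC -ler_pdivlMr.
have b3 : (C + c) * p2 * tail K <= e / 3 by rewrite mulrC -ler_pdivlMr.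
apply: (le_trans (lerD (lerD b1 b2) b3)).
rewrite le_eqVlt; apply/orP; left; by apply/eqP; field.
Qed.

End Sharp.

(** * The limit of the normalized connection probabilities *)

Lemma cvg_root (R : realType) (T : Type) (F : set_system T) (FF : Filter F) (s : nat)
    (u r : T -> R) (L : R) : s = 1%N \/ s = 2%N -> 0 <= L -> u x @[x --> F] --> L ->
  (\forall x \near F, 0 <= r x /\ r x ^+ s = u x) -> r x @[x --> F] --> L `^ (s%:R^-1).
Proof.
move=> s12 L0 uL hr; case: s12 hr => -> hr.
  rewrite invr1 powRr1 //; apply: cvg_trans uL; apply: near_eq_cvg.
  by apply: filterS hr => x [_ <-]; rewrite expr1.
rewrite powR12_sqrt //.
have cv : Num.sqrt (u x) @[x --> F] --> Num.sqrt L.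
  by apply: continuous_cvg uL; exact: sqrt_continuous.
apply: cvg_trans cv; apply: near_eq_cvg.
by apply: filterS hr => x [r0 <-]; rewrite sqrtr_sqr ger0_norm.
Qed.

Section Limit.
Variables (R : realType) (mu : probability nat R).
Variable Q : probability (tree_space setT) R.
Variables (q betac : R).
Hypothesis H : critical_tree mu Q q betac.
Let m := mean_children Q.
Let m_gt1 : 1 < m := ct_mean H.
Let m_gt0 : 0 < m. Proof. exact: lt_trans ltr01 m_gt1. Qed.
Let s := crit_exp q.
Let bc0 : 0 < betac. Proof. exact: (betac_gt0 (ct_q H) (ct_mean H) (ct_crit H)). Qed.
Let s12 : s = 1%N \/ s = 2%N := crit_expP q.
Let q_gt0 : 0 < q. Proof. by have /andP[] := ct_q H. Qed.

Notation E := (Ex Q).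
Notation Itg := (Itg Q).
Notation f := (msg_mean Q q).
Notation sc := (scaling betac).
Notation W := (gw_lim Q).
Notation gw := (gw Q).
Notation X := (X q).
Notation mean_X := (mean_X Q q).
Notation root_eps := (root_eps q betac).
Notation rho := (rho Q q).
Notation inrange beta := (betac <= beta <= betac + 1).
Implicit Types z : R * nat.

Hypothesis Zs : Itg (fun x => (x [::])%:R ^+ s.+1).

Let Wi : Itg W. Proof. by have [] := gw_lim_moments H Zs. Qed.
Let EW1 : E W = 1. Proof. by have [] := gw_lim_moments H Zs. Qed.
Let Wsi : Itg (fun x => W x ^+ s.+1). Proof. by have [] := gw_lim_moments H Zs. Qed.
Let W0 x : 0 <= W x. Proof. exact: (gw_lim_ge0 H). Qed.
Let EW := E (fun x => W x ^+ s.+1).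

(** The tangent at one of the power [s + 1]; the mean of the limit is one. *)
Lemma limit_moment_ge1 : 1 <= EW.
Proof.
have i := ItgB (ItgZ s.+1%:R Wi) (Itg_cst Q s%:R).
have pt x : s.+1%:R * W x - s%:R <= W x ^+ s.+1; last first.
  have := le_Ex i Wsi pt; rewrite (ExB (ItgZ _ Wi) (Itg_cst Q _)) (ExZ _ Wi) EW1 Ex_cst.
  by rewrite (_ : s.+1%:R * 1 - s%:R = 1) // mulr1 -(natr1 s) addrC addKr.
move: (W x) (W0 x) => w w0.
rewrite -subr_ge0; case: s12 => ->.
  rewrite (_ : _ - _ = (w - 1) ^+ 2) ?sqr_ge0 //; by ring.
rewrite (_ : _ - _ = (w - 1) ^+ 2 * (w + 2)); last by ring.
by rewrite mulr_ge0 ?sqr_ge0 // addr_ge0.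
Qed.

Let EW_gt0 : 0 < EW. Proof. exact: lt_le_trans ltr01 limit_moment_ge1. Qed.

Definition pull_coef : R := defect_coef q betac * EW * m ^+ s.+1.

Let pc0 : 0 < pull_coef.
Proof.
rewrite mulr_gt0 ?exprn_gt0 // mulr_gt0 //.
exact: (defect_coef_gt0 (ct_q H) (ct_mean H) (ct_crit H)).
Qed.

(** The mean defect is asymptotically its leading coefficient times the moment
    of order [s + 1] of the log odds. *)
Lemma pull_cvg :
  E (fun x => defect q z.1 (X z x)) / f z.1 z.2 ^+ s.+1 @[z --> sc] --> pull_coef.
Proof.
have [K K0 hK] := defect_upper (ct_q H) (ct_mean H) (ct_crit H).
have cv := @power_functional _ _ _ _ _ H Zs (defect q) (defect_coef q betac) K
  (ltW (defect_coef_gt0 (ct_q H) (ct_mean H) (ct_crit H))) K0 _ _ _.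
have cv2 : E (fun x => defect q z.1 (X z x)) / mean_X z ^+ s.+1 @[z --> sc] -->
    defect_coef q betac * EW.
  apply: cv.
  - by move=> z hb; exact: (meas_defect H hb z.2).
  - move=> beta y hb y0; have /andP[h1 h2] := hb.
    rewrite ger0_norm; first exact: hK.
    exact: (defect_ge0 (ct_q H) (lt_le_trans bc0 h1) y0).
  - move=> eta eta0; have [delta d0 hd] := defect_sharp (ct_q H) (ct_mean H) (ct_crit H) eta0.
    exists delta => // beta y h1 h2 y0 yd; have [g1 g2] := hd _ _ h1 h2 y0 yd.
    move: g1 g2; rewrite mulrBl mulrDl; move: (defect _ _ _) (_ * _) (eta * _) => u v w g1 g2.
    by rewrite ler_norml; apply/andP; split; lra.
rewrite /pull_coef; have cv3 : (E (fun x => defect q z.1 (X z x)) / mean_X z ^+ s.+1) * m ^+ s.+1 @[z --> sc] -->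
    defect_coef q betac * EW * m ^+ s.+1 by apply: cvgM cv2 (cvg_cst _).
apply: cvg_trans cv3; apply: near_eq_cvg.
apply: filterS (near_scaling betac 0 ltr01) => z [h1 h2 _].
have hb : inrange z.1 by rewrite (ltW h1).
have f0 : 0 < f z.1 z.2 := msg_mean_gt0 H hb z.2.
have e : mean_X z ^+ s.+1 = m ^+ s.+1 * f z.1 z.2 ^+ s.+1 by rewrite -exprMn.
have fs : f z.1 z.2 ^+ s.+1 != 0 by rewrite expf_neq0 // gt_eqF.
have ms : m ^+ s.+1 != 0 by rewrite expf_neq0 // gt_eqF.
rewrite e; move: (f z.1 z.2 ^+ s.+1) fs (m ^+ s.+1) ms => u u0 v v0; field.
by rewrite u0.
Qed.

Definition level_coef : R := growth_rate q m betac / pull_coef.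

Let gr0 : 0 < growth_rate q m betac.
Proof.
have ec : 1 < expR betac by rewrite expR_gt1.
rewrite /growth_rate divr_gt0 //; move: m_gt1 q_gt0 ec; first by move: (expR betac) => *; lra.
by move: (expR betac) => *; lra.
Qed.

Let lc0 : 0 < level_coef. Proof. exact: divr_gt0. Qed.

(** The mean message is asymptotically the level where growth and pull
    balance: it is at least this level because it decreases with the height,
    and from above the level it would decrease geometrically over the second
    half of the heights. *)
Lemma msg_mean_level : f z.1 z.2 ^+ s / (z.1 - betac) @[z --> sc] --> level_coef.
Proof.
have pc := pc0; have gr := gr0; have lc := lc0.
set L := level_coef in lc *; set c := pull_coef in pc *; set g := growth_rate q m betac in gr *.
have Lc : L * c = g by rewrite /L /level_coef -/c -/g divfK // gt_eqF.
apply/cvgrPdist_le => eta eta0.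
have D0 : 0 < 1 + L + eta by rewrite !addr_gt0.
(* The error in the growth rate and in the pull that a distance [eta] to the
   level tolerates with a margin [kappa]. *)
pose delta := eta * c / (2 * (1 + L + eta)).
have d0 : 0 < delta by apply: divr_gt0; apply: mulr_gt0.
have dD : delta * (1 + L + eta) = eta * c / 2.
  by rewrite /delta; field; rewrite gt_eqF.
pose kappa := eta * c / 2; have ka0 : 0 < kappa by rewrite divr_gt0 // mulr_gt0.
have [dg dg0 hg] := growth_sharp (ct_q H) (ct_mean H) (ct_crit H) d0.
have [c1 [c2 [c10 c20 ho]]] := msg_mean_order H Zs.
move/cvgrPdist_le : pull_cvg => /(_ _ d0)[e1 [M1 [e10 hp]]].
have em : 0 < Num.min (Num.min dg e1) 1 by rewrite !lt_min dg0 e10 ltr01.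
have ho2 : \forall z \near sc, c1 * root_eps (z.1, z.2./2) <= f z.1 z.2./2 <= c2 * root_eps (z.1, z.2./2).
  exact: (@scaling_half R betac _ ho).
have hM : \forall z \near sc, M1 <= (z.2./2)%:R * (z.1 - betac).
  suff hM0 : \forall z \near sc, M1 <= z.2%:R * (z.1 - betac) by exact: (@scaling_half R betac _ hM0).
  by apply: filterS (near_scaling betac M1 ltr01) => z [].
apply: filterS2 (filterI ho ho2) (filterI hM (near_scaling betac (2 * c2 / (c1 * kappa) + 1) em)) => z.
case=> /andP[ o1 o2] /andP[ o3 o4] [hM1] [h1 h2 h3].
set beta := z.1 in o1 o2 o3 o4 hM1 h1 h2 h3 *; set n := z.2 in o1 o2 o3 o4 hM1 h1 h2 h3 *.
set ep := beta - betac in hM1 h3 *; have ep0 : 0 < ep by rewrite subr_gt0.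
have hb : inrange beta by rewrite (ltW h1) (le_trans h2) // lerD2l !ge_min lexx orbT.
have f0 j : 0 < f beta j := msg_mean_gt0 H hb j.
have h2g : beta <= betac + dg by apply: (le_trans h2); rewrite lerD2l !ge_min lexx.
have [g1 g2] := hg beta (ltW h1) h2g.
rewrite -/m -/g -/ep in g1 g2.
pose k j := E (fun x => defect q beta (X (beta, j) x)) / f beta j ^+ s.+1.
have hk j : (n./2 <= j)%N -> `|c - k j| <= delta.
  move=> nj; apply: (hp beta j) => //.
    by apply: (le_trans h2); rewrite lerD2l !ge_min lexx orbT.
  by apply: (le_trans hM1); rewrite ler_wpM2r ?(ltW ep0) // ler_nat.
have rec j : f beta j.+1 = f beta j * (m * psi q beta - k j * f beta j ^+ s).
  rewrite (msg_meanS H hb) -/m /k -/(X (beta, j)) exprS mulrBr; congr (_ - _); first by rewrite mulrC.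
  have fs : f beta j ^+ s != 0 by rewrite expf_neq0 // gt_eqF.
  move: (f beta j ^+ s) fs (f beta j) (f0 j) => u u0 v v0; field.
  by rewrite expf_neq0 ?(gt_eqF v0).
have fs0 j : 0 < f beta j ^+ s by rewrite exprn_gt0.
have half : (n./2 <= n)%N by rewrite -{2}(odd_double_half n) -addnn addnA leq_addl.
rewrite distrC ler_norml; apply/andP; split.
  have an := msg_mean_anti H hb n; rewrite rec -[leRHS]mulr1 ler_pM2l // in an.
  have := hk n half; rewrite ler_norml => /andP[k1 k2].
  rewrite lerBrDl ler_pdivlMr //.
  have cd : 0 < c + delta by rewrite addr_gt0.
  rewrite -(ler_pM2l cd); apply: (@le_trans _ _ (k n * f beta n ^+ s)); last first.
    by apply: ler_wpM2r; [exact: ltW | lra].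
  apply: (@le_trans _ _ ((g - delta) * ep)); last first.
    apply: (le_trans g1); move: an; move: (k n * _) (m * _) => u v; lra.
  rewrite mulrA; apply: ler_wpM2r; first exact: ltW.
  have e1' : (c + delta) * (L - eta) = L * c - eta * c + delta * L - delta * eta by ring.
  rewrite -[L + - eta]/(L - eta) e1' Lc; move: dD; rewrite !mulrDr mulr1.
  have p1 : 0 <= delta * eta by rewrite mulr_ge0 // ltW.
  have p2 : 0 <= eta * c by rewrite mulr_ge0 // ltW.
  by move: (delta * L) (delta * eta) (eta * c) p1 p2 => u v w p1 p2; lra.
rewrite lerBlDr leNgt; apply/negP => big.
have big2 j : (j <= n)%N -> (L + eta) * ep <= f beta j ^+ s.
  move=> jn; move: big; rewrite ltr_pdivlMr // addrC => /ltW big.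
  by apply: (le_trans big); rewrite lerXn2r ?nnegrE ?(ltW (f0 _)) // (msg_mean_le H hb).
have dec j : (n./2 <= j)%N -> (j <= n)%N -> f beta j.+1 <= f beta j * (1 - kappa * ep).
  move=> nj jn; rewrite rec ler_pM2l //; have := hk j nj; rewrite ler_norml => /andP[k1 k2].
  have cd : 0 <= c - delta.
    rewrite subr_ge0 -(ler_pM2r D0) dD !mulrDr mulr1.
    have p1 : 0 <= c * L by rewrite mulr_ge0 // ltW.
    have p2 : 0 < eta * c by rewrite mulr_gt0.
    by rewrite (mulrC c eta); move: (c * L) (eta * c) p1 p2 => u v p1 p2; lra.
  have q1 : (c - delta) * ((L + eta) * ep) <= k j * f beta j ^+ s.
    have ckj : c - delta <= k j by move: k2; move: (k j) => *; lra.
    have le0 : 0 <= (L + eta) * ep by apply: mulr_ge0 (ltW ep0); apply: addr_ge0; apply: ltW.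
    exact: ler_pM cd le0 ckj (big2 _ jn).
  have q2 : (c - delta) * ((L + eta) * ep) = (g - (delta * (L + eta) - eta * c)) * ep.
    by rewrite -Lc; ring.
  have q3 : delta * (L + eta) = eta * c / 2 - delta by rewrite -dD; ring.
  rewrite q2 q3 in q1.
  have q4 : (g - (eta * c / 2 - delta - eta * c)) * ep = g * ep + kappa * ep + delta * ep.
    by rewrite /kappa; field.
  rewrite q4 in q1; rewrite mulrDl in g2; move: q1 g2.
  by move: (k j * _) (m * _) (g * ep) (kappa * ep) (delta * ep) => *; lra.
have tele i : (n./2 + i <= n)%N -> f beta (n./2 + i) * (1 + i%:R * (kappa * ep)) <= f beta n./2.
  elim: i => [|i IHi] hi; first by rewrite addn0 mul0r addr0 mulr1.
  have hi' : (n./2 + i <= n)%N by rewrite ltnW // -addnS.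
  apply: le_trans (IHi hi'); rewrite addnS.
  have x0 : 0 <= kappa * ep by rewrite mulr_ge0 // ltW.
  have d1 : 0 <= 1 + i.+1%:R * (kappa * ep) by rewrite addr_ge0 // mulr_ge0.
  apply: (le_trans (ler_wpM2r d1 (dec _ (leq_addr _ _) hi'))).
  rewrite -mulrA ler_pM2l // -(natr1 i); move: (kappa * ep) x0 => x x0.
  rewrite -subr_ge0 (_ : _ - _ = (i%:R + 1) * x ^+ 2); last by ring.
  by rewrite mulr_ge0 ?sqr_ge0 // addr_ge0.
have := tele (n - n./2)%N; rewrite subnKC // => /(_ (leqnn n)) tn.
have hn : n%:R / 2 <= (n - n./2)%N%:R :> R.
  have hh : (n./2 * 2 <= n)%N by rewrite muln2 -{2}(odd_double_half n) leq_addl.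
  by rewrite ler_pdivrMr // -natrM ler_nat mulnBl muln2 -addnn -addnBA // leq_addr.
have re : root_eps (beta, n./2) = root_eps z by [].
rewrite re in o4; have rp : 0 < root_eps z by apply: root_eps_gt0.
have x0 : 0 <= kappa * ep by rewrite mulr_ge0 // ltW.
have q5 : c1 * root_eps z * (1 + n%:R / 2 * (kappa * ep)) <= c2 * root_eps z.
  apply: le_trans o4; apply: le_trans tn.
  have b0 : 0 <= 1 + n%:R / 2 * (kappa * ep) by rewrite addr_ge0 // mulr_ge0 // divr_ge0.
  by apply: ler_pM => //; [rewrite mulr_ge0 // ltW | rewrite lerD2l ler_wpM2r].
have q6 : c1 * (1 + n%:R / 2 * (kappa * ep)) <= c2.
  by rewrite -(ler_pM2r rp) mulrAC.
have q7 : n%:R * ep <= 2 * c2 / (c1 * kappa).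
  have ck : 0 < c1 * kappa by exact: mulr_gt0.
  rewrite (ler_pdivlMr _ _ ck); move: q6; rewrite mulrDr mulr1.
  have -> : c1 * (n%:R / 2 * (kappa * ep)) = n%:R * ep * (c1 * kappa) / 2 by field.
  by move: (n%:R * ep * (c1 * kappa)) c10 => u c10 q6; lra.
by move: h3 q7; lra.
Qed.

Definition root_level : R := level_coef `^ (s%:R^-1).

Lemma mean_X_ratio : mean_X z / root_eps z @[z --> sc] --> m * root_level.
Proof.
have cv : f z.1 z.2 / root_eps z @[z --> sc] --> root_level.
  apply: (@cvg_root R _ sc _ s _ _ level_coef s12 (ltW lc0) msg_mean_level).
  apply: filterS (near_scaling betac 0 ltr01) => z [h1 h2 _].
  have hb : inrange z.1 by rewrite (ltW h1).
  have f0 : 0 < f z.1 z.2 := msg_mean_gt0 H hb z.2.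
  split; first by rewrite divr_ge0 ?powR_ge0 // ltW.
  by rewrite exprMn exprVn root_eps_expr.
have cv3 : m * (f z.1 z.2 / root_eps z) @[z --> sc] --> m * root_level by apply: cvgM (cvg_cst _) cv.
apply: cvg_trans cv3; apply: near_eq_cvg; apply: nearW => z.
by rewrite /mean_X mulrA.
Qed.

(** ** Almost sure convergence *)

(** With parameters that approach the critical value geometrically, the
    comparison with the linear recursion over the last [i] generations at step
    [i] has an error exponentially small in [i] in mean, hence summable. *)
Lemma ae_cvg_along (tau : R) (b : nat -> R) (N : nat -> nat) : 0 < tau -> tau < 1 ->
  (forall i, betac < b i /\ b i <= betac + tau ^+ (2 * i)) ->
  (N i)%:R * (b i - betac) @[i --> \oo] --> +oo ->
  {ae Q, forall x, X (b i, N i) x / root_eps (b i, N i) @[i --> \oo] --> m * root_level * W x}.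
Proof.
move=> t0 t1 hb hN.
have t2 : tau ^+ 2 < 1 by rewrite expr2 -[ltRHS]mulr1 ltr_pM // ltW.
have p2 : 0 < tau ^+ 2 by exact: exprn_gt0.
have ti i : 0 < tau ^+ i by exact: exprn_gt0.
have ep0 i : 0 < b i - betac by rewrite subr_gt0; have [] := hb i.
have ep1 i : b i - betac <= tau ^+ i * tau ^+ i.
  by rewrite lerBlDl -exprD addnn -mul2n; have [] := hb i.
have one : 0 < 1 - tau by rewrite subr_gt0.
have iep i : i%:R * (b i - betac) <= (1 - tau)^-1 * tau ^+ i.
  apply: (le_trans (ler_wpM2l (ler0n R i) (ep1 i))); rewrite mulrA.
  by apply: ler_wpM2r (nat_expr_le i t0 t1); exact: ltW.
have iep1 i : i%:R * (b i - betac) <= (1 - tau)^-1.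
  by apply: (le_trans (iep i)); rewrite ler_piMr ?invr_ge0 ?(ltW one) // exprn_ile1 // ltW.
have cvb : b i @[i --> \oo] --> betac.
  apply: (@squeeze_cvgr _ _ _ _ (fun=> betac) (fun i => betac + tau ^+ i)).
  - apply: nearW => i; have [h1 h2] := hb i; rewrite (ltW h1) /= (le_trans h2) // lerD2l.
    by rewrite ler_wiXn2l ?(ltW t0) ?(ltW t1) // mul2n -addnn leq_addr.
  - exact: cvg_cst.
  - rewrite -[X in _ --> X]addr0; apply: cvgD; first exact: cvg_cst.
    by apply: cvg_expr; rewrite ger0_norm // ltW.
have cz : (b i, N i) @[i --> \oo] --> sc by exact: scaling_seq.
have hN2 : (N i - i)%N%:R * (b i - betac) @[i --> \oo] --> +oo.
  apply/cvgryPge => A; move/cvgryPge : hN => /(_ (A + (1 - tau)^-1)); apply: filterS => i hA.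
  have hn : (N i)%:R - i%:R <= (N i - i)%N%:R :> R.
    by rewrite lerBlDr -natrD ler_nat addnC -leq_subLR.
  apply: le_trans (ler_wpM2r (ltW (ep0 i)) hn); rewrite mulrBl lerBrDr; apply: le_trans hA.
  by rewrite lerD2l.
have cz2 : (b i, (N i - i)%N) @[i --> \oo] --> sc by exact: (@scaling_seq _ _ b (fun i => N i - i)%N).
have [er [kappa [er0 er1 ka0 hr]]] := rho_bound H Zs.
have [el [C [el0 el1 C0 hl]]] := tot_dist H Zs.
have [c1 [c2 [c10 c20 ho]]] := msg_mean_order H Zs.
pose th := (1 + m^-1) / 2.
have th0 : 0 < th by rewrite divr_gt0 // addr_gt0 // invr_gt0.
have th1 : th < 1.
  have h : m^-1 < 1 by rewrite invf_lt1.
  by rewrite /th; lra.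
pose t := Num.max tau th.
have tt0 : 0 < t by rewrite lt_max t0.
have tt1 : t < 1 by rewrite gt_max t1.
pose B := kappa * c2 ^+ s * (1 - tau)^-1.
have B0 : 0 < B by rewrite !mulr_gt0 ?exprn_gt0 ?invr_gt0.
have eB : 0 < (2 * B)^-1 by rewrite invr_gt0 mulr_gt0.
have near_small : \forall i \near \oo, tau ^+ i <= (2 * B)^-1.
  have cv : tau ^+ i @[i --> \oo] --> (0 : R) by apply: cvg_expr; rewrite ger0_norm // ltW.
  move/cvgrPdist_le : cv => /(_ _ eB); apply: filterS => i.
  by rewrite sub0r normrN ger0_norm // ltW.
have near_iN : \forall i \near \oo, (i <= N i)%N.
  move/cvgryPge : hN => /(_ ((1 - tau)^-1)); apply: filterS => i hi.
  by have := le_trans (iep1 i) hi; rewrite ler_pM2r // ler_nat.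
have em : 0 < Num.min er el by rewrite lt_min er0.
have near_e : \forall i \near \oo, [/\ betac < b i, b i <= betac + Num.min er el & 0 <= (N i)%:R * (b i - betac)].
  by have := cz _ (near_scaling betac 0 em).
have near_o : \forall i \near \oo, f (b i) (N i - i) <= c2 * root_eps (b i, (N i - i)%N).
  suff : \forall i \near \oo, c1 * root_eps (b i, (N i - i)%N) <= f (b i) (N i - i) <=
      c2 * root_eps (b i, (N i - i)%N) by apply: filterS => i /andP[].
  exact: (cz2 _ ho).
have good : \forall i \near \oo, inrange (b i) /\
    E (fun x => `|X (b i, N i) x / mean_X (b i, N i) - gw i x|) <= (4 * B + 2 * C) * t ^+ i.
  apply: filterS (filterI (filterI near_small near_iN) (filterI near_e near_o)) => i.
  move=> [[s1 iN] [[h1 h2 _] o2]].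
  have h2r : b i <= betac + er by rewrite (le_trans h2) // lerD2l ge_min lexx.
  have h2l : b i <= betac + el by rewrite (le_trans h2) // lerD2l ge_min lexx orbT.
  have hbi : inrange (b i) by rewrite (ltW h1) (le_trans h2r) // lerD2l.
  split => //; have f0 j : 0 < f (b i) j := msg_mean_gt0 H hbi j.
  have y1 : i%:R * (kappa * f (b i) (N i - i) ^+ s) <= B * tau ^+ i.
    have fs : f (b i) (N i - i) ^+ s <= c2 ^+ s * (b i - betac).
      have e : (c2 * root_eps (b i, (N i - i)%N)) ^+ s = c2 ^+ s * (b i - betac).
        by rewrite exprMn root_eps_expr.
      by rewrite -e lerXn2r ?nnegrE ?mulr_ge0 ?powR_ge0 // ltW.
    have kc : 0 <= kappa * c2 ^+ s by rewrite mulr_ge0 ?exprn_ge0 // ltW.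
    rewrite mulrCA; apply: (@le_trans _ _ (kappa * (i%:R * (c2 ^+ s * (b i - betac))))).
      by apply: (ler_wpM2l (ltW ka0)); apply: ler_wpM2l.
    have -> : kappa * (i%:R * (c2 ^+ s * (b i - betac))) = kappa * c2 ^+ s * (i%:R * (b i - betac)) by ring.
    by rewrite /B -[leRHS]mulrA; apply: ler_wpM2l.
  have y2 : B * tau ^+ i <= 2^-1.
    apply: (le_trans (ler_wpM2l (ltW B0) s1)).
    by rewrite le_eqVlt; apply/orP; left; apply/eqP; field; rewrite gt_eqF.
  have [r1 r2] := hr (b i, N i) i (ltW h1) h2r iN (le_trans y1 y2).
  have [_ d1 _ _] := hl (b i) (N i - i)%N i (ltW h1) h2l; rewrite subnK // in d1.
  rewrite -/m -/(rho i (b i, N i)) -/(X (b i, N i)) -/(mean_X (b i, N i)) -/th in d1.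
  apply: (le_trans d1); move: (rho i (b i, N i)) r1 r2 => r r1 r2.
  have r3 : r - 1 <= 2 * (B * tau ^+ i) by apply: (le_trans r2); rewrite ler_pM2l.
  have rr : r <= 2 by move: r3 y2; lra.
  have q1 : tau ^+ i <= t ^+ i.
    by rewrite lerXn2r ?nnegrE ?(ltW t0) ?(ltW tt0) // /t le_max lexx.
  have q2 : th ^+ i <= t ^+ i.
    by rewrite lerXn2r ?nnegrE ?(ltW th0) ?(ltW tt0) // /t le_max lexx orbT.
  have q3 : C * r * th ^+ i <= C * 2 * t ^+ i.
    have r0 : 0 <= r := le_trans ler01 r1.
    apply: ler_pM => //; [exact: mulr_ge0 (ltW C0) r0 | exact: exprn_ge0 (ltW th0) |].
    by rewrite ler_pM2l.
  have q4 := ler_wpM2l (ltW B0) q1.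
  rewrite (mulrDl (4 * B)); have -> : 2 * C * t ^+ i = C * 2 * t ^+ i by ring.
  have -> : 4 * B * t ^+ i = 4 * (B * t ^+ i) by ring.
  move: r3 q4 q3; move: (B * tau ^+ i) (B * t ^+ i) (C * r * _) (C * 2 * _) => *; lra.
have [i0 _ hgood] := good.
pose F i x := `|X (b (i + i0)%N, N (i + i0)%N) x / mean_X (b (i + i0)%N, N (i + i0)%N) - gw (i + i0) x|.
have Fi i : Itg (F i).
  have [hbi _] := hgood (i + i0)%N (leq_addl _ _).
  have [Xi _] := Itg_X H Zs (z := (b (i + i0)%N, N (i + i0)%N)) hbi.
  apply: Itg_norm; apply: ItgB; last by have [] := gw_mean H (i + i0).
  by apply: eq_Itg (ItgZ (mean_X (b (i + i0)%N, N (i + i0)%N))^-1 Xi) => x; rewrite mulrC.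
pose D := 4 * B + 2 * C; have D0 : 0 < D by apply: addr_gt0; apply: mulr_gt0.
have FB n : \sum_(0 <= i < n) E (F i) <= D * (1 - t)^-1.
  apply: (@le_trans _ _ (\sum_(0 <= i < n) D * t ^+ i)).
    apply: ler_sum => i _; have [_ h] := hgood (i + i0)%N (leq_addl _ _); apply: (le_trans h).
    by rewrite ler_pM2l // ler_wiXn2l ?(ltW tt0) ?(ltW tt1) // leq_addr.
  by rewrite -mulr_sumr ler_pM2l // geo_sum_le.
have rat : mean_X (b i, N i) / root_eps (b i, N i) @[i --> \oo] --> m * root_level.
  exact: (cvg_comp (fun i => (b i, N i)) (fun z => mean_X z / root_eps z) cz mean_X_ratio).
apply: aeS (aeI (ae_cvg0 Fi (fun i x => normr_ge0 _) FB) (gw_cvg H Zs)) => x [c0 cg].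
have cA : X (b i, N i) x / mean_X (b i, N i) @[i --> \oo] --> W x.
  have cd : (X (b i, N i) x / mean_X (b i, N i) - gw i x) @[i --> \oo] --> (0 : R).
    rewrite -(cvg_shiftn i0); apply/cvgr0Pnorm_le => e e0.
    move/cvgr0Pnorm_le : c0 => /(_ _ e0); apply: filterS => i; by rewrite /F normr_id.
  have cs : (X (b i, N i) x / mean_X (b i, N i) - gw i x) + gw i x @[i --> \oo] --> 0 + W x.
    by apply: cvgD cd cg.
  rewrite add0r in cs; apply: cvg_trans cs; apply: near_eq_cvg.
  by apply: nearW => i /=; rewrite subrK.
have cp : mean_X (b i, N i) / root_eps (b i, N i) * (X (b i, N i) x / mean_X (b i, N i)) @[i --> \oo] -->
    m * root_level * W x by apply: cvgM rat cA.
apply: cvg_trans cp; apply: near_eq_cvg.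
apply: filterS good => i [hbi _] /=.
have a0 := mean_X_gt0 H (z := (b i, N i)) hbi.
by move: (root_eps _) => r; rewrite mulrC mulrA divfK // gt_eqF.
Qed.

(** The log odds increase with the parameter and decrease with the height. *)
Lemma X_mono (b b' : R) n k x : betac <= b -> b <= b' -> b' <= betac + 1 ->
  X (b, n + k)%N x <= X (b', n) x.
Proof.
move=> h1 h2 h3; have hb : inrange b by rewrite h1 (le_trans h2).
have b0 : 0 < b := lt_le_trans bc0 h1.
apply: (@le_trans _ _ (X (b, n) x)).
  elim: k => [|k IHk]; first by rewrite addn0.
  apply: le_trans IHk; rewrite addnS; apply: ler_sum => i _; exact: (message_anti H hb).
by apply: ler_sum => i _; have /andP[] := message_mono_beta n (shift i x) (ct_q H) b0 h2.
Qed.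

End Limit.

Lemma psi_homo (R : realType) (q x y : R) : 0 < q <= 2 -> 0 <= x -> x <= y -> psi q x <= psi q y.
Proof.
move=> hq; rewrite le_eqVlt => /predU1P[<-|x0]; last exact: (psi_mono hq).
by move=> y0; rewrite [leLHS](_ : _ = 0) ?expR0 ?/psi ?expR0 ?subrr ?mul0r //; have [] := psi_quad hq y0.
Qed.

Lemma root_epsE (R : realType) (q betac : R) z :
  root_eps q betac z = (z.1 - betac) `^ ((crit_exp q)%:R^-1).
Proof. by []. Qed.

Lemma root_levelE (R : realType) (Q : probability (tree_space setT) R) (q betac : R) :
  root_level Q q betac = level_coef Q q betac `^ ((crit_exp q)%:R^-1).
Proof. by []. Qed.

Section AlmostSure.
Variables (R : realType) (mu : probability nat R).
Variable Q : probability (tree_space setT) R.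
Variables (q betac : R).
Hypothesis H : critical_tree mu Q q betac.
Let m := mean_children Q.
Let m_gt1 : 1 < m := ct_mean H.
Let m_gt0 : 0 < m. Proof. exact: lt_trans ltr01 m_gt1. Qed.
Let s := crit_exp q.
Let bc0 : 0 < betac. Proof. exact: (betac_gt0 (ct_q H) (ct_mean H) (ct_crit H)). Qed.
Let s12 : s = 1%N \/ s = 2%N := crit_expP q.
Let q_gt0 : 0 < q. Proof. by have /andP[] := ct_q H. Qed.

Notation E := (Ex Q).
Notation Itg := (Itg Q).
Notation sc := (scaling betac).
Notation W := (gw_lim Q).
Notation gw := (gw Q).
Notation X := (X q).
Notation mean_X := (mean_X Q q).
Notation root_eps := (root_eps q betac).
Notation rho := (rho Q q).
Notation inrange beta := (betac <= beta <= betac + 1).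
Implicit Types z : R * nat.

Hypothesis Zs : Itg (fun x => (x [::])%:R ^+ s.+1).

Let Wi : Itg W. Proof. by have [] := gw_lim_moments H Zs. Qed.
Let Wsi : Itg (fun x => W x ^+ s.+1). Proof. by have [] := gw_lim_moments H Zs. Qed.
Let W0 x : 0 <= W x. Proof. exact: (gw_lim_ge0 H). Qed.
Let EW := E (fun x => W x ^+ s.+1).

Notation root_level := (root_level Q q betac).

Let gr (th : R) : R := th `^ (s%:R^-1).

Let gr_gt0 th : 0 < th -> 0 < gr th. Proof. exact: powR_gt0. Qed.

Let gr_le th th' : 0 <= th -> th <= th' -> gr th <= gr th'.
Proof.
move=> h1 h2; apply: ge0_ler_powR => //; rewrite ?nnegrE ?invr_ge0 //.
exact: le_trans h2.
Qed.

Let gr_ge (tau : R) : 0 < tau -> tau <= 1 -> tau ^+ 2 <= gr (tau ^+ 2).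
Proof.
move=> t0 t1; rewrite /gr; case: s12 => ->; first by rewrite invr1 powRr1 // sqr_ge0.
by rewrite powR12_sqrt ?sqr_ge0 // sqrtr_sqr ger0_norm ?(ltW t0) // expr2 ler_piMl // ltW.
Qed.

Section Sandwich.
Variable b : nat -> R.
Hypothesis cb : b n @[n --> \oo] --> betac.
Hypothesis cn : n%:R * (b n - betac) @[n --> \oo] --> +oo.
Let eps n := b n - betac.
Variable tau : R.
Hypotheses (t0 : 0 < tau) (t1 : tau < 1).
Let th := tau ^+ 2.
Let th0 : 0 < th. Proof. exact: exprn_gt0. Qed.
Let th1 : th < 1. Proof. by rewrite /th expr2 -[ltRHS]mulr1 ltr_pM // ltW. Qed.
Let thi i : 0 < th ^+ i. Proof. exact: exprn_gt0. Qed.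

Let th_small (e : R) : 0 < e -> \forall i \near \oo, th ^+ i < e.
Proof.
move=> e0; have cv : th ^+ i @[i --> \oo] --> (0 : R).
  by apply: cvg_expr; rewrite ger0_norm // ltW.
move/cvgr0Pnorm_lt : cv => /(_ _ e0); apply: filterS => i.
by rewrite ger0_norm // ltW.
Qed.

Let eps_small (e : R) : 0 < e -> \forall n \near \oo, eps n <= e.
Proof.
move=> e0; move/cvgrPdist_le : cb => /(_ _ e0); apply: filterS => n h.
by apply: le_trans h; rewrite distrC ler_norm.
Qed.

Let eps_pos : \forall n \near \oo, 0 < eps n.
Proof.
move/cvgryPge : cn => /(_ 1); apply: filterS => n h; rewrite ltNge; apply/negP => hle.
by have := le_trans h (mulr_ge0_le0 (ler0n R n) hle); rewrite ler10.
Qed.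

Let scale_of (e : R) : 0 < e -> e <= 1 -> exists i, th ^+ i.+1 < e /\ e <= th ^+ i.
Proof.
move=> e0 e1; have ex : exists i, th ^+ i.+1 < e.
  have [i0 _ h] := th_small e0; exists i0; exact: (h i0.+1 (leqnSn _)).
have [i hi mi] := ex_minnP ex; exists i; split=> //.
case: i hi mi => [|i] hi mi; first by rewrite expr0.
by rewrite leNgt; apply/negP => /mi; rewrite ltnn.
Qed.

(** The least height after which the parameter lies within the given scale. At
    a fixed parameter, the log odds are largest at this height among those of
    the scale, and it still belongs to the regime of the theorem. *)
Let first_height : exists N : nat -> nat, (N i)%:R * th ^+ i @[i --> \oo] --> +oo /\
  \forall n \near \oo, forall i, eps n <= th ^+ i -> (N i <= n)%N.
Proof.
have [n0 _ hn0] := eps_pos.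
have ex i : exists n, (n0 <= n)%N && (eps n <= th ^+ i).
  have [n1 _ h] := eps_small (thi i); exists (maxn n0 n1).
  by rewrite leq_maxl; exact: (h (maxn n0 n1) (leq_maxr _ _)).
pose N i := ex_minn (ex i); exists N; split; last first.
  exists n0 => // n /= hn i he; rewrite /N; case: ex_minnP => k _; apply.
  by rewrite hn.
have hN i : (n0 <= N i)%N /\ eps (N i) <= th ^+ i.
  by rewrite /N; case: ex_minnP => k /andP[].
have big K : \forall i \near \oo, (K <= N i)%N.
  elim: K => [|K IHK]; first exact: nearW.
  have [hK|hK] := ltnP K n0.
    by apply: nearW => i; apply: leq_trans hK (proj1 (hN i)).
  apply: filterS2 IHK (th_small (hn0 _ hK)) => i h1 h2.
  rewrite ltn_neqAle h1 andbT; apply/eqP => e; have := proj2 (hN i).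
  by rewrite -e leNgt h2.
apply/cvgryPge => A; move/cvgryPge : cn => /(_ A)[n1 _ h1].
apply: filterS (big n1) => i hi; apply: (le_trans (h1 _ hi)).
by apply: ler_wpM2l => //; have [] := hN i.
Qed.

(** A height above all those at which the parameter exceeds the given scale,
    large enough for the product with the scale to diverge. *)
Let last_height : exists N : nat -> nat, (N i)%:R * th ^+ i @[i --> \oo] --> +oo /\
  forall i n, th ^+ i < eps n -> (n <= N i)%N.
Proof.
have ex i : exists N : nat, i%:R <= N%:R * th ^+ i /\ forall n, th ^+ i < eps n -> (n <= N)%N.
  have [n1 _ h] := eps_small (thi i).
  have [k hk] : exists k : nat, i%:R / th ^+ i <= k%:R.
    exists (Num.bound (i%:R / th ^+ i)); apply: ltW; apply: archi_boundP.
    by rewrite divr_ge0 // ltW.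
  exists (maxn k n1); split.
    rewrite -ler_pdivrMr //; apply: (le_trans hk); rewrite ler_nat; exact: leq_maxl.
  move=> n hn; apply: leq_trans (leq_maxr k n1); apply: ltnW; rewrite ltnNge; apply/negP => /h /=.
  by rewrite leNgt hn.
have [N hN] := choice ex; exists N; split; last by move=> i; exact: (proj2 (hN i)).
apply/cvgryPge => A; apply: filterS (nbhs_infty_ger A) => i hi.
by apply: (le_trans hi); have [] := hN i.
Qed.

Let re_scale i n : root_eps (betac + th ^+ i, n) = gr (th ^+ i).
Proof. by rewrite root_epsE /= addrAC subrr add0r. Qed.

Let gr_scaleS i : gr (th ^+ i.+1) = gr th * gr (th ^+ i).
Proof. by rewrite /gr exprS powRM // ltW. Qed.

(** Monotonicity in both the parameter and the height compares the normalized
    log odds with those at the two ends of the geometric scale of the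
    parameter, to which the almost sure convergence along geometric parameters
    applies. *)
Lemma ae_sandwich : {ae Q, forall x, forall e : R, 0 < e -> \forall n \near \oo,
  gr th * (m * root_level * W x - e) <= X (b n, n) x / root_eps (b n, n) /\
  X (b n, n) x / root_eps (b n, n) <= (m * root_level * W x + e) / gr th}.
Proof.
have [N1 [cN1 hN1]] := first_height; have [N2 [cN2 hN2]] := last_height.
have c1 : {ae Q, forall x, X (betac + th ^+ i, N1 i) x / root_eps (betac + th ^+ i, N1 i)
    @[i --> \oo] --> m * root_level * W x}.
  apply: (ae_cvg_along H Zs t0 t1 (b := fun i => betac + th ^+ i)) => [i|].
    by rewrite ltrDl thi exprM.
  by apply: cvg_trans cN1; apply: near_eq_cvg; apply: nearW => i; rewrite addrAC subrr add0r.
have c2 : {ae Q, forall x, X (betac + th ^+ i.+1, N2 i.+1) x / root_eps (betac + th ^+ i.+1, N2 i.+1)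
    @[i --> \oo] --> m * root_level * W x}.
  apply: (ae_cvg_along H Zs t0 t1 (b := fun i => betac + th ^+ i.+1) (N := fun i => N2 i.+1)) => [i|].
    by rewrite ltrDl thi lerD2l exprM -/th exprS ler_piMl // ltW.
  have cs : (N2 i.+1)%:R * th ^+ i.+1 @[i --> \oo] --> +oo.
    by apply/cvgryPge => A; move/cvgryPge : cN2 => /(_ A)[k _ hk]; exists k => // i /= ki; apply: hk; exact: leqW.
  by apply: cvg_trans cs; apply: near_eq_cvg; apply: nearW => i; rewrite addrAC subrr add0r.
apply: aeS (aeI c1 c2) => x [d1 d2] e e0.
move/cvgrPdist_le : d1 => /(_ _ e0)[k1 _ h1]; move/cvgrPdist_le : d2 => /(_ _ e0)[k2 _ h2].
have e1 : 0 < Num.min 1 (th ^+ (maxn k1 k2).+1) by rewrite lt_min ltr01 thi.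
apply: filterS3 (eps_small e1) eps_pos hN1 => n hs hp hN.
move: hs; rewrite le_min => /andP[s1 s2].
have [i [i1 i2]] := scale_of hp s1.
have Ki : (maxn k1 k2 <= i)%N.
  rewrite leqNgt; apply/negP => lt; move: (lt_le_trans i1 s2); rewrite ltNge => /negP; apply.
  by apply: (ler_wiXn2l (ltW th0) (ltW th1)); exact: leqW.
move: (h1 i (leq_trans (leq_maxl _ _) Ki)) (h2 i (leq_trans (leq_maxr _ _) Ki)) => /=.
rewrite !ler_norml re_scale re_scale gr_scaleS => /andP[u1 _] /andP[_ u2].
set g := gr th in u2 *; set r := gr (th ^+ i) in u1 u2.
have g0 : 0 < g := gr_gt0 th0; have r0 : 0 < r := gr_gt0 (thi i).
set rn := root_eps (b n, n); have rn1 : rn <= r by apply: gr_le i2; exact: ltW.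
have rn2 : g * r <= rn by rewrite /g /r -gr_scaleS; apply: gr_le (ltW i1); exact: ltW.
have rn0 : 0 < rn by apply: lt_le_trans rn2; exact: mulr_gt0.
have thi1 j : th ^+ j <= 1 by rewrite exprn_ile1 // ltW.
have bn1 : betac <= b n by rewrite -subr_ge0 ltW.
have X1 : X (b n, n) x <= X (betac + th ^+ i, N1 i) x.
  have h1' : b n <= betac + th ^+ i by rewrite -lerBlDl.
  have h2' : betac + th ^+ i <= betac + 1 by rewrite lerD2l.
  by have := X_mono H (N1 i) (n - N1 i) x bn1 h1' h2'; rewrite subnKC // hN.
have X2 : X (betac + th ^+ i.+1, N2 i.+1) x <= X (b n, n) x.
  have h1' : betac <= betac + th ^+ i.+1 by rewrite lerDl ltW.
  have h2' : betac + th ^+ i.+1 <= b n by rewrite -lerBrDl ltW.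
  have h3' : b n <= betac + 1 by rewrite -lerBlDl.
  by have := X_mono H n (N2 i.+1 - n) x h1' h2' h3'; rewrite subnKC // hN2.
have hbn : inrange (b n) by rewrite bn1 -lerBlDl.
have Xn0 : 0 <= X (b n, n) x := X_ge0 H (z := (b n, n)) x hbn.
have Xb0 : 0 <= X (betac + th ^+ i.+1, N2 i.+1) x.
  by apply: (X_ge0 H); rewrite /= lerDl lerD2l thi1 ltW.
move: (X (b n, n) x) (X (betac + th ^+ i, _) x) (X (betac + th ^+ i.+1, _) x)
  Xn0 Xb0 X1 X2 u1 u2 => Xn Xa Xb Xn0 Xb0 X1 X2 u1 u2.
have ub : Xa / r <= m * root_level * W x + e by move: u1; move: (Xa / r) (_ * W x) => *; lra.
have lb : m * root_level * W x - e <= Xb / (g * r) by move: u2; move: (Xb / _) (_ * W x) => *; lra.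
split.
  apply: (le_trans (ler_wpM2l (ltW g0) lb)).
  have -> : g * (Xb / (g * r)) = Xb / r by field; rewrite !gt_eqF.
  by apply: ler_pM => //; rewrite ?invr_ge0 ?(ltW r0) // lef_pV2.
rewrite ler_pdivlMr //; apply: le_trans ub; rewrite ler_pdivlMr //.
have -> : Xn / rn * g * r = Xn * (g * r / rn) by field; rewrite gt_eqF.
by apply: le_trans X1; apply: ler_piMr => //; rewrite ler_pdivrMr // mul1r.
Qed.

End Sandwich.

(** The ratio of the geometric scales may be taken arbitrarily close to one. *)
Lemma ae_root_cvg (b : nat -> R) : b n @[n --> \oo] --> betac ->
  n%:R * (b n - betac) @[n --> \oo] --> +oo ->
  {ae Q, forall x, X (b n, n) x / root_eps (b n, n) @[n --> \oo] --> m * root_level * W x}.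
Proof.
move=> cb cn; pose tau l : R := 1 - l.+2%:R^-1.
have il (l : nat) : 0 < l.+2%:R^-1 :> R /\ l.+2%:R^-1 < 1 :> R.
  by rewrite invr_gt0 ltr0n invf_lt1 ?ltr0n // ltr1n.
have t0 l : 0 < tau l by rewrite subr_gt0; have [] := il l.
have t1 l : tau l < 1 by rewrite /tau gtrBl; have [] := il l.
have := ae_foralln (fun l => ae_sandwich cb cn (t0 l) (t1 l)).
apply: filterS => x hx; apply/cvgrPdist_le => e e0.
set w := m * root_level * W x in hx *.
have w0 : 0 <= w by rewrite !mulr_ge0 ?powR_ge0 // ltW.
have [l hl] : exists l, 2 * (w + e) / (e / 2) <= l.+2%:R.
  exists (Num.bound (2 * (w + e) / (e / 2))); apply: ltW.
  apply: (lt_trans (archi_boundP _)); last by rewrite ltr_nat.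
  by rewrite divr_ge0 ?mulr_ge0 ?addr_ge0 ?divr_ge0 // ltW.
have e2 : 0 < e / 2 by exact: divr_gt0.
apply: filterS (hx l _ e2) => n; have := gr_ge (t0 l) (ltW (t1 l)).
have g1 : gr (tau l ^+ 2) <= 1.
  have e1 : gr 1 = 1 by rewrite /gr powR1.
  rewrite -[leRHS]e1; apply: gr_le; first exact: sqr_ge0.
  by rewrite exprn_ile1 // ltW.
have g0 : 0 < gr (tau l ^+ 2) by apply: gr_gt0; exact: exprn_gt0.
move: (gr (tau l ^+ 2)) g0 g1 => g g0 g1 gt [h1 h2].
have dl : (1 - g) * (w + e) <= e / 2.
  have d1 : 1 - g <= 2 / l.+2%:R.
    have := sqr_ge0 (l.+2%:R^-1 : R); move: gt; rewrite /tau; move: (l.+2%:R^-1) => v.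
    have -> : (1 - v) ^+ 2 = 1 - 2 * v + v ^+ 2 by ring.
    by move: (v ^+ 2) => v2; lra.
  have we : 0 <= w + e by rewrite addr_ge0 // ltW.
  apply: (le_trans (ler_wpM2r we d1)); rewrite mulrAC ler_pdivrMr ?ltr0n // mulrC.
  by move: hl; rewrite ler_pdivrMr // mulrC (mulrC (e / 2)) (mulrC l.+2%:R).
move: h2; rewrite ler_pdivlMr // => h2.
move: (X _ _ / _) h1 h2 => a h1 h2; rewrite distrC ler_norml; apply/andP; split.
  have : (1 - g) * (w + e) = w + e - g * w - g * e by ring.
  have : g * (w - e / 2) = g * w - g * e / 2 by field.
  have : g * e <= e by rewrite ler_piMl // ltW.
  by move: dl h1; move: ((1 - g) * _) (g * (w - _)) (g * w) (g * e) => *; lra.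
rewrite -(ler_pM2r g0) mulrBl.
have : (1 - g) * (w + e) = w + e - g * w - g * e by ring.
by move: dl h2; rewrite (mulrC e g) (mulrC w g); move: ((1 - g) * _) (a * g) (g * w) (g * e) => *; lra.
Qed.


(** ** From the log odds to the connection probability *)

Let psi_close (y : R) : 0 <= y -> `|psi q y - y / q| <= y ^+ 2 / q ^+ 2.
Proof.
by move=> y0; have [_ h1 h2] := psi_quad (ct_q H) y0; rewrite distrC ger0_norm // subr_ge0.
Qed.

(** The function [psi] has slope [1 / q] at the origin, and the log odds go to
    zero. *)
Lemma ae_psi_cvg (b : nat -> R) : b n @[n --> \oo] --> betac ->
  n%:R * (b n - betac) @[n --> \oo] --> +oo ->
  {ae Q, forall x, psi q (X (b n, n) x) / root_eps (b n, n) @[n --> \oo] -->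
     m * root_level / q * W x}.
Proof.
move=> cb cn; have cz : (b n, n) @[n --> \oo] --> sc by exact: (@scaling_seq _ _ b id).
have rz : root_eps (b n, n) @[n --> \oo] --> (0 : R).
  exact: (cvg_comp (fun n => (b n, n)) (fun z => root_eps z) cz (root_eps_cvg q betac)).
have nb : \forall n \near \oo, [/\ betac < b n, b n <= betac + 1 & 0 <= n%:R * (b n - betac)].
  by have := cz _ (near_scaling betac 0 ltr01).
apply: aeS (ae_root_cvg cb cn) => x cx.
have cA : X (b n, n) x / root_eps (b n, n) / q @[n --> \oo] --> m * root_level * W x / q.
  by apply: cvgM cx (cvg_cst _).
have cB : X (b n, n) x / root_eps (b n, n) / q - (X (b n, n) x / root_eps (b n, n)) ^+ 2 *
    root_eps (b n, n) / q ^+ 2 @[n --> \oo] --> m * root_level * W x / q -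
    (m * root_level * W x) ^+ 2 * 0 / q ^+ 2.
  apply: cvgB cA _; apply: cvgM (cvg_cst _); apply: cvgM rz.
  by under eq_cvg do rewrite expr2; rewrite expr2; apply: cvgM.
rewrite mulr0 mul0r subr0 in cB; rewrite mulrAC.
apply: squeeze_cvgr cB cA; apply: filterS nb => n [h1 h2 _].
have hb : inrange (b n) by rewrite (ltW h1).
have r0 : 0 < root_eps (b n, n) by apply: root_eps_gt0.
have x0 : 0 <= X (b n, n) x := X_ge0 H (z := (b n, n)) x hb.
have [_ p1 p2] := psi_quad (ct_q H) x0.
move: (root_eps _) r0 (X _ x) x0 p1 p2 => r r0 y y0 p1 p2; apply/andP; split.
  rewrite ler_pdivlMr // mulrBl.
  have -> : y / r / q * r = y / q by field; rewrite !gt_eqF.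
  have -> : (y / r) ^+ 2 * r / q ^+ 2 * r = y ^+ 2 / q ^+ 2 by field; rewrite !gt_eqF.
  by rewrite lerBlDl -lerBlDr.
by rewrite (mulrAC y) ler_pM2r ?invr_gt0.
Qed.

Let psi_power (y : R) : 0 <= y -> `|psi q y - y / q| <= y / q.
Proof.
by move=> y0; have [h0 h1 _] := psi_quad (ct_q H) y0; rewrite distrC ger0_norm ?subr_ge0 // lerBlDl lerDr.
Qed.

Let meas_psi_X z : inrange z.1 -> meas setT (fun x => psi q (X z x)).
Proof.
move=> hb; have [Xi _] := Itg_X H Zs hb.
apply: (@meas_mono _ setT (psi q) (X z)); first by move=> y y'; exact: (psi_homo (ct_q H)).
- by move=> x; exact: (X_ge0 H x hb).
- exact: (Itg_meas Xi).
Qed.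

Let meas_psi_diff z : inrange z.1 -> meas setT (fun x => psi q (X z x) - X z x / q).
Proof.
move=> hb; have [Xi _] := Itg_X H Zs hb; have mX := Itg_meas Xi.
apply: measurable_funB; first exact: meas_psi_X.
by apply: measurable_funM => //; exact: mX.
Qed.

Let psi_error_cvg : E (fun x => `|psi q (X z x) - X z x / q| ^+ s.+1) / mean_X z ^+ s.+1
  @[z --> sc] --> (0 : R).
Proof.
rewrite -[X in _ --> X](mul0r (E (fun x => W x ^+ s.+1))).
apply: (@power_functional _ _ _ _ _ H Zs (fun _ y => `|psi q y - y / q| ^+ s.+1) 0 (q^-1 ^+ s.+1)).
- exact: lexx.
- by rewrite exprn_gt0 // invr_gt0.
- move=> z hb; apply: measurable_funX; apply: measurableT_comp => //.
  exact: meas_psi_diff.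
- move=> beta y _ y0; rewrite ger0_norm ?exprn_ge0 // -exprMn lerXn2r ?nnegrE //.
    by rewrite mulr_ge0 // invr_ge0 ltW.
  by rewrite (mulrC q^-1); exact: psi_power.
- move=> eta eta0; exists (q ^+ 2 * Num.min 1 eta).
    by rewrite mulr_gt0 ?exprn_gt0 // lt_min ltr01.
  move=> beta y _ _ y0 yd; rewrite mul0r subr0 ger0_norm ?exprn_ge0 //.
  have q2 : 0 < q ^+ 2 by exact: exprn_gt0.
  have v0 : 0 <= y / q ^+ 2 by rewrite divr_ge0 // ltW.
  have v1 : y / q ^+ 2 <= Num.min 1 eta by rewrite ler_pdivrMr // mulrC.
  apply: (@le_trans _ _ ((y * (y / q ^+ 2)) ^+ s.+1)).
    have -> : y * (y / q ^+ 2) = y ^+ 2 / q ^+ 2 by rewrite mulrA -expr2.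
    apply: lerXn2r; rewrite ?nnegrE ?divr_ge0 ?sqr_ge0 //; exact: psi_close.
  rewrite exprMn mulrC ler_wpM2r ?exprn_ge0 //.
  move: v1; rewrite le_min => /andP[v1 v2]; apply: le_trans v2.
  by rewrite exprS ler_piMr // exprn_ile1.
Qed.

(** The error is the sum of three terms: the curvature of [psi], the distance
    between the normalized log odds and the limit, and the difference of the
    normalizations. *)
Lemma mean_psi_cvg :
  E (fun x => `|psi q (X z x) / root_eps z - m * root_level / q * W x| ^+ s.+1)
    @[z --> sc] --> (0 : R).
Proof.
set kap := m * root_level.
pose r z := mean_X z / root_eps z.
pose p2 : R := 2 ^+ s.+1; have p20 : 0 < p2 by exact: exprn_gt0.
pose U z := p2 * (E (fun x => `|psi q (X z x) - X z x / q| ^+ s.+1) / mean_X z ^+ s.+1 * r z ^+ s.+1 +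
  p2 * ((r z / q) ^+ s.+1 * dist_X Q q s.+1 z + (`|r z - kap| / q) ^+ s.+1 * EW)).
have cr : r z @[z --> sc] --> kap := mean_X_ratio H Zs.
have cU : U z @[z --> sc] --> p2 * (0 * kap ^+ s.+1 + p2 * ((kap / q) ^+ s.+1 * 0 + (`|kap - kap| / q) ^+ s.+1 * EW)).
  have cX (k : nat) (u : R * nat -> R) (l : R) : u z @[z --> sc] --> l -> u z ^+ k @[z --> sc] --> l ^+ k.
    by move=> cu; apply: (@cvg_comp _ _ _ _ (fun y : R => y ^+ k) _ _ _ cu); exact: exprn_continuous.
  apply: cvgM (cvg_cst _) _; apply: cvgD; first by apply: cvgM psi_error_cvg (cX _ _ _ cr).
  apply: cvgM (cvg_cst _) _; apply: cvgD.
    by apply: cvgM (dist_X_cvg H Zs); apply: cX; apply: cvgM cr (cvg_cst _).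
  apply: cvgM (cvg_cst _); apply: cX; apply: cvgM (cvg_cst _).
  by apply: cvg_norm; apply: cvgB cr (cvg_cst _).
rewrite subrr normr0 (mul0r q^-1) expr0n /= !(mul0r, mulr0, addr0) in cU.
apply: squeeze_cvgr (cvg_cst _) cU.
apply: filterS (near_scaling betac 0 ltr01) => z [h1 h2 _].
have hb : inrange z.1 by rewrite (ltW h1).
have a0 := mean_X_gt0 H hb; have e0 : 0 < root_eps z by apply: root_eps_gt0.
rewrite Ex_ge0 /=; last by move=> x; exact: exprn_ge0.
have [_ di] := Itg_dist H Zs hb; have mD := meas_psi_diff hb.
have mP : meas setT (fun x => `|psi q (X z x) - X z x / q| ^+ s.+1).
  by apply: measurable_funX; apply: measurableT_comp.
have [Xi Xsi] := Itg_X H Zs hb.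
have iP : Itg (fun x => `|psi q (X z x) - X z x / q| ^+ s.+1).
  apply: (Itg_le mP _ (ItgZ (q^-1 ^+ s.+1) Xsi)) => x.
  have x0 := X_ge0 H x hb.
  rewrite ger0_norm ?exprn_ge0 // -exprMn lerXn2r ?nnegrE //.
    by rewrite mulr_ge0 // invr_ge0 ltW.
  by rewrite (mulrC q^-1); exact: psi_power.
have pt x : `|psi q (X z x) / root_eps z - kap / q * W x| ^+ s.+1 <=
    p2 * ((root_eps z)^-1 ^+ s.+1 * `|psi q (X z x) - X z x / q| ^+ s.+1 +
    p2 * ((r z / q) ^+ s.+1 * `|X z x / mean_X z - W x| ^+ s.+1 + (`|r z - kap| / q) ^+ s.+1 * W x ^+ s.+1)).
  rewrite -!exprMn; set u := _ * `|psi _ _ - _|; set v := _ * `|_ - W x|; set w := `|r z - kap| / q * W x.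
  have u0 : 0 <= u by rewrite mulr_ge0 // invr_ge0 ltW.
  have r0 : 0 <= r z by rewrite divr_ge0 // ltW.
  have v0 : 0 <= v by rewrite mulr_ge0 // divr_ge0 // ltW.
  have w0 : 0 <= w by rewrite mulr_ge0 // divr_ge0 // ltW.
  apply: (@le_trans _ _ ((u + (v + w)) ^+ s.+1)); last first.
    apply: (le_trans (add_expr_le s.+1 u0 (addr_ge0 v0 w0))).
    by rewrite ler_pM2l // lerD2l; exact: add_expr_le.
  rewrite lerXn2r ?nnegrE ?addr_ge0 //.
  have split3 (e a g y w' k : R) : e != 0 -> a != 0 -> q != 0 -> g / e - k / q * w' =
      e^-1 * (g - y / q) + (a / e / q * (y / a - w') + (a / e - k) / q * w').
    by move=> h1' h2' h3'; field; rewrite h1' h2' h3'.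
  rewrite [X in `|X|](split3 _ (mean_X z) _ (X z x)) ?gt_eqF //.
  apply: (le_trans (ler_normD _ _)); apply: lerD.
    by rewrite normrM (ger0_norm (_ : 0 <= (root_eps z)^-1)) // invr_ge0 ltW.
  apply: (le_trans (ler_normD _ _)); apply: lerD.
    by rewrite normrM (ger0_norm (_ : 0 <= r z / q)) // divr_ge0 // ltW.
  by rewrite !normrM (ger0_norm (W0 x)) (ger0_norm (_ : 0 <= q^-1)) // invr_ge0 ltW.
have iR := ItgZ p2 (ItgD (ItgZ ((root_eps z)^-1 ^+ s.+1) iP)
  (ItgZ p2 (ItgD (ItgZ ((r z / q) ^+ s.+1) di) (ItgZ ((`|r z - kap| / q) ^+ s.+1) Wsi)))).
have mL : meas setT (fun x => `|psi q (X z x) / root_eps z - kap / q * W x| ^+ s.+1).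
  apply: measurable_funX; apply: measurableT_comp => //; apply: measurable_funB.
    by apply: measurable_funM => //; exact: meas_psi_X.
  by apply: measurable_funM => //; exact: (Itg_meas Wi).
have iL : Itg (fun x => `|psi q (X z x) / root_eps z - kap / q * W x| ^+ s.+1).
  by apply: (Itg_le mL _ iR) => x; rewrite ger0_norm ?exprn_ge0.
apply: (le_trans (le_Ex iL iR pt)).
have i1 := ItgZ ((r z / q) ^+ s.+1) di; have i2 := ItgZ ((`|r z - kap| / q) ^+ s.+1) Wsi.
have i3 := ItgZ p2 (ItgD i1 i2); have i4 := ItgZ ((root_eps z)^-1 ^+ s.+1) iP.
rewrite (ExZ _ (ItgD i4 i3)) (ExD i4 i3) (ExZ _ iP) (ExZ _ (ItgD i1 i2)) (ExD i1 i2) (ExZ _ di) (ExZ _ Wsi).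
rewrite /U ler_pM2l // lerD2r.
have -> : r z ^+ s.+1 = mean_X z ^+ s.+1 * (root_eps z)^-1 ^+ s.+1 by rewrite -exprMn.
have a1 : 0 < mean_X z ^+ s.+1 by exact: exprn_gt0.
by rewrite mulrA divfK ?gt_eqF // mulrC.
Qed.

(** The parameter [betac] is eliminated through [critical_expR]; then the
    constant is a rational function of [m] and [q], up to a square root when
    [q = 2]. *)
Lemma limit_const : m * root_level / q =
  crit_const q m (E (fun x => W x ^+ 2)) (E (fun x => W x ^+ 3)).
Proof.
have cE := critical_expR (ct_crit H).
have cr : m * psi q betac = 1 := ct_crit H.
have e1 : 1 < expR betac by rewrite expR_gt1.
have q0 := q_gt0; have m1 := m_gt1; have m0 := m_gt0; have W1 : 0 < EW := lt_le_trans ltr01 (limit_moment_ge1 H Zs).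
have ps : psi q betac = m^-1 by rewrite -[LHS]mul1r -(mulVf (lt0r_neq0 m0)) -mulrA cr mulr1.
rewrite -/m in cE m1.
have m10 : 0 < m - 1 by rewrite subr_gt0.
have e2 : expR betac = (m - 1 + q) / (m - 1) by rewrite -cE mulrC mulKf ?gt_eqF.
rewrite root_levelE /level_coef /pull_coef /defect_coef /defect_factor ps expR0 mulr1.
rewrite /growth_rate e2 /crit_const; move: W1; rewrite /EW /s /crit_exp.
have [q2|q2] := ltP q 2 => W1.
  have u0 : 0 < m - 1 + q by rewrite addr_gt0.
  have v0 : 0 < 2 - q by rewrite subr_gt0.
  rewrite invr1 -/m; move: (E _) W1 m10 u0 v0 => w w0 m10 u0 v0.
  have -> : (m - 1 + q) / ((m - 1 + q) / (m - 1) + q - 1) /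
      (m^-1 * ((m - 1 + q) / (m - 1) - (q - 1) * ((m - 1 + q) / (m - 1) + q - 2)) /
       (((m - 1 + q) / (m - 1) + q - 1) * (1 + (m - 1 + q) / (m - 1) + q - 2)) / 2 * w * m ^+ 2) =
      2 * (m - 1 + q) / ((2 - q) * m * w).
    field.
    rewrite (_ : m - 1 + (m - 1 + q) + q * (m - 1) + -2 * (m - 1) = q * m); last by ring.
    rewrite (_ : m - 1 + q - _ = m * q * (2 - q)); last by ring.
    by rewrite !mulf_neq0 ?gt_eqF.
  rewrite powRr1; last by rewrite divr_ge0 ?mulr_ge0 // ltW.
  by field; rewrite !gt_eqF.
have q22 : q = 2 by apply/eqP; rewrite eq_le q2 andbT; have /andP[] := ct_q H.
rewrite q22 -/m; move: (E _) W1 m10 => w w0 m10.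
have -> : (m - 1 + 2) / ((m - 1 + 2) / (m - 1) + 2 - 1) /
    (m^-1 * ((m - 1 + 2) / (m - 1)) /
     (((m - 1 + 2) / (m - 1) + 2 - 1) * (1 + (m - 1 + 2) / (m - 1) + 2 - 2)) / 3 * w * m ^+ 3) =
    6 / (m * w).
  field.
  rewrite (_ : m - 1 + (m - 1 + 2) + 2 * (m - 1) + -2 * (m - 1) = 2 * m); last by ring.
  by rewrite mulf_neq0 ?gt_eqF // addr_gt0.
rewrite powR12_sqrt ?divr_ge0 ?mulr_ge0 ?(ltW w0) ?(ltW m0) //.
rewrite powRN powR12_sqrt ?(ltW w0) // -sqrtrV ?(ltW w0) // -sqrtrM ?divr_ge0 ?mulr_ge0 ?(ltW m0) //.
have e4 : m / 2 = Num.sqrt ((m / 2) ^+ 2) by rewrite sqrtr_sqr ger0_norm // divr_ge0 // ltW.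
rewrite mulrAC e4 -sqrtrM ?sqr_ge0 //; congr Num.sqrt.
by field; rewrite !gt_eqF.
Qed.

End AlmostSure.

(** * Regularly varying offspring *)

(** Along halving, a function of positive index of regular variation at zero
    decreases geometrically. *)
Section RegularVariation.
Variables (R : realType) (L : R -> R) (alpha : R).
Hypothesis alpha_gt1 : 1 < alpha.
Hypothesis slow : slowly_varying L.
Let hh (c : R) : R := L c^-1 * c `^ (alpha - 1).

(** The factor [2 ^ (1 - alpha)] of regular variation is smaller than one, and
    slow variation perturbs it as little as desired. *)
Lemma halving : exists r c0 : R, [/\ 0 < r /\ r < 1, 0 < c0, c0 <= 1 &
  forall c, 0 < c -> c <= c0 -> 0 < hh c /\ hh (2^-1 * c) <= r * hh c].
Proof.
have [[X0 [_ Lpos]] sv] := slow.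
have a0 : 0 < alpha - 1 by rewrite subr_gt0.
pose t := 2^-1 `^ (alpha - 1) : R.
have t0 : 0 < t by rewrite powR_gt0 // invr_gt0.
have t1 : t < 1.
  rewrite -(_ : 1 `^ (alpha - 1) = 1); last by rewrite powR1.
  by apply: gt0_ltr_powR; rewrite ?nnegrE ?invr_ge0 // invf_lt1 // ltr1n.
have d0 : 0 < (1 - t) / 2 by rewrite divr_gt0 // subr_gt0.
have := sv 2 (ltr0Sn R 1); move/cvgrPdist_le => /(_ _ d0)[M [_ hM]].
pose K := Num.max 1 (Num.max X0 (M + 1)).
have K0 : 0 < K by rewrite lt_max ltr01.
exists ((1 + t) / 2), K^-1; split.
- split; first by rewrite divr_gt0 // addr_gt0.
  by rewrite ltr_pdivrMr // mul1r (_ : 2 = 1 + 1) // ltrD2l.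
- by rewrite invr_gt0.
- by rewrite invf_le1 // le_max lexx.
move=> c c0 cK; have ic : K <= c^-1 by rewrite -(invrK K) lef_pV2 ?posrE ?invr_gt0.
have p1 : 0 < c `^ (alpha - 1) by exact: powR_gt0.
have L1 : 0 < L c^-1 by apply: Lpos; apply: le_trans ic; rewrite !le_max lexx orbT.
split; first exact: mulr_gt0.
have hc : M < c^-1 by apply: lt_le_trans ic; rewrite !lt_max ltrDl ltr01 !orbT.
have L2 : L (2 * c^-1) <= (1 + (1 - t) / 2) * L c^-1.
  have := hM _ hc; rewrite /= ler_norml => /andP[h _].
  by rewrite -ler_pdivrMr //; move: h; move: (L _ / L _) (_ / 2) => u v; lra.
rewrite /hh invfM invrK powRM ?invr_ge0 ?(ltW c0) // -/t.
have arith (l2 l p u : R) : 0 < p -> 0 < l -> 0 < u -> u < 1 -> l2 <= (1 + (1 - u) / 2) * l ->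
    l2 * (u * p) <= (1 + u) / 2 * (l * p).
  move=> p0 l0 u0 u1 h; rewrite mulrA (mulrA ((1 + u) / 2)) ler_pM2r //.
  apply: (le_trans (ler_wpM2r (ltW u0) h)); rewrite mulrAC ler_pM2r //.
  rewrite -subr_ge0 (_ : _ - _ = (1 - u) ^+ 2 / 2); last by field.
  by rewrite divr_ge0 ?sqr_ge0.
exact: arith.
Qed.

Lemma halving_iter : exists r c0 : R, [/\ 0 < r /\ r < 1, 0 < c0, c0 <= 1 &
  forall c j, 0 < c -> c <= c0 -> 0 < hh c /\ hh (2^-1 ^+ j * c) <= r ^+ j * hh c].
Proof.
have [r [c0 [[r0 r1] c00 c01 h]]] := halving; exists r, c0; split => // c j cp cc.
split; first by have [] := h c cp cc.
elim: j => [|j IHj]; first by rewrite !expr0 !mul1r.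
have p0 : 0 < 2^-1 ^+ j :> R by rewrite exprn_gt0 // invr_gt0.
have q0 : 2^-1 ^+ j * c <= c0.
  by apply: le_trans cc; rewrite ler_piMl ?(ltW cp) // exprn_ile1 ?invr_ge0 // invf_le1 // ler1n.
have [_ h2] := h _ (mulr_gt0 p0 cp) q0.
rewrite (exprS 2^-1) -mulrA; apply: (le_trans h2); rewrite (exprS r) -mulrA.
by rewrite ler_pM2l.
Qed.

End RegularVariation.

Section PartTwo.
Variables (R : realType) (mu : probability nat R).
Variable Q : probability (tree_space setT) R.
Variables (q betac : R).
Hypothesis H : critical_tree mu Q q betac.
Let m := mean_children Q.
Let bc0 : 0 < betac. Proof. exact: (betac_gt0 (ct_q H) (ct_mean H) (ct_crit H)). Qed.

Notation E := (Ex Q).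
Notation Itg := (Itg Q).
Notation f := (msg_mean Q q).
Notation Phi := (Phi Q q).
Notation pull := (pull Q q).
Notation sc := (scaling betac).
Notation X := (X q).
Implicit Types z : R * nat.

Lemma scaling_right (A : R -> Prop) : (\forall e \near 0^'+, A e) ->
  \forall z \near sc, A (z.1 - betac).
Proof.
case=> e /= e0 h; apply: filterS (near_scaling betac 0 (divr_gt0 e0 (ltr0Sn R 1))) => z [h1 h2 _].
have p0 : 0 < z.1 - betac by rewrite subr_gt0.
apply: h => //=; rewrite sub0r normrN gtr0_norm // ltrBlDl; apply: (le_lt_trans h2).
by rewrite ltrD2l ltr_pdivrMr // ltr_pMr // ltr1n.
Qed.

Section Order.
Variables (L : R -> R) (alpha c1 c2 : R).
Hypothesis alpha_gt1 : 1 < alpha.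
Hypothesis slow : slowly_varying L.
Hypotheses (c10 : 0 < c1) (c20 : 0 < c2).
Let hh (c : R) : R := L c^-1 * c `^ (alpha - 1).
Hypothesis Phi_hh : forall c, 0 < c -> c <= 1 -> c1 * (c * hh c) <= Phi c <= c2 * (c * hh c).

(** Each halving of the scale gains a factor smaller than [1 / 2], one half
    from the scale and the rest from the regular variation. *)
Lemma regular_of_variation : regular_tail Q q.
Proof.
have [r [c0 [[r0 r1] c00 c01 h]]] := halving_iter alpha_gt1 slow.
exists (c2 / c1), (r / 2), c0; split => //; first exact: divr_gt0.
  by rewrite divr_gt0 //; split => //; rewrite -[ltRHS]mul1r ltr_pM2r ?invr_gt0.
move=> c j cp cc; have [hp hj] : 0 < hh c /\ hh (2^-1 ^+ j * c) <= r ^+ j * hh c := h c j cp cc.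
have p0 : 0 < 2^-1 ^+ j :> R by rewrite exprn_gt0 // invr_gt0.
have p1 : 2^-1 ^+ j * c <= 1.
  by apply: (le_trans _ (le_trans cc c01)); rewrite ler_piMl ?(ltW cp) // exprn_ile1 ?invr_ge0 // invf_le1 // ler1n.
have /andP[_ u] := Phi_hh (mulr_gt0 p0 cp) p1; have /andP[l _] := Phi_hh cp (le_trans cc c01).
apply: (le_trans u).
have k0 : 0 <= 2^-1 ^+ j * c by apply: ltW; exact: mulr_gt0.
apply: (le_trans (ler_wpM2l (ltW c20) (ler_wpM2l k0 hj))).
have w0 : 0 <= c2 / c1 * (r / 2) ^+ j by rewrite mulr_ge0 ?exprn_ge0 ?divr_ge0 // ltW.
apply: le_trans (ler_wpM2l w0 l).
rewrite exprMn le_eqVlt; apply/orP; left; apply/eqP; move: (hh c) (r ^+ j) (2^-1 ^+ j) => *.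
by field; rewrite gt_eqF.
Qed.

(** The mean message is of the order of the asymptotic inverse: dividing, or
    multiplying, the inverse by a large power of two makes the pull as small,
    or as large, as required for the comparison with the stationary level. *)
Lemma msg_mean_inverse (hinv : R -> R) : asymptotic_inverse hh hinv ->
  exists a1 a2 : R, [/\ 0 < a1, 0 < a2 & \forall z \near sc,
    0 < hinv (z.1 - betac) /\
    a1 * hinv (z.1 - betac) <= f z.1 z.2 <= a2 * hinv (z.1 - betac)].
Proof.
move=> [ip iz ii].
have reg := regular_of_variation.
have [r [c0 [[r0 r1] c00 c01 h]]] := halving_iter alpha_gt1 slow.
have {}h c j : 0 < c -> c <= c0 -> 0 < hh c /\ hh (2^-1 ^+ j * c) <= r ^+ j * hh c := h c j.
have [e0 [k1 [k2 [rr [C [[e00 e01] [k10 k20] [rr0 rr1] C0 hf]]]]]] := msg_mean_scale H reg.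
have [B B0 hB] := pull_le_Phi H reg ltr01.
have cvr : r ^+ j @[j --> \oo] --> (0 : R) by apply: cvg_expr; rewrite ger0_norm // ltW.
have smallr (e : R) : 0 < e -> exists j, r ^+ j <= e.
  move=> ep; move/cvgr0Pnorm_le : cvr => /(_ _ ep)[j _ hj]; exists j.
  by have := hj j (leqnn j); rewrite /= ger0_norm // exprn_ge0 // ltW.
have [j1 hj1] : exists j, r ^+ j <= k1 / (B * c2 * 2) by apply: smallr; rewrite divr_gt0 ?mulr_gt0.
have [j2 hj2] : exists j, r ^+ j <= c1 / (2 * k2) by apply: smallr; rewrite divr_gt0 ?mulr_gt0.
pose p1 : R := 2^-1 ^+ j1; pose p2 : R := 2 ^+ j2.
have p10 : 0 < p1 by rewrite exprn_gt0 // invr_gt0.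
have p20 : 0 < p2 by rewrite exprn_gt0.
have p11 : p1 <= 1 by rewrite exprn_ile1 ?invr_ge0 // invf_le1 // ler1n.
have p21 : 1 <= p2 by rewrite exprn_ege1 // ler1n.
exists (rr * p1), p2; split => //; first exact: mulr_gt0.
have d0 : 0 < Num.min c0 betac / p2 by rewrite divr_gt0 // lt_min c00.
have n1 := scaling_right ip.
have n2 : \forall z \near sc, hinv (z.1 - betac) <= Num.min c0 betac / p2.
  move/cvgr0Pnorm_le : iz => /(_ _ d0) hz; apply: filterS (scaling_right hz) => z hz'.
  by apply: le_trans hz'; exact: ler_norm.
have n3 : \forall z \near sc, `|1 - hh (hinv (z.1 - betac)) / (z.1 - betac)| <= 2^-1.
  have i2 : 0 < 2^-1 :> R by rewrite invr_gt0.
  by move/cvgrPdist_le : ii => ii; exact: (scaling_right (ii _ i2)).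
apply: filterS3 n1 (filterI n2 n3) (near_scaling betac (C + 1) e00) => z y0 [ys hy] [h1 h2 h3].
split => //; have ep0 : 0 < z.1 - betac by rewrite subr_gt0.
move: (hinv _) y0 ys hy => y y0 ys hy.
have ys1 : p2 * y <= Num.min c0 betac by rewrite mulrC -ler_pdivlMr.
move: ys1; rewrite le_min => /andP[yc yb].
have yc0 : y <= c0 by apply: le_trans yc; rewrite ler_peMl // ltW.
have yb0 : y <= betac by apply: le_trans yb; rewrite ler_peMl // ltW.
have [hlo hhi] := hf z.1 z.2 h1 h2.
have hy2 : 2^-1 * (z.1 - betac) <= hh y /\ hh y <= 2 * (z.1 - betac).
  move: hy; rewrite ler_norml => /andP[u1 u2].
  have arith (v : R) : - 2^-1 <= 1 - v -> 1 - v <= 2^-1 -> 2^-1 <= v /\ v <= 2.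
    by move=> v1 v2; split; lra.
  have [v1 v2] := arith _ u1 u2; split; first by rewrite -ler_pdivlMr.
  by rewrite -ler_pdivrMr.
have [hy3 hy4] := hy2; apply/andP; split.
  rewrite -mulrA; have py0 : 0 < p1 * y by exact: mulr_gt0.
  have py1 : p1 * y <= y by rewrite ler_piMl // ltW.
  apply: hlo => //; first exact: le_trans py1 yb0.
  have pyo : p1 * y <= 1 by apply: le_trans (le_trans py1 yc0) c01.
  have /andP[_ u] := Phi_hh py0 pyo; have v := hB _ py0 pyo.
  have [_ w] := h y j1 y0 yc0; rewrite -/p1 in w.
  have x1 : pull (p1 * y) <= B * c2 * hh (p1 * y).
    rewrite -(ler_pM2l py0); apply: (le_trans v); apply: (le_trans (ler_wpM2l (ltW B0) u)).
    have ar4 (a b c e : R) : a * (b * (c * e)) = c * (a * b * e) by ring.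
    by rewrite ar4.
  have Bc : 0 < B * c2 by exact: mulr_gt0.
  apply: (le_trans x1); apply: (le_trans (ler_wpM2l (ltW Bc) w)).
  have rj : 0 <= r ^+ j1 by rewrite exprn_ge0 // ltW.
  apply: (le_trans (ler_wpM2l (ltW Bc) (ler_wpM2l rj hy4))).
  have e2 : 0 <= 2 * (z.1 - betac) by rewrite mulr_ge0 // ltW.
  apply: (le_trans (ler_wpM2l (ltW Bc) (ler_wpM2r e2 hj1))).
  rewrite le_eqVlt; apply/orP; left; apply/eqP; move: (z.1 - betac) => e.
  by field; rewrite !gt_eqF.
have py0 : 0 < p2 * y by exact: mulr_gt0.
have pyo : p2 * y <= 1 by exact: le_trans yc c01.
case: (hhi (p2 * y) py0 _) => // [|bad]; last by have := le_trans h3 bad; rewrite gerDl ler10.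
have [hp w] := h (p2 * y) j2 py0 yc.
have e1 : 2^-1 ^+ j2 * (p2 * y) = y.
  by rewrite /p2 mulrA -exprMn mulVf ?pnatr_eq0 // expr1n mul1r.
rewrite e1 in w; have /andP[u _] := Phi_hh py0 pyo; have v := Phi_le_pull H (ltW py0).
have x1 : c1 * hh (p2 * y) <= pull (p2 * y).
  rewrite -(ler_pM2l py0); apply: le_trans v; apply: le_trans u.
  by rewrite mulrCA.
apply: le_trans x1; have x2 := le_trans hy3 (le_trans w (ler_wpM2r (ltW hp) hj2)).
have arith (e t : R) : 2^-1 * e <= c1 / (2 * k2) * t -> k2 * e <= c1 * t.
  move=> ht; have k22 : 0 <= 2 * k2 by rewrite mulr_ge0 // ltW.
  have := ler_wpM2l k22 ht.
  have -> : 2 * k2 * (2^-1 * e) = k2 * e by field.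
  by have -> : 2 * k2 * (c1 / (2 * k2) * t) = c1 * t by field; rewrite gt_eqF.
exact: arith.
Qed.

End Order.

(** ** Tightness *)

Let ind (lo hi y : R) z x : R := (lo <= psi q (X z x) / y <= hi)%R%:R.

Lemma X_pos z x : 0 < z.1 -> 0 <= X z x.
Proof.
move=> b0; apply: sumr_ge0 => i _.
by have /andP[] := message_mono_beta z.2 (shift i x) (ct_q H) b0 (lexx _).
Qed.

Lemma meas_X z : 0 < z.1 -> meas setT (X z).
Proof.
move=> b0; apply: meas_tot; case: z b0 => b n /= b0; elim: n => [|n IHn]; first exact: measurable_cst.
apply: (@meas_mono _ setT (transfer q b) (X (b, n))) => [y y'|x|].
- exact: (transfer_mono (ct_q H)).
- exact: X_pos.
- exact: meas_tot.
Qed.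

Lemma meas_psi_X z : 0 < z.1 -> meas setT (fun x => psi q (X z x)).
Proof.
move=> b0; apply: (@meas_mono _ setT (psi q) (X z)) => [y y'|x|].
- exact: (psi_homo (ct_q H)).
- exact: X_pos.
- exact: meas_X.
Qed.

Let Itg_ind lo hi y z : 0 < z.1 -> Itg (ind lo hi y z).
Proof.
move=> b0; apply: (@Itg_bounded _ Q _ 1); last first.
  by move=> x; rewrite /ind; case: (_ <= _ <= _); rewrite ?normr1 ?normr0.
have mu1 : measurable_fun setT (fun v : R => (lo <= v)%R%:R : R).
  apply: nondecreasing_measurable => // v v' vv; rewrite ler_nat; case: (leP lo v) => // h.
  by rewrite (le_trans h vv).
have mu2 : measurable_fun setT (fun v : R => (hi < v)%R%:R : R).
  apply: nondecreasing_measurable => // v v' vv; rewrite ler_nat; case: (ltP hi v) => // h.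
  by rewrite (lt_le_trans h vv).
have -> : ind lo hi y z = (fun x => (fun v : R => (lo <= v)%R%:R * (1 - (hi < v)%R%:R)) (psi q (X z x) / y)).
  by apply/funext => x; rewrite /ind ltNge; case: (lo <= _); case: (_ <= hi); rewrite ?subr0 ?subrr ?mulr1 ?mulr0.
apply: (meas_comp (g := fun v : R => (lo <= v)%R%:R * (1 - (hi < v)%R%:R))).
  by apply: measurable_funM => //; apply: measurable_funB.
by apply: measurable_funM => //; exact: meas_psi_X.
Qed.

Lemma ind_mono lo hi lo' hi' y z : 0 < z.1 -> lo' <= lo -> hi <= hi' ->
  E (ind lo hi y z) <= E (ind lo' hi' y z).
Proof.
move=> b0 hl hh; apply: le_Ex; [exact: Itg_ind | exact: Itg_ind |] => x.
rewrite /ind ler_nat; case: andP => // -[h1 h2].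
by rewrite (le_trans hl h1) (le_trans h2 hh).
Qed.

Lemma Ex_event lo hi y z : 0 < z.1 ->
  (E (fun x => (lo <= psi q (X z x) / y <= hi)%R%:R))%:E =
  Q [set x : tree_space setT | lo <= psi q (X z x) / y <= hi].
Proof.
move=> b0; rewrite ExE; last exact: Itg_ind.
have mA : measurable [set x : tree_space setT | lo <= psi q (X z x) / y <= hi].
  have mg : meas setT (fun x => psi q (X z x) / y) by apply: measurable_funM => //; exact: meas_psi_X.
  have := mg measurableT _ (measurable_itv `[lo, hi]); rewrite setTI.
  by congr measurable; apply/seteqP; split => x /=; rewrite in_itv.
rewrite -[RHS]/(Q _) -[in RHS](setIT [set x | _]) -integral_indic //.
apply: eq_integral => x _; rewrite indicE; congr ((_ : bool)%:R%:E).
by apply/idP/idP; rewrite inE.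
Qed.

Let tight_single (beta y : R) n : betac <= beta -> 0 < y ->
  exists lo hi : R, [/\ 0 < lo, lo <= hi & 1 <= E (ind lo hi y (beta, n))].
Proof.
move=> hb y0; have b0 : 0 < beta := lt_le_trans bc0 hb.
have [c cp hc] := log_odds_pos_ae H n hb.
have pc : 0 < psi q c := psi_gt0 (ct_q H) cp.
have pc1 : psi q c <= 1 := ltW (psi_lt1 (ct_q H) cp).
exists (psi q c / y), (1 / y); split; first exact: divr_gt0.
  by rewrite ler_pM2r ?invr_gt0.
rewrite -[leLHS](Ex_cst Q); apply: le_Ex_ae; [exact: Itg_cst | exact: Itg_ind |].
apply: aeS hc => x hx; rewrite /ind !ler_pM2r ?invr_gt0 //.
have hX : 0 < X (beta, n) x := lt_le_trans cp hx.
by rewrite (psi_homo (ct_q H) (ltW cp) hx) (ltW (psi_lt1 (ct_q H) hX)).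
Qed.

(** Each connection probability is almost surely positive, so that finitely
    many of them do not affect tightness. *)
Lemma tight_prefix (b y : nat -> R) n1 : exists lo hi : R, [/\ 0 < lo, lo <= hi &
  forall n, (n < n1)%N -> betac < b n -> 0 < y n -> 1 <= E (ind lo hi (y n) (b n, n))].
Proof.
elim: n1 => [|n1 [lo [hi [l0 lh IH]]]]; first by exists 1, 1.
have [[h1 h2]|no] := pselect (betac < b n1 /\ 0 < y n1); last first.
  exists lo, hi; split => // n; rewrite ltnS leq_eqVlt => /predU1P[->|]; last exact: IH.
  by move=> h1 h2; case: no.
have [lo' [hi' [l0' lh' h]]] := tight_single n1 (ltW h1) h2.
exists (Num.min lo lo'), (Num.max hi hi'); split.
- by rewrite lt_min l0.
- by rewrite ge_min le_max lh.
move=> n; rewrite ltnS leq_eqVlt => /predU1P[-> _ _|nn b0 y0].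
  apply: (le_trans h); apply: ind_mono; rewrite /= ?(lt_trans bc0) // ?ge_min ?le_max lexx orbT //.
apply: (le_trans (IH n nn b0 y0)).
by apply: ind_mono; rewrite /= ?(lt_trans bc0) // ?ge_min ?le_max lexx.
Qed.

End PartTwo.

(** * The random tree *)

Section RandomTree.
Variables (d : measure_display) (Omega : measurableType d) (R : realType).
Variables (P : probability Omega R) (mu : probability nat R).
Variable xi : seq nat -> {RV P >-> nat}.
Hypothesis gwh : galton_watson mu xi.

(** The random offspring numbers as a random point of the space of offspring
    functions; its law is determined by the independence and the common law of
    these numbers. *)
Definition tree_of (w : Omega) : tree_space setT := fun u => xi u w.

Lemma measurable_tree_of : measurable_fun setT tree_of.
Proof.
apply: (@measurability _ _ Omega (tree_space setT) setT tree_of (coordinate_events setT)) => //.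
move=> _ [_ [u [A [_ ->]]] <-]; rewrite setTI.
by apply: (measurable_funPTI (xi u) (Y := A)).
Qed.

HB.instance Definition _ := isMeasurableFun.Build _ _ _ _ tree_of measurable_tree_of.

Definition tree_prob : probability (tree_space setT) R := distribution P tree_of.

Notation Q := tree_prob.

Lemma tree_prob_law : tree_law mu Q.
Proof.
move=> s A us; have [law ind] := gwh.
have -> : Q [set x | forall u, u \in s -> A u (x u)] =
    P (\bigcap_(i in [set i | i \in s]) (xi i @^-1` A i)) by [].
rewrite ind //; apply: eq_bigr => u _; rewrite -(law u (A u)) //.
Qed.

Lemma tree_prob_preimage (A : set (seq nat -> nat)) : Q A = P (tree_of @^-1` A).
Proof. by []. Qed.

Lemma integral_tree (g : (seq nat -> nat) -> R) : meas setT g -> (forall x, 0 <= g x) ->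
  (\int[P]_w (g (tree_of w))%:E = \int[Q]_x (g x)%:E)%E.
Proof.
move=> mg g0; rewrite (@ge0_integral_distribution _ _ _ _ _ P tree_of (fun x => (g x)%:E)) //.
exact/measurable_EFinP.
Qed.

Lemma ae_tree (A : (seq nat -> nat) -> Prop) : {ae Q, forall x, A x} ->
  {ae P, forall w, A (tree_of w)}.
Proof.
case=> B [mB QB AB]; exists (tree_of @^-1` B); split => //.
- by apply: (measurable_funPTI tree_of).
- by move=> w hw; exact: AB.
Qed.

Lemma meas_root_fun (c : nat -> R) : meas setT (fun x => c (x [::])).
Proof.
have mc : measurable_fun [set: nat] c by [].
exact: (measurableT_comp mc (@measurable_coordinate setT [::] I)).
Qed.

Lemma integral_offspring (c : nat -> R) : (forall k, 0 <= c k) ->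
  (\int[Q]_x (c (x [::]))%:E = \int[mu]_k (c k)%:E)%E.
Proof.
move=> c0; rewrite -integral_tree //; last exact: meas_root_fun.
transitivity (\int[distribution P (xi [::])]_k (c k)%:E)%E.
  by rewrite ge0_integral_distribution // => k; rewrite lee_fin.
by apply: eq_measure_integral => A mA _; have [law _] := gwh; exact: law.
Qed.

Lemma Ex_offspring (c : nat -> R) : (forall k, 0 <= c k) ->
  Ex Q (fun x => c (x [::])) = fine (\int[mu]_k (c k)%:E)%E.
Proof. by move=> c0; rewrite /Ex integral_offspring. Qed.

Lemma Itg_offspring k : (offspring_moment mu k < +oo)%E -> Itg Q (fun x => (x [::])%:R ^+ k).
Proof.
move=> h; apply: ItgP; first exact: (meas_root_fun (fun N => N%:R ^+ k)).
have c0 N : 0 <= `|N%:R ^+ k| :> R by [].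
rewrite (integral_offspring c0); apply: le_lt_trans h.
by under eq_integral do rewrite ger0_norm ?exprn_ge0 //.
Qed.

Lemma mean_childrenE : mean_children Q = offspring_mean mu.
Proof.
by rewrite /mean_children (@Ex_offspring (fun N => N%:R)).
Qed.

Hypothesis mu0 : mu [set 0%N] = 0%E.
Hypothesis mu1 : (mu [set 1%N] < 1)%E.
Hypothesis mean_fin : (offspring_moment mu 1 < +oo)%E.

Lemma root_event (A : set nat) : Q [set x | A (x [::])] = mu A.
Proof.
have := @tree_prob_law [:: [::]] (fun=> A) isT; rewrite big_seq1 => <-.
congr (Q _); apply/seteqP; split => x /= h; first by move=> u; rewrite inE => /eqP ->.
by apply: h; rewrite inE.
Qed.

Lemma single_child_lt1 : Ex Q (fun x => (x [::] == 1%N)%:R) < 1.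
Proof.
rewrite (@Ex_offspring (fun N => (N == 1%N)%:R)) //.
have -> : (\int[mu]_k ((k == 1%N)%:R)%:E = mu [set 1%N])%E.
  transitivity (\int[mu]_k (\1_[set 1%N] k)%:E)%E; last by rewrite integral_indic // setIT.
  apply: eq_integral => k _; rewrite indicE; congr ((_ : bool)%:R%:E).
  by apply/eqP/idP => [->|]; rewrite inE.
by rewrite -lte_fin fineK // ge0_fin_numE // (lt_trans mu1) // ltry.
Qed.

Lemma root_pos : {ae Q, forall x : seq nat -> nat, (0 < x [::])%N}.
Proof.
exists [set x : tree_space setT | x [::] = 0%N]; split.
- rewrite -[X in measurable X]setTI.
  exact: (@measurable_coordinate setT [::] I measurableT [set 0%N] Logic.I).
- have := root_event [set 0%N]; rewrite mu0 => e; exact: e.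
- by move=> x /= /negP; rewrite -leqNgt leqn0 => /eqP.
Qed.

(** The mean exceeds one because every vertex has a child and some have more. *)
Lemma tree_prob_critical (q betac : R) : 0 < q <= 2 ->
  offspring_mean mu * psi q betac = 1 -> critical_tree mu Q q betac.
Proof.
move=> hq crit; have i1 : Itg Q (fun x => (x [::])%:R).
  by apply: eq_Itg (Itg_offspring mean_fin) => x; rewrite expr1.
split => //; [exact: tree_prob_law | exact: root_pos | | by rewrite mean_childrenE].
have i2 : Itg Q (fun x => (x [::] == 1%N)%:R).
  apply: (@Itg_bounded _ Q _ 1); first exact: (meas_root_fun (fun N => (N == 1%N)%:R)).
  by move=> x; case: (_ == _); rewrite ?normr1 ?normr0.
have i3 := ItgB (Itg_cst Q 2) i2.
apply: (@lt_le_trans _ _ (Ex Q (fun x => 2 - (x [::] == 1%N)%:R))).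
  rewrite (ExB (Itg_cst Q 2) i2) Ex_cst ltrBrDl -ltrBrDr (_ : 2 - 1 = 1); last by ring.
  exact: single_child_lt1.
apply: le_Ex_ae => //; apply: aeS root_pos => x; case: (x [::]) => // -[|k] _.
  have e : 2 - 1%:R = 1 :> R by ring.
  by rewrite eqxx /= e.
by rewrite subr0 ler_nat.
Qed.

Lemma gw_limit_tree : gw_limit (offspring_mean mu) xi =1 gw_lim Q \o tree_of.
Proof.
move=> w; rewrite /gw_limit /= /gw_lim; congr (limn _); apply/funext => k.
by rewrite /gw gen_sum_size mean_childrenE.
Qed.

Lemma gw_limit_moment_tree k : meas setT (gw_lim Q) -> (forall x, 0 <= gw_lim Q x) ->
  gw_limit_moment (offspring_mean mu) xi k = Ex Q (fun x => gw_lim Q x ^+ k).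
Proof.
move=> mW W0; rewrite /gw_limit_moment /Ex unlock; congr fine.
rewrite -integral_tree; first by apply: eq_integral => w _; rewrite gw_limit_tree.
  by apply: (meas_comp (g := fun y : R => y ^+ k)) => //; exact: exprn_measurable.
by move=> x; exact: exprn_ge0.
Qed.

Lemma gw_conn_prob_tree (q beta : R) n w : 0 < q -> 0 < beta ->
  gw_conn_prob xi q n.+1 beta w = psi q (X q (beta, n) (tree_of w)).
Proof. by move=> q0 b0; rewrite /gw_conn_prob conn_prob_log_odds. Qed.

End RandomTree.

(** * The theorem *)

(** The root of the tree of height zero is its own boundary. *)
Lemma conn_prob0 (R : realType) (q beta : R) xi : 0 < q -> 0 < beta -> conn_prob q xi 0 beta = 1.
Proof.
move=> q0 b0; rewrite /conn_prob /rc_prob.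
have p0 : 0 < 1 - expR (- beta) by rewrite subr_gt0 expR_lt1 oppr_lt0.
have w0 w : 0 < rc_weight (1 - expR (- beta)) q (w : {ffun edge (wired_tree xi 0) -> bool}).
  by rewrite !mulr_gt0 ?exprn_gt0 // subKr expR_gt0.
rewrite (eq_bigl predT) => [|w]; last first.
  rewrite /root_to_boundary /= /merge_vertex insubF ?connect0 //.
  by rewrite inE.
rewrite divff // gt_eqF // (bigD1 [ffun=> false]) //= ltr_pwDl //.
by apply: sumr_ge0 => w _; exact: ltW.
Qed.

(** The tree of height [n.+1] corresponds to the log odds of height [n], so
    the sequences are shifted by one. *)
Lemma shifted_regime (R : realType) (betac : R) (b : nat -> R) : b n @[n --> \oo] --> betac ->
  n%:R * (b n - betac) @[n --> \oo] --> +oo ->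
  b n.+1 @[n --> \oo] --> betac /\ n%:R * (b n.+1 - betac) @[n --> \oo] --> +oo.
Proof.
move=> cb cn; split; first by rewrite (cvg_shiftS b).
apply/cvgryPge => A; move/cvgryPge : cn => /(_ (A + 1))[k _ hk].
move/cvgrPdist_le : cb => /(_ 1 ltr01)[l _ hl].
exists (maxn k l) => // n /=; rewrite geq_max => /andP[kn ln].
have h1 := hk n.+1 (leqW kn); have h2 := hl n.+1 (leqW ln).
have h3 : b n.+1 - betac <= 1 by apply: le_trans h2; rewrite distrC ler_norm.
have arith (x y : R) : A + 1 <= x + y -> y <= 1 -> A <= x by move=> *; lra.
by apply: arith h3; move: h1; rewrite /= -(natr1 n) mulrDl mul1r.
Qed.

Lemma powR_balance (R : realType) (c alpha : R) k : 0 < c ->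
  c ^+ k * c^-1 `^ (k%:R - alpha) = c * c `^ (alpha - 1).
Proof.
move=> c0; have cn : c != 0 by rewrite gt_eqF.
rewrite -powR_mulrn ?(ltW c0) // -powR_inv1 ?(ltW c0) // -powRrM mulN1r -powRD ?cn ?implybT //.
rewrite -[X in X * _](powRr1 (ltW c0)) -powRD ?cn ?implybT //.
by congr (_ `^ _); ring.
Qed.

(** The truncation level is the inverse of the message. *)
Lemma Phi_truncated (d : measure_display) (Omega : measurableType d) (R : realType)
    (P : probability Omega R) (mu : probability nat R) (xi : seq nat -> {RV P >-> nat})
    (q alpha c1 c2 : R) (L : R -> R) : galton_watson mu xi ->
  let s := crit_exp q in
  (forall x : R, 1 <= x ->
     ((c1 * L x * x `^ ((1 + s)%:R - alpha))%:E <= truncated_moment mu (1 + s) x)%E /\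
     (truncated_moment mu (1 + s) x <= (c2 * L x * x `^ ((1 + s)%:R - alpha))%:E)%E) ->
  forall c, 0 < c -> c <= 1 -> c1 * (c * (L c^-1 * c `^ (alpha - 1))) <= Phi (tree_prob xi) q c <=
    c2 * (c * (L c^-1 * c `^ (alpha - 1))).
Proof.
move=> gwh s hL c c0 c1'; have ic : 1 <= c^-1 by rewrite invf_ge1.
have [h1 h2] := hL _ ic.
pose T := truncated_moment mu (1 + s) c^-1.
have fT : T \is a fin_num.
  by rewrite fin_numE; apply/andP; split; apply/eqP => e; move: h1 h2; rewrite -/T e.
have ph : Phi (tree_prob xi) q c = c ^+ s.+1 * fine T.
  rewrite /Phi; transitivity (Ex (tree_prob xi) (fun x => c ^+ s.+1 * Num.min (x [::])%:R c^-1 ^+ s.+1)).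
    apply: eq_Ex => x; rewrite /trunc_root -exprMn minr_pMr ?(ltW c0) //.
    by rewrite mulfV ?gt_eqF // mulrC.
  have m0 N : 0 <= Num.min N%:R c^-1 ^+ s.+1 :> R.
    by rewrite exprn_ge0 // le_min ler0n invr_ge0 ltW.
  rewrite ExZ; first by rewrite (Ex_offspring gwh m0).
  apply: (@Itg_bounded _ _ _ (c^-1 ^+ s.+1)); first exact: (meas_root_fun (fun N => Num.min N%:R c^-1 ^+ s.+1)).
  move=> x; rewrite ger0_norm // lerXn2r ?nnegrE ?invr_ge0 ?(ltW c0) //; last by rewrite ge_min lexx orbT.
  by rewrite le_min ler0n invr_ge0 ltW.
have bal := powR_balance alpha s.+1 c0.
have ck : 0 < c ^+ s.+1 by exact: exprn_gt0.
have e k : k * (c * (L c^-1 * c `^ (alpha - 1))) = c ^+ s.+1 * (k * L c^-1 * c^-1 `^ ((1 + s)%:R - alpha)).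
  by rewrite (mulrCA c) -bal; move: (_ `^ _) (L _) (_ ^+ _) => *; ring.
by rewrite ph !e !ler_pM2l // -!lee_fin fineK // h1 h2.
Qed.

Section Limits.
Variables (R : realType) (mu : probability nat R).
Variables (d : measure_display) (Omega : measurableType d) (P : probability Omega R).
Variables (xi : seq nat -> {RV P >-> nat}) (q betac : R) (beta : nat -> R).
Hypothesis mu0 : mu [set 0%N] = 0%E.
Hypothesis mu1 : (mu [set 1%N] < 1)%E.
Hypothesis mean_fin : (offspring_moment mu 1 < +oo)%E.
Hypothesis gwh : galton_watson mu xi.
Hypothesis q_range : 0 < q <= 2.
Hypothesis critical : offspring_mean mu * psi q betac = 1.
Hypothesis beta_cvg : beta n @[n --> \oo] --> betac.
Hypothesis beta_near : n%:R * (beta n - betac) @[n --> \oo] --> +oo.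

Notation Q := (tree_prob xi).
Let H : critical_tree mu Q q betac := tree_prob_critical gwh mu0 mu1 mean_fin q_range critical.
Let bc0 : 0 < betac. Proof. exact: (betac_gt0 (ct_q H) (ct_mean H) (ct_crit H)). Qed.
Let q_gt0 : 0 < q. Proof. by have /andP[] := q_range. Qed.
Let s := crit_exp q.
Let m := offspring_mean mu.
Let b n := beta n.+1.
Let cb : b n @[n --> \oo] --> betac. Proof. by have [] := shifted_regime beta_cvg beta_near. Qed.
Let cn : n%:R * (b n - betac) @[n --> \oo] --> +oo.
Proof. by have [] := shifted_regime beta_cvg beta_near. Qed.
Let cz : (b n, n) @[n --> \oo] --> scaling betac.
Proof. exact: (@scaling_seq _ _ b id). Qed.
Let near_b : \forall n \near \oo, [/\ betac < b n, b n <= betac + 1 & 0 <= n%:R * (b n - betac)].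
Proof. by have := cz (near_scaling betac 0 ltr01). Qed.

Notation X := (X q).
Notation root_eps := (root_eps q betac).
Let ratio n w := gw_conn_prob xi q n (beta n) w / (beta n - betac) `^ (s%:R^-1).

Let ratioE n w : betac < b n ->
  ratio n.+1 w = psi q (X (b n, n) (tree_of xi w)) / root_eps (b n, n).
Proof. by move=> h; rewrite /ratio gw_conn_prob_tree // (lt_trans bc0). Qed.

Section Moments.
Hypothesis Zs : (offspring_moment mu (1 + s) < +oo)%E.
Let Zi : Itg Q (fun x => (x [::])%:R ^+ s.+1) := Itg_offspring gwh Zs.
Let alpha_q := crit_const q m (gw_limit_moment m xi 2) (gw_limit_moment m xi 3).

Let alphaE : mean_children Q * root_level Q q betac / q = alpha_q.
Proof.
have W0 := gw_lim_ge0 H; have mW := meas_gw_lim H.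
rewrite (limit_const H Zi) /alpha_q /m !(gw_limit_moment_tree gwh) //.
by rewrite (mean_childrenE gwh).
Qed.

Lemma ae_limit : {ae P, forall w, ratio n w @[n --> \oo] --> alpha_q * gw_limit m xi w}.
Proof.
apply: filterS (ae_tree (ae_psi_cvg H Zi cb cn)) => w cw.
rewrite -(cvg_shiftS (fun n => ratio n w)) (gw_limit_tree gwh) -alphaE /=.
apply: cvg_trans cw; apply: near_eq_cvg.
by apply: filterS near_b => n [h _ _]; rewrite ratioE.
Qed.

(** The connection probabilities are at most one, so all the norms are finite. *)
Lemma Lnorm_limit : ('N[P]_((1 + s)%:R%:E)[(fun w => (ratio n w - alpha_q * gw_limit m xi w)%:E)])%E
  @[n --> \oo] --> 0%E.
Proof.
set N := fun n : nat => ('N[P]_ _ [_])%E.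
pose g n x := `|psi q (X (b n, n) x) / root_eps (b n, n) - alpha_q * gw_lim Q x| ^+ s.+1.
have cg : Ex Q (g n) @[n --> \oo] --> (0 : R).
  rewrite /g -alphaE; have cv := mean_psi_cvg H Zi.
  exact: (@cvg_comp _ _ _ (fun n : nat => (b n, n)) _ _ _ _ cz cv).
have a0 : 0 <= alpha_q.
  by rewrite -alphaE divr_ge0 ?mulr_ge0 ?powR_ge0 ?(ltW q_gt0) // ltW // (lt_trans ltr01 (ct_mean H)).
have [Wi _ Wsi] := gw_lim_moments H Zi.
have Ng : \forall n \near \oo, N n.+1 = (Ex Q (g n) `^ ((1 + s)%:R^-1))%:E.
  apply: filterS near_b => n [h1 h2 _].
  have b0 : 0 < (b n, n).1 := lt_trans bc0 h1.
  have r0 : 0 < root_eps (b n, n) by apply: root_eps_gt0.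
  have mg : meas setT (g n).
    apply: measurable_funX; apply: measurableT_comp => //; apply: measurable_funB.
      by apply: measurable_funM => //; exact: (meas_psi_X H).
    by apply: measurable_funM => //; exact: (meas_gw_lim H).
  have ig : Itg Q (g n).
    have ib := ItgZ (2 ^+ s.+1) (ItgD (Itg_cst Q ((root_eps (b n, n))^-1 ^+ s.+1)) (ItgZ (alpha_q ^+ s.+1) Wsi)).
    apply: (Itg_le mg _ ib) => x; rewrite ger0_norm ?exprn_ge0 // -exprMn.
    have W0 := gw_lim_ge0 H x; have x0 := X_pos H x b0.
    have i0 : 0 <= (root_eps (b n, n))^-1 by rewrite invr_ge0 ltW.
    apply: le_trans (add_expr_le s.+1 i0 (mulr_ge0 a0 W0)).
    rewrite lerXn2r ?nnegrE ?addr_ge0 ?mulr_ge0 //.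
    apply: (le_trans (ler_normB _ _)); rewrite (ger0_norm (mulr_ge0 a0 W0)) lerD2r.
    have [p0 _ _] := psi_quad (ct_q H) x0.
    rewrite (ger0_norm (mulr_ge0 p0 i0)) ler_piMl //.
    move: x0; rewrite le_eqVlt => /predU1P[<-|x0]; last by rewrite ltW // (psi_lt1 (ct_q H)).
    by rewrite /psi expR0 subrr mul0r.
  rewrite /N unlock -poweR_EFin; congr (_ `^ _)%E; rewrite (ExE ig) -integral_tree //; last first.
    by move=> x; exact: exprn_ge0.
  apply: eq_integral => w _; rewrite ratioE // (gw_limit_tree gwh) /g /= -powR_mulrn //.
rewrite -(cvg_shiftS N).
have ce : (Ex Q (g n) `^ ((1 + s)%:R^-1))%:E @[n --> \oo] --> 0%E.
  apply: cvg_EFin; first exact: nearW.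
  apply/cvgr0Pnorm_le => e e0; have es : 0 < e ^+ (1 + s) by exact: exprn_gt0.
  move/cvgr0Pnorm_le : cg => /(_ _ es); apply: filterS => n.
  have E0 : 0 <= Ex Q (g n) by apply: Ex_ge0 => x; exact: exprn_ge0.
  rewrite /= (ger0_norm E0) (ger0_norm (powR_ge0 _ _)) => h.
  have -> : e = (e ^+ (1 + s)) `^ ((1 + s)%:R^-1).
    by rewrite -powR_mulrn ?(ltW e0) // -powRrM mulfV ?pnatr_eq0 // powRr1 // ltW.
  by apply: ge0_ler_powR; rewrite ?nnegrE ?invr_ge0 ?(ltW es).
by apply: cvg_trans ce; apply: near_eq_cvg; apply: filterS Ng => n /= ->.
Qed.

End Moments.

(** Large heights are handled together, the others one by one. *)
Lemma tight_limit (alpha c1 c2 : R) (L hinv : R -> R) : 1 < alpha -> slowly_varying L ->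
  0 < c1 -> 0 < c2 ->
  (forall x : R, 1 <= x ->
     ((c1 * L x * x `^ ((1 + s)%:R - alpha))%:E <= truncated_moment mu (1 + s) x)%E /\
     (truncated_moment mu (1 + s) x <= (c2 * L x * x `^ ((1 + s)%:R - alpha))%:E)%E) ->
  asymptotic_inverse (fun x => L (x^-1) * x `^ (alpha - 1)) hinv ->
  tight_pos P [set n | 0 < beta n - betac /\ 0 < hinv (beta n - betac)]
    (fun n w => gw_conn_prob xi q n (beta n) w / hinv (beta n - betac)).
Proof.
move=> al sl c10 c20 hL hi eps eps0.
have hP := Phi_truncated gwh hL.
have reg := regular_of_variation al sl c10 c20 hP.
have [p [pr Zp]] := regular_moment H reg.
have [a1 [a2 [a10 a20 hm]]] := msg_mean_inverse H al sl c10 c20 hP hi.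
pose y n := hinv (b n - betac).
have [n0 _ hn0] := filterI near_b (cz hm).
have y0 : y n @[n --> \oo] --> (0 : R).
  have [_ iz _] := hi; apply/cvgr0Pnorm_le => e e0.
  move/cvgr0Pnorm_le : iz => /(_ _ e0) hz.
  exact: (cz (scaling_right betac hz)).
have tight := psi_tight H (single_child_lt1 gwh mu1) pr Zp (b := b) (y := y) (n0 := n0) a10 a20 _ y0 eps0.
have [n nn|lo [hi' [n1 [lo0 lh h1]]]] := tight.
  have [[g1 g2 _] [g3 g4]] := hn0 n nn.
  by split => //; rewrite (ltW g1).
have [lo' [hi'' [lo0' lh' h2]]] := tight_prefix H b y n1.
pose t : R := if 0 < hinv (beta 0%N - betac) then (hinv (beta 0%N - betac))^-1 else 1.
have t0 : 0 < t by rewrite /t; case: ifP => // h; rewrite invr_gt0.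
exists (Num.min (Num.min lo lo') t), (Num.max (Num.max hi' hi'') t); split.
- by rewrite !lt_min lo0 lo0' t0.
- by apply: (@le_trans _ _ t); rewrite ?ge_min ?le_max lexx orbT.
case=> [|n] [/= e0 i0].
  have cw w : gw_conn_prob xi q 0 (beta 0%N) w / hinv (beta 0%N - betac) = t.
    rewrite /gw_conn_prob conn_prob0 //; first by rewrite /t i0 mul1r.
    by rewrite (lt_trans bc0) // -subr_gt0.
  rewrite (_ : [set w | _] = setT); first by rewrite probability_setT lee_fin gerBl ltW.
  by apply/seteqP; split => // w _ /=; rewrite cw ge_min le_max !lexx !orbT.
have bn : betac < b n by rewrite -subr_gt0.
have b0 : 0 < (b n, n).1 := lt_trans bc0 bn.
have -> : [set w | Num.min (Num.min lo lo') t <=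
    gw_conn_prob xi q n.+1 (beta n.+1) w / hinv (beta n.+1 - betac) <= Num.max (Num.max hi' hi'') t] =
    tree_of xi @^-1` [set x | Num.min (Num.min lo lo') t <= psi q (X (b n, n) x) / y n <=
      Num.max (Num.max hi' hi'') t].
  by apply/seteqP; split => w /=; rewrite gw_conn_prob_tree.
rewrite -tree_prob_preimage -(Ex_event H) // lee_fin.
pose A := Num.min (Num.min lo lo') t; pose B := Num.max (Num.max hi' hi'') t.
pose I (u v : R) := Ex Q (fun x => (u <= psi q (X (b n, n) x) / y n <= v)%R%:R).
have mono u v : A <= u -> v <= B -> I u v <= I A B.
  by move=> Au vB; exact: (ind_mono H (y n) b0 Au vB).
rewrite -/A -/B -/(I A B); have [nn|nn] := leqP n1 n.
  have g1 : 1 - eps <= I lo hi' := h1 n nn.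
  by apply: le_trans g1 (mono _ _ _ _); rewrite /A /B ?ge_min ?le_max lexx.
have g2 : 1 <= I lo' hi'' := h2 n nn bn i0.
apply: (@le_trans _ _ 1); first by rewrite gerBl ltW.
by apply: le_trans g2 (mono _ _ _ _); rewrite /A /B ?ge_min ?le_max lexx orbT.
Qed.

End Limits.

Theorem theorem2p8
  (R : realType) (mu : probability nat R)
  (d : measure_display) (Omega : measurableType d) (P : probability Omega R)
  (xi : seq nat -> {RV P >-> nat})
  (q betac : R) (beta : nat -> R)
  (mu0 : mu [set 0%N] = 0%E)
  (mu1 : (mu [set 1%N] < 1)%E)
  (mean_fin : (offspring_moment mu 1 < +oo)%E)
  (gw : galton_watson mu xi)
  (q_range : 0 < q <= 2)
  (critical : offspring_mean mu * psi q betac = 1)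
  (beta_cvg : beta n @[n --> \oo] --> betac)
  (beta_near : n%:R * (beta n - betac) @[n --> \oo] --> +oo) :
  let m := offspring_mean mu in
  let s := crit_exp q in
  let W := gw_limit m xi in
  let alpha_q :=
    crit_const q m (gw_limit_moment m xi 2) (gw_limit_moment m xi 3) in
  let ratio := fun (n : nat) (w : Omega) =>
    gw_conn_prob xi q n (beta n) w / (beta n - betac) `^ (s%:R^-1) in
  ((offspring_moment mu (1 + s) < +oo)%E ->
     {ae P, forall w, ratio n w @[n --> \oo] --> alpha_q * W w} /\
     'N[P]_((1 + s)%:R%:E)[(fun w => (ratio n w - alpha_q * W w)%:E)]%E
       @[n --> \oo] --> 0%E)
  /\
  (forall (alpha : R) (L hinv : R -> R) (c1 c2 : R),
     1 < alpha <= (1 + s)%:R ->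
     slowly_varying L ->
     0 < c1 -> 0 < c2 ->
     (forall x : R, 1 <= x ->
        ((c1 * L x * x `^ ((1 + s)%:R - alpha))%:E
           <= truncated_moment mu (1 + s) x)%E /\
        (truncated_moment mu (1 + s) x
           <= (c2 * L x * x `^ ((1 + s)%:R - alpha))%:E)%E) ->
     asymptotic_inverse (fun x => L (x^-1) * x `^ (alpha - 1)) hinv ->
     tight_pos P
       [set n | 0 < beta n - betac /\ 0 < hinv (beta n - betac)]
       (fun n w => gw_conn_prob xi q n (beta n) w / hinv (beta n - betac))).
Proof.
move=> m s W alpha_q ratio; split.
  move=> Zs; split.
    exact: (ae_limit mu0 mu1 mean_fin gw q_range critical beta_cvg beta_near Zs).
  exact: (Lnorm_limit mu0 mu1 mean_fin gw q_range critical beta_cvg beta_near Zs).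
move=> alpha L hinv c1 c2 /andP[alpha1 _] slow c10 c20 hL hi.
exact: (tight_limit mu0 mu1 mean_fin gw q_range critical beta_cvg beta_near alpha1 slow c10 c20 hL hi).
Qed.
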